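(* Let $\mathbb{K}$ be a perfect field, let $(S,W)$ be a $\mathbb{K}$-species with potential over a quiver $Q$, and let $C$ be a preprojective cut. Put $\Lambda=\mathcal P(S,W,C)$. If $k\in Q_0$ is a strict sink of $(Q,C)$ and gives a $2$-APR tilting $\Lambda$-module $T=\tau_2^-(\Lambda e_k)\oplus\Lambda(1-e_k)$, then $\mu_k^-(C)$ is a preprojective cut and $$\mathrm{End}_{\mathcal P(S,W,C)}(T)^{op}\cong\mathcal P(S,W,\mu_k^-(C)).$$
   Context: Modules are left modules; arrows and morphisms compose from right to left; quivers are finite and connected. Species. A $\mathbb{K}$-species $S$ over a quiver $Q$ without multiple arrows consists of finite-dimensional division $\mathbb{K}$-algebras $D_i$ ($i\in Q_0$) and finite-dimensional $D_j$-$D_i$-bimodules $M_\alpha$ (for each arrow $\alpha:i\to j$) on which $\mathbb{K}$ acts centrally. Put $D=\bigoplus_i D_i$, $M=\bigoplus_\alpha M_\alpha$, $T(S)=\bigoplus_{k\ge0}M^{\otimes_D k}$, $\widehat T(S)=\prod_{k\ge0}M^{\otimes_D k}$, $M^*=\mathrm{Hom}_{\mathbb{K}}(M,\mathbb{K})$; $e_i$ is the unit of $D_i$. Fix a $\mathbb{K}$-linear map $\mathfrak t:D\to\mathbb{K}$ with $\mathfrak t(ab)=\mathfrak t(ba)$ and no nonzero ideal in its kernel. Composition with $\mathfrak t$ gives isomorphisms $\mathfrak t_l:\mathrm{Hom}_D(M,D)\to M^*$ and $\mathfrak t_r:\mathrm{Hom}_{D^{op}}(M,D)\to M^*$; define $\mathfrak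 b(x\otimes\xi)=\mathfrak t_l^{-1}(\xi)(x)$ and $\mathfrak b(\xi\otimes x)=\mathfrak t_r^{-1}(\xi)(x)$ for $x\in M$, $\xi\in M^*$. Potentials. A potential is an element $W\in T(S)$, with components only in tensor degrees $\ge2$, such that $dW=Wd$ for all $d\in D$. For $\xi\in M^*$ put $\partial^l_\xi(a\otimes u)=\mathfrak b(\xi\otimes a)u$ ($a\in M$). Let $\sum_i x_i^*\otimes x_i\in M^*\otimes_DM$ be the Casimir element, i.e. $\sum_i\mathfrak b(x\otimes x_i^* )x_i=x$ for all $x\in M$. Put $\varepsilon_l(W)=\sum_i\partial^l_{x_i^*}(W)x_i$, and $\varepsilon_c(W)=\sum_{k=0}^{d}\varepsilon_l^k(W)$ for $W$ homogeneous of degree $d+1$ (extended additively). Set $\partial_\xi(W)=\partial^l_\xi(\varepsilon_c(W))$. The Jacobian algebra is $\mathcal P(S,W)=\widehat T(S)/\overline{\langle\partial_\xi(W)\mid\xi\in M^*\rangle}$. Cuts. $(S,W)$ determines a quiver with cycles $Q=(Q_0,Q_1,Q_2)$, where $Q_2$ is a minimal set of cycles of $Q$ such that $W$ lies in the sum, over all $\alpha_n\cdots\alpha_1\in Q_2$ and all $1\le i\le n$, of $M_{\alpha_i}\otimes_D\cdots\otimes_DM_{\alpha_1}\otimes_DM_{\alpha_n}\otimes_D\cdots\otimes_DM_{\alpha_{i+1}}$. For $C\subseteq Q_1$ let $g_C(\alpha)=1$ if $\alpha\in C$ and $0$ otherwise, extended additively to paths. $C$ is a cut if $g_C(c)=1$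 for all $c\in Q_2$; then $g_C$ induces a grading on $\mathcal P(S,W)$. A vertex $k$ is a strict sink of $(Q,C)$ if all arrows starting at $k$ belong to $C$ and no arrow ending at $k$ belongs to $C$; then $\mu_k^-(C)$ is obtained from $C$ by removing all arrows starting at $k$ and adding all arrows ending at $k$. Truncated Jacobian algebra. For a cut $C$ let $S_C$ be the restriction of $S$ to $Q_C=(Q_0,Q_1\setminus C)$, and $\mathcal P(S,W,C)=\widehat T(S_C)/\overline{\langle\partial_\xi(W)\mid\xi\in M_\alpha^*,\ \alpha\in C\rangle}$, which is the degree $0$ part of $\mathcal P(S,W)$ graded by $g_C$. Preprojective cut. For a finite-dimensional algebra $\Lambda$ with $\mathrm{gldim}\,\Lambda\le2$ put $\tau_2^-=\mathrm{Ext}^2_\Lambda(\mathsf D\Lambda,-)$ with $\mathsf D=\mathrm{Hom}_{\mathbb{K}}(-,\mathbb{K})$, and let $\widehat\Pi_3(\Lambda)=\prod_{i\ge0}\mathrm{Hom}_\Lambda(\Lambda,\tau_2^{-i}\Lambda)$ with product $uv=\tau_2^{-i}(v)\circ u$ for $u$ of degree $i$. $C$ is preprojective if $\mathrm{gldim}\,\mathcal P(S,W,C)\le2$ and there is an isomorphism of complete graded algebras $\widehat\Pi_3(\mathcal P(S,W,C))\cong\mathcal P(S,W)$, with $\mathcal P(S,W)$ graded by $g_C$, which is the identity on the degree $0$ part. $2$-APR tilting. Let $\Lambda$ be a basic algebra and $P$ a simple projective module with $\mathrm{Hom}_\Lambda(\mathsf D\Lambda,P)=\mathrm{Ext}^1_\Lambda(\mathsf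 D\Lambda,P)=0$ and injective dimension $2$; write $\Lambda=P\oplus P'$. Then $T=\tau_2^-(P)\oplus P'$ is called a $2$-APR tilting module. ''$k$ gives a $2$-APR tilting module'' means that these conditions hold for $P=\Lambda e_k$. *)

(* Defs.v *)
From HB Require Import structures.
From mathcomp Require Import all_boot all_order all_algebra all_field.
From mathcomp Require Import boolp classical_sets functions.

Set Implicit Arguments.
Unset Strict Implicit.
Unset Printing Implicit Defensive.

Import GRing.Theory.
Local Open Scope classical_set_scope.
Local Open Scope ring_scope.
Local Open Scope quotient_scope.

(* A [K]-algebra is a ring with a central ring morphism [scal] from [K].       *)
(* [algType] would require 1 != 0, which is not available for quotients and    *)
(* endomorphism rings before one knows that they are nonzero.                  *)
HB.mixin Record PzRing_isKAlg (K : fieldType) A of GRing.PzRing A := {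
  scal : K -> A;
  scal1 : scal 1 = 1;
  scalD : forall k l, scal (k + l) = scal k + scal l;
  scalM : forall k l, scal (k * l) = scal k * scal l;
  scalC : forall k (x : A), scal k * x = x * scal k
}.
#[short(type="kalgType")]
HB.structure Definition KAlg (K : fieldType) :=
  {A of GRing.PzRing A & PzRing_isKAlg K A}.

Section FalgKAlg.
Variables (K : fieldType) (A : falgType K).
Lemma falg_scal1 : 1%:A = 1 :> A. Proof. exact: scale1r. Qed.
Lemma falg_scalD (k l : K) : (k + l)%:A = k%:A + l%:A :> A.
Proof. exact: scalerDl. Qed.
Lemma falg_scalM (k l : K) : (k * l)%:A = k%:A * l%:A :> A.
Proof. by rewrite -scalerAl mul1r scalerA. Qed.
Lemma falg_scalC (k : K) (x : A) : k%:A * x = x * k%:A.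
Proof. by rewrite -scalerAl -scalerAr mul1r mulr1. Qed.
HB.instance Definition _ := PzRing_isKAlg.Build K A
  falg_scal1 falg_scalD falg_scalM falg_scalC.
End FalgKAlg.

Definition restr_scal (K : fieldType) (A : kalgType K) (V : lmodType A) : Type :=
  V.
Section RestrScal.
Variables (K : fieldType) (A : kalgType K) (V : lmodType A).
HB.instance Definition _ := GRing.Zmodule.on (restr_scal V).
Definition restr_scale (k : K) (v : restr_scal V) : restr_scal V :=
  scal k *: (v : V).
Lemma restr_scaleA a b v :
  restr_scale a (restr_scale b v) = restr_scale (a * b) v.
Proof. by rewrite /restr_scale scalerA scalM. Qed.
Lemma restr_scale1 : left_id 1 restr_scale.
Proof. by move=> v; rewrite /restr_scale scal1 scale1r. Qed.
Lemma restr_scaleDr : right_distributive restr_scale +%R.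
Proof. by move=> k u v; rewrite /restr_scale scalerDr. Qed.
Lemma restr_scaleDl v : {morph restr_scale^~ v : a b / a + b}.
Proof. by move=> a b; rewrite /restr_scale scalD scalerDl. Qed.
HB.instance Definition _ := GRing.Zmodule_isLmodule.Build K (restr_scal V)
  restr_scaleA restr_scale1 restr_scaleDr restr_scaleDl.
End RestrScal.

Definition findim (K : fieldType) (V : lmodType K) : Prop :=
  exists (n : nat) (v : 'I_n -> V),
    forall x, exists c : 'I_n -> K, x = \sum_i c i *: v i.

(* Restriction of scalars of the regular module, i.e. [A] as a K-space. *)
Notation kspace A := (restr_scal (A : kalgType _)^o).

Definition kalg_hom (K : fieldType) (A B : kalgType K) (f : A -> B) : Prop :=
  [/\ forall x y, f (x + y) = f x + f y, forall x y, f (x * y) = f x * f y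
    & forall k : K, f (scal k) = scal k].

Definition alg_iso (K : fieldType) (A B : kalgType K) : Prop :=
  exists2 f : A -> B, kalg_hom f & bijective f.

(* Subgroups of an additive group, as (possibly undecidable) propositions.     *)
Record addsub (V : zmodType) := AddSub {
  as_set :> V -> Prop;
  as0 : as_set 0;
  asB : forall x y, as_set x -> as_set y -> as_set (x - y)
}.

Section AddSub.
Variables (V : zmodType) (B : addsub V).
Lemma asN x : B x -> B (- x).
Proof. by move=> Bx; rewrite -sub0r; apply: asB => //; exact: as0. Qed.
Lemma asD x y : B x -> B y -> B (x + y).
Proof. by move=> Bx By; rewrite -[y]opprK; apply: asB => //; exact: asN. Qed.

Definition as_mem : {pred V} := [pred x | `[< B x >]].
Lemma as_memP x : reflect (B x) (x \in as_mem).
Proof. exact: asboolP. Qed.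
Lemma as_zmod : zmod_closed as_mem.
Proof.
split; first by apply/as_memP; exact: as0.
by move=> x y /as_memP Bx /as_memP By; apply/as_memP; exact: asB.
Qed.
HB.instance Definition _ := GRing.isZmodClosed.Build V as_mem as_zmod.

Definition subgrp : Type := {x : V | x \in as_mem}.
HB.instance Definition _ := SubChoice.on subgrp.
HB.instance Definition _ := [SubChoice_isSubZmodule of subgrp by <:].

Definition quo_rel : rel V := fun x y => `[< B (x - y) >].
Lemma quo_equiv : equiv_class_of quo_rel.
Proof.
split.
- by move=> x; apply/asboolP; rewrite subrr; exact: as0.
- by move=> x y; apply/asboolP/asboolP => /asN; rewrite opprB.
- move=> y x z /asboolP xy /asboolP yz; apply/asboolP.
  by rewrite -(subrK y x) -addrA; exact: asD.
Qed.
Canonical quo_equivrel := EquivRelPack quo_equiv.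

Definition quot : Type := {eq_quot quo_rel}.
HB.instance Definition _ := Choice.on quot.
HB.instance Definition _ := EqQuotient.on quot.

Lemma quot_eqP x y : reflect (B (x - y)) (\pi_quot x == \pi_quot y).
Proof. by rewrite eqmodE; exact: asboolP. Qed.
Lemma quot_eq x y : B (x - y) -> \pi_quot x = \pi_quot y.
Proof. by move=> h; apply/eqP/quot_eqP. Qed.
Lemma quot_repr x : B (repr (\pi_quot x) - x).
Proof. by apply/quot_eqP; rewrite reprK. Qed.
Lemma quotP (P : quot -> Prop) : (forall x, P (\pi_quot x)) -> forall q, P q.
Proof. by move=> h q; rewrite -[q]reprK; exact: h. Qed.

Definition quot_add (p q : quot) : quot := \pi_quot (repr p + repr q).
Definition quot_opp (p : quot) : quot := \pi_quot (- repr p).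
Lemma quot_addE x y : quot_add (\pi_quot x) (\pi_quot y) = \pi_quot (x + y).
Proof.
by apply: quot_eq; rewrite opprD addrACA; apply: asD; exact: quot_repr.
Qed.
Lemma quot_oppE x : quot_opp (\pi_quot x) = \pi_quot (- x).
Proof. by apply: quot_eq; rewrite -opprD; apply: asN; exact: quot_repr. Qed.
Lemma quot_addA : associative quot_add.
Proof.
by elim/quotP => x; elim/quotP => y; elim/quotP => z; rewrite !quot_addE addrA.
Qed.
Lemma quot_addC : commutative quot_add.
Proof. by elim/quotP => x; elim/quotP => y; rewrite !quot_addE addrC. Qed.
Lemma quot_add0 : left_id (\pi_quot 0) quot_add.
Proof. by elim/quotP => x; rewrite !quot_addE add0r. Qed.
Lemma quot_addN : left_inverse (\pi_quot 0) quot_opp quot_add.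
Proof. by elim/quotP => x; rewrite quot_oppE !quot_addE addNr. Qed.
HB.instance Definition _ := GRing.isZmodule.Build quot
  quot_addA quot_addC quot_add0 quot_addN.

Definition qcl (x : V) : quot := \pi_quot x.
Lemma qclD x y : qcl (x + y) = qcl x + qcl y.
Proof. by rewrite [RHS]quot_addE. Qed.
Lemma qclP (P : quot -> Prop) : (forall x, P (qcl x)) -> forall q, P q.
Proof. exact: quotP. Qed.
Lemma qcl_eq x y : B (x - y) -> qcl x = qcl y.
Proof. exact: quot_eq. Qed.
Lemma qcl_repr x : B (repr (qcl x) - x).
Proof. exact: quot_repr. Qed.
Lemma qcl_eq_repr x : B (x - repr (qcl x)).
Proof. by rewrite -opprB; apply: asN; exact: qcl_repr. Qed.
End AddSub.

Record ideal (A : pzRingType) := Ideal {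
  id_set :> addsub A;
  idMl : forall a x, id_set x -> id_set (a * x);
  idMr : forall a x, id_set x -> id_set (x * a)
}.

Definition quotalg (K : fieldType) (A : kalgType K) (I : ideal A) : Type :=
  quot I.
Section QuotAlg.
Variables (K : fieldType) (A : kalgType K) (I : ideal A).
HB.instance Definition _ := GRing.Zmodule.on (quotalg I).
Local Notation cl := (qcl I).
Definition qa_mul (p q : quotalg I) : quotalg I := cl (repr p * repr q).
Lemma qa_mulE x y : qa_mul (cl x) (cl y) = cl (x * y).
Proof.
apply: qcl_eq; rewrite -[X in X - _](subrK (x * repr (cl y))) -mulrBl -addrA.
rewrite -mulrBr; apply: asD; first by apply: idMr; exact: qcl_repr.
by apply: idMl; exact: qcl_repr.
Qed.
Lemma qa_mulA : associative qa_mul.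
Proof.
by elim/qclP => x; elim/qclP => y; elim/qclP => z; rewrite !qa_mulE mulrA.
Qed.
Lemma qa_mul1 : left_id (cl 1) qa_mul.
Proof. by elim/qclP => x; rewrite qa_mulE mul1r. Qed.
Lemma qa_mulr1 : right_id (cl 1) qa_mul.
Proof. by elim/qclP => x; rewrite qa_mulE mulr1. Qed.
Lemma qa_mulDl : left_distributive qa_mul +%R.
Proof.
elim/qclP => x; elim/qclP => y; elim/qclP => z.
by rewrite -qclD !qa_mulE mulrDl qclD.
Qed.
Lemma qa_mulDr : right_distributive qa_mul +%R.
Proof.
elim/qclP => x; elim/qclP => y; elim/qclP => z.
by rewrite -qclD !qa_mulE mulrDr qclD.
Qed.
HB.instance Definition _ := GRing.Zmodule_isPzRing.Build (quotalg I)
  qa_mulA qa_mul1 qa_mulr1 qa_mulDl qa_mulDr.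
Definition qa_scal (k : K) : quotalg I := cl (scal k).
Lemma qa_scal1 : qa_scal 1 = 1. Proof. by rewrite /qa_scal scal1. Qed.
Lemma qa_scalD k l : qa_scal (k + l) = qa_scal k + qa_scal l.
Proof. by rewrite /qa_scal scalD qclD. Qed.
Lemma qa_scalM k l : qa_scal (k * l) = qa_scal k * qa_scal l.
Proof. by rewrite [RHS]qa_mulE /qa_scal scalM. Qed.
Lemma qa_scalC k (x : quotalg I) : qa_scal k * x = x * qa_scal k.
Proof. by elim/qclP: x => x; rewrite [LHS]qa_mulE [RHS]qa_mulE scalC. Qed.
HB.instance Definition _ := PzRing_isKAlg.Build K (quotalg I)
  qa_scal1 qa_scalD qa_scalM qa_scalC.
End QuotAlg.

(* The left action is the module structure; [ract x b] is the right action.    *)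
(* By [ract_scal], [K] acts centrally.                                         *)
Record bimodule (K : fieldType) (A B : kalgType K) := Bimodule {
  bim_car :> lmodType A;
  ract : bim_car -> B -> bim_car;
  ractDl : forall x y b, ract (x + y) b = ract x b + ract y b;
  ractDr : forall x b c, ract x (b + c) = ract x b + ract x c;
  ract1 : forall x, ract x 1 = x;
  ractM : forall x b c, ract x (b * c) = ract (ract x b) c;
  ractZ : forall a x b, ract (a *: x) b = a *: ract x b;
  ract_scal : forall (k : K) x, ract x (scal k) = scal k *: x
}.

Section Tensor.
Variables (K : fieldType) (D : kalgType K) (M : bimodule D D) (V : lmodType D).

(* [M (x)_D V] is the set of formal sums of pairs, represented by sequences,   *)
(* modulo the congruence generated by the defining relations of the tensor     *)
(* product.                                                                    *)
Inductive tens_rel : seq (M * V) -> seq (M * V) -> Prop :=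
| TensRefl s : tens_rel s s
| TensSym s t : tens_rel s t -> tens_rel t s
| TensTrans s t u : tens_rel s t -> tens_rel t u -> tens_rel s u
| TensCat s t s' t' :
    tens_rel s t -> tens_rel s' t' -> tens_rel (s ++ s') (t ++ t')
| TensC s t : tens_rel (s ++ t) (t ++ s)
| Tens0 v : tens_rel [:: (0, v)] [::]
| TensDl x y v : tens_rel [:: (x + y, v)] [:: (x, v); (y, v)]
| TensDr x u v : tens_rel [:: (x, u + v)] [:: (x, u); (x, v)]
| TensBal x d v : tens_rel [:: (ract x d, v)] [:: (x, d *: v)].

Definition tens_eq : rel (seq (M * V)) := fun s t => `[< tens_rel s t >].
Lemma tens_equiv : equiv_class_of tens_eq.
Proof.
split.
- by move=> s; apply/asboolP; exact: TensRefl.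
- by move=> s t; apply/asboolP/asboolP; exact: TensSym.
- by move=> t s u /asboolP st /asboolP tu; apply/asboolP; exact: TensTrans tu.
Qed.
Canonical tens_equivrel := EquivRelPack tens_equiv.

Definition tens : Type := {eq_quot tens_eq}.
HB.instance Definition _ := Choice.on tens.
HB.instance Definition _ := EqQuotient.on tens.

Definition tens_cl (s : seq (M * V)) : tens := \pi_tens s.
Lemma tens_clP s t : reflect (tens_rel s t) (tens_cl s == tens_cl t).
Proof. by rewrite eqmodE; exact: asboolP. Qed.
Lemma tens_cl_eq s t : tens_rel s t -> tens_cl s = tens_cl t.
Proof. by move=> h; apply/eqP/tens_clP. Qed.
Lemma tens_repr s : tens_rel (repr (tens_cl s)) s.
Proof. by apply/tens_clP; rewrite /tens_cl reprK. Qed.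
Lemma tensP (P : tens -> Prop) : (forall s, P (tens_cl s)) -> forall t, P t.
Proof. by move=> h q; rewrite -[q]reprK; exact: h. Qed.

Definition seq_map1 (f : M -> M) (s : seq (M * V)) : seq (M * V) :=
  [seq (f p.1, p.2) | p <- s].
Lemma seq_map1_rel (f : M -> M) s t :
    (forall x y, f (x + y) = f x + f y) ->
    (forall x d, f (ract x d) = ract (f x) d) ->
  tens_rel s t -> tens_rel (seq_map1 f s) (seq_map1 f t).
Proof.
move=> fD fR; have f0 : f 0 = 0 by apply: (addrI (f 0)); rewrite -fD !addr0.
elim=> /= {s t}.
- by move=> s; exact: TensRefl.
- by move=> s t _; exact: TensSym.
- by move=> s t u _ st _; exact: TensTrans.
- by move=> s t s' t' _ h _ h'; rewrite /seq_map1 !map_cat; exact: TensCat.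
- by move=> s t; rewrite /seq_map1 !map_cat; exact: TensC.
- by move=> v; rewrite f0; exact: Tens0.
- by move=> x y v; rewrite fD; exact: TensDl.
- by move=> x u v; exact: TensDr.
- by move=> x d v; rewrite fR; exact: TensBal.
Qed.

Lemma tens_rel_swap a b s t :
  tens_rel (a :: (s ++ b :: t)) ([:: a; b] ++ (s ++ t)).
Proof.
rewrite -[a :: _]/([:: a] ++ (s ++ ([:: b] ++ t))).
rewrite -[[:: a; b] ++ _]/([:: a] ++ ([:: b] ++ (s ++ t))).
apply: TensCat; first exact: TensRefl.
by rewrite !catA; apply: TensCat; [exact: TensC | exact: TensRefl].
Qed.

Definition tens_add (p q : tens) : tens := tens_cl (repr p ++ repr q).
Definition tens_opp (p : tens) : tens := tens_cl (seq_map1 -%R (repr p)).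
Lemma tens_addE s t : tens_add (tens_cl s) (tens_cl t) = tens_cl (s ++ t).
Proof. by apply: tens_cl_eq; apply: TensCat; exact: tens_repr. Qed.
Lemma tens_map1E (f : M -> M) s :
    (forall x y, f (x + y) = f x + f y) ->
    (forall x d, f (ract x d) = ract (f x) d) ->
  tens_cl (seq_map1 f (repr (tens_cl s))) = tens_cl (seq_map1 f s).
Proof.
by move=> fD fR; apply: tens_cl_eq; apply: seq_map1_rel => //; exact: tens_repr.
Qed.
Lemma ractN (x : M) (d : D) : - ract x d = ract (- x) d.
Proof.
have r0 : ract (0 : M) d = 0 :> M.
  by apply: (addrI (ract (0 : M) d)); rewrite -ractDl !addr0.
by apply: (addIr (ract x d)); rewrite -ractDl !addNr r0.
Qed.
Lemma tens_oppE s : tens_opp (tens_cl s) = tens_cl (seq_map1 -%R s).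
Proof. by apply: tens_map1E; [exact: opprD | exact: ractN]. Qed.
Lemma tens_addA : associative tens_add.
Proof.
by elim/tensP => x; elim/tensP => y; elim/tensP => z; rewrite !tens_addE catA.
Qed.
Lemma tens_addC : commutative tens_add.
Proof.
elim/tensP => x; elim/tensP => y; rewrite !tens_addE; apply: tens_cl_eq.
exact: TensC.
Qed.
Lemma tens_add0 : left_id (tens_cl [::]) tens_add.
Proof. by elim/tensP => x; rewrite tens_addE. Qed.
Lemma tens_addN : left_inverse (tens_cl [::]) tens_opp tens_add.
Proof.
elim/tensP => s; rewrite tens_oppE tens_addE; apply: tens_cl_eq.
elim: s => [|[x v] s IHs] /=; first exact: TensRefl.
apply: (@TensTrans _ ([:: (- x, v); (x, v)] ++ (seq_map1 -%R s ++ s))).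
  exact: tens_rel_swap.
rewrite -[[::]]/([::] ++ [::] : seq (M * V)); apply: TensCat => //.
apply: TensTrans (Tens0 v); apply: TensSym.
by rewrite -(addNr x); exact: TensDl.
Qed.
HB.instance Definition _ := GRing.isZmodule.Build tens
  tens_addA tens_addC tens_add0 tens_addN.

Lemma tens_clD s t : tens_cl (s ++ t) = tens_cl s + tens_cl t.
Proof. by rewrite [RHS]tens_addE. Qed.

Definition tens_scale (d : D) (p : tens) : tens :=
  tens_cl (seq_map1 ( *:%R d) (repr p)).
Lemma tens_scaleE d s :
  tens_scale d (tens_cl s) = tens_cl (seq_map1 ( *:%R d) s).
Proof. by apply: tens_map1E => [|x e]; [exact: scalerDr | rewrite ractZ]. Qed.
Lemma tens_scaleA a b v : tens_scale a (tens_scale b v) = tens_scale (a * b) v.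
Proof.
elim/tensP: v => s; rewrite !tens_scaleE /seq_map1 -map_comp; congr tens_cl.
by apply: eq_map => p /=; rewrite scalerA.
Qed.
Lemma tens_scale1 : left_id 1 tens_scale.
Proof.
elim/tensP => s; rewrite !tens_scaleE /seq_map1; congr tens_cl.
by rewrite -[RHS]map_id; apply: eq_map => -[x v] /=; rewrite scale1r.
Qed.
Lemma tens_scaleDr : right_distributive tens_scale +%R.
Proof.
move=> d; elim/tensP => s; elim/tensP => t.
by rewrite -tens_clD !tens_scaleE -tens_clD /seq_map1 map_cat.
Qed.
Lemma tens_scaleDl v : {morph tens_scale^~ v : a b / a + b}.
Proof.
move=> a b; elim/tensP: v => s; rewrite !tens_scaleE -tens_clD.
apply: tens_cl_eq; elim: s => [|[x v] s IHs] /=; first exact: TensRefl.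
apply: (@TensTrans _ ([:: (a *: x, v); (b *: x, v)] ++
    (seq_map1 ( *:%R a) s ++ seq_map1 ( *:%R b) s))).
  rewrite -cat1s; apply: TensCat => //; rewrite scalerDl; exact: TensDl.
exact/TensSym/tens_rel_swap.
Qed.
HB.instance Definition _ := GRing.Zmodule_isLmodule.Build D tens
  tens_scaleA tens_scale1 tens_scaleDr tens_scaleDl.

Definition ptens (x : M) (v : V) : tens := tens_cl [:: (x, v)].

(* The value of a balanced biadditive map [f] on an element of [M (x)_D V].    *)
Definition tens_lift (Z : zmodType) (f : M -> V -> Z) (t : tens) : Z :=
  \sum_(p <- repr t) f p.1 p.2.

Definition balanced (Z : zmodType) (f : M -> V -> Z) :=
  [/\ forall x y v, f (x + y) v = f x v + f y v,
      forall x u v, f x (u + v) = f x u + f x v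
    & forall x d v, f (ract x d) v = f x (d *: v)].

Lemma tens_lift_cl (Z : zmodType) (f : M -> V -> Z) s :
  balanced f -> tens_lift f (tens_cl s) = \sum_(p <- s) f p.1 p.2.
Proof.
move=> [fDl fDr fB].
have f0 v : f 0 v = 0 by apply: (addrI (f 0 v)); rewrite -fDl !addr0.
rewrite /tens_lift; move: (tens_repr s); move: (repr _) => r; elim=> {r s} //=.
- by move=> s t u _ -> _ ->.
- by move=> s t s' t' _ h _ h'; rewrite !big_cat /= h h'.
- by move=> s t; rewrite !big_cat /= addrC.
- by move=> v; rewrite big_seq1 big_nil f0.
- by move=> x y v; rewrite !big_cons !big_nil /= fDl !addr0.
- by move=> x u v; rewrite !big_cons !big_nil /= fDr !addr0.
- by move=> x d v; rewrite !big_seq1 fB.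
Qed.
Lemma tens_liftE (Z : zmodType) (f : M -> V -> Z) x v :
  balanced f -> tens_lift f (ptens x v) = f x v.
Proof. by move=> fb; rewrite tens_lift_cl // big_seq1. Qed.
Lemma tens_liftD (Z : zmodType) (f : M -> V -> Z) p q :
  balanced f -> tens_lift f (p + q) = tens_lift f p + tens_lift f q.
Proof.
move=> fb; elim/tensP: p => s; elim/tensP: q => t.
by rewrite -tens_clD !tens_lift_cl // big_cat.
Qed.
Lemma ptens_ind (P : tens -> Prop) : P 0 -> (forall x v, P (ptens x v)) ->
  (forall p q, P p -> P q -> P (p + q)) -> forall t, P t.
Proof.
move=> P0 P1 PD; elim/tensP; elim=> [|[x v] s IHs]; first exact: P0.
by rewrite -cat1s tens_clD; apply: PD => //; exact: P1.
Qed.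
Lemma ptensDl x y v : ptens (x + y) v = ptens x v + ptens y v.
Proof. by rewrite -tens_clD; apply: tens_cl_eq; exact: TensDl. Qed.
Lemma ptensDr x u v : ptens x (u + v) = ptens x u + ptens x v.
Proof. by rewrite -tens_clD; apply: tens_cl_eq; exact: TensDr. Qed.
Lemma ptensB x d v : ptens (ract x d) v = ptens x (d *: v).
Proof. by apply: tens_cl_eq; exact: TensBal. Qed.
Lemma ptensZ d x v : d *: ptens x v = ptens (d *: x) v.
Proof. by rewrite [LHS]tens_scaleE. Qed.
Lemma ptens0r x : ptens x 0 = 0.
Proof. by apply: (addrI (ptens x 0)); rewrite -ptensDr !addr0. Qed.
Lemma ptens0l v : ptens 0 v = 0.
Proof. by apply: (addrI (ptens 0 v)); rewrite -ptensDl !addr0. Qed.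
End Tensor.

Definition dprod (I : Type) (V : I -> Type) : Type := forall i, V i.
HB.instance Definition _ I V := gen_eqMixin (@dprod I V).
HB.instance Definition _ I V := gen_choiceMixin (@dprod I V).
Lemma dprodP I (V : I -> Type) (f g : dprod V) : (forall i, f i = g i) -> f = g.
Proof. exact: functional_extensionality_dep. Qed.

Section DProdZmod.
Variables (I : Type) (V : I -> zmodType).
Implicit Types f g h : dprod V.
Definition dp_add f g : dprod V := fun i => f i + g i.
Definition dp_opp f : dprod V := fun i => - f i.
Definition dp_zero : dprod V := fun i => 0.
Lemma dp_addA : associative dp_add.
Proof. by move=> f g h; apply: dprodP => i; exact: addrA. Qed.
Lemma dp_addC : commutative dp_add.
Proof. by move=> f g; apply: dprodP => i; exact: addrC. Qed.
Lemma dp_add0 : left_id dp_zero dp_add.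
Proof. by move=> f; apply: dprodP => i; exact: add0r. Qed.
Lemma dp_addN : left_inverse dp_zero dp_opp dp_add.
Proof. by move=> f; apply: dprodP => i; exact: addNr. Qed.
HB.instance Definition _ := GRing.isZmodule.Build (dprod V)
  dp_addA dp_addC dp_add0 dp_addN.
Lemma dp_sumE (J : Type) (r : seq J) P (F : J -> dprod V) i :
  (\sum_(j <- r | P j) F j) i = \sum_(j <- r | P j) F j i.
Proof. by apply: (big_morph (fun f : dprod V => f i)). Qed.
End DProdZmod.

Section DProdLmod.
Variables (R : pzRingType) (I : Type) (V : I -> lmodType R).
Implicit Types f g h : dprod V.
Definition dp_scale (a : R) f : dprod V := fun i => a *: f i.
Lemma dp_scaleA a b f : dp_scale a (dp_scale b f) = dp_scale (a * b) f.
Proof. by apply: dprodP => i; exact: scalerA. Qed.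
Lemma dp_scale1 : left_id 1 dp_scale.
Proof. by move=> f; apply: dprodP => i; exact: scale1r. Qed.
Lemma dp_scaleDr : right_distributive dp_scale +%R.
Proof. by move=> a f g; apply: dprodP => i; exact: scalerDr. Qed.
Lemma dp_scaleDl f : {morph dp_scale^~ f : a b / a + b}.
Proof. by move=> a b; apply: dprodP => i; exact: scalerDl. Qed.
HB.instance Definition _ := GRing.Zmodule_isLmodule.Build R (dprod V)
  dp_scaleA dp_scale1 dp_scaleDr dp_scaleDl.
End DProdLmod.

Section CompletedTensorAlgebra.
Variables (K : fieldType) (D : kalgType K) (M : bimodule D D).

(* The k-th power is bracketed to the right and ends with a factor [D]:        *)
(* M (x)_D (M (x)_D ... (x)_D (M (x)_D D)).                                    *)
Fixpoint tpow (n : nat) : lmodType D :=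
  if n is m.+1 then tens M (tpow m) else D^o.

Definition ctens : Type := dprod tpow.
HB.instance Definition _ := GRing.Lmodule.on ctens.
Implicit Types (f g h : ctens).

Definition ct_shift (x : M) f : ctens :=
  fun n => if n is m.+1 return tpow n then ptens x (f m) else 0.

(* The product [t * g] of an element of the n-th tensor power with an element  *)
(* of the completed algebra: (x (x) u) * g = x (x) (u * g).                    *)
Fixpoint ct_act (n : nat) : tpow n -> ctens -> ctens :=
  match n return tpow n -> ctens -> ctens with
  | 0 => fun d g => (d : D) *: g
  | m.+1 => fun t g =>
      tens_lift (fun (x : M) (u : tpow m) => ct_shift x (ct_act u g)) t
  end.

Definition ct_mul f g : ctens := fun n => \sum_(k < n.+1) ct_act (f k) g n.

Definition ct_deg0 (d : D) : ctens :=
  fun n => if n is 0 return tpow n then d else 0.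
Definition ct_deg1 (x : M) : ctens :=
  fun n => match n return tpow n with 1 => ptens x (1 : D^o) | _ => 0 end.
Definition ct_comp (n : nat) f : ctens := fun m => if m == n then f m else 0.

Lemma ct_shiftDl x y f : ct_shift (x + y) f = ct_shift x f + ct_shift y f.
Proof.
apply: dprodP => -[|n]; first exact: (esym (addr0 _)).
exact: ptensDl.
Qed.
Lemma ct_shiftDr x f g : ct_shift x (f + g) = ct_shift x f + ct_shift x g.
Proof.
apply: dprodP => -[|n]; first exact: (esym (addr0 _)).
exact: ptensDr.
Qed.
Lemma ct_shiftB x d f : ct_shift (ract x d) f = ct_shift x (d *: f).
Proof. by apply: dprodP => -[|n] //; exact: ptensB. Qed.
Lemma ct_shiftZ x d f : d *: ct_shift x f = ct_shift (d *: x) f.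
Proof. by apply: dprodP => -[|n]; [exact: scaler0 | exact: ptensZ]. Qed.

Lemma ct_act_lin n g :
  (forall t u : tpow n, ct_act (t + u) g = ct_act t g + ct_act u g) /\
  (forall d (t : tpow n), ct_act (d *: t) g = d *: ct_act t g).
Proof.
elim: n => [|n [IHD IHZ]] /=.
  split => [t u|d t]; first exact: scalerDl.
  exact: (esym (scalerA d (t : D) g)).
have bal : balanced (fun x (u : tpow n) => ct_shift x (ct_act u g)).
  split=> [x y v|x u v|x d v]; first exact: ct_shiftDl.
    by rewrite IHD ct_shiftDr.
  by rewrite IHZ ct_shiftB.
split=> [t u|d t]; first exact: tens_liftD.
elim/ptens_ind: t => [|x v|p q hp hq]; last 1 first.
- by rewrite scalerDr !tens_liftD // hp hq scalerDr.
- rewrite scaler0 -[0](ptens0r (tpow n) (0 : M)) tens_liftE //.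
  rewrite [ct_shift _ _](_ : _ = 0) ?scaler0 //.
  by apply: dprodP => -[|m] //; exact: ptens0l.
by rewrite ptensZ !tens_liftE // ct_shiftZ.
Qed.
Lemma ct_actD n (t u : tpow n) g : ct_act (t + u) g = ct_act t g + ct_act u g.
Proof. exact: (ct_act_lin n g).1. Qed.
Lemma ct_actDE n (t u : tpow n) g m :
  ct_act (t + u) g m = ct_act t g m + ct_act u g m.
Proof. by rewrite ct_actD. Qed.
Lemma ct_actZ n d (t : tpow n) g : ct_act (d *: t) g = d *: ct_act t g.
Proof. exact: (ct_act_lin n g).2. Qed.
Lemma ct_act0 n g : ct_act (0 : tpow n) g = 0.
Proof. by apply: (addrI (ct_act (0 : tpow n) g)); rewrite -ct_actD !addr0. Qed.
Lemma ct_act0E n g m : ct_act (0 : tpow n) g m = 0.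
Proof. by rewrite ct_act0. Qed.
Lemma ct_act_bal n g :
  balanced (fun x (u : tpow n) => ct_shift x (ct_act u g)).
Proof.
split=> [x y v|x u v|x d v]; first exact: ct_shiftDl.
  by rewrite ct_actD ct_shiftDr.
by rewrite ct_actZ ct_shiftB.
Qed.
Lemma ct_act_ptens n (x : M) (u : tpow n) g :
  ct_act (ptens x u : tpow n.+1) g = ct_shift x (ct_act u g).
Proof. by rewrite /= tens_liftE //; exact: ct_act_bal. Qed.

Lemma ct_actDr n (t : tpow n) g h : ct_act t (g + h) = ct_act t g + ct_act t h.
Proof.
elim: n t => [|n IHn] t; first exact: scalerDr.
elim/ptens_ind: t => [|x v|p q hp hq].
- by rewrite !(@ct_act0 n.+1) addr0.
- by rewrite !ct_act_ptens IHn ct_shiftDr.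
by rewrite !(@ct_actD n.+1) hp hq addrACA.
Qed.
Lemma ct_act_local n (t : tpow n) g h m :
  (forall i, (i <= m)%N -> g i = h i) -> ct_act t g m = ct_act t h m.
Proof.
elim: n t m => [|n IHn] t m gh; first by congr (_ *: _); exact: gh.
elim/ptens_ind: t => [|x v|p q hp hq].
- by rewrite !(@ct_act0 n.+1).
- rewrite !ct_act_ptens; case: m gh => //= m gh; congr ptens; apply: IHn.
  by move=> i im; apply: gh; exact: leqW.
by rewrite !(@ct_actDE n.+1) hp hq.
Qed.
Lemma ct_act_low n (t : tpow n) g m : (m < n)%N -> ct_act t g m = 0.
Proof.
elim: n t m => // n IHn t m mn.
elim/ptens_ind: t => [|x v|p q hp hq].
- by rewrite !(@ct_act0 n.+1).
- by rewrite !ct_act_ptens; case: m mn => //= m mn; rewrite IHn // ptens0r.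
by rewrite !(@ct_actDE n.+1) hp hq addr0.
Qed.

Lemma ct_mulDl : left_distributive ct_mul +%R.
Proof.
move=> f g h; apply: dprodP => n.
rewrite [RHS](_ : _ = ct_mul f h n + ct_mul g h n) // /ct_mul -big_split /=.
by apply: eq_bigr => k _; rewrite [(f + g) k](_ : _ = f k + g k) // ct_actD.
Qed.
Lemma ct_mulDr : right_distributive ct_mul +%R.
Proof.
move=> f g h; apply: dprodP => n.
rewrite [RHS](_ : _ = ct_mul f g n + ct_mul f h n) // /ct_mul -big_split /=.
by apply: eq_bigr => k _; rewrite ct_actDr.
Qed.
Lemma ct_mul_local f f' g g' n :
  (forall i, (i <= n)%N -> f i = f' i) -> (forall i, (i <= n)%N -> g i = g' i) ->
  ct_mul f g n = ct_mul f' g' n.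
Proof.
move=> ff gg; apply: eq_bigr => k _.
by rewrite ff -1?ltnS //; exact: ct_act_local.
Qed.
Lemma ct_mul_shift x f g : ct_mul (ct_shift x f) g = ct_shift x (ct_mul f g).
Proof.
apply: dprodP => -[|n] /=; rewrite /ct_mul big_ord_recl ct_act0 add0r.
  by rewrite big_ord0.
rewrite (big_morph _ (ptensDr x) (ptens0r _ x)); apply: eq_bigr => k _.
by rewrite [ct_shift _ _ _]/= ct_act_ptens.
Qed.
Lemma ct_mul_scale d f g : ct_mul (d *: f) g = d *: ct_mul f g.
Proof.
apply: dprodP => n; rewrite [RHS]scaler_sumr; apply: eq_bigr => k _.
by rewrite [(d *: f) k](_ : _ = d *: f k) // ct_actZ.
Qed.
Lemma ct_mul_act n (t : tpow n) g h :
  ct_mul (ct_act t g) h = ct_act t (ct_mul g h).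
Proof.
elim: n t => [|n IHn] t; first exact: ct_mul_scale.
elim/ptens_ind: t => [|x v|p q hp hq].
- rewrite !(@ct_act0 n.+1); apply: dprodP => m; rewrite /ct_mul big1 // => k _.
  exact: ct_act0E.
- by rewrite !ct_act_ptens ct_mul_shift IHn.
by rewrite !(@ct_actD n.+1) ct_mulDl hp hq.
Qed.
Lemma ct_mul_suml (J : Type) (r : seq J) (F : J -> ctens) h :
  ct_mul (\sum_(j <- r) F j) h = \sum_(j <- r) ct_mul (F j) h.
Proof.
apply: (big_morph (fun f => ct_mul f h)) => [f g|]; first exact: ct_mulDl.
by apply: (addrI (ct_mul 0 h)); rewrite -ct_mulDl !addr0.
Qed.
Lemma ct_mulA : associative ct_mul.
Proof.
move=> f g h; apply: dprodP => n.
pose F : ctens := \sum_(k < n.+1) ct_act (f k) g.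
have FE i : (i <= n)%N -> ct_mul f g i = F i.
  move=> lein; rewrite [RHS]dp_sumE /ct_mul.
  rewrite (big_ord_widen n.+1 (fun k => ct_act (f k) g i)) //.
  rewrite [RHS](bigID (fun k : 'I_n.+1 => (k < i.+1)%N)) /=.
  rewrite [X in _ = _ + X]big1 ?addr0 // => k; rewrite -leqNgt => ik.
  exact: ct_act_low.
rewrite [RHS](@ct_mul_local _ F h h) // /F ct_mul_suml dp_sumE.
by apply: eq_bigr => k _; rewrite ct_mul_act.
Qed.
Lemma ct_mul0act (d : D) g : ct_mul (ct_deg0 d) g = d *: g.
Proof.
apply: dprodP => n; rewrite /ct_mul big_ord_recl /= big1 ?addr0 // => k _.
exact: (@ct_act0E k.+1).
Qed.
Lemma ct_mul1 : left_id (ct_deg0 1) ct_mul.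
Proof. by move=> f; rewrite ct_mul0act scale1r. Qed.
Lemma ct_act_deg0 n (t : tpow n) :
  ct_act t (ct_deg0 1) n = t /\
  forall m, m != n -> ct_act t (ct_deg0 1) m = 0.
Proof.
elim: n t => [|n IHn] t.
  split=> [|[|m] // _]; first exact: mulr1.
  exact: (@scaler0 D (tpow m.+1) (t : D)).
elim/ptens_ind: t => [|x v|p q [hp hp'] [hq hq']].
- by rewrite ct_act0.
- rewrite ct_act_ptens /=; split; first by rewrite (IHn v).1.
  by move=> [|m] //= mn; rewrite (IHn v).2 // ptens0r.
split=> [|m mn]; first by rewrite (@ct_actDE n.+1) hp hq.
by rewrite (@ct_actDE n.+1) hp' // hq' // addr0.
Qed.
Lemma ct_mulr1 : right_id (ct_deg0 1) ct_mul.
Proof.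
move=> f; apply: dprodP => n; rewrite /ct_mul big_ord_recr /=.
rewrite (ct_act_deg0 (f n)).1 big1 ?add0r // => k _.
by apply: (ct_act_deg0 (f k)).2; rewrite gtn_eqF.
Qed.
HB.instance Definition _ := GRing.Zmodule_isPzRing.Build ctens
  ct_mulA ct_mul1 ct_mulr1 ct_mulDl ct_mulDr.

Definition ct_scal (k : K) : ctens := ct_deg0 (scal k).
Lemma ct_deg0D d e : ct_deg0 (d + e) = ct_deg0 d + ct_deg0 e.
Proof. by apply: dprodP => -[|n] //; exact: (esym (addr0 _)). Qed.
Lemma ct_deg0M d e : ct_deg0 (d * e) = ct_deg0 d * ct_deg0 e.
Proof.
by rewrite [RHS]ct_mul0act; apply: dprodP => -[|n];
  [|exact: (esym (@scaler0 D (tpow n.+1) d))].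
Qed.
Lemma ct_scal1 : ct_scal 1 = 1. Proof. by rewrite /ct_scal scal1. Qed.
Lemma ct_scalD k l : ct_scal (k + l) = ct_scal k + ct_scal l.
Proof. by rewrite /ct_scal scalD ct_deg0D. Qed.
Lemma ct_scalM k l : ct_scal (k * l) = ct_scal k * ct_scal l.
Proof. by rewrite /ct_scal scalM ct_deg0M. Qed.
Lemma ct_act_scal n (t : tpow n) (k : K) g :
  ct_act t ((scal k : D) *: g) = (scal k : D) *: ct_act t g.
Proof.
elim: n t => [|n IHn] t; first by rewrite /= !scalerA scalC.
elim/ptens_ind: t => [|x v|p q hp hq].
- by rewrite !(@ct_act0 n.+1) scaler0.
- by rewrite !ct_act_ptens IHn -ct_shiftB ract_scal ct_shiftZ.
by rewrite !(@ct_actD n.+1) hp hq scalerDr.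
Qed.
Lemma ct_scalC k f : ct_scal k * f = f * ct_scal k.
Proof.
rewrite [LHS]ct_mul0act -{1}[f]mulr1 -[ct_scal k]mulr1.
rewrite [ct_scal k * 1]ct_mul0act.
apply: dprodP => n; rewrite [LHS]scaler_sumr; apply: eq_bigr => i _.
by rewrite ct_act_scal.
Qed.
HB.instance Definition _ := PzRing_isKAlg.Build K ctens
  ct_scal1 ct_scalD ct_scalM ct_scalC.

(* The closure of an ideal for the product topology on [prod_n M^(x)n].        *)
Definition ct_closure (I : set ctens) : set ctens :=
  [set f | forall n, exists2 g, I g & forall m, (m <= n)%N -> f m = g m].

Section Closure.
Variable (I : ideal ctens).
Lemma ct_closure0 : ct_closure I 0.
Proof. by move=> n; exists 0 => //; exact: as0. Qed.
Lemma ct_closureB f g :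
  ct_closure I f -> ct_closure I g -> ct_closure I (f - g).
Proof.
move=> cf cg n; have [f' If ff] := cf n; have [g' Ig gg] := cg n.
exists (f' - g'); first exact: asB.
move=> m mn; rewrite [LHS](_ : _ = f m - g m) //.
by rewrite [RHS](_ : _ = f' m - g' m) // ff // gg.
Qed.
Lemma ct_closureMl f g : ct_closure I g -> ct_closure I (f * g).
Proof.
move=> cg n; have [g' Ig gg] := cg n; exists (f * g'); first exact: idMl.
by move=> m mn; apply: ct_mul_local => // i im; apply: gg; exact: leq_trans mn.
Qed.
Lemma ct_closureMr f g : ct_closure I g -> ct_closure I (g * f).
Proof.
move=> cg n; have [g' Ig gg] := cg n; exists (g' * f); first exact: idMr.
by move=> m mn; apply: ct_mul_local => // i im; apply: gg; exact: leq_trans mn.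
Qed.
Definition closed_ideal : ideal ctens :=
  @Ideal ctens (AddSub ct_closure0 ct_closureB) ct_closureMl ct_closureMr.
End Closure.
End CompletedTensorAlgebra.

Section GeneratedIdeal.
Variables (A : pzRingType) (G : set A).
Definition gen_set : set A := [set x | forall I : ideal A, G `<=` I -> I x].
Lemma gen_set0 : gen_set 0. Proof. by move=> I _; exact: as0. Qed.
Lemma gen_setB x y : gen_set x -> gen_set y -> gen_set (x - y).
Proof. by move=> gx gy I GI; apply: asB; [exact: gx | exact: gy]. Qed.
Lemma gen_setMl a x : gen_set x -> gen_set (a * x).
Proof. by move=> gx I GI; apply: idMl; exact: gx. Qed.
Lemma gen_setMr a x : gen_set x -> gen_set (x * a).
Proof. by move=> gx I GI; apply: idMr; exact: gx. Qed.
Definition gen_ideal : ideal A :=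
  @Ideal A (AddSub gen_set0 gen_setB) gen_setMl gen_setMr.
End GeneratedIdeal.

Definition addspan (V : zmodType) (G : set V) : set V :=
  [set x | exists2 s : seq V, (forall y, y \in s -> G y) & x = \sum_(y <- s) y].

Record quiver := Quiver {
  vert : finType;
  arr : finType;
  src : arr -> vert;
  tgt : arr -> vert
}.

(* No two arrows have the same source and the same target.                     *)
Definition simply_arrowed (Q : quiver) : Prop :=
  injective (fun a : arr Q => (src a, tgt a)).

Definition adjacent (Q : quiver) : rel (vert Q) :=
  [rel i j | [exists a : arr Q, ((src a == i) && (tgt a == j))
                             || ((src a == j) && (tgt a == i))]].
Definition connected_quiver (Q : quiver) : Prop :=
  forall i j : vert Q, connect (@adjacent Q) i j.

Definition delete_arrows (Q : quiver) (C : {set arr Q}) : quiver :=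
  @Quiver (vert Q) {a : arr Q | a \notin C}
    (fun a => src (val a)) (fun a => tgt (val a)).

Record species (K : fieldType) (Q : quiver) := Species {
  sp_D : vert Q -> falgType K;
  sp_division : forall i (x : sp_D i), x != 0 -> x \is a GRing.unit;
  sp_M : forall a : arr Q, bimodule (sp_D (tgt a)) (sp_D (src a));
  sp_findim : forall a, findim (restr_scal (sp_M a))
}.

Definition restrict_species (K : fieldType) (Q : quiver) (S : species K Q)
    (C : {set arr Q}) : species K (delete_arrows C) :=
  @Species K (delete_arrows C) (sp_D S) (@sp_division K Q S)
    (fun a => sp_M S (val a)) (fun a => sp_findim S (val a)).

Section TotalAlgebra.
Variables (K : fieldType) (I : Type) (D : I -> falgType K).
Definition totD : Type := dprod D.
HB.instance Definition _ := GRing.Zmodule.on totD.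
Definition totD_mul (d e : totD) : totD := fun i => d i * e i.
Definition totD_one : totD := fun=> 1.
Lemma totD_mulA : associative totD_mul.
Proof. by move=> d e f; apply: dprodP => i; exact: mulrA. Qed.
Lemma totD_mul1 : left_id totD_one totD_mul.
Proof. by move=> d; apply: dprodP => i; exact: mul1r. Qed.
Lemma totD_mulr1 : right_id totD_one totD_mul.
Proof. by move=> d; apply: dprodP => i; exact: mulr1. Qed.
Lemma totD_mulDl : left_distributive totD_mul +%R.
Proof. by move=> d e f; apply: dprodP => i; exact: mulrDl. Qed.
Lemma totD_mulDr : right_distributive totD_mul +%R.
Proof. by move=> d e f; apply: dprodP => i; exact: mulrDr. Qed.
HB.instance Definition _ := GRing.Zmodule_isPzRing.Build totD
  totD_mulA totD_mul1 totD_mulr1 totD_mulDl totD_mulDr.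
Definition totD_scal (k : K) : totD := fun=> scal k.
Lemma totD_scal1 : totD_scal 1 = 1.
Proof. by apply: dprodP => i; exact: scal1. Qed.
Lemma totD_scalD k l : totD_scal (k + l) = totD_scal k + totD_scal l.
Proof. by apply: dprodP => i; exact: scalD. Qed.
Lemma totD_scalM k l : totD_scal (k * l) = totD_scal k * totD_scal l.
Proof. by apply: dprodP => i; exact: scalM. Qed.
Lemma totD_scalC k (x : totD) : totD_scal k * x = x * totD_scal k.
Proof. by apply: dprodP => i; exact: scalC. Qed.
HB.instance Definition _ := PzRing_isKAlg.Build K totD
  totD_scal1 totD_scalD totD_scalM totD_scalC.
End TotalAlgebra.

Definition vertex_unit (K : fieldType) (Q : quiver) (S : species K Q)
  (i : vert Q) : totD (sp_D S) := fun j => if j == i then 1 else 0.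

Section TotalBimodule.
Variables (K : fieldType) (Q : quiver) (S : species K Q).
Local Notation D := (totD (sp_D S)).
Definition totM_car : Type := dprod (fun a => bim_car (sp_M S a)).
HB.instance Definition _ := GRing.Zmodule.on totM_car.
Implicit Types (x y : totM_car) (d e : D).
Definition totM_scale d x : totM_car := fun a => d (tgt a) *: x a.
Lemma totM_scaleA d e x : totM_scale d (totM_scale e x) = totM_scale (d * e) x.
Proof. by apply: dprodP => a; exact: scalerA. Qed.
Lemma totM_scale1 : left_id 1 totM_scale.
Proof. by move=> x; apply: dprodP => a; exact: scale1r. Qed.
Lemma totM_scaleDr : right_distributive totM_scale +%R.
Proof. by move=> d x y; apply: dprodP => a; exact: scalerDr. Qed.
Lemma totM_scaleDl x : {morph totM_scale^~ x : d e / d + e}.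
Proof. by move=> d e; apply: dprodP => a; exact: scalerDl. Qed.
HB.instance Definition _ := GRing.Zmodule_isLmodule.Build D totM_car
  totM_scaleA totM_scale1 totM_scaleDr totM_scaleDl.
Definition totM_ract x d : totM_car := fun a => ract (x a) (d (src a)).
Lemma totM_ractDl x y d :
  totM_ract (x + y) d = totM_ract x d + totM_ract y d.
Proof. by apply: dprodP => a; exact: ractDl. Qed.
Lemma totM_ractDr x d e :
  totM_ract x (d + e) = totM_ract x d + totM_ract x e.
Proof. by apply: dprodP => a; exact: ractDr. Qed.
Lemma totM_ract1 x : totM_ract x 1 = x.
Proof. by apply: dprodP => a; exact: ract1. Qed.
Lemma totM_ractM x d e : totM_ract x (d * e) = totM_ract (totM_ract x d) e.
Proof. by apply: dprodP => a; exact: ractM. Qed.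
Lemma totM_ractZ d x e : totM_ract (d *: x) e = d *: totM_ract x e.
Proof. by apply: dprodP => a; exact: ractZ. Qed.
Lemma totM_ract_scal (k : K) x : totM_ract x (scal k) = (scal k : D) *: x.
Proof. by apply: dprodP => a; exact: ract_scal. Qed.
Definition totM : bimodule D D := @Bimodule K D D totM_car totM_ract
  totM_ractDl totM_ractDr totM_ract1 totM_ractM totM_ractZ totM_ract_scal.
End TotalBimodule.

Definition That (K : fieldType) (Q : quiver) (S : species K Q) : kalgType K :=
  ctens (totM S).

Section Inclusion.
Variables (K : fieldType) (Q : quiver) (S : species K Q) (C : {set arr Q}).
Local Notation SC := (restrict_species S C).

(* Extension by zero on the arrows in [C].                                     *)
Definition totM_incl (x : totM SC) : totM S := fun a =>
  match @idP (a \notin C) with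
  | ReflectT aC => x (exist (fun a => a \notin C) a aC)
  | ReflectF _ => 0
  end.
Fixpoint tpow_incl (n : nat) : tpow (totM SC) n -> tpow (totM S) n :=
  match n return tpow (totM SC) n -> tpow (totM S) n with
  | 0 => fun d => d
  | m.+1 => tens_lift (fun (x : totM SC) (u : tpow (totM SC) m) =>
              ptens (totM_incl x) (tpow_incl u))
  end.
Definition That_incl (f : That SC) : That S := fun n => tpow_incl (f n).
End Inclusion.

Section SymmetricForm.
Variables (K : fieldType) (D : kalgType K).
Definition symmetrizing_form (t : {linear kspace D -> K^o}) : Prop :=
  (forall a b : D, t (a * b) = t (b * a)) /\
  (forall I : ideal D, (forall x, I x -> t x = 0) -> forall x, I x -> x = 0).
End SymmetricForm.

Section Derivatives.
Variables (K : fieldType) (D : kalgType K) (M : bimodule D D).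
Variable t : {linear kspace D -> K^o}.

Definition dualK : Type := {linear restr_scal M -> K^o}.
Coercion dualK_fun (xi : dualK) : M -> K := GRing.Linear.sort xi.

(* [pair_l xi] and [pair_r xi] are the preimages of [xi] under composition     *)
(* with [t], on left and on right D-linear maps M -> D respectively; thus      *)
(* [pair_l xi x] is b(x (x) xi) and [pair_r xi x] is b(xi (x) x).              *)
Definition pair_l (xi : dualK) : M -> D := xget (fun=> 0)
  [set f | [/\ forall x y, f (x + y) = f x + f y,
               forall (d : D) x, f (d *: x) = d * f x
             & forall x, t (f x) = xi x]].
Definition pair_r (xi : dualK) : M -> D := xget (fun=> 0)
  [set f | [/\ forall x y, f (x + y) = f x + f y,
               forall (d : D) x, f (ract x d) = f x * d
             & forall x, t (f x) = xi x]].

Definition casimir (xs : seq (dualK * M)) : Prop :=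
  forall x : M, \sum_(p <- xs) pair_l p.1 x *: p.2 = x.

Definition pderl (xi : dualK) (f : ctens M) : ctens M :=
  fun n => tens_lift (fun (a : M) (u : tpow M n) => pair_r xi a *: u) (f n.+1).

Variable xs : seq (dualK * M).
Definition eps_l (f : ctens M) : ctens M :=
  \sum_(p <- xs) pderl p.1 f * ct_deg1 p.2.
(* In tensor degree n = d + 1 the sum runs over 0 <= k <= d.                   *)
Definition eps_c (f : ctens M) : ctens M :=
  fun n => (\sum_(k < n) iter k eps_l (ct_comp n f)) n.
Definition pder (xi : dualK) (f : ctens M) : ctens M := pderl xi (eps_c f).

Definition potential (W : ctens M) : Prop :=
  [/\ exists N, forall n, (N <= n)%N -> W n = 0,
      forall n, (n < 2)%N -> W n = 0
    & forall d : D, ct_deg0 M d * W = W * ct_deg0 M d].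
End Derivatives.

Section Jacobian.
Variables (K : fieldType) (Q : quiver) (S : species K Q).
Local Notation D := (totD (sp_D S)).
Local Notation M := (totM S).
Variable t : {linear kspace D -> K^o}.
Variable xs : seq (dualK M * M).
Variable W : That S.

Definition jac_rel : set (That S) := [set pder t xs xi W | xi in setT].
Definition jac_ideal : ideal (That S) := closed_ideal (gen_ideal jac_rel).
Definition jacobian : kalgType K := quotalg jac_ideal.

(* Words [:: a_n; ...; a_1] are written in the order of composition.           *)
(* [path_span L] is the sum of the M_(a_n) (x)_D ... (x)_D M_(a_1) over the    *)
(* words in [L]; the summand of the empty word is [D].                         *)
Fixpoint path_tensor (w : seq (arr Q)) : set (That S) :=
  if w is a :: w' then
    [set f | exists (x : M) (g : That S),
      [/\ forall b, b != a -> x b = 0, path_tensor w' g & f = ct_deg1 x * g]]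
  else [set f | exists d : D, f = ct_deg0 M d].
Definition path_span (L : set (seq (arr Q))) : set (That S) :=
  addspan [set f | exists2 w, L w & path_tensor w f].

Definition quiver_cycle (c : seq (arr Q)) : bool :=
  (c != [::]) && cycle (fun a b => src a == tgt b) c.
Definition carries_potential (Q2 : set (seq (arr Q))) : Prop :=
  (forall c, Q2 c -> quiver_cycle c) /\
  path_span [set w | exists c i, Q2 c /\ w = rot i c] W.
Definition cycles_of_potential (Q2 : set (seq (arr Q))) : Prop :=
  carries_potential Q2 /\
  forall Q2', Q2' `<=` Q2 -> carries_potential Q2' -> Q2' = Q2.

Definition cut_deg (C : {set arr Q}) (w : seq (arr Q)) : nat :=
  count (fun a => a \in C) w.
Definition cut (Q2 : set (seq (arr Q))) (C : {set arr Q}) : Prop :=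
  forall c, Q2 c -> cut_deg C c = 1%N.

(* The product, over the degrees [i] in [L], of the homogeneous parts of       *)
(* degree [i] for the grading by [g_C].                                        *)
Definition That_deg (C : {set arr Q}) (L : set nat) : set (That S) :=
  [set f | forall n,
     path_span [set w | size w = n /\ L (cut_deg C w)] (ct_comp n f)].
Definition jac_deg (C : {set arr Q}) (L : set nat) : set jacobian :=
  [set p | exists2 f, That_deg C L f & p = qcl jac_ideal f].

Variable C : {set arr Q}.
(* [xi] lies in the summand M_a^* of M^* iff it kills the elements whose       *)
(* component at [a] is zero.                                                   *)
Definition trunc_rel : set (That (restrict_species S C)) :=
  [set r | exists (a : arr Q) (xi : dualK M),
    [/\ a \in C, forall x : M, x a = 0 -> xi x = 0
      & That_incl r = pder t xs xi W]].
Definition trunc_ideal : ideal (That (restrict_species S C)) :=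
  closed_ideal (gen_ideal trunc_rel).
Definition trunc_jacobian : kalgType K := quotalg trunc_ideal.

Definition trunc_incl (p : trunc_jacobian) : jacobian :=
  qcl jac_ideal (That_incl (repr p)).
Definition trunc_idem (k : vert Q) : trunc_jacobian :=
  qcl trunc_ideal (ct_deg0 (totM (restrict_species S C)) (vertex_unit S k)).

Definition strict_sink (k : vert Q) : Prop :=
  (forall a : arr Q, src a = k -> a \in C) /\
  (forall a : arr Q, tgt a = k -> a \notin C).
Definition mutate_cut (k : vert Q) : {set arr Q} :=
  (C :\: [set a | src a == k])%SET :|: [set a | tgt a == k]%SET.
End Jacobian.

Section LinearMaps.
Variables (R : pzRingType) (U V : lmodType R).
Lemma linear_ext (f g : {linear U -> V}) : f =1 g -> f = g.
Proof.
move=> /funext; case: f g => [f [[f1] [f2]]] [g [[g1] [g2]]] /= fg.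
move: f1 f2 g1 g2; rewrite fg => f1 f2 g1 g2.
by rewrite (Prop_irrelevance f1 g1) (Prop_irrelevance f2 g2).
Qed.
HB.instance Definition _ := gen_eqMixin {linear U -> V}.
HB.instance Definition _ := gen_choiceMixin {linear U -> V}.
Implicit Types f g h : {linear U -> V}.
Definition lin_add f g : {linear U -> V} := f \+ g.
Definition lin_opp f : {linear U -> V} := \- f.
Definition lin_zero : {linear U -> V} := \0.
Lemma lin_addA : associative lin_add.
Proof. by move=> f g h; apply: linear_ext => x /=; rewrite addrA. Qed.
Lemma lin_addC : commutative lin_add.
Proof. by move=> f g; apply: linear_ext => x /=; rewrite addrC. Qed.
Lemma lin_add0 : left_id lin_zero lin_add.
Proof. by move=> f; apply: linear_ext => x /=; rewrite add0r. Qed.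
Lemma lin_addN : left_inverse lin_zero lin_opp lin_add.
Proof. by move=> f; apply: linear_ext => x /=; rewrite addNr. Qed.
HB.instance Definition _ := GRing.isZmodule.Build {linear U -> V}
  lin_addA lin_addC lin_add0 lin_addN.
Lemma lin_sumE (I : Type) (r : seq I) P (F : I -> {linear U -> V}) x :
  (\sum_(i <- r | P i) F i) x = \sum_(i <- r | P i) F i x.
Proof. by apply: (big_morph (fun f : {linear U -> V} => f x)). Qed.
End LinearMaps.

Definition lin_comp (R : pzRingType) (U V W : lmodType R)
  (g : {linear V -> W}) (f : {linear U -> V}) : {linear U -> W} := g \o f.

Section ScalarMap.
Variables (K : fieldType) (A : kalgType K) (V : lmodType A) (k : K).
Definition scal_fun (x : V) : V := (scal k : A) *: x.
Lemma scal_fun_linear : linear scal_fun.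
Proof.
by move=> a x y; rewrite /scal_fun scalerDr !scalerA scalC.
Qed.
HB.instance Definition _ := GRing.isLinear.Build A V V *:%R scal_fun
  scal_fun_linear.
Definition scal_map : {linear V -> V} := scal_fun.
End ScalarMap.

(* The opposite of the endomorphism algebra.                                   *)
Definition end_op (K : fieldType) (A : kalgType K) (T : lmodType A) : Type :=
  {linear T -> T}.
Section EndOp.
Variables (K : fieldType) (A : kalgType K) (T : lmodType A).
HB.instance Definition _ := GRing.Zmodule.on (end_op T).
Implicit Types f g h : end_op T.
Definition eo_mul f g : end_op T := lin_comp g f.
Definition eo_one : end_op T := idfun.
Lemma eo_mulA : associative eo_mul.
Proof. by move=> f g h; exact: linear_ext. Qed.
Lemma eo_mul1 : left_id eo_one eo_mul.
Proof. by move=> f; exact: linear_ext. Qed.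
Lemma eo_mulr1 : right_id eo_one eo_mul.
Proof. by move=> f; exact: linear_ext. Qed.
Lemma eo_mulDl : left_distributive eo_mul +%R.
Proof. by move=> f g h; apply: linear_ext => x /=; rewrite linearD. Qed.
Lemma eo_mulDr : right_distributive eo_mul +%R.
Proof. by move=> f g h; exact: linear_ext. Qed.
HB.instance Definition _ := GRing.Zmodule_isPzRing.Build (end_op T)
  eo_mulA eo_mul1 eo_mulr1 eo_mulDl eo_mulDr.
Definition eo_scal (k : K) : end_op T := scal_map T k.
Lemma eo_scal1 : eo_scal 1 = 1.
Proof. by apply: linear_ext => x /=; rewrite /scal_fun scal1 scale1r. Qed.
Lemma eo_scalD k l : eo_scal (k + l) = eo_scal k + eo_scal l.
Proof. by apply: linear_ext => x /=; rewrite /scal_fun scalD scalerDl. Qed.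
Lemma eo_scalM k l : eo_scal (k * l) = eo_scal k * eo_scal l.
Proof.
by apply: linear_ext => x /=; rewrite /scal_fun scalerA mulrC scalM.
Qed.
Lemma eo_scalC k f : eo_scal k * f = f * eo_scal k.
Proof. by apply: linear_ext => x /=; rewrite /scal_fun linearZ. Qed.
HB.instance Definition _ := PzRing_isKAlg.Build K (end_op T)
  eo_scal1 eo_scalD eo_scalM eo_scalC.
End EndOp.

(* The left module [Hom_K(A, K)], with [(a f)(x) = f(x a)], and the right      *)
(* action [(f a)(x) = f(a x)].                                                 *)
Definition dual_mod (K : fieldType) (A : kalgType K) : Type :=
  {linear kspace A -> K^o}.
Section DualMod.
Variables (K : fieldType) (A : kalgType K).
Definition dual_fun (f : dual_mod A) : A -> K := GRing.Linear.sort f.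
Lemma dual_ext (f g : dual_mod A) : dual_fun f =1 dual_fun g -> f = g.
Proof. exact: (@linear_ext K (kspace A) K^o f g). Qed.
Lemma dual_funD (f : dual_mod A) x y :
  dual_fun f (x + y) = dual_fun f x + dual_fun f y.
Proof. exact: linearD. Qed.
Lemma dual_funZ (f : dual_mod A) (k : K) (x : A) :
  dual_fun f (scal k * x) = k *: (dual_fun f x : K^o).
Proof.
pose g : {linear kspace A -> K^o} := f.
exact: (linearZ_LR g k (x : kspace A)).
Qed.
HB.instance Definition _ := GRing.Zmodule.on (dual_mod A).
Lemma dual_add_fun (f g : dual_mod A) x :
  dual_fun (f + g) x = dual_fun f x + dual_fun g x.
Proof. by []. Qed.

Definition dual_lfun (a : A) (f : dual_mod A) : kspace A -> K^o :=
  fun x => dual_fun f ((x : A) * a).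
Lemma dual_lfun_linear a f : linear (dual_lfun a f).
Proof.
move=> k x y; rewrite /dual_lfun -dual_funZ -dual_funD; congr dual_fun.
by rewrite mulrDl mulrA.
Qed.
HB.instance Definition _ a f := GRing.isLinear.Build K (kspace A) K^o *:%R
  (dual_lfun a f) (dual_lfun_linear a f).
Definition dual_scale (a : A) (f : dual_mod A) : dual_mod A :=
  (dual_lfun a f : {linear kspace A -> K^o}).
Lemma dual_scale_fun a f x : dual_fun (dual_scale a f) x = dual_fun f (x * a).
Proof. by []. Qed.
Lemma dual_scaleA a b f : dual_scale a (dual_scale b f) = dual_scale (a * b) f.
Proof. by apply: dual_ext => x; rewrite !dual_scale_fun mulrA. Qed.
Lemma dual_scale1 : left_id 1 dual_scale.
Proof. by move=> f; apply: dual_ext => x; rewrite dual_scale_fun mulr1. Qed.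
Lemma dual_scaleDr : right_distributive dual_scale +%R.
Proof. by move=> a f g; apply: dual_ext. Qed.
Lemma dual_scaleDl f : {morph dual_scale^~ f : a b / a + b}.
Proof.
move=> a b; apply: dual_ext => x.
by rewrite dual_add_fun !dual_scale_fun mulrDr dual_funD.
Qed.
HB.instance Definition _ := GRing.Zmodule_isLmodule.Build A (dual_mod A)
  dual_scaleA dual_scale1 dual_scaleDr dual_scaleDl.
Lemma dual_scaleE (a : A) (f : dual_mod A) x :
  dual_fun (a *: f) x = dual_fun f (x * a).
Proof. by []. Qed.

Definition dual_rfun (a : A) (f : dual_mod A) : kspace A -> K^o :=
  fun x => dual_fun f (a * (x : A)).
Lemma dual_rfun_linear a f : linear (dual_rfun a f).
Proof.
move=> k x y; rewrite /dual_rfun -dual_funZ -dual_funD; congr dual_fun.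
by rewrite mulrDr !mulrA -scalC.
Qed.
HB.instance Definition _ a f := GRing.isLinear.Build K (kspace A) K^o *:%R
  (dual_rfun a f) (dual_rfun_linear a f).
Definition dual_ract (a : A) (f : dual_mod A) : dual_mod A :=
  (dual_rfun a f : {linear kspace A -> K^o}).
Lemma dual_ract_fun a f x : dual_fun (dual_ract a f) x = dual_fun f (a * x).
Proof. by []. Qed.
Lemma dual_ract_linear a : linear (dual_ract a).
Proof.
move=> b f g; apply: dual_ext => x.
by rewrite !(dual_add_fun, dual_ract_fun, dual_scaleE) mulrA.
Qed.
HB.instance Definition _ a := GRing.isLinear.Build A (dual_mod A) (dual_mod A)
  *:%R (dual_ract a) (dual_ract_linear a).
Lemma dual_ract1 f : dual_ract 1 f = f.
Proof. by apply: dual_ext => x; rewrite dual_ract_fun mul1r. Qed.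
Lemma dual_ractM a b f : dual_ract (a * b) f = dual_ract b (dual_ract a f).
Proof. by apply: dual_ext => x; rewrite !dual_ract_fun mulrA. Qed.
Lemma dual_ractD a b f : dual_ract (a + b) f = dual_ract a f + dual_ract b f.
Proof.
apply: dual_ext => x.
by rewrite dual_add_fun !dual_ract_fun mulrDl dual_funD.
Qed.
Lemma dual_ract_scal (k : K) f : dual_ract (scal k) f = (scal k : A) *: f.
Proof. by apply: dual_ext => x; rewrite dual_ract_fun dual_scaleE scalC. Qed.
End DualMod.

(* Ext over a K-algebra [A], computed from the bar resolution                  *)
(*   ... -> A (x) A^(x)n (x) X -> ... -> A (x) X -> X   (tensors over K)       *)
(* of [X], which is projective because [K] is a field: an [A]-linear map from  *)
(* the n-th term to [Y] is a K-multilinear map [A^n * X -> Y].                 *)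
Section BarComplex.
Variables (K : fieldType) (A : kalgType K) (X Y : lmodType A).

Definition cochain (n : nat) : Type := ('I_n -> A) -> X -> Y.
HB.instance Definition _ n := GRing.Zmodule.on (cochain n).

Definition upd (n : nat) (t : 'I_n -> A) (i : 'I_n) (a : A) : 'I_n -> A :=
  fun j => if j == i then a else t j.

Definition multilinear (n : nat) (c : cochain n) : Prop :=
  (forall t (k : K) x y,
     c t ((scal k : A) *: x + y) = (scal k : A) *: c t x + c t y) /\
  (forall t i (k : K) a b x,
     c (upd t i (scal k * a + b)) x
     = (scal k : A) *: c (upd t i a) x + c (upd t i b) x).

Definition bar_merge (n : nat) (t : 'I_n.+1 -> A) (i : 'I_n) : 'I_n -> A :=
  fun j => if (j < i)%N then t (widen_ord (leqnSn n) j)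
           else if j == i then t (widen_ord (leqnSn n) j) * t (lift ord0 j)
           else t (lift ord0 j).

Definition bar_d (n : nat) (c : cochain n) : cochain n.+1 := fun t x =>
  t ord0 *: c (fun j => t (lift ord0 j)) x
  + \sum_(i < n) ((-1) ^+ i.+1 : A) *: c (bar_merge t i) x
  + ((-1) ^+ n.+1 : A) *:
      c (fun j => t (widen_ord (leqnSn n) j)) (t ord_max *: x).

Lemma cochB n (c d : cochain n) t x : (c - d) t x = c t x - d t x.
Proof. by []. Qed.

Lemma addrB3 (V : zmodType) (a a' b b' c c' : V) :
  (a - a') + (b - b') + (c - c') = (a + b + c) - (a' + b' + c').
Proof. by rewrite !opprD [RHS]addrACA; congr (_ + _); rewrite addrACA. Qed.
Lemma bar_dB n (c d : cochain n) : bar_d (c - d) = bar_d c - bar_d d.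
Proof.
apply/funext => t; apply/funext => x; rewrite cochB /bar_d !cochB !scalerBr.
under eq_bigr do rewrite cochB scalerBr.
by rewrite sumrB addrB3.
Qed.
Lemma bar_d0 n : bar_d (0 : cochain n) = 0.
Proof. by rewrite -[0](subrr 0) bar_dB subrr. Qed.

Lemma multilinear0 n : multilinear (0 : cochain n).
Proof. by split=> *; rewrite scaler0 addr0. Qed.
Lemma multilinearB n (c d : cochain n) :
  multilinear c -> multilinear d -> multilinear (c - d).
Proof.
move=> [c1 c2] [d1 d2]; split=> [t k x y|t i k a b x].
  by rewrite !cochB c1 d1 opprD addrACA -scalerBr.
by rewrite !cochB c2 d2 opprD addrACA -scalerBr.
Qed.

Definition cocycle n : set (cochain n) :=
  [set c | multilinear c /\ bar_d c = 0].
Lemma cocycle0 n : cocycle (0 : cochain n).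
Proof. by split; [exact: multilinear0 | exact: bar_d0]. Qed.
Lemma cocycleB n (c d : cochain n) : cocycle c -> cocycle d -> cocycle (c - d).
Proof.
move=> [c1 c2] [d1 d2]; split; first exact: multilinearB.
by rewrite bar_dB c2 d2 subrr.
Qed.
Definition cocycles n : addsub (cochain n) :=
  AddSub (@cocycle0 n) (@cocycleB n).

Definition coboundary n : set (subgrp (cocycles n)) :=
  match n return set (subgrp (cocycles n)) with
  | 0 => [set 0]
  | m.+1 => [set z | exists2 c : cochain m, multilinear c & val z = bar_d c]
  end.
Lemma coboundary0 n : coboundary (0 : subgrp (cocycles n)).
Proof.
by case: n => [|n] //=; exists 0; [exact: multilinear0 | rewrite bar_d0].
Qed.
Lemma coboundaryB n (y z : subgrp (cocycles n)) :
  coboundary y -> coboundary z -> coboundary (y - z).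
Proof.
case: n y z => [|n] y z /=; first by move=> -> ->; rewrite subr0.
move=> [c mc yc] [d md zd]; exists (c - d); first exact: multilinearB.
by rewrite bar_dB -yc -zd.
Qed.
Definition coboundaries n : addsub (subgrp (cocycles n)) :=
  AddSub (@coboundary0 n) (@coboundaryB n).

Definition Ext (n : nat) : Type := quot (coboundaries n).
HB.instance Definition _ n := GRing.Zmodule.on (Ext n).
End BarComplex.

Section ExtMap.
Variables (K : fieldType) (A : kalgType K) (X X' Y Y' : lmodType A).
Variables (b : {linear X' -> X}) (g : {linear Y -> Y'}).

Definition cochain_map n (c : cochain X Y n) : cochain X' Y' n :=
  fun t x => g (c t (b x)).
Lemma cochain_mapB n (c d : cochain X Y n) :
  cochain_map (c - d) = cochain_map c - cochain_map d.
Proof.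
apply/funext => t; apply/funext => x.
by rewrite cochB /cochain_map cochB linearB.
Qed.
Lemma cochain_map0 n : cochain_map (0 : cochain X Y n) = 0.
Proof. by rewrite -[0](subrr 0) cochain_mapB subrr. Qed.
Lemma bar_d_map n (c : cochain X Y n) :
  bar_d (cochain_map c) = cochain_map (bar_d c).
Proof.
apply/funext => t; apply/funext => x; rewrite /bar_d /cochain_map.
rewrite !linearD !linearZ linear_sum /=; congr (_ + _ + _).
by apply: eq_bigr => i _; rewrite linearZ.
Qed.
Lemma multilinear_map n (c : cochain X Y n) :
  multilinear c -> multilinear (cochain_map c).
Proof.
move=> [c1 c2]; split=> [t k x y|t i k a d x]; rewrite /cochain_map.
  by rewrite !linearP c1 linearP.
by rewrite c2 linearP.
Qed.
Lemma cocycle_map_subproof n (z : subgrp (cocycles X Y n)) :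
  cochain_map (val z) \in as_mem (cocycles X' Y' n).
Proof.
have /as_memP[z1 z2] := valP z; apply/as_memP; split.
  exact: multilinear_map.
by rewrite bar_d_map z2 cochain_map0.
Qed.
Definition cocycle_map n (z : subgrp (cocycles X Y n)) :
  subgrp (cocycles X' Y' n) := 
  exist (fun c => c \in as_mem (cocycles X' Y' n)) _ (cocycle_map_subproof z).
Lemma cocycle_mapB n (y z : subgrp (cocycles X Y n)) :
  cocycle_map (y - z) = cocycle_map y - cocycle_map z.
Proof. by apply: val_inj; rewrite /= cochain_mapB. Qed.
Lemma cocycle_mapD n (y z : subgrp (cocycles X Y n)) :
  cocycle_map (y + z) = cocycle_map y + cocycle_map z.
Proof.
have c0 : cocycle_map (0 : subgrp (cocycles X Y n)) = 0.
  by rewrite -[0](subrr 0) cocycle_mapB subrr.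
rewrite -[z in LHS]opprK cocycle_mapB -[- z]sub0r cocycle_mapB.
by rewrite c0 sub0r opprK.
Qed.
Lemma coboundary_map n (z : subgrp (cocycles X Y n)) :
  coboundary z -> coboundary (cocycle_map z).
Proof.
case: n z => [|n] z /=.
  by move=> ->; rewrite -[0](subrr 0) cocycle_mapB subrr.
move=> [c mc zc]; exists (cochain_map c); first exact: multilinear_map.
by rewrite bar_d_map -zc.
Qed.
Definition Ext_map n (e : Ext X Y n) : Ext X' Y' n :=
  qcl (coboundaries X' Y' n) (cocycle_map (repr e)).
Lemma Ext_mapE n z : Ext_map (qcl (coboundaries X Y n) z)
  = qcl (coboundaries X' Y' n) (cocycle_map z).
Proof.
apply: qcl_eq; rewrite -cocycle_mapB; apply: coboundary_map.
exact: (qcl_repr (coboundaries X Y n) z).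
Qed.
Lemma Ext_mapD n (d e : Ext X Y n) : Ext_map (d + e) = Ext_map d + Ext_map e.
Proof.
elim/qclP: d => y; elim/qclP: e => z.
by rewrite -qclD !Ext_mapE cocycle_mapD qclD.
Qed.
End ExtMap.

Section Tau.
Variables (K : fieldType) (A : kalgType K).
Implicit Types (X Y Z : lmodType A).
Local Notation DA := (dual_mod A).
Local Notation id_ X := (idfun : {linear X -> X}).

Section TauObject.
Variable X : lmodType A.

(* [Ext^2(DA, X)] is a left module through the right action of [A] on [DA].    *)
Definition tau2 : Type := Ext DA X 2.
HB.instance Definition _ := GRing.Zmodule.on tau2.
Local Notation cl := (qcl (coboundaries DA X 2)).

Lemma tau2P (P : tau2 -> Prop) : (forall z, P (cl z)) -> forall e, P e.
Proof. exact: qclP. Qed.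
Definition tau2_scale (a : A) (e : tau2) : tau2 :=
  Ext_map (dual_ract a) (id_ X) e.
Lemma tau2_scaleE a z : tau2_scale a (cl z) =
  cl (cocycle_map (dual_ract a) (id_ X) z).
Proof. exact: Ext_mapE. Qed.
Lemma tau2_scaleA a b e : tau2_scale a (tau2_scale b e) = tau2_scale (a * b) e.
Proof.
move: e; apply: tau2P => z; rewrite !tau2_scaleE; congr (cl _).
apply: val_inj; apply/funext => t; apply/funext => f /=.
by rewrite /cochain_map /= dual_ractM.
Qed.
Lemma tau2_scale1 : left_id 1 tau2_scale.
Proof.
apply: tau2P => z; rewrite !tau2_scaleE; congr (cl _).
apply: val_inj; apply/funext => t; apply/funext => f /=.
by rewrite /cochain_map /= dual_ract1.
Qed.
Lemma tau2_scaleDr : right_distributive tau2_scale +%R.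
Proof. by move=> a d e; exact: Ext_mapD. Qed.
Lemma tau2_scaleDl e : {morph tau2_scale^~ e : a b / a + b}.
Proof.
move=> a b; move: e; apply: tau2P => z; rewrite !tau2_scaleE -qclD.
congr (cl _); apply: val_inj; apply/funext => t; apply/funext => f /=.
have /as_memP[[z1 _] _] := valP z.
rewrite /cochain_map /= dual_ractD.
by have := z1 t 1 (dual_ract a f) (dual_ract b f); rewrite scal1 !scale1r.
Qed.
HB.instance Definition _ := GRing.Zmodule_isLmodule.Build A tau2
  tau2_scaleA tau2_scale1 tau2_scaleDr tau2_scaleDl.
End TauObject.

Section TauMap.
Variables (X Y : lmodType A) (g : {linear X -> Y}).
Definition tau2_fun (e : tau2 X) : tau2 Y := Ext_map (id_ DA) g e.
Lemma tau2_funE z : tau2_fun (qcl (coboundaries DA X 2) z) =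
  qcl (coboundaries DA Y 2) (cocycle_map (id_ DA) g z).
Proof. exact: Ext_mapE. Qed.
Lemma tau2_fun_linear : linear tau2_fun.
Proof.
move=> a d e; rewrite /tau2_fun Ext_mapD; congr (_ + _).
move: d; apply: tau2P => z.
rewrite -/(tau2_fun _) -/(tau2_fun _) [a *: _]tau2_scaleE !tau2_funE.
by rewrite [RHS]tau2_scaleE; congr (qcl _ _); exact: val_inj.
Qed.
HB.instance Definition _ := GRing.isLinear.Build A (tau2 X) (tau2 Y) *:%R
  tau2_fun tau2_fun_linear.
Definition tau2_map : {linear tau2 X -> tau2 Y} := tau2_fun.
End TauMap.

Lemma tau2_map_id X : tau2_map (id_ X) = id_ (tau2 X).
Proof.
apply: linear_ext; apply: tau2P => z; rewrite [LHS]tau2_funE.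
by congr (qcl _ _); exact: val_inj.
Qed.
Lemma tau2_map_comp X Y Z (g : {linear Y -> Z}) (f : {linear X -> Y}) :
  tau2_map (lin_comp g f) = lin_comp (tau2_map g) (tau2_map f).
Proof.
apply: linear_ext; apply: tau2P => z; rewrite [LHS]tau2_funE.
rewrite /lin_comp /= !tau2_funE.
by congr (qcl _ _); exact: val_inj.
Qed.
Lemma tau2_mapD X Y (f g : {linear X -> Y}) :
  tau2_map (f + g) = tau2_map f + tau2_map g.
Proof.
apply: linear_ext; apply: tau2P => z; rewrite [LHS]tau2_funE.
rewrite [RHS](_ : _ = tau2_map f (qcl _ z) + tau2_map g (qcl _ z)) //.
rewrite [X in _ = X + _]tau2_funE [X in _ = _ + X]tau2_funE -qclD.
by congr (qcl _ _); exact: val_inj.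
Qed.
Lemma tau2_map0 X Y : tau2_map (0 : {linear X -> Y}) = 0.
Proof.
by apply: (addrI (tau2_map (0 : {linear X -> Y}))); rewrite -tau2_mapD !addr0.
Qed.
Lemma tau2_map_sum X Y (I : Type) (r : seq I) (F : I -> {linear X -> Y}) :
  tau2_map (\sum_(i <- r) F i) = \sum_(i <- r) tau2_map (F i).
Proof.
by apply: (big_morph (@tau2_map X Y)); [exact: tau2_mapD | exact: tau2_map0].
Qed.
Lemma tau2_map_scal X (k : K) : tau2_map (scal_map X k) = scal_map (tau2 X) k.
Proof.
apply: linear_ext; apply: tau2P => z; rewrite [LHS]tau2_funE [RHS]tau2_scaleE.
congr (qcl _ _); apply: val_inj; apply/funext => t; apply/funext => f /=.
have /as_memP[[z1 _] _] := valP z.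
have z0 : val z t 0 = 0.
  have := z1 t 1 0 0; rewrite scal1 !scale1r addr0 -[LHS]addr0.
  by move=> /addrI.
rewrite /cochain_map /= dual_ract_scal.
by have := z1 t k f 0; rewrite z0 !addr0.
Qed.
End Tau.

Section Preprojective.
Variables (K : fieldType) (A : kalgType K).

Fixpoint tau2_iter (i : nat) (X : lmodType A) : lmodType A :=
  if i is j.+1 then tau2 (tau2_iter j X) else X.

Local Notation T i := (tau2_iter i A^o).

Definition pi3 : Type := dprod (fun i => {linear A^o -> T i}).
HB.instance Definition _ := GRing.Zmodule.on pi3.
Implicit Types (u v w : pi3).

(* [tau2^i] applied to the component of [v] of degree [n - i], and 0 if n < i. *)
Fixpoint tau2_comp v (i n : nat) : {linear T i -> T n} :=
  match i, n return {linear T i -> T n} with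
  | 0, n => v n
  | j.+1, 0 => \0
  | j.+1, m.+1 => tau2_map (tau2_comp v j m)
  end.

(* For [u] of degree i the product is u * v = tau2^i(v) o u.                   *)
Definition pi3_mul u v : pi3 :=
  fun n => \sum_(i < n.+1) lin_comp (tau2_comp v i n) (u i).
Definition pi3_deg0 (f : {linear A^o -> A^o}) : pi3 :=
  fun n => if n is 0 return {linear A^o -> T n} then f else \0.
Definition pi3_one : pi3 := pi3_deg0 idfun.

Lemma lin_compDl (X Y Z : lmodType A) (g h : {linear Y -> Z})
    (f : {linear X -> Y}) :
  lin_comp (g + h) f = lin_comp g f + lin_comp h f.
Proof. exact: linear_ext. Qed.
Lemma lin_compDr (X Y Z : lmodType A) (g : {linear Y -> Z})
    (f h : {linear X -> Y}) :
  lin_comp g (f + h) = lin_comp g f + lin_comp g h.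
Proof. by apply: linear_ext => x /=; rewrite linearD. Qed.
Lemma lin_comp0l (X Y Z : lmodType A) (f : {linear X -> Y}) :
  lin_comp (0 : {linear Y -> Z}) f = 0.
Proof. exact: linear_ext. Qed.
Lemma lin_comp0r (X Y Z : lmodType A) (g : {linear Y -> Z}) :
  lin_comp g (0 : {linear X -> Y}) = 0.
Proof. by apply: linear_ext => x; exact: linear0. Qed.
Lemma lin_comp_suml (X Y Z : lmodType A) (I : Type) (r : seq I)
    (F : I -> {linear Y -> Z}) (f : {linear X -> Y}) :
  lin_comp (\sum_(i <- r) F i) f = \sum_(i <- r) lin_comp (F i) f.
Proof.
by apply: (big_morph (fun g => lin_comp g f)) => [g h|];
  [exact: lin_compDl | exact: lin_comp0l].
Qed.
Lemma lin_comp_sumr (X Y Z : lmodType A) (I : Type) (r : seq I)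
    (g : {linear Y -> Z}) (F : I -> {linear X -> Y}) :
  lin_comp g (\sum_(i <- r) F i) = \sum_(i <- r) lin_comp g (F i).
Proof.
by apply: (big_morph (fun f => lin_comp g f)) => [f h|];
  [exact: lin_compDr | exact: lin_comp0r].
Qed.

Lemma tau2_compD u v i n :
  tau2_comp (u + v) i n = tau2_comp u i n + tau2_comp v i n.
Proof.
elim: i n => [|i IHi] [|n] //=; last by rewrite IHi tau2_mapD.
exact: (esym (addr0 (0 : {linear _ -> _}))).
Qed.
Lemma tau2_comp_low v i n : (n < i)%N -> tau2_comp v i n = 0.
Proof.
by elim: i n => [|i IHi] [|n] //= ni; rewrite IHi // tau2_map0.
Qed.
Lemma tau2_comp_mul u v i n :
  tau2_comp (pi3_mul u v) i n =
  \sum_(k < n.+1) lin_comp (tau2_comp v k n) (tau2_comp u i k).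
Proof.
elim: i n => [|i IHi] [|n] //=.
  by rewrite big_ord1 lin_comp0r.
rewrite big_ord_recl lin_comp0r add0r IHi tau2_map_sum.
by apply: eq_bigr => k _; rewrite tau2_map_comp.
Qed.
Lemma pi3_mulA : associative pi3_mul.
Proof.
move=> u v w; apply: dprodP => n; rewrite /pi3_mul.
under eq_bigr => i _.
  rewrite -/(pi3_mul v w) tau2_comp_mul lin_comp_suml.
  over.
rewrite exchange_big /=; apply: eq_bigr => k _.
rewrite lin_comp_sumr.
rewrite [LHS](bigID (fun i : 'I_n.+1 => (i < k.+1)%N)) /=.
rewrite [X in _ + X]big1 ?addr0; last first.
  move=> i; rewrite -leqNgt => ki; rewrite (tau2_comp_low v) //.
  by rewrite lin_comp0r lin_comp0l.
rewrite (big_ord_widen n.+1 (fun i =>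
  lin_comp (tau2_comp w k n) (lin_comp (tau2_comp v i k) (u i)))) //.
by apply: eq_bigr => i _; exact: linear_ext.
Qed.
Lemma pi3_mulDl : left_distributive pi3_mul +%R.
Proof.
move=> u v w; apply: dprodP => n.
rewrite [RHS](_ : _ = pi3_mul u w n + pi3_mul v w n) // /pi3_mul -big_split /=.
by apply: eq_bigr => i _; rewrite -lin_compDr.
Qed.
Lemma pi3_mulDr : right_distributive pi3_mul +%R.
Proof.
move=> u v w; apply: dprodP => n.
rewrite [RHS](_ : _ = pi3_mul u v n + pi3_mul u w n) // /pi3_mul -big_split /=.
by apply: eq_bigr => i _; rewrite tau2_compD lin_compDl.
Qed.
Lemma pi3_mul_deg0 f v n : pi3_mul (pi3_deg0 f) v n = lin_comp (v n) f.
Proof.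
rewrite /pi3_mul big_ord_recl /= big1 ?addr0 // => i _; exact: lin_comp0r.
Qed.
Lemma pi3_mul1 : left_id pi3_one pi3_mul.
Proof.
by move=> v; apply: dprodP => n; rewrite pi3_mul_deg0; exact: linear_ext.
Qed.
Lemma tau2_comp_deg0_neq f i n : i != n -> tau2_comp (pi3_deg0 f) i n = 0.
Proof.
elim: i n => [|i IHi] [|n] //= ni; by rewrite IHi // tau2_map0.
Qed.
Lemma tau2_comp_scal (k : K) n :
  tau2_comp (pi3_deg0 (scal_map A^o k)) n n = scal_map (T n) k.
Proof. by elim: n => //= n ->; exact: tau2_map_scal. Qed.
Lemma tau2_comp_one n : tau2_comp pi3_one n n = idfun.
Proof. by elim: n => //= n ->; exact: tau2_map_id. Qed.
Lemma pi3_mulr_deg0 v f n :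
  pi3_mul v (pi3_deg0 f) n = lin_comp (tau2_comp (pi3_deg0 f) n n) (v n).
Proof.
rewrite /pi3_mul big_ord_recr /= big1 ?add0r // => i _.
by rewrite tau2_comp_deg0_neq ?lin_comp0l // ltn_eqF.
Qed.
Lemma pi3_mulr1 : right_id pi3_one pi3_mul.
Proof.
move=> v; apply: dprodP => n; rewrite pi3_mulr_deg0 tau2_comp_one.
exact: linear_ext.
Qed.
HB.instance Definition _ := GRing.Zmodule_isPzRing.Build pi3
  pi3_mulA pi3_mul1 pi3_mulr1 pi3_mulDl pi3_mulDr.

Definition pi3_scal (k : K) : pi3 := pi3_deg0 (scal_map A^o k).
Lemma pi3_scal1 : pi3_scal 1 = 1.
Proof.
apply: dprodP => -[|n] //; apply: linear_ext => x /=.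
by rewrite /scal_fun scal1 scale1r.
Qed.
Lemma pi3_scalD k l : pi3_scal (k + l) = pi3_scal k + pi3_scal l.
Proof.
apply: dprodP => -[|n]; last exact: (esym (addr0 (0 : {linear _ -> _}))).
by apply: linear_ext => x /=; rewrite /scal_fun scalD scalerDl.
Qed.
Lemma pi3_scalM k l : pi3_scal (k * l) = pi3_scal k * pi3_scal l.
Proof.
apply: dprodP => n; rewrite [RHS]pi3_mul_deg0; case: n => [|n].
  by apply: linear_ext => x /=; rewrite /scal_fun scalerA mulrC scalM.
exact: linear_ext.
Qed.
Lemma pi3_scalC k v : pi3_scal k * v = v * pi3_scal k.
Proof.
apply: dprodP => n; rewrite [LHS]pi3_mul_deg0 [RHS]pi3_mulr_deg0.
rewrite tau2_comp_scal; apply: linear_ext => x /=.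
by rewrite /scal_fun linearZ.
Qed.
HB.instance Definition _ := PzRing_isKAlg.Build K pi3
  pi3_scal1 pi3_scalD pi3_scalM pi3_scalC.
End Preprojective.

Section Modules.
Variables (R : pzRingType).
Implicit Types (U V X : lmodType R).

Definition surj (T T' : Type) (f : T -> T') : Prop :=
  forall y, exists x, f x = y.

Definition projective_mod X : Prop :=
  forall U V (g : {linear U -> V}) (f : {linear X -> V}), surj g ->
    exists h : {linear X -> U}, forall x, g (h x) = f x.
Definition injective_mod X : Prop :=
  forall U V (i : {linear U -> V}) (f : {linear U -> X}), injective i ->
    exists h : {linear V -> X}, forall u, h (i u) = f u.

Definition short_exact U V X (f : {linear U -> V}) (g : {linear V -> X}) : Prop :=
  [/\ injective f, surj g & forall v, g v = 0 <-> exists u, v = f u].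

Fixpoint projdim_le (n : nat) X : Prop :=
  if n is m.+1 then
    exists U V (f : {linear U -> V}) (g : {linear V -> X}),
      [/\ projective_mod V, short_exact f g & projdim_le m U]
  else projective_mod X.
Fixpoint injdim_le (n : nat) X : Prop :=
  if n is m.+1 then
    exists U V (f : {linear X -> U}) (g : {linear U -> V}),
      [/\ injective_mod U, short_exact f g & injdim_le m V]
  else injective_mod X.
Definition injdim_eq (n : nat) X : Prop :=
  injdim_le n X /\ forall m, injdim_le m X -> (n <= m)%N.
Definition gldim_le (n : nat) : Prop := forall X, projdim_le n X.

Definition simple_mod X : Prop :=
  (exists x : X, x != 0) /\
  forall U : addsub X, (forall (a : R) x, U x -> U (a *: x)) ->
    (forall x, U x -> x = 0) \/ (forall x, U x).

Definition mod_iso U V : Prop := exists f : {linear U -> V}, bijective f.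
End Modules.

(* The left ideal [A e] as a module.                                           *)
Section PrincipalModule.
Variables (A : pzRingType) (e : A).
Definition princ_mem : {pred A^o} := [pred x | `[< exists y : A, x = y * e >]].
Lemma princ_submod : submod_closed princ_mem.
Proof.
split; first by apply/asboolP; exists 0; rewrite mul0r.
move=> a x y /asboolP[u ->] /asboolP[v ->]; apply/asboolP.
by exists (a * u + v); rewrite mulrDl -mulrA.
Qed.
HB.instance Definition _ :=
  GRing.isSubmodClosed.Build A A^o princ_mem princ_submod.
Definition princ : Type := {x : A^o | x \in princ_mem}.
HB.instance Definition _ := SubChoice.on princ.
HB.instance Definition _ := [SubChoice_isSubLmodule of princ by <:].
End PrincipalModule.

Definition idempotent (A : pzRingType) (e : A) : Prop := e * e = e.
Definition primitive (A : pzRingType) (e : A) : Prop :=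
  [/\ idempotent e, e != 0 & forall f g : A, idempotent f -> idempotent g ->
    f * g = 0 -> g * f = 0 -> e = f + g -> f = 0 \/ g = 0].
Definition basic_ring (A : pzRingType) : Prop :=
  exists (n : nat) (e : 'I_n -> A),
    [/\ forall i, primitive (e i), forall i j, i != j -> e i * e j = 0,
        \sum_i e i = 1
      & forall i j, mod_iso (princ (e i)) (princ (e j)) -> i = j].

Section APR.
Variables (K : fieldType) (A : kalgType K) (e : A).
Definition apr2_module : lmodType A := (tau2 (princ e) * princ (1 - e))%type.
(* The conditions on P = A e under which [apr2_module] is a 2-APR tilting      *)
(* module.                                                                     *)
Definition gives_apr2_tilting : Prop :=
  [/\ basic_ring A, simple_mod (princ e) /\ projective_mod (princ e),
      forall f : {linear dual_mod A -> princ e}, f = 0,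
      forall x : Ext (dual_mod A) (princ e) 1, x = 0
    & injdim_eq 2 (princ e)].
End APR.

Section Cuts.
Variables (K : fieldType) (Q : quiver) (S : species K Q).
Variable t : {linear kspace (totD (sp_D S)) -> K^o}.
Variable xs : seq (dualK (totM S) * totM S).
Variable W : That S.
Variable Q2 : set (seq (arr Q)).

(* An isomorphism of complete graded algebras [prod_i A_i -> prod_i B_i] is an *)
(* algebra isomorphism that carries [prod_(i in L) A_i] onto                   *)
(* [prod_(i in L) B_i] for every set [L] of degrees. The last clause says that *)
(* [phi] is the identity in degree 0, where Hom_A(A, A) is identified with [A] *)
(* by evaluation at 1 and [A] with the degree 0 part by [trunc_incl].          *)
Definition preprojective_cut (C : {set arr Q}) : Prop :=
  let A := trunc_jacobian t xs W C in
  [/\ cut Q2 C, findim (kspace A), gldim_le A 2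
    & exists phi : pi3 A -> jacobian t xs W,
      [/\ kalg_hom phi, bijective phi,
          forall L : set nat,
            phi @` [set u : pi3 A | forall i, ~ L i -> u i = 0]
            = jac_deg C L
        & forall f : {linear A^o -> A^o},
            phi (pi3_deg0 f) = trunc_incl (f (1 : A))]].
End Cuts.

Definition perfect_field (K : fieldType) : Prop :=
  forall p : {poly K}, irreducible_poly p -> separable_poly p.

(* Main.v *)
(* Put A = P(S, W, C), e = e_k, P = A e and tau = tau_2^-. Since k is a strict  *)
(* sink, e A e is a division algebra with (1 - e) A e = 0, and an injective     *)
(* coresolution of P yields an exact sequence 0 -> P -> P1 -> P2 -> tau P -> 0  *)
(* with P1, P2 in add A(1 - e), along which Hom into every tau X and into       *)
(* A(1 - e) stays exact. Hence Ext^1 and Ext^2 from T = tau P (+) A(1 - e) into *)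
(* T and into every tau X vanish.                                               *)
(*                                                                              *)
(* Let A' = End(T)^op with its idempotent e' for tau P, f = 1 - e. Splicing a   *)
(* T-resolution of the dual of the right module fA with the sequence of P gives *)
(* an A'-projective resolution ending in the dual of A', so that Ext^2 of that  *)
(* dual with coefficients Hom(T, Y) is eY (+) f tau(Y) for every Y as above.    *)
(*                                                                              *)
(* Inside R = Pi_3(A), graded by C, let U_n be the part of degree n for the     *)
(* mutated cut and Y_n = R_(n+1) e (+) R_n f. Then Y_0 = T, U_0 = A',           *)
(* tau Y_n = Y_(n+1), and U_n agrees with Hom(T, Y_n) on (1 - e')-parts; the    *)
(* formula above becomes tau' U_n = U_(n+1), compatibly with multiplication,    *)
(* and the iterates of these isomorphisms assemble to Pi_3(A') = R.             *)
(*                                                                              *)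
(* For species: the Casimir element is invariant under bimodule endomorphisms,  *)
(* so cyclic symmetrization preserves the degree of W for every cut; hence      *)
(* P(S, W, C') is the degree 0 part of the Jacobian algebra for C', and the     *)
(* gradings of C and C' = mu_k^-(C) differ by the shift on e_k x (1 - e_k).     *)
From HB Require Import structures.
From mathcomp Require Import all_boot all_order all_algebra all_field.
From mathcomp Require Import boolp classical_sets functions.
From mathcomp Require Import zify.
Require Import Defs.

Set Implicit Arguments.
Unset Strict Implicit.
Unset Printing Implicit Defensive.

Import GRing.Theory.
Local Open Scope classical_set_scope.
Local Open Scope ring_scope.

(** * Linear algebra *)

(** Write A for the truncated Jacobian algebra of C, e for the idempotent of k, f = 1 - e, P = A e,
    Z = tau P, and R for the algebra Pi_3(A), which is the Jacobian algebra graded by C.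

    Mutating the cut leaves the Jacobian algebra unchanged and only regrades it. Along a path the
    two degrees differ by the contributions of its end points ([path_deg]), so e R e and f R f keep
    their degrees, f R e loses one and e R f gains one ([regrading]). The new degree 0 part is
    therefore e A e (+) f A f (+) f R_1 e. Since R_1 e is tau P, this is the opposite endomorphism
    algebra A' of T = Z (+) A f ([tilt_pi], [end_op_iso]). On the side of species it is the
    truncated Jacobian algebra of the new cut: cyclic symmetrization and differentiation respect the
    grading of any cut ([eps_c_deg], [pder_deg]), whence [trunc_incl_inj] and [trunc_incl_image].
    What remains, [pi3_mutation], concerns only A and R: A' has global dimension at most 2, and
    Pi_3(A') is R with its new grading.

    The conditions on P enter through [apr_data_exists]. Applying Hom(DA, -) to an injective
    coresolution of P gives an exact sequence from P to tau P through two modules in add A f; Hom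
    into A f and into every tau W stays exact on it, and Ext^2(tau P, P) carries a linear form that
    behaves like a trace.

    The heart is the computation of tau' = Ext^2(DA', -). The functionals on f' A' are resolved by
    Hom(T, -) of a T-resolution of D(fA), those on e' A' by Hom(T, -) of the sequence of P, the
    trace form providing the augmentation ([Xi_exact]). Reading off Ext^2 identifies tau' Hom(T, Y)
    with e Y (+) f tau Y, and the action of A' can be followed through the identification
    ([theta_act_e], [theta_act_f], [theta_act_l]). Let U_n be the part of R of new degree n, and Y_n
    = R_(n+1) e (+) R_n f, so that tau Y_n = Y_(n+1). The natural map from U_n to Hom(T, Y_n) is
    bijective on f'-parts, and this is all that tau' sees ([fiso_tau2]). Hence tau' U_n = e Y_n (+)
    f Y_(n+1) = U_(n+1), compatibly with right multiplication ([om], [om_nat]). Iteration from U_0 =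
    A' gives an isomorphism from tau'^n A' onto U_n for all n, and their sum [Ph] is the isomorphism
    from Pi_3(A') to R.

    For the global dimension, A' is triangular: f' A' f' is the corner f A f of A, e' A' e' is a
    division ring, and [tilt_gldim] treats the two parts of a module separately. *)

Section GeneralizedInverse.
Variables (R : pzRingType) (X Y : lmodType R) (f : {linear X -> Y}).
Hypothesis actsR : forall r : R,
  ((forall x : X, r *: x = 0) /\ (forall y : Y, r *: y = 0)) \/
  exists s, (forall x : X, s *: (r *: x) = x) /\ (forall y : Y, s *: (r *: y) = y).
Let good (G : set (Y * X)) := [/\
  forall (r : R) (p q : (Y * X)%type), G p -> G q -> G (r *: p + q),
  forall x, G (0, x) -> x = 0 &
  forall y x, G (y, x) -> (exists x0, y = f x0) -> f x = y].
Let good_chain (F : set (set (Y * X))) :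
  F `<=` good -> total_on F subset -> good (\bigcup_(G in F) G).
Proof.
move=> FP Ftot; split.
- move=> r p q [G FG Gp] [H FH Hq].
  have [GH|HG] := Ftot _ _ FG FH.
    by exists H => //; have [h _ _] := FP _ FH; apply: h => //; exact: GH.
  by exists G => //; have [h _ _] := FP _ FG; apply: h => //; exact: HG.
- by move=> x [G FG Gx]; have [_ h _] := FP _ FG; exact: h.
- by move=> y x [G FG Gx]; have [_ _ h] := FP _ FG; exact: h.
Qed.
(** Under [actsR] the ring acts like a division ring on both modules, so the vector space argument
    applies: Zorn's lemma yields a maximal partial inverse, given by its graph. The hypothesis
    covers the field K and also modules over an algebra that acts through a division corner. *)
Lemma ginv : exists g : {linear Y -> X}, forall x, f (g (f x)) = f x.
Proof.
have [G [[Glin Gfun Gim] Gmax]] := Zorn_bigcup good_chain.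
have max H : good H -> G `<=` H -> H `<=` G.
  move=> gH GH; have [//|nHG] := pselect (H `<=` G).
  by case: (Gmax H (conj GH nHG)).
(* The empty relation is [good] as well, so the pair of zeros has to be adjoined explicitly. *)
have G00 : G (0, 0).
  pose G1 : set (Y * X) := [set p | G p \/ p = 0].
  have gG1 : good G1.
    split.
    - move=> r p q [Gp|->] [Gq|->]; last by right; rewrite scaler0 addr0.
      + by left; exact: Glin.
      + left; rewrite -(addNr p).
        by apply: (Glin) => //; rewrite -scaleN1r; exact: Glin.
      + by left; rewrite scaler0 add0r.
    - by move=> x [/Gfun //|[]].
    - move=> y x [Gyx|[-> ->] _]; last by rewrite linear0.
      exact: Gim.
  by apply: (max _ gG1) => [p|]; [left|right].
have GZ r p : G p -> G (r *: p) by move=> Gp; rewrite -[_ *: _]addr0; exact: Glin.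
have GD p q : G p -> G q -> G (p + q).
  by move=> Gp Gq; rewrite -[p]scale1r; exact: Glin.
have GB p q : G p -> G q -> G (p - q).
  by move=> Gp Gq; rewrite addrC -scaleN1r; exact: Glin.
(* Otherwise the relation could be extended by a pair (y, x'), against maximality. *)
have tot y : exists x, G (y, x).
  apply: contrapT => ny.
  pose ext (x' : X) := [set p : Y * X | exists r q, G q /\ p = r *: (y, x') + q].
  have dom_inv r a b s : G (a, b) -> (forall y0 : Y, s *: (r *: y0) = y0) ->
      r *: y + a = 0 -> False.
    move=> Gab sr /(congr1 ( *:%R s)); rewrite scalerDr sr scaler0 => /eqP.
    rewrite addr_eq0 => /eqP ysa; apply: ny; exists (- s *: b).
    have -> : y = - s *: a by rewrite scaleNr.
    exact: (GZ (- s) (a, b)).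
  have gext x' : (forall r a b s x0, G (a, b) -> (forall x : X, s *: (r *: x) = x) ->
       (forall y0 : Y, s *: (r *: y0) = y0) ->
       r *: y + a = f x0 -> f (r *: x' + b) = r *: y + a) -> good (ext x').
    move=> hx'; split.
    - move=> t _ _ [r1 [q1 [G1 ->]]] [r2 [q2 [G2 ->]]].
      exists (t * r1 + r2), (t *: q1 + q2); split; first exact: Glin.
      by rewrite scalerDr scalerDl scalerA addrACA.
    - move=> x [r [[a b] [Gab [h0 ->]]]]; move: h0 => /esym h0.
      case: (actsR r) => [[rX rY]|[s [_ sY]]].
        move: h0 Gab; rewrite rY rX !add0r => -> /Gfun -> //.
      by case: (dom_inv _ _ _ _ Gab sY h0).
    - move=> _ _ [r [[a b] [Gab [-> ->]]]] /= [x0].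
      case: (actsR r) => [[rX rY]|[s [sX sY]]].
        by rewrite rX rY !add0r => h; apply: Gim => //; exists x0.
      by move=> e0; have := hx' r a b s x0 Gab sX sY e0.
  have [x' gx'] : exists x', good (ext x').
    (* If some y + y2 with y2 in the domain lies in the image of f, the condition on the image
       prescribes x' up to the kernel of f; otherwise the value 0 is consistent. *)
    have [[y2 [x2 [x1 [G2 e1]]]]|no] :=
        pselect (exists y2 x2 x1, G (y2, x2) /\ y + y2 = f x1).
      exists (x1 - x2); apply: gext => r a b s x0 Gab sX sY e0.
      have G3 : G (a - r *: y2, b - r *: x2).
        exact: (GB (a, b) _ Gab (GZ r (y2, x2) G2)).
      have e3 : a - r *: y2 = f (x0 - r *: x1).
        by rewrite linearB linearZ_LR -e0 -e1 scalerDr opprD addrACA subrr add0r.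
      have e4 := Gim _ _ G3 (ex_intro _ _ e3).
      rewrite scalerBr addrAC -addrA linearD linearZ_LR e4 -e1.
      by rewrite scalerDr -addrA [_ + (a - _)]addrC subrK.
    exists 0; apply: gext => r a b s x0 Gab sX sY e0; exfalso; apply: no.
    exists (s *: a), (s *: b), (s *: x0); split; first exact: (GZ s (a, b)).
    by rewrite -[y in LHS]sY -scalerDr e0 linearZ.
  have sub : G `<=` ext x'.
    by move=> p Gp; exists 0, p; split => //; rewrite scale0r add0r.
  apply: ny; exists x'; apply: (max _ gx' sub).
  by exists 1, 0; rewrite scale1r addr0.
pose g y : X := sval (cid (tot y)).
have Gg y : G (y, g y) by exact: svalP (cid (tot y)).
have gU y x : G (y, x) -> g y = x.
  move=> Gyx; apply/eqP; rewrite -subr_eq0; apply/eqP; apply: Gfun.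
  by rewrite -(subrr y); exact: (GB (_, _) (_, _)).
have glin : linear g.
  by move=> r y z; apply: gU; apply: (Glin r (_, _) (_, _)).
pose gL := GRing.isLinear.Build R Y X *:%R g glin.
exists (HB.pack g gL : {linear Y -> X}) => x.
by apply: Gim; [exact: Gg | exists x].
Qed.
End GeneralizedInverse.

Definition mklin (R : pzRingType) (X Y : lmodType R) (f : X -> Y)
    (f_lin : linear f) : {linear X -> Y} :=
  HB.pack f (GRing.isLinear.Build R X Y *:%R f f_lin).
Arguments mklin {R X Y f} f_lin.

Section Submodules.
Variables (R : pzRingType) (V : lmodType R).
Record submodule := Submodule {
  sm_set :> V -> Prop;
  sm0 : sm_set 0;
  smP : forall (a : R) x y, sm_set x -> sm_set y -> sm_set (a *: x + y)
}.
Variable S : submodule.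
Definition sm_mem : {pred V} := [pred x | `[< S x >]].
Lemma sm_memP x : reflect (S x) (x \in sm_mem).
Proof. exact: asboolP. Qed.
Lemma sm_closed : submod_closed sm_mem.
Proof.
split; first by apply/sm_memP; exact: sm0.
by move=> a x y /sm_memP Sx /sm_memP Sy; apply/sm_memP; exact: smP.
Qed.
HB.instance Definition _ := GRing.isSubmodClosed.Build R V sm_mem sm_closed.
Definition smod : Type := {x : V | x \in sm_mem}.
HB.instance Definition _ := SubChoice.on smod.
HB.instance Definition _ := [SubChoice_isSubLmodule of smod by <:].
Lemma smodP (x : smod) : S (val x).
Proof. exact/sm_memP/(valP x). Qed.
Definition smk x (Sx : S x) : smod := exist _ x (introT (sm_memP x) Sx).
Definition sm_incl : {linear smod -> V} := val.
Lemma sm_incl_inj : injective sm_incl.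
Proof. exact: val_inj. Qed.
Lemma smodZ x a : S x -> S (a *: x).
Proof. by move=> Sx; rewrite -[_ *: _]addr0; apply: smP => //; exact: sm0. Qed.
Lemma smodD x y : S x -> S y -> S (x + y).
Proof. by move=> Sx Sy; rewrite -[x]scale1r; exact: smP. Qed.
Variables (U : lmodType R) (f : {linear U -> V}).
Hypothesis fS : forall u, S (f u).
Lemma sm_corestr_linear : linear (fun u => smk (fS u)).
Proof. by move=> a u v; apply: val_inj; rewrite /= linearP. Qed.
Definition sm_corestr : {linear U -> smod} := mklin sm_corestr_linear.
End Submodules.

Section KernelImage.
Variables (R : pzRingType) (U V : lmodType R) (f : {linear U -> V}).
Lemma ker0 : f 0 = 0. Proof. exact: linear0. Qed.
Lemma kerP (a : R) x y : f x = 0 -> f y = 0 -> f (a *: x + y) = 0.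
Proof. by move=> fx fy; rewrite linearP fx fy scaler0 addr0. Qed.
Definition kersm : submodule U := @Submodule R U (fun x => f x = 0) ker0 kerP.
Lemma im0 : exists u, 0 = f u. Proof. by exists 0; rewrite linear0. Qed.
Lemma imP (a : R) x y : (exists u, x = f u) -> (exists u, y = f u) ->
  exists u, a *: x + y = f u.
Proof. by move=> [u ->] [v ->]; exists (a *: u + v); rewrite linearP. Qed.
Definition imsm : submodule V :=
  @Submodule R V (fun x => exists u, x = f u) im0 imP.
End KernelImage.

Section FiniteDimension.
Variable K : fieldType.
Implicit Types U V : lmodType K.
Lemma field_acts U V (k : K) :
  ((forall x : U, k *: x = 0) /\ (forall y : V, k *: y = 0)) \/
  exists l, (forall x : U, l *: (k *: x) = x) /\
            (forall y : V, l *: (k *: y) = y).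
Proof.
have [->|k0] := eqVneq k 0; first by left; split=> ?; rewrite scale0r.
by right; exists k^-1; split=> ?; rewrite scalerA mulVf // scale1r.
Qed.
Lemma kginv U V (f : {linear U -> V}) :
  exists g : {linear V -> U}, forall x, f (g (f x)) = f x.
Proof. by apply: ginv => k; exact: field_acts. Qed.
Definition dual_basis V n (v : 'I_n -> V) (a : 'I_n -> {linear V -> K^o}) :=
  forall x, x = \sum_i (a i x : K) *: v i.
(** The functionals are the components of a generalized inverse of the coordinate map from K^n onto
    V, so the spanning family may be dependent. *)
Lemma findim_dual_basis V : findim V -> exists n v a, @dual_basis V n v a.
Proof.
move=> [n [v vspan]].
have slin : linear (fun c : dprod (fun _ : 'I_n => K^o) => \sum_i (c i : K) *: v i).
  move=> k c d; rewrite scaler_sumr -big_split /=; apply: eq_bigr => i _.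
  rewrite scalerA -scalerDl //.
have [g gP] := kginv (mklin slin).
have alin i : linear (fun x => g x i) by move=> k x y; rewrite linearP.
exists n, v, (fun i => mklin (alin i)) => x.
have [c xc] := vspan x; have := gP (c : dprod (fun _ : 'I_n => K^o)).
by rewrite /= -xc.
Qed.
Lemma findim_surj U V (f : {linear U -> V}) :
  (forall y, exists x, f x = y) -> findim U -> findim V.
Proof.
move=> fs [n [v vspan]]; exists n, (fun i => f (v i)) => y.
have [x <-] := fs y; have [c ->] := vspan x; exists c.
by rewrite linear_sum; apply: eq_bigr => i _; rewrite linearZ_LR.
Qed.
Lemma findim_inj U V (f : {linear U -> V}) : injective f -> findim V -> findim U.
Proof.
move=> fi; have [g gP] := kginv f; apply: (@findim_surj _ _ g) => x.
by exists (f x); exact: fi.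
Qed.
(** The functional is the coordinate along w = y - f (g y), which is nonzero, of the part of a
    vector left over by the projection f g. *)
Lemma kseparate U V (f : {linear U -> V}) (y : V) : (forall x, f x != y) ->
  exists a : {linear V -> K^o}, (forall x, a (f x) = 0) /\ a y <> 0.
Proof.
move=> nf; have [g gP] := kginv f; pose w := y - f (g y).
have w0 : w <> 0 by move/eqP; rewrite subr_eq0 eq_sym => h; have := nf (g y); rewrite h.
have clin : linear (fun k : K^o => (k : K) *: w).
  by move=> k a b; rewrite scalerDl scalerA.
have [r rP] := kginv (mklin clin).
have alin : linear (fun v => r (v - f (g v))).
  move=> k u v; rewrite -[RHS]linearP; congr (r _).
  by rewrite (linearP g) (linearP f) /= scalerBr opprD addrACA.
exists (mklin alin); split => [x|] /=; first by rewrite gP subrr linear0.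
move=> h; apply: w0; have := rP 1; rewrite /= scale1r.
by rewrite -/w in h; rewrite h scale0r.
Qed.
End FiniteDimension.

(** * The bar complex and its long exact sequences *)

(** The cancellation behind d d = 0: the simplicial identity matches each term with i <= j to one
    below the diagonal of opposite sign. Signs appear as differences of conditional multiples
    because V is only an additive group. *)
Lemma alternating_faces (V : zmodType) (N : nat) (G : nat -> nat -> V) :
  (forall i j, (i <= j)%N -> (j < N)%N -> G i j = G j.+1 i) ->
  \sum_(i < N.+1) (\sum_(j < N) G i j *+ ~~ odd (i + j) - \sum_(j < N) G i j *+ odd (i + j)) = 0.
Proof.
move=> GG; pose H i j := G i j *+ ~~ odd (i + j) - G i j *+ odd (i + j).
under eq_bigr => i _ do rewrite -sumrB.
rewrite (eq_bigr (fun i : 'I_N.+1 => \sum_(j < N | (i <= j)%N) H i j +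
                             \sum_(j < N | ~~ (i <= j)%N) H i j)); last first.
  by move=> i _; rewrite [LHS](bigID (fun j : 'I_N => (i <= j)%N)).
rewrite big_split /= big_ord_recr /= [X in _ + X + _]big1; last first.
  by move=> j; rewrite leqNgt ltn_ord.
rewrite addr0 [X in _ + X]big_ord_recl /= [X in _ + (X + _)]big1 // add0r.
rewrite [X in _ + X](eq_bigr (fun i : 'I_N => - \sum_(j < N | (j <= i)%N) H j i)).
  rewrite sumrN (exchange_big_dep predT) //= -sumrB big1 // => i _.
  by rewrite subrr.
move=> i _; rewrite -sumrN; apply: eq_big => j; first by rewrite -ltnNge ltnS.
rewrite -ltnNge ltnS => ji; rewrite /H /bump /= add1n -GG //= [(j + i)%N]addnC.
by rewrite negbK opprB.
Qed.

Section BarSquare.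
Variables (K : fieldType) (A : kalgType K) (X Y : lmodType A).
Implicit Types (phi : (nat -> A) -> X -> Y) (s : nat -> A).
Definition merge_seq (i : nat) s : nat -> A :=
  fun j => if (j < i)%N then s j else if j == i then s j * s j.+1 else s j.+1.
(** Cochains are evaluated on infinite sequences so that the faces of all degrees take arguments of
    one type. An n-cochain sees the first n entries, and entry number n is the one that the last
    face moves onto X. *)
Definition face n i phi : (nat -> A) -> X -> Y := fun s x =>
  if i == 0%N then s 0%N *: phi (fun j => s j.+1) x
  else if (i <= n)%N then phi (merge_seq i.-1 s) x else phi s (s n *: x).
Definition seq_d n phi : (nat -> A) -> X -> Y := fun s x =>
  \sum_(i < n.+2) ((-1) ^+ i : A) *: face n i phi s x.
Definition seq_cochain n (c : cochain X Y n) : (nat -> A) -> X -> Y :=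
  fun s x => c (fun i : 'I_n => s i) x.
Definition ext_seq n (t : 'I_n -> A) : nat -> A :=
  fun j => if insub j is Some i then t i else 0.
Lemma ext_seqE n (t : 'I_n -> A) (i : 'I_n) : ext_seq t i = t i.
Proof. by rewrite /ext_seq valK. Qed.
Lemma seq_cochain_ext n (c : cochain X Y n) t x :
  seq_cochain c (ext_seq t) x = c t x.
Proof. by rewrite /seq_cochain; congr (c _ x); apply/funext => i; exact: ext_seqE. Qed.
Lemma seq_bar_d n (c : cochain X Y n) s x :
  seq_cochain (bar_d c) s x = seq_d n (seq_cochain c) s x.
Proof.
rewrite /seq_d big_ord_recl big_ord_recr /= expr0 scale1r /seq_cochain /bar_d.
rewrite -addrA; congr (_ + (_ + _)).
- apply: eq_bigr => i _; rewrite /face /= /bump /= add1n ltn_ord.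
  congr (_ *: _); congr (c _ x); by apply/funext => j; rewrite /bar_merge /merge_seq.
- rewrite /face /= /bump /= add1n ltnNge leqnn /=; congr (_ *: c _ _).
Qed.
Lemma seq_d_sq n phi s x :
    (forall s s' x, (forall j, (j < n)%N -> s j = s' j) -> phi s x = phi s' x) ->
  seq_d n.+1 (seq_d n phi) s x = 0.
Proof.
move=> phil.
have faceS (a : A) : forall i, ((-1) ^+ i : A) * a = a * (-1) ^+ i.
  by move=> i; exact/esym/commr_sign.
have step i : face n.+1 i (seq_d n phi) s x =
    \sum_(j < n.+2) ((-1) ^+ j : A) *: face n.+1 i (face n j phi) s x.
  rewrite /face; case: ifP => _; last by case: ifP.
  by rewrite /seq_d scaler_sumr; apply: eq_bigr => j _; rewrite !scalerA faceS.
pose G i j := face n.+1 i (face n j phi) s x.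
rewrite /seq_d -[RHS](@alternating_faces Y n.+2 G); last first.
  move=> i j ij; rewrite ltnS => jn; rewrite /G.
  have [i0|i0] := posnP i; have [j0|j0] := posnP j.
  - by rewrite i0 j0 /face /= scalerA.
  - rewrite i0 /face /= (gtn_eqF j0) ltnS.
    case: (leqP j n) => jn'.
      rewrite /merge_seq /= j0.
      congr (_ *: phi _ x); apply/funext => k.
      by case: j j0 jn jn' ij => // j _ _ _ _ /=; rewrite ltnS eqSS.
    by [].
  - by move: ij; rewrite j0 leqn0 => /eqP i00; rewrite i00 in i0.
  - have i_n : (i <= n.+1)%N by exact: leq_trans jn.
    rewrite /face /= !(gtn_eqF i0) !(gtn_eqF j0) i_n ltnS.
    case: (leqP j n) => jn'.
      rewrite (leq_trans ij jn').
      congr (phi _ x); apply/funext => k; rewrite /merge_seq.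
      by do !(case: ifP => ?); rewrite ?mulrA //; exfalso; lia.
    case: ifP => i_n'.
      by rewrite /merge_seq (_ : (n < i.-1)%N = false) 1?(_ : (n == i.-1) = false) //; lia.
    have -> : i.-1 = n by lia.
    rewrite [merge_seq n s n]/merge_seq ltnn eqxx scalerA; apply: phil => k kn.
    by rewrite /merge_seq kn.
apply: eq_bigr => i _; rewrite step scaler_sumr -sumrB; apply: eq_bigr => j _.
rewrite scalerA -exprD -signr_odd; case: odd => /=.
  by rewrite expr1 scaleN1r mulr0n mulr1n add0r.
by rewrite expr0 scale1r mulr0n mulr1n subr0.
Qed.
End BarSquare.

Section BarComplexTheory.
Variables (K : fieldType) (A : kalgType K).
Definition klinear (X Y : lmodType A) (f : X -> Y) :=
  forall (k : K) x y, f ((scal k : A) *: x + y) = (scal k : A) *: f x + f y.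
Lemma linear_klinear (X Y : lmodType A) (f : {linear X -> Y}) : klinear f.
Proof. by move=> k x y; rewrite linearP. Qed.
Lemma scal_scale (Y : lmodType A) (k : K) (a : A) (y : Y) :
  (scal k : A) *: (a *: y) = a *: ((scal k : A) *: y).
Proof. by rewrite !scalerA scalC. Qed.

Section Fixed.
Variables (X Y : lmodType A).
Implicit Types (phi : (nat -> A) -> X -> Y) (s : nat -> A).
Definition upds s (i : nat) (a : A) : nat -> A := fun j => if j == i then a else s j.
Definition seq_multilinear n phi :=
  (forall s, klinear (phi s)) /\
  (forall s i (k : K) a b x, (i < n)%N ->
     phi (upds s i (scal k * a + b)) x
     = (scal k : A) *: phi (upds s i a) x + phi (upds s i b) x).
Lemma seq_cochain_multilinear n (c : cochain X Y n) :
  multilinear c <-> seq_multilinear n (seq_cochain c).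
Proof.
split=> -[c1 c2]; split.
- by move=> s k x y; exact: c1.
- move=> s i k a b x ni; have updE a' : (fun j : 'I_n => upds s i a' j) =
      upd (fun j : 'I_n => s j) (Ordinal ni) a'.
    by apply/funext => j; rewrite /upds /upd -val_eqE.
  by rewrite /seq_cochain !updE c2.
- by move=> t k x y; rewrite -!seq_cochain_ext c1.
- move=> t i k a b x; have updE a' : upd t i a' =
      (fun j : 'I_n => upds (ext_seq t) i a' j).
    by apply/funext => j; rewrite /upds /upd -val_eqE ext_seqE.
  by rewrite !updE; apply: c2.
Qed.
Lemma face_multilinear n i phi : (i < n.+2)%N ->
    (forall s s' x, (forall j, (j < n)%N -> s j = s' j) -> phi s x = phi s' x) ->
  seq_multilinear n phi -> seq_multilinear n.+1 (face n i phi).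
Proof.
move=> ni phil [p1 p2]; rewrite /face; case: eqP => [_|/eqP i0].
  split=> [s k x y|s j k a b x jn]; first by rewrite p1 scalerDr scal_scale.
  have [j0|j0] := posnP j.
    rewrite j0 (_ : (fun j0 => _) = (fun j => s j.+1)) //.
    by rewrite {1}/upds /= scalerDl scalerA.
  have uE a' : (fun j0 => upds s j a' j0.+1) = upds (fun j => s j.+1) j.-1 a'.
    by apply/funext => l; rewrite /upds -[in LHS](prednK j0) eqSS.
  rewrite !uE /upds (ltn_eqF j0) -/(upds _ _ _) p2; last by lia.
  by rewrite scalerDr scal_scale.
case: (leqP i n) => i_n.
  split=> [s k x y|s j k a b x jn]; first exact: p1.
  (* After the merge at [i.-1], a change of entry j shows up in entry j', multiplied by its merged
     neighbour as recorded by [m]. *)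
  pose j' := if (j <= i.-1)%N then j else j.-1.
  have j'n : (j' < n)%N by rewrite /j'; case: ifP; lia.
  pose m a' := if j == i.-1 then a' * s i else if j == i then s i.-1 * a' else a'.
  have uE a' : merge_seq i.-1 (upds s j a') = upds (merge_seq i.-1 s) j' (m a').
    apply/funext => l; rewrite /merge_seq /upds /j' /m.
    have {i0} := i0; case: i i_n {ni j' j'n m} => // i _ _ /=.
    case: (leqP j i) => ji; do !(case: ifP => ?); rewrite //;
      do ?[by exfalso; lia | by congr (s _ * _); lia | by congr (_ * s _); lia | by congr s; lia].
  rewrite !uE (_ : m _ = scal k * m a + m b) ?p2 //.
  rewrite /m; case: ifP => _; first by rewrite mulrDl mulrA.
  by case: ifP => // _; rewrite mulrDr !mulrA scalC.
split=> [s k x y|s j k a b x jn].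
  by rewrite scalerDr -scal_scale p1.
have [->|jn'] := eqVneq j n.
  have pE a' y : phi (upds s n a') y = phi s y.
    by apply: phil => l; rewrite /upds => /ltn_eqF ->.
  by rewrite !pE /upds eqxx scalerDl -scalerA p1.
have uE a' : upds s j a' n = s n by rewrite /upds eq_sym (negbTE jn').
by rewrite !uE p2 //; lia.
Qed.
Lemma multilinear_bar_d n (c : cochain X Y n) : multilinear c -> multilinear (bar_d c).
Proof.
rewrite !seq_cochain_multilinear => mc.
have sE : seq_cochain (bar_d c) = seq_d n (seq_cochain c).
  by apply/funext => s; apply/funext => x; exact: seq_bar_d.
have floc s s' x : (forall j, (j < n)%N -> s j = s' j) ->
    seq_cochain c s x = seq_cochain c s' x.
  by move=> ss; rewrite /seq_cochain; congr (c _ x); apply/funext => j; exact: ss.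
have fm (i : 'I_n.+2) := face_multilinear (ltn_ord i) floc mc.
rewrite sE; split=> [s k x y|s i k a b x ni]; rewrite /seq_d.
  rewrite scaler_sumr -big_split /=; apply: eq_bigr => i _.
  by have [-> _] := fm i; rewrite scalerDr scal_scale.
rewrite scaler_sumr -big_split /=; apply: eq_bigr => j _.
by have [_ ->] := fm j; rewrite // scalerDr scal_scale.
Qed.
Lemma bar_dd n (c : cochain X Y n) : bar_d (bar_d c) = 0.
Proof.
apply/funext => t; apply/funext => x; rewrite -seq_cochain_ext seq_bar_d.
rewrite (_ : seq_cochain (bar_d c) = seq_d n (seq_cochain c)); last first.
  by apply/funext => s; apply/funext => y; exact: seq_bar_d.
rewrite seq_d_sq // => s s' y ss; rewrite /seq_cochain; congr (c _ y).
by apply/funext => j; exact: ss.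
Qed.
End Fixed.
End BarComplexTheory.

(** The groups consist of all functions, and [cx_set] marks the actual cochains; for the bar complex
    these are the multilinear ones. *)
Record complex := Complex {
  cx_grp :> nat -> zmodType;
  cx_set : forall n, cx_grp n -> Prop;
  cx_d : forall n, cx_grp n -> cx_grp n.+1;
  cx_setB : forall n (x y : cx_grp n), cx_set x -> cx_set y -> cx_set (x - y);
  cx_setd : forall n (x : cx_grp n), cx_set x -> cx_set (cx_d x);
  cx_dB : forall n (x y : cx_grp n), cx_d (x - y) = cx_d x - cx_d y;
  cx_dd : forall n (x : cx_grp n), cx_d (cx_d x) = 0
}.
(* [acyclic n C] says that the cohomology of [C] vanishes in degree [n.+1].    *)
Definition acyclic n (C : complex) : Prop := forall c : C n.+1,
  cx_set c -> cx_d c = 0 -> exists2 b : C n, cx_set b & c = cx_d b.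

Section ShortExactComplexes.
Variables (C1 C2 C3 : complex).
Variables (i : forall n, C1 n -> C2 n) (p : forall n, C2 n -> C3 n).
Hypothesis pB : forall n (x y : C2 n), p (x - y) = p x - p y.
Hypothesis iB : forall n (x y : C1 n), i (x - y) = i x - i y.
Hypothesis pd : forall n (x : C2 n), p (cx_d x) = cx_d (p x).
Hypothesis id_ : forall n (x : C1 n), i (cx_d x) = cx_d (i x).
Hypothesis iS : forall n (x : C1 n), cx_set x -> cx_set (i x).
Hypothesis pS : forall n (x : C2 n), cx_set x -> cx_set (p x).
Hypothesis i_inj : forall n (x : C1 n), i x = 0 -> x = 0.
Hypothesis ip : forall n (x : C1 n), cx_set x -> p (i x) = 0.
Hypothesis mid : forall n (x : C2 n), cx_set x -> p x = 0 ->
  exists2 y, cx_set y & i y = x.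
Hypothesis psurj : forall n (x : C3 n), cx_set x -> exists2 y, cx_set y & p y = x.
(** The boundary of any lift of c is a cocycle coming from C1; by acyclicity it bounds there, and
    subtracting a primitive corrects the lift. *)
Lemma cocycle_lift n (c : C3 n) : acyclic n C1 -> cx_set c -> cx_d c = 0 ->
  exists c2, [/\ cx_set c2, cx_d c2 = 0 & p c2 = c].
Proof.
move=> ac1 Sc dc; have [c2 Sc2 pc2] := psurj Sc.
have [|e Se ie] := mid (cx_setd Sc2); first by rewrite pd pc2.
have [||b Sb eb] := ac1 e => //.
  by apply: i_inj; rewrite id_ ie cx_dd.
exists (c2 - i b); split.
- by apply: cx_setB => //; exact: iS.
- by rewrite cx_dB -ie eb id_ subrr.
- by rewrite pB ip // pc2 subr0.
Qed.
Lemma cocycle_factor n (c : C2 n.+1) (b : C3 n) :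
  cx_set c -> cx_d c = 0 -> cx_set b -> p c = cx_d b ->
  exists c1 b2, [/\ cx_set c1, cx_d c1 = 0, cx_set b2 & i c1 = c - cx_d b2].
Proof.
move=> Sc dc Sb pc; have [b2 Sb2 pb2] := psurj Sb.
have [||c1 Sc1 ic1] := @mid _ (c - cx_d b2).
- by apply: cx_setB => //; exact: cx_setd.
- by rewrite pB pd pb2 pc subrr.
exists c1, b2; split => //.
by apply: i_inj; rewrite id_ ic1 cx_dB dc cx_dd subrr.
Qed.
Lemma coboundary_restrict n (c : C1 n.+1) (b b' : C2 n) :
  cx_set b -> i c = cx_d b -> cx_set b' -> cx_d b' = 0 -> p b' = p b ->
  exists2 b1, cx_set b1 & c = cx_d b1.
Proof.
move=> Sb ic Sb' db' pb'.
have [||b1 Sb1 ib1] := @mid _ (b - b'); first exact: cx_setB.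
  by rewrite pB pb' subrr.
exists b1 => //; apply/eqP; rewrite -subr_eq0; apply/eqP; apply: i_inj.
by rewrite iB id_ ib1 cx_dB db' subr0 ic subrr.
Qed.
Lemma coboundary_inj n (c : C1 n.+2) (b : C2 n.+1) : acyclic n C3 ->
  cx_set c -> cx_set b -> i c = cx_d b -> exists2 b1, cx_set b1 & c = cx_d b1.
Proof.
move=> ac3 Sc Sb ic; have [||b3 Sb3 pb] := ac3 (p b); first exact: pS.
  by rewrite -pd -ic ip //.
have [b2 Sb2 pb2] := psurj Sb3.
apply: (coboundary_restrict Sb ic (cx_setd Sb2)); first exact: cx_dd.
by rewrite pd pb2.
Qed.
Lemma acyclic_mid n : acyclic n C1 -> acyclic n C3 -> acyclic n C2.
Proof.
move=> ac1 ac3 c Sc dc; have [||b Sb pc] := ac3 (p c); first exact: pS.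
  by rewrite -pd dc -(subrr 0) pB subrr.
have [c1 [b2 [Sc1 dc1 Sb2 ic1]]] := cocycle_factor Sc dc Sb pc.
have [b1 Sb1 e] := ac1 _ Sc1 dc1; exists (i b1 - (0 - b2)).
  apply: cx_setB; first exact: iS.
  by apply: cx_setB => //; rewrite -(subrr b2); exact: cx_setB.
rewrite !cx_dB -id_ -e ic1 -(subrr b2) cx_dB subrr sub0r opprK.
by rewrite subrK.
Qed.
Lemma acyclic_left n : acyclic n C3 -> acyclic n.+1 C2 -> acyclic n.+1 C1.
Proof.
move=> ac3 ac2 c Sc dc; have [||b Sb ic] := ac2 (i c); first exact: iS.
  by rewrite -id_ dc -(subrr 0) iB subrr.
exact: coboundary_inj ic.
Qed.
Lemma acyclic_right n : acyclic n C2 -> acyclic n.+1 C1 -> acyclic n C3.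
Proof.
move=> ac2 ac1 c Sc dc; have [c2 [Sc2 dc2 <-]] := cocycle_lift ac1 Sc dc.
by have [b Sb ->] := ac2 _ Sc2 dc2; exists (p b); [exact: pS | rewrite pd].
Qed.
(** In the lowest degree the acyclicity of C3 is replaced by the assumption that its 0-cocycles lift
    to 0-cocycles of C2. *)
Lemma acyclic_left0 :
  (forall c : C3 0%N, cx_set c -> cx_d c = 0 ->
     exists c2, [/\ cx_set c2, cx_d c2 = 0 & p c2 = c]) ->
  acyclic 0 C2 -> acyclic 0 C1.
Proof.
move=> lift ac2 c Sc dc; have [||b Sb ic] := ac2 (i c); first exact: iS.
  by rewrite -id_ dc -(subrr 0) iB subrr.
have [||b' [Sb' db' pb']] := lift (p b); first exact: pS.
  by rewrite -pd -ic ip //.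
exact: coboundary_restrict ic Sb' db' pb'.
Qed.
End ShortExactComplexes.

Section Cochains.
Variables (K : fieldType) (A : kalgType K).
Implicit Types X Y : lmodType A.
Definition cochain_complex X Y : complex :=
  @Complex (cochain X Y) (@multilinear K A X Y) (@bar_d K A X Y)
    (@multilinearB K A X Y) (@multilinear_bar_d K A X Y) (@bar_dB K A X Y)
    (@bar_dd K A X Y).
(* [xv n X Y] says that [Ext X Y n.+1] vanishes.                               *)
Definition xv n X Y : Prop := acyclic n (cochain_complex X Y).
Definition cmap X X' Y Y' (b : X' -> X) (g : Y -> Y') n (c : cochain X Y n) :
  cochain X' Y' n := fun t x => g (c t (b x)).
Lemma cmap_multilinear X X' Y Y' (b : X' -> X) (g : Y -> Y') n (c : cochain X Y n) :
  klinear b -> klinear g -> multilinear c -> multilinear (cmap b g c).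
Proof.
move=> bl gl [c1 c2]; split=> [t k x y|t i k a d x]; rewrite /cmap.
  by rewrite bl c1 gl.
by rewrite c2 gl.
Qed.
Lemma cmap_d X X' Y Y' (b : {linear X' -> X}) (g : {linear Y -> Y'}) n
  (c : cochain X Y n) : bar_d (cmap b g c) = cmap b g (bar_d c).
Proof. exact: bar_d_map. Qed.
Lemma cmapB X X' Y Y' (b : X' -> X) (g : {linear Y -> Y'}) n (c d : cochain X Y n) :
  cmap b g (c - d) = cmap b g c - cmap b g d.
Proof.
apply/funext => t; apply/funext => x; rewrite cochB /cmap cochB.
by rewrite linearB.
Qed.
Lemma klinear_comp X Y (Z : lmodType A) (f : Y -> Z) (g : X -> Y) :
  klinear f -> klinear g -> klinear (f \o g).
Proof. by move=> fl gl k x y; rewrite /= gl fl. Qed.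
Lemma klinear0 X Y (f : X -> Y) : klinear f -> f 0 = 0.
Proof.
move=> fl; have := fl 1 0 0; rewrite scal1 !scale1r addr0 -[LHS]addr0.
by move=> /addrI.
Qed.
Lemma klinearB X Y (f : X -> Y) x y : klinear f -> f (x - y) = f x - f y.
Proof.
by move=> fl; have := fl 1 (x - y) y; rewrite scal1 !scale1r subrK => ->; rewrite addrK.
Qed.
Lemma klinear_ginv X Y (f : X -> Y) : klinear f ->
  exists2 g : Y -> X, klinear g & forall x, f (g (f x)) = f x.
Proof.
move=> fl; have fl' : linear (f : restr_scal X -> restr_scal Y) by [].
have [g gP] := kginv (mklin fl'); exists g => // k x y.
exact: (linearP g k x y).
Qed.
(** Cochains are only K-multilinear, so c can be composed with a K-linear generalized inverse of
    f. *)
Lemma cochain_descend X X' Y (f : X' -> X) n (c : cochain X' Y n) :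
  klinear f -> multilinear c -> (forall t x, f x = 0 -> c t x = 0) ->
  exists2 c', multilinear c' & cmap f id c' = c.
Proof.
move=> fl mc cf; have [g gl gP] := klinear_ginv fl.
exists (cmap g id c); first exact: cmap_multilinear.
apply/funext => t; apply/funext => x; rewrite /cmap; have [c1 _] := mc.
apply/eqP; rewrite -subr_eq0 -(klinearB _ _ (c1 t)) cf //.
by rewrite klinearB // gP subrr.
Qed.
Lemma klinear_factor X X' Y (f : X' -> X) (h : X' -> Y) : klinear f -> klinear h ->
  (forall x, f x = 0 -> h x = 0) ->
  exists2 h' : X -> Y, klinear h' & forall x, h' (f x) = h x.
Proof.
move=> fl hl fh; have [g gl gP] := klinear_ginv fl.
exists (h \o g); first exact: klinear_comp.
move=> x /=; apply/eqP; rewrite -subr_eq0 -klinearB //; apply/eqP/fh.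
by rewrite klinearB // gP subrr.
Qed.
End Cochains.

Section ExtCalculus.
Variables (K : fieldType) (A : kalgType K).
Implicit Types X Y U V W : lmodType A.
Definition cochain0 X Y (h : X -> Y) : cochain X Y 0 := fun _ x => h x.
Lemma cochain0_multilinear X Y (h : X -> Y) : klinear h -> multilinear (cochain0 h).
Proof. by move=> hl; split=> [t k x y|t []//]; exact: hl. Qed.
Lemma cochain0E X Y (c : cochain X Y 0) : c = cochain0 (c (fun=> 0)).
Proof.
apply/funext => t; apply/funext => x; congr (c _ x).
by apply/funext => -[].
Qed.
Lemma bar_d_cochain0 X Y (h : X -> Y) t x :
  bar_d (cochain0 h) t x = t ord0 *: h x - h (t ord0 *: x).
Proof.
rewrite /bar_d big_ord0 addr0 /cochain0 expr1 scaleN1r.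
by rewrite (_ : ord_max = ord0) //; apply: val_inj.
Qed.
Lemma cocycle0_linear X Y (h : X -> Y) : multilinear (cochain0 h) ->
  bar_d (cochain0 h) = 0 -> linear h.
Proof.
move=> [h1 _] dh a x y; have hl : klinear h by move=> k u v; exact: (h1 (fun=> 0)).
have hZ u : h (a *: u) = a *: h u.
  apply/eqP; rewrite eq_sym -subr_eq0; apply/eqP.
  by have := congr1 (fun c => c (fun=> a) u) dh; rewrite bar_d_cochain0.
by have := hl 1 (a *: x) y; rewrite scal1 !scale1r hZ.
Qed.
Lemma linear_cocycle0 X Y (h : {linear X -> Y}) :
  multilinear (cochain0 h) /\ bar_d (cochain0 h) = 0.
Proof.
split; first by apply: cochain0_multilinear; exact: linear_klinear.
by apply/funext => t; apply/funext => x; rewrite bar_d_cochain0 linearZ_LR subrr.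
Qed.

Section FirstVariable.
Variables (U V W Y : lmodType A) (f : {linear U -> V}) (g : {linear V -> W}).
Hypothesis fg : short_exact f g.
Local Notation i := (fun n => @cmap K A W V Y Y g id n).
Local Notation p := (fun n => @cmap K A V U Y Y f id n).
Let pB n (x y : cochain V Y n) : p n (x - y) = p n x - p n y. Proof. by []. Qed.
Let iB n (x y : cochain W Y n) : i n (x - y) = i n x - i n y. Proof. by []. Qed.
Let pd n (x : cochain V Y n) : p n.+1 (bar_d x) = bar_d (p n x).
Proof. by rewrite (@cmap_d _ _ V U Y Y f idfun). Qed.
Let id_ n (x : cochain W Y n) : i n.+1 (bar_d x) = bar_d (i n x).
Proof. by rewrite (@cmap_d _ _ W V Y Y g idfun). Qed.
Let iS n (x : cochain W Y n) : multilinear x -> multilinear (i n x).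
Proof. by apply: cmap_multilinear => //; exact: linear_klinear. Qed.
Let pS n (x : cochain V Y n) : multilinear x -> multilinear (p n x).
Proof. by apply: cmap_multilinear => //; exact: linear_klinear. Qed.
Let i_inj n (x : cochain W Y n) : i n x = 0 -> x = 0.
Proof.
move=> ix; apply/funext => t; apply/funext => w; have [_ gs _] := fg.
by have [v <-] := gs w; exact: (congr1 (fun c => c t v) ix).
Qed.
Let ip n (x : cochain W Y n) : multilinear x -> p n (i n x) = 0.
Proof.
move=> [x1 _]; apply/funext => t; apply/funext => u; have [_ _ ge] := fg.
rewrite /cmap /= (ge (f u)).2; last by exists u.
exact: (klinear0 (x1 t)).
Qed.
Let mid n (x : cochain V Y n) : multilinear x -> p n x = 0 ->
  exists2 y, multilinear y & i n y = x.
Proof.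
move=> mx px; apply: cochain_descend => //; first exact: linear_klinear.
move=> t v gv; have [_ _ ge] := fg; have [u ->] := (ge v).1 gv.
exact: (congr1 (fun c => c t u) px).
Qed.
Let psurj n (x : cochain U Y n) : multilinear x -> exists2 y, multilinear y & p n y = x.
Proof.
move=> mx; apply: cochain_descend => //; first exact: linear_klinear.
move=> t u fu; have [fi _ _] := fg; have -> : u = 0 by apply: fi; rewrite fu linear0.
by have [x1 _] := mx; exact: (klinear0 (x1 t)).
Qed.
Local Notation CW := (cochain_complex W Y).
Local Notation CV := (cochain_complex V Y).
Local Notation CU := (cochain_complex U Y).
Lemma cocycle_extend n (c : cochain U Y n) : xv n W Y -> multilinear c ->
  bar_d c = 0 -> exists c2 : cochain V Y n,
    [/\ multilinear c2, bar_d c2 = 0 & cmap f id c2 = c].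
Proof. exact: (@cocycle_lift CW CV CU i p pB pd id_ iS i_inj ip mid psurj). Qed.
Lemma cocycle_descend n (c : cochain V Y n.+1) (b : cochain U Y n) :
  multilinear c -> bar_d c = 0 -> multilinear b -> cmap f id c = bar_d b ->
  exists c1 b2, [/\ multilinear c1, bar_d c1 = 0, multilinear b2 &
    cmap g id c1 = c - bar_d b2].
Proof. exact: (@cocycle_factor CW CV CU i p pB pd id_ i_inj mid psurj). Qed.
Lemma coboundary_descend n (c : cochain W Y n.+2) (b : cochain V Y n.+1) :
  xv n U Y -> multilinear c -> multilinear b -> cmap g id c = bar_d b ->
  exists2 b1, multilinear b1 & c = bar_d b1.
Proof. exact: (@coboundary_inj CW CV CU i p pB iB pd id_ pS i_inj ip mid psurj). Qed.
(** In this family of lemmas the suffix names the term of U -> V -> W whose Ext is shown to vanish;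
    [xvl] refers to the first and [xvr] to the second variable of Ext. *)
Lemma xvl_mid n : xv n U Y -> xv n W Y -> xv n V Y.
Proof.
by move=> h1 h2; exact: (@acyclic_mid CW CV CU i p pB pd id_ iS pS i_inj mid psurj).
Qed.
Lemma xvl_quo n : xv n U Y -> xv n.+1 V Y -> xv n.+1 W Y.
Proof. exact: (@acyclic_left CW CV CU i p pB iB pd id_ iS pS i_inj ip mid psurj). Qed.
Lemma xvl_sub n : xv n V Y -> xv n.+1 W Y -> xv n U Y.
Proof. exact: (@acyclic_right CW CV CU i p pB pd id_ iS pS i_inj ip mid psurj). Qed.
Lemma xvl_quo0 :
  (forall h : {linear U -> Y}, exists h' : {linear V -> Y}, forall u, h' (f u) = h u) ->
  xv 0 V Y -> xv 0 W Y.
Proof.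
move=> ext; apply: (@acyclic_left0 CW CV CU i p pB iB pd id_ iS pS i_inj ip mid).
move=> c; rewrite (cochain0E c) => mc dc.
have [h' hh'] := ext (mklin (cocycle0_linear mc dc)).
have [mh dh] := linear_cocycle0 h'; exists (cochain0 h'); split => //.
by apply/funext => t; apply/funext => u; exact: hh'.
Qed.
Lemma xvl_ext (h : {linear U -> Y}) : xv 0 W Y ->
  exists h' : {linear V -> Y}, forall u, h' (f u) = h u.
Proof.
move=> xW; have [mh dh] := linear_cocycle0 h.
have [c [mc dc ce]] := cocycle_extend xW mh dh.
rewrite (cochain0E c) in mc dc ce; exists (mklin (cocycle0_linear mc dc)) => u.
exact: (congr1 (fun c => c (fun=> 0) u) ce).
Qed.
End FirstVariable.

Section SecondVariable.
Variables (X U V W : lmodType A) (f : {linear U -> V}) (g : {linear V -> W}).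
Hypothesis fg : short_exact f g.
Local Notation i := (fun n => @cmap K A X X U V id f n).
Local Notation p := (fun n => @cmap K A X X V W id g n).
Let pB n (x y : cochain X V n) : p n (x - y) = p n x - p n y.
Proof. exact: cmapB. Qed.
Let iB n (x y : cochain X U n) : i n (x - y) = i n x - i n y.
Proof. exact: cmapB. Qed.
Let pd n (x : cochain X V n) : p n.+1 (bar_d x) = bar_d (p n x).
Proof. by rewrite (@cmap_d _ _ X X V W idfun g). Qed.
Let id_ n (x : cochain X U n) : i n.+1 (bar_d x) = bar_d (i n x).
Proof. by rewrite (@cmap_d _ _ X X U V idfun f). Qed.
Let iS n (x : cochain X U n) : multilinear x -> multilinear (i n x).
Proof. by apply: cmap_multilinear => //; exact: linear_klinear. Qed.
Let pS n (x : cochain X V n) : multilinear x -> multilinear (p n x).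
Proof. by apply: cmap_multilinear => //; exact: linear_klinear. Qed.
Let i_inj n (x : cochain X U n) : i n x = 0 -> x = 0.
Proof.
move=> ix; apply/funext => t; apply/funext => w; have [fi _ _] := fg.
apply: fi; rewrite linear0; exact: (congr1 (fun c => c t w) ix).
Qed.
Let ip n (x : cochain X U n) : multilinear x -> p n (i n x) = 0.
Proof.
move=> _; apply/funext => t; apply/funext => u; have [_ _ ge] := fg.
by apply/(ge _).2; exists (x t u).
Qed.
Let mid n (x : cochain X V n) : multilinear x -> p n x = 0 ->
  exists2 y, multilinear y & i n y = x.
Proof.
move=> mx px; have [fi _ ge] := fg.
have [r rl rP] := klinear_ginv (linear_klinear f).
exists (cmap id r x); first exact: cmap_multilinear.
apply/funext => t; apply/funext => y.
have [u xu] := (ge (x t y)).1 (congr1 (fun c => c t y) px).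
by rewrite /cmap xu rP.
Qed.
Let psurj n (x : cochain X W n) : multilinear x -> exists2 y, multilinear y & p n y = x.
Proof.
move=> mx; have [_ gs _] := fg.
have [r rl rP] := klinear_ginv (linear_klinear g).
exists (cmap id r x); first exact: cmap_multilinear.
apply/funext => t; apply/funext => y; rewrite /cmap.
by have [v <-] := gs (x t y); rewrite rP.
Qed.
Local Notation CU := (cochain_complex X U).
Local Notation CV := (cochain_complex X V).
Local Notation CW := (cochain_complex X W).
Lemma cocycle_liftr n (c : cochain X W n) : xv n X U -> multilinear c ->
  bar_d c = 0 -> exists c2 : cochain X V n,
    [/\ multilinear c2, bar_d c2 = 0 & cmap id g c2 = c].
Proof. exact: (@cocycle_lift CU CV CW i p pB pd id_ iS i_inj ip mid psurj). Qed.
Lemma cocycle_factorr n (c : cochain X V n.+1) (b : cochain X W n) :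
  multilinear c -> bar_d c = 0 -> multilinear b -> cmap id g c = bar_d b ->
  exists c1 b2, [/\ multilinear c1, bar_d c1 = 0, multilinear b2 &
    cmap id f c1 = c - bar_d b2].
Proof. exact: (@cocycle_factor CU CV CW i p pB pd id_ i_inj mid psurj). Qed.
Lemma coboundary_injr n (c : cochain X U n.+2) (b : cochain X V n.+1) :
  xv n X W -> multilinear c -> multilinear b -> cmap id f c = bar_d b ->
  exists2 b1, multilinear b1 & c = bar_d b1.
Proof. exact: (@coboundary_inj CU CV CW i p pB iB pd id_ pS i_inj ip mid psurj). Qed.
Lemma xvr_sub n : xv n X W -> xv n.+1 X V -> xv n.+1 X U.
Proof. exact: (@acyclic_left CU CV CW i p pB iB pd id_ iS pS i_inj ip mid psurj). Qed.
Lemma xvr_quo n : xv n X V -> xv n.+1 X U -> xv n X W.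
Proof. exact: (@acyclic_right CU CV CW i p pB pd id_ iS pS i_inj ip mid psurj). Qed.
Lemma xvr_sub0 :
  (forall h : {linear X -> W}, exists h' : {linear X -> V}, forall x, g (h' x) = h x) ->
  xv 0 X V -> xv 0 X U.
Proof.
move=> ext; apply: (@acyclic_left0 CU CV CW i p pB iB pd id_ iS pS i_inj ip mid).
move=> c; rewrite (cochain0E c) => mc dc.
have [h' hh'] := ext (mklin (cocycle0_linear mc dc)).
have [mh dh] := linear_cocycle0 h'; exists (cochain0 h'); split => //.
by apply/funext => t; apply/funext => u; exact: hh'.
Qed.
Lemma xvr_lift (h : {linear X -> W}) : xv 0 X U ->
  exists h' : {linear X -> V}, forall x, g (h' x) = h x.
Proof.
move=> xW; have [mh dh] := linear_cocycle0 h.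
have [c [mc dc ce]] := cocycle_liftr xW mh dh.
rewrite (cochain0E c) in mc dc ce; exists (mklin (cocycle0_linear mc dc)) => u.
exact: (congr1 (fun c => c (fun=> 0) u) ce).
Qed.
End SecondVariable.
Lemma xv_retractl n X X' Y (i : {linear X -> X'}) (r : {linear X' -> X}) :
  (forall x, r (i x) = x) -> xv n X' Y -> xv n X Y.
Proof.
move=> ri xX' c mc dc; have {}dc : bar_d c = 0 := dc.
have [||b mb cb] := xX' (cmap r id c).
- by apply: cmap_multilinear => //; exact: linear_klinear.
- by rewrite [LHS](@cmap_d _ _ X X' Y Y r idfun) dc.
exists (cmap i id b); first by apply: cmap_multilinear => //; exact: linear_klinear.
rewrite [RHS](@cmap_d _ _ X' X Y Y i idfun) -[bar_d b]cb.
by apply/funext => t; apply/funext => x; rewrite /cmap ri.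
Qed.
End ExtCalculus.

(** * Tensor products over the ground field, free modules and projective dimension *)

Section BaseFieldAlgebra.
Variable K : fieldType.
Definition base_alg : Type := K.
HB.instance Definition _ := GRing.Field.on base_alg.
Lemma base_scal1 : (1 : K) = 1 :> base_alg. Proof. by []. Qed.
Lemma base_scalD (k l : K) : k + l = (k : base_alg) + l :> base_alg. Proof. by []. Qed.
Lemma base_scalM (k l : K) : k * l = (k : base_alg) * l :> base_alg. Proof. by []. Qed.
Lemma base_scalC (k : K) (x : base_alg) : (k : base_alg) * x = x * k.
Proof. exact: mulrC. Qed.
HB.instance Definition _ := PzRing_isKAlg.Build K base_alg
  base_scal1 base_scalD base_scalM base_scalC.
End BaseFieldAlgebra.

Section ScalarTensor.
Variables (K : fieldType) (A : kalgType K).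
Local Notation K1 := (base_alg K).

Section Construction.
Variables (X : lmodType A) (V : lmodType K).
Definition kbim_ract (x : restr_scal X) (k : K) : restr_scal X := k *: x.
Lemma kbim_ractDl x y k : kbim_ract (x + y) k = kbim_ract x k + kbim_ract y k.
Proof. exact: scalerDr. Qed.
Lemma kbim_ractDr x k l : kbim_ract x (k + l) = kbim_ract x k + kbim_ract x l.
Proof. exact: scalerDl. Qed.
Lemma kbim_ract1 x : kbim_ract x 1 = x. Proof. exact: scale1r. Qed.
Lemma kbim_ractM x k l : kbim_ract x (k * l) = kbim_ract (kbim_ract x k) l.
Proof. by rewrite /kbim_ract scalerA mulrC. Qed.
Lemma kbim_ractZ (k : K) x l : kbim_ract (k *: x) l = k *: kbim_ract x l.
Proof. by rewrite /kbim_ract !scalerA mulrC. Qed.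
Definition kbim : bimodule K1 K1 := @Bimodule K K1 K1
  (restr_scal X : lmodType K) kbim_ract kbim_ractDl kbim_ractDr kbim_ract1
  kbim_ractM kbim_ractZ (fun _ _ => erefl).
(** This is X (x)_K V with A acting on X: the field acts on both sides of X through [scal], so
    balancing over it gives the tensor product over K. *)
Definition ktens : Type := tens kbim (V : lmodType K1).
HB.instance Definition _ := GRing.Zmodule.on ktens.
Definition kpt (x : X) (v : V) : ktens := @ptens K K1 kbim (V : lmodType K1) x v.
Lemma kptDl x y v : kpt (x + y) v = kpt x v + kpt y v.
Proof. exact: (@ptensDl K K1 kbim (V : lmodType K1)). Qed.
Lemma kptDr x u v : kpt x (u + v) = kpt x u + kpt x v.
Proof. exact: (@ptensDr K K1 kbim (V : lmodType K1)). Qed.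
Lemma kptB (k : K) x v : kpt ((scal k : A) *: x) v = kpt x (k *: v).
Proof. exact: (@ptensB K K1 kbim (V : lmodType K1)). Qed.
Lemma kpt_ind (P : ktens -> Prop) : P 0 -> (forall x v, P (kpt x v)) ->
  (forall p q, P p -> P q -> P (p + q)) -> forall t, P t.
Proof. exact: (@ptens_ind K K1 kbim (V : lmodType K1)). Qed.
Definition kbim_lact (a : A) (x : kbim) : kbim := (a *: (x : X) : X).
Let aD (a : A) (x y : kbim) : kbim_lact a (x + y) = kbim_lact a x + kbim_lact a y.
Proof. exact: (@scalerDr A X a x y). Qed.
Let aR (a : A) (x : kbim) (k : K1) : kbim_lact a (ract x k) = ract (kbim_lact a x) k.
Proof.
change (a *: ((scal (k : K) : A) *: (x : X)) = (scal (k : K) : A) *: (a *: (x : X))).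
by rewrite scal_scale.
Qed.
Definition ktens_scale (a : A) (p : ktens) : ktens :=
  tens_cl (seq_map1 (kbim_lact a) (repr p)).
Lemma ktens_scaleE a s : ktens_scale a (tens_cl s) = tens_cl (seq_map1 (kbim_lact a) s).
Proof. by apply: tens_map1E; [exact: aD | exact: aR]. Qed.
Lemma ktens_scale_pt a x v : ktens_scale a (kpt x v) = kpt (a *: x) v.
Proof. exact: ktens_scaleE. Qed.
Lemma ktens_scaleA a b t : ktens_scale a (ktens_scale b t) = ktens_scale (a * b) t.
Proof.
elim/tensP: t => s; rewrite !ktens_scaleE /seq_map1 -map_comp; congr tens_cl.
by apply: eq_map => -[x v] /=; rewrite /kbim_lact scalerA.
Qed.
Lemma ktens_scale1 : left_id 1 ktens_scale.
Proof.
elim/tensP => s; rewrite ktens_scaleE; congr tens_cl.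
by rewrite -[RHS]map_id; apply: eq_map => -[x v] /=; rewrite /kbim_lact scale1r.
Qed.
Lemma ktens_scaleDr : right_distributive ktens_scale +%R.
Proof.
move=> d; elim/tensP => s; elim/tensP => t.
by rewrite -tens_clD !ktens_scaleE -tens_clD /seq_map1 map_cat.
Qed.
Lemma ktens_scaleDl v : {morph ktens_scale^~ v : a b / a + b}.
Proof.
move=> a b; elim/kpt_ind: v => [|x v|p q hp hq].
- have h0 c : ktens_scale c 0 = 0.
    by apply: (addrI (ktens_scale c 0)); rewrite -ktens_scaleDr !addr0.
  by rewrite !h0 addr0.
- by rewrite !ktens_scale_pt scalerDl kptDl.
by rewrite !ktens_scaleDr hp hq addrACA.
Qed.
HB.instance Definition _ := GRing.Zmodule_isLmodule.Build A ktens
  ktens_scaleA ktens_scale1 ktens_scaleDr ktens_scaleDl.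
Lemma kptZ (a : A) x v : a *: kpt x v = kpt (a *: x) v.
Proof. exact: ktens_scale_pt. Qed.

Section Lift.
Variables (Y : lmodType A) (h : X -> V -> Y).
Hypothesis hX : forall v, klinear (h^~ v).
Hypothesis hV : forall x (k : K) u v, h x (k *: u + v) = (scal k : A) *: h x u + h x v.
Let h_bal : balanced (h : kbim -> (V : lmodType K1) -> Y).
Proof.
have h0 x : h x 0 = 0.
  by have := hV x 1 0 0; rewrite scal1 !scale1r addr0 -[LHS]addr0 => /addrI.
split=> [x y v|x u v|x k v].
- by have := hX v 1 x y; rewrite scal1 !scale1r.
- by have := hV x 1 u v; rewrite scal1 !scale1r.
- have := hV x k v 0; rewrite h0 !addr0 => e; rewrite [RHS]e.
  by have := hX v k x 0; rewrite (klinear0 (hX v)) !addr0.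
Qed.
Definition kt_lift (t : ktens) : Y := tens_lift (h : kbim -> (V : lmodType K1) -> Y) t.
Lemma kt_liftE x v : kt_lift (kpt x v) = h x v.
Proof. exact: tens_liftE. Qed.
Lemma kt_liftD p q : kt_lift (p + q) = kt_lift p + kt_lift q.
Proof. exact: tens_liftD. Qed.
Lemma kt_lift0 : kt_lift 0 = 0.
Proof. by apply: (addrI (kt_lift 0)); rewrite -kt_liftD !addr0. Qed.
Lemma kt_lift_scale a : (forall x v, h (a *: x) v = a *: h x v) ->
  forall t, kt_lift (a *: t) = a *: kt_lift t.
Proof.
move=> ha t; elim/kpt_ind: t => [|x v|p q hp hq].
- by rewrite scaler0 kt_lift0 scaler0.
- by rewrite kptZ !kt_liftE ha.
by rewrite scalerDr !kt_liftD hp hq scalerDr.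
Qed.
Lemma kt_lift_klinear : klinear kt_lift.
Proof.
move=> k p q; rewrite kt_liftD kt_lift_scale // => x v.
by have := hX v k x 0; rewrite (klinear0 (hX v)) !addr0.
Qed.
Lemma kt_lift_linear : (forall a x v, h (a *: x) v = a *: h x v) -> linear kt_lift.
Proof. by move=> ha a p q; rewrite kt_liftD kt_lift_scale. Qed.
End Lift.
Lemma klinear_kpt (Y : lmodType A) (f g : (ktens : lmodType A) -> Y) :
  klinear f -> klinear g -> (forall x v, f (kpt x v) = g (kpt x v)) -> f =1 g.
Proof.
move=> fl gl fg t.
have fD (h : (ktens : lmodType A) -> Y) : klinear h -> forall p q, h (p + q) = h p + h q.
  by move=> hl p q; have := hl 1 p q; rewrite scal1 !scale1r.
elim/kpt_ind: t => [|x v|p q hp hq]; first by rewrite !klinear0.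
  exact: fg.
by rewrite !fD // hp hq.
Qed.
End Construction.
Lemma bar_d_klinear n (X Y : lmodType A) (k : K) (c d : cochain X Y n) :
  bar_d (fun t x => (scal k : A) *: c t x + d t x) =
  fun t x => (scal k : A) *: bar_d c t x + bar_d d t x.
Proof.
rewrite (_ : (fun t x => _) = cmap id (scal_map Y k) c - (0 - d)); last first.
  apply/funext => t; apply/funext => x; rewrite !cochB.
  by rewrite [(0 : cochain X Y n) t x](_ : _ = 0) // sub0r opprK.
rewrite !bar_dB bar_d0 (@cmap_d _ _ X X Y Y idfun) sub0r opprK.
by apply/funext => t; apply/funext => x.
Qed.
(* K-linear selection of primitives: the cochains [c (-) (x (x) v)] depend     *)
(* linearly on [v].                                                            *)
Lemma xv_ktens n (X Y : lmodType A) (V : lmodType K) : xv n X Y -> xv n (ktens X V) Y.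
Proof.
move=> xXY c mc dc; have {}dc : bar_d c = 0 := dc.
pose Fn m : lmodType K := ('I_m -> A) -> X -> restr_scal Y.
have ml0 : multilinear (0 : cochain X Y n) by exact: multilinear0.
have mlP (k : K) (x y : Fn n) : multilinear (x : cochain X Y n) ->
    multilinear (y : cochain X Y n) -> multilinear (k *: x + y : cochain X Y n).
  move=> [x1 x2] [y1 y2]; split=> [t l u v|t i l a b u].
    rewrite [LHS](_ : _ = (scal k : A) *: x t ((scal l : A) *: u + v) + y t ((scal l : A) *: u + v)) //.
    by rewrite x1 y1 scalerDr scal_scale addrACA -scalerDr.
  rewrite [LHS](_ : _ = (scal k : A) *: x (upd t i (scal l * a + b)) u + y (upd t i (scal l * a + b)) u) //.
  by rewrite x2 y2 scalerDr scal_scale addrACA -scalerDr.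
pose M := @Submodule K (Fn n) (fun x => multilinear (x : cochain X Y n)) ml0 mlP.
have dlin : linear (fun x : smod M => (bar_d (val x : cochain X Y n) : Fn n.+1)).
  move=> k x y; have e : (val (k *: x + y) : cochain X Y n) =
      fun t u => (scal k : A) *: (val x : cochain X Y n) t u + (val y : cochain X Y n) t u.
    by rewrite linearP.
  exact: (etrans (congr1 (@bar_d K A X Y n) e) (bar_d_klinear k _ _)).
have [g gP] := kginv (mklin dlin).
pose cv (v : V) : Fn n.+1 := fun t x => c t (kpt x v).
have cvlin : linear cv.
  move=> k u v; apply/funext => t; apply/funext => x; have [c1 _] := mc.
  rewrite [RHS](_ : _ = (scal k : A) *: c t (kpt x u) + c t (kpt x v)) //.
  by rewrite /cv kptDr -kptB -kptZ c1.
have cvP v : exists z : smod M, bar_d (val z : cochain X Y n) = cv v.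
  have [c1 c2] := mc; have [||b mb cb] := xXY (cv v).
  - split=> [t k x y|t i k a b x]; last by rewrite /cv c2.
    by rewrite /cv kptDl -kptZ c1.
  - apply/funext => t; apply/funext => x.
    rewrite -[RHS](congr1 (fun c => c t (kpt x v)) dc) /= /bar_d /cv kptZ.
    by [].
  - by exists (@smk _ _ M b mb).
have [h [gm hV hd]] : exists h : V -> cochain X Y n, [/\ forall v, multilinear (h v),
    forall t x (k : K) u v, h (k *: u + v) t x = (scal k : A) *: h u t x + h v t x
    & forall v, bar_d (h v) = cv v].
  exists (fun v => val (g (cv v))); split.
  - by move=> v; exact: (smodP (g (cv v))).
  - move=> t x k u v; rewrite cvlin; pose gi := lin_comp (@sm_incl _ _ M) g.
    exact: (congr1 (fun c : Fn n => c t x) (linearP gi k (cv u) (cv v))).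
  - move=> v; have [z zP] := cvP v; rewrite -zP; exact: (gP z).
have hX t v : klinear (h v t) by have [m1 _] := gm v; exact: m1.
pose B : cochain (ktens X V) Y n := fun t => @kt_lift X V Y (fun x v => h v t x).
have B0 t : B t 0 = 0 := kt_lift0 (hX t) (hV t).
have BE t x v : B t (kpt x v) = h v t x := kt_liftE (hX t) (hV t) x v.
have BD t p q : B t (p + q) = B t p + B t q := kt_liftD (hX t) (hV t) p q.
have Bk t : klinear (B t) := kt_lift_klinear (hX t) (hV t).
clearbody B.
have mB : multilinear B.
  split=> [t|t i k a b x]; first exact: Bk.
  elim/kpt_ind: x => [|x v|p q hp hq].
  - by rewrite !B0 scaler0 addr0.
  - by rewrite !BE; have [_ ->] := gm v.
  by rewrite !BD hp hq scalerDr addrACA.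
exists B => //; apply/funext => t; apply/funext.
apply: (@klinear_kpt X V Y (c t) (bar_d B t)).
- by have [c1 _] := mc; exact: c1.
- by have [c1 _] := multilinear_bar_d mB; exact: c1.
move=> x v; have := congr1 (fun c => c t x) (hd v); rewrite /cv => <-.
rewrite /= /bar_d kptZ !BE; congr (_ + _ + _).
by apply: eq_bigr => i _; rewrite BE.
Qed.
End ScalarTensor.

Section ExactSequences.
Variables (R : pzRingType) (U V : lmodType R) (g : {linear U -> V}).
Lemma ker_exact : surj g -> short_exact (@sm_incl _ _ (kersm g)) g.
Proof.
move=> gs; split; [exact: (@sm_incl_inj _ _ (kersm g)) | exact: gs |].
move=> u; split=> [gu|[x ->]]; last exact: (smodP x).
by exists (@smk _ _ (kersm g) u gu).
Qed.
Definition im_corestr : {linear U -> smod (imsm g)} :=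
  @sm_corestr _ _ (imsm g) _ g (fun u => ex_intro _ u erefl).
Lemma im_corestr_surj : surj im_corestr.
Proof. by move=> y; have [u yu] := smodP y; exists u; apply: val_inj. Qed.
Lemma im_corestr_eq0 u : im_corestr u = 0 <-> g u = 0.
Proof. by split=> [/(congr1 val)|gu] //; apply: val_inj. Qed.
End ExactSequences.

Section FreeModules.
Variables (K : fieldType) (A : kalgType K).
Implicit Types X Y U V W : lmodType A.
(** The bar resolution of A has a contracting homotopy: the argument in A is moved into the last bar
    slot and the cochain is evaluated at 1. *)
Lemma xv_regular n Y : xv n (A^o : lmodType A) Y.
Proof.
move=> c mc dc; have {}dc : bar_d c = 0 := dc.
pose h : cochain A^o Y n := fun t a => c (fun i : 'I_n.+1 => upds (ext_seq t) n a i) 1.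
have hE s a : seq_cochain h s a = seq_cochain c (upds s n a) 1.
  rewrite /seq_cochain /h; congr (c _ 1); apply/funext => i; rewrite /upds.
  case: eqP => // /eqP ni; have iN : (i < n)%N by have := ltn_ord i; lia.
  by rewrite (ext_seqE _ (Ordinal iN)).
have cloc s s' (x : A^o) : (forall j, (j < n.+1)%N -> s j = s' j) ->
    seq_cochain c s x = seq_cochain c s' x.
  by move=> ss; rewrite /seq_cochain; congr (c _ x); apply/funext => j; exact: ss.
have mcs := (seq_cochain_multilinear c).1 mc.
have mh : multilinear h.
  apply/seq_cochain_multilinear; have [m1 m2] := mcs; split.
    move=> s k x y; rewrite !hE.
    by have := m2 s n k x y 1 (ltnSn n).
  move=> s i k a b x ni; rewrite !hE.
  have uC a' : upds (upds s i a') n x = upds (upds s n x) i a'.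
    by apply/funext => j; rewrite /upds; do 2 case: eqP => //; lia.
  by rewrite !uC m2 // ltnW.
(* The homotopy returns c with the sign (-1)^(n+1). *)
pose sg : bool := odd n.
exists (if sg then h else 0 - h).
  by case: sg => //; apply: multilinearB => //; exact: multilinear0.
have dhE : bar_d h = if sg then c else 0 - c.
  apply/funext => t; apply/funext => a; rewrite -seq_cochain_ext seq_bar_d.
  set s := ext_seq t; have := congr1 (fun c0 : cochain (A^o : lmodType A) Y n.+2 =>
    seq_cochain c0 (upds s n.+1 a) 1) dc.
  rewrite /= seq_bar_d /seq_d big_ord_recr /= => /eqP.
  rewrite addr_eq0 (eq_bigr (fun i : 'I_n.+2 =>
    ((-1) ^+ i : A) *: face n i (seq_cochain h) s a)); last first.
    move=> i _; congr (_ *: _); rewrite /face; case: eqP => [_|/eqP i0].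
      by congr (_ *: _); rewrite hE.
    case: (leqP i n) => i_n.
      rewrite (leq_trans i_n (leqnSn n)) hE; apply: cloc => j jn.
      by rewrite /upds /merge_seq; do !(case: eqP => ?) => //; do !(case: ifP => ?) => //; exfalso; lia.
    have -> : nat_of_ord i = n.+1 by have := ltn_ord i; lia.
    rewrite leqnn hE; apply: cloc => j jn; rewrite /upds /merge_seq /=.
    case: (ltngtP j n) jn => [jn _|jn|-> _]; [|lia|].
      by rewrite ltn_eqF // ltnW.
    by rewrite ?eqxx ltn_eqF.
  move=> /eqP ->; rewrite {1}/face /= ltnn.
  rewrite [seq_cochain c _ _](_ : _ = c t a); last first.
    have one (b : A) : b *: (1 : A^o) = (b : A^o) := mulr1 b.
    rewrite one {2}/upds eqxx -seq_cochain_ext; apply: cloc => j jn.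
    by rewrite /upds ltn_eqF.
  rewrite -signr_odd /= negbK /sg; case: (odd n) => /=.
    by rewrite expr1 scaleN1r opprK.
  by rewrite expr0 scale1r cochB sub0r.
case: (sg) dhE => dhE; first exact: esym.
apply: etrans (esym (bar_dB _ _)); rewrite dhE bar_d0.
by rewrite !sub0r opprK.
Qed.
Lemma surj_section_klinear U V (g : {linear U -> V}) : surj g ->
  exists2 r : V -> U, klinear r & forall v, g (r v) = v.
Proof.
move=> gs; have [r rl rP] := klinear_ginv (linear_klinear g); exists r => // v.
by have [u <-] := gs v; rewrite rP.
Qed.
Lemma kpt_scal X (V : lmodType K) (x : X) (k : K) (v : V) :
  kpt x (k *: v) = (scal k : A) *: kpt x v.
Proof. by rewrite -kptB kptZ. Qed.
Definition free_mod (V : lmodType K) : lmodType A := ktens (A^o : lmodType A) V.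
Lemma xv_free n (V : lmodType K) Y : xv n (free_mod V) Y.
Proof. by apply: xv_ktens; exact: xv_regular. Qed.

Section FreeLift.
Variables (V : lmodType K) (Y : lmodType A) (s : V -> Y).
Hypothesis sl : forall (k : K) u v, s (k *: u + v) = (scal k : A) *: s u + s v.
Let h (a : A^o) (v : V) : Y := (a : A) *: s v.
Let hX v : klinear (h^~ v).
Proof. by move=> k x y; rewrite /h scalerDl scalerA. Qed.
Let hV x (k : K) u v : h x (k *: u + v) = (scal k : A) *: h x u + h x v.
Proof. by rewrite /h sl scalerDr scal_scale. Qed.
Let hA a x v : h (a *: x) v = a *: h x v.
Proof. by rewrite /h scalerA. Qed.
Definition free_lift : {linear free_mod V -> Y} := mklin (kt_lift_linear hX hV hA).
Lemma free_liftE a v : free_lift (kpt (a : A^o) v) = a *: s v.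
Proof. exact: (kt_liftE hX hV). Qed.
End FreeLift.
Lemma free_ext (V : lmodType K) Y (f g : {linear free_mod V -> Y}) :
  (forall v, f (kpt (1 : A^o) v) = g (kpt (1 : A^o) v)) -> f =1 g.
Proof.
move=> fg; apply: (@klinear_kpt K A A^o V Y f g); try exact: linear_klinear.
by move=> a v; rewrite -[a]mulr1 -(kptZ (a : A) (1 : A^o)) !linearZ_LR fg.
Qed.
Lemma free_projective (V : lmodType K) : projective_mod (free_mod V).
Proof.
move=> U W g f gs; have [r rl rP] := surj_section_klinear gs.
have sl (k : K) u v : r (f (kpt (1 : A^o) (k *: u + v))) =
    (scal k : A) *: r (f (kpt (1 : A^o) u)) + r (f (kpt (1 : A^o) v)).
  by rewrite kptDr kpt_scal linearP rl.
exists (free_lift sl); apply: (@free_ext V W (lin_comp g (free_lift sl)) f) => v.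
rewrite -[RHS]rP; congr (g _); exact: etrans (free_liftE sl 1 v) (scale1r _).
Qed.

Section FreeCover.
Variable X : lmodType A.
Definition free_cover : {linear free_mod (restr_scal X) -> X} :=
  @free_lift (restr_scal X) X id (fun k u v => erefl).
Lemma free_cover_surj : surj free_cover.
Proof.
move=> x; exists (kpt (1 : A^o) (x : restr_scal X)).
exact: etrans (@free_liftE (restr_scal X) X id _ 1 x) (scale1r x).
Qed.
End FreeCover.
Lemma projective_xv n X Y : projective_mod X -> xv n X Y.
Proof.
move=> pX; have [h hP] := pX _ _ (free_cover X) (idfun : {linear X -> X}) (@free_cover_surj X).
by apply: (xv_retractl hP); exact: xv_free.
Qed.
Lemma xv_projective X : (forall Y, xv 0 X Y) -> projective_mod X.
Proof. by move=> xX U V g f gs; exact: (xvr_lift (ker_exact gs)). Qed.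
Lemma projdim_xv n X Y : projdim_le n X -> xv n X Y.
Proof.
elim: n X => [|n IHn] X /=; first exact: projective_xv.
move=> [U [V [f [g [pV fg pU]]]]]; apply: (xvl_quo fg); first exact: IHn.
exact: projective_xv.
Qed.
(** Dimension shift along the free cover. Together with [projdim_xv] it turns the bound 2 on the
    global dimension into the vanishing of Ext^3, which is [xv 2]. *)
Lemma xv_projdim n X : (forall Y, xv n X Y) -> projdim_le n X.
Proof.
elim: n X => [|n IHn] X xX; first exact: xv_projective.
exists (smod (kersm (free_cover X))), (free_mod (restr_scal X)), (@sm_incl _ _ (kersm (free_cover X))), (free_cover X).
have ex := ker_exact (@free_cover_surj X).
split=> //; first exact: free_projective.
by apply: IHn => Y; apply: (xvl_sub ex); [exact: xv_free | exact: xX].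
Qed.
Lemma injective_xv n X Y : injective_mod Y -> xv n X Y.
Proof.
move=> iY; elim: n X => [|n IHn] X; have ex := ker_exact (@free_cover_surj X).
  apply: (xvl_quo0 ex); last exact: xv_free.
  by move=> h; apply: iY; exact: (@sm_incl_inj _ _ (kersm (free_cover X))).
by apply: (xvl_quo ex); [exact: IHn | exact: xv_free].
Qed.
End FreeModules.

(** * Classes in Ext and their representation by linear maps *)

Section ExtClasses.
Variables (K : fieldType) (A : kalgType K).
Implicit Types X Y Z U V W : lmodType A.
(** Classes are handled through this relation to cocycles, so that constructions can be made on any
    convenient representative. *)
Definition class_of X Y n (x : Ext X Y n) (c : cochain X Y n) : Prop :=
  exists2 z, x = qcl (coboundaries X Y n) z & val z = c.
Lemma class_ofP X Y n (x : Ext X Y n) :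
  exists c, [/\ class_of x c, multilinear c & bar_d c = 0].
Proof.
elim/qclP: x => z; have /as_memP[z1 z2] := valP z.
by exists (val z); split => //; exists z.
Qed.
Lemma class_of_exists X Y n (c : cochain X Y n) : multilinear c -> bar_d c = 0 ->
  exists x, class_of x c.
Proof.
move=> mc dc; have cP : c \in as_mem (cocycles X Y n) by apply/as_memP.
by exists (qcl _ (exist _ c cP : subgrp (cocycles X Y n))), (exist _ c cP).
Qed.
Lemma cocycle_valB X Y n (z w : subgrp (cocycles X Y n)) :
  val (z - w) = val z - val w :> cochain X Y n.
Proof. exact: (raddfB (val : subgrp (cocycles X Y n) -> cochain X Y n)). Qed.
Lemma cocycle_valD X Y n (z w : subgrp (cocycles X Y n)) :
  val (z + w) = val z + val w :> cochain X Y n.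
Proof. exact: (raddfD (val : subgrp (cocycles X Y n) -> cochain X Y n)). Qed.
Lemma cocycle_valN X Y n (z : subgrp (cocycles X Y n)) :
  val (- z) = - val z :> cochain X Y n.
Proof. exact: (raddfN (val : subgrp (cocycles X Y n) -> cochain X Y n)). Qed.
Lemma class_of_eq X Y n (x y : Ext X Y n.+1) c d : class_of x c -> class_of y d ->
  (x = y <-> exists2 b, multilinear b & c - d = bar_d b).
Proof.
move=> [z -> <-] [w -> <-]; split.
  by move=> /eqP/quot_eqP[b mb zw]; exists b; rewrite -?cocycle_valB.
by move=> [b mb zw]; apply: qcl_eq; exists b; rewrite ?cocycle_valB.
Qed.
Lemma class_of_map X X' Y Y' (b : {linear X' -> X}) (g : {linear Y -> Y'}) n
  (x : Ext X Y n) c : class_of x c -> class_of (Ext_map b g x) (cmap b g c).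
Proof. by move=> [z -> <-]; rewrite Ext_mapE; exists (cocycle_map b g z). Qed.
Lemma class_ofD X Y n (x y : Ext X Y n) c d : class_of x c -> class_of y d ->
  class_of (x + y) (c + d).
Proof. by move=> [z -> <-] [w -> <-]; exists (z + w); rewrite ?qclD ?cocycle_valD. Qed.
Lemma class_of0 X Y n : class_of (0 : Ext X Y n) 0.
Proof. by exists 0. Qed.
Lemma class_ofN X Y n (x : Ext X Y n) c : class_of x c -> class_of (- x) (- c).
Proof.
move=> [z -> <-]; exists (- z); rewrite ?cocycle_valN //.
have e := qclD (coboundaries X Y n) z (- z); rewrite subrr in e.
by apply: (addrI (qcl _ z : Ext X Y n)); rewrite subrr; exact: e.
Qed.
Lemma class_ofB X Y n (x y : Ext X Y n) c d : class_of x c -> class_of y d ->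
  class_of (x - y) (c - d).
Proof. by move=> xc yd; apply: class_ofD => //; exact: class_ofN. Qed.
Lemma class_of_eq0 X Y n (x : Ext X Y n.+1) c : class_of x c ->
  (x = 0 <-> exists2 b, multilinear b & c = bar_d b).
Proof. by move=> xc; have := class_of_eq xc (class_of0 X Y n.+1); rewrite subr0. Qed.
Lemma class_of_uniq X Y n (x y : Ext X Y n.+1) c : class_of x c -> class_of y c -> x = y.
Proof.
move=> xc yc; apply/(class_of_eq xc yc); exists 0; first exact: multilinear0.
by rewrite subrr bar_d0.
Qed.
Lemma xvP X Y n : xv n X Y <-> forall x : Ext X Y n.+1, x = 0.
Proof.
split=> [xX x|xX c mc dc].
  have [c [xc mc dc]] := class_ofP x; apply/(class_of_eq0 xc).
  by have [b mb cb] := xX c mc dc; exists b.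
by have [x xc] := class_of_exists mc dc; exact: (class_of_eq0 xc).1 (xX x).
Qed.
Lemma Ext_map_comp X X' X2 Y Y' Y2 (b : {linear X' -> X}) (b' : {linear X2 -> X'})
    (g : {linear Y -> Y'}) (g' : {linear Y' -> Y2}) n (x : Ext X Y n.+1) :
  Ext_map b' g' (Ext_map b g x) = Ext_map (lin_comp b b') (lin_comp g' g) x.
Proof.
have [c [xc _ _]] := class_ofP x.
apply: (@class_of_uniq _ _ _ _ _ (cmap b' g' (cmap b g c))).
  by do 2 apply: class_of_map.
exact: (class_of_map (lin_comp b b') (lin_comp g' g) xc).
Qed.
Lemma Ext_map_id X Y n (x : Ext X Y n.+1) :
  Ext_map (idfun : {linear X -> X}) (idfun : {linear Y -> Y}) x = x.
Proof.
have [c [xc _ _]] := class_ofP x.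
by exact: (class_of_uniq (class_of_map idfun idfun xc) xc).
Qed.
Lemma Ext_mapDl X X' Y Y' (b b' : {linear X' -> X}) (g : {linear Y -> Y'}) n
    (x : Ext X Y n.+1) : Ext_map (b + b') g x = Ext_map b g x + Ext_map b' g x.
Proof.
have [c [xc [c1 _] _]] := class_ofP x.
have := class_of_map (b + b') g xc; rewrite (_ : cmap _ g c = cmap b g c + cmap b' g c).
  by move=> h; apply: (class_of_uniq h); apply: class_ofD; exact: class_of_map.
apply/funext => t; apply/funext => y.
rewrite [RHS](_ : _ = g (c t (b y)) + g (c t (b' y))) // -linearD; congr (g _).
by have := c1 t 1 (b y) (b' y); rewrite scal1 !scale1r.
Qed.
Lemma Ext_mapDr X X' Y Y' (b : {linear X' -> X}) (g g' : {linear Y -> Y'}) n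
    (x : Ext X Y n.+1) : Ext_map b (g + g') x = Ext_map b g x + Ext_map b g' x.
Proof.
have [c [xc _ _]] := class_ofP x.
by apply: (class_of_uniq (class_of_map b (g + g') xc)); apply: class_ofD; exact: class_of_map.
Qed.
Lemma Ext_map0 X X' Y Y' (b : {linear X' -> X}) (g : {linear Y -> Y'}) n :
  Ext_map b g (0 : Ext X Y n) = 0.
Proof. by apply: (addrI (Ext_map b g 0)); rewrite -Ext_mapD !addr0. Qed.
Lemma Ext_map_sum X X' Y Y' (b : {linear X' -> X}) (g : {linear Y -> Y'}) n
    (I : Type) (r : seq I) (F : I -> Ext X Y n) :
  Ext_map b g (\sum_(i <- r) F i) = \sum_(i <- r) Ext_map b g (F i).
Proof.
apply: (big_ind2 (fun x y => Ext_map b g x = y)) => [|x1 x2 y1 y2 <- <-|//].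
  exact: Ext_map0.
exact: Ext_mapD.
Qed.
Lemma Ext_mapN X X' Y Y' (b : {linear X' -> X}) (g : {linear Y -> Y'}) n
  (x : Ext X Y n) : Ext_map b g (- x) = - Ext_map b g x.
Proof. by apply: (addrI (Ext_map b g x)); rewrite -Ext_mapD !subrr Ext_map0. Qed.
Lemma Ext_map0l X X' Y Y' (g : {linear Y -> Y'}) n (x : Ext X Y n.+1) :
  Ext_map (0 : {linear X' -> X}) g x = 0.
Proof.
by apply: (addrI (Ext_map (0 : {linear X' -> X}) g x)); rewrite -Ext_mapDl !addr0.
Qed.
Lemma Ext_map_suml X X' Y Y' (g : {linear Y -> Y'}) n (I : Type) (r : seq I)
    (F : I -> {linear X' -> X}) (x : Ext X Y n.+1) :
  Ext_map (\sum_(i <- r) F i) g x = \sum_(i <- r) Ext_map (F i) g x.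
Proof.
apply: (big_ind2 (fun b y => Ext_map b g x = y)) => [|x1 x2 y1 y2 <- <-|//].
  exact: Ext_map0l.
exact: Ext_mapDl.
Qed.

Section LongExact.
Variables (U V W : lmodType A) (f : {linear U -> V}) (g : {linear V -> W}).
Hypothesis fg : short_exact f g.
Local Notation id_ X := (idfun : {linear X -> X}).
Variable Y : lmodType A.
Lemma Ext_restrict_surj n (x : Ext U Y n.+1) : xv n.+1 W Y ->
  exists x', Ext_map f (id_ Y) x' = x.
Proof.
move=> xW; have [c [xc mc dc]] := class_ofP x.
have [c2 [mc2 dc2 cE]] := cocycle_extend fg xW mc dc.
have [x' xc'] := class_of_exists mc2 dc2; exists x'.
apply: (class_of_uniq _ xc); rewrite -cE; exact: (class_of_map f (id_ Y) xc').
Qed.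
Lemma Ext_restrict_ker n (x : Ext V Y n.+1) : Ext_map f (id_ Y) x = 0 ->
  exists x', Ext_map g (id_ Y) x' = x.
Proof.
move=> fx; have [c [xc mc dc]] := class_ofP x.
have [b mb cb] := (class_of_eq0 (class_of_map f (id_ Y) xc)).1 fx.
have [c1 [b2 [mc1 dc1 mb2 cE]]] := cocycle_descend fg mc dc mb cb.
have [x' xc'] := class_of_exists mc1 dc1; exists x'.
apply/(class_of_eq (class_of_map g (id_ Y) xc') xc).
exists (0 - b2); first by apply: multilinearB => //; exact: multilinear0.
by rewrite [cmap _ _ _]cE addrAC subrr sub0r bar_dB bar_d0 sub0r.
Qed.
Lemma Ext_pull_inj n (x : Ext W Y n.+2) : xv n U Y ->
  Ext_map g (id_ Y) x = 0 -> x = 0.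
Proof.
move=> xU gx; have [c [xc mc dc]] := class_ofP x; apply/(class_of_eq0 xc).
have [b mb cb] := (class_of_eq0 (class_of_map g (id_ Y) xc)).1 gx.
by have [b1 mb1 e] := coboundary_descend fg xU mc mb cb; exists b1.
Qed.
Variable X : lmodType A.
Lemma Ext_push_surj n (x : Ext X W n.+1) : xv n.+1 X U ->
  exists x', Ext_map (id_ X) g x' = x.
Proof.
move=> xU; have [c [xc mc dc]] := class_ofP x.
have [c2 [mc2 dc2 cE]] := cocycle_liftr fg xU mc dc.
have [x' xc'] := class_of_exists mc2 dc2; exists x'.
apply: (class_of_uniq _ xc); rewrite -cE; exact: (class_of_map (id_ X) g xc').
Qed.
Lemma Ext_push_inj n (x : Ext X U n.+2) : xv n X W ->
  Ext_map (id_ X) f x = 0 -> x = 0.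
Proof.
move=> xU gx; have [c [xc mc dc]] := class_ofP x; apply/(class_of_eq0 xc).
have [b mb cb] := (class_of_eq0 (class_of_map (id_ X) f xc)).1 gx.
by have [b1 mb1 e] := coboundary_injr fg xU mc mb cb; exists b1.
Qed.
End LongExact.
End ExtClasses.

Section Representation.
Variables (K : fieldType) (A : kalgType K).
Variables (K2 V1 V0 M : lmodType A).
Variables (d2 : {linear K2 -> V1}) (d1 : {linear V1 -> V0}) (p : {linear V0 -> M}).
Variable Y : lmodType A.
(* A class in [Ext M Y 2] is represented by [psi : K2 -> Y] when successive    *)
(* primitives along M <- V0 <- V1 restrict to [psi] on K2.                     *)
Definition rep (c : cochain M Y 2) (psi : K2 -> Y) : Prop :=
  exists (b : cochain V0 Y 1) (h : V1 -> Y), [/\ multilinear b, klinear h,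
    cmap p id c = bar_d b, cmap d1 id b = bar_d (cochain0 h) &
    forall k, h (d2 k) = psi k].
Definition Rep (x : Ext M Y 2) (psi : K2 -> Y) : Prop :=
  exists2 c, class_of x c & rep c psi.
Definition exact2 : Prop := [/\ surj p, forall v, p v = 0 <-> exists w, v = d1 w,
  forall w, d1 w = 0 <-> exists k, w = d2 k & injective d2].
Implicit Types X : lmodType A.
Let cmapl_d X X' n (f : {linear X' -> X}) (c : cochain X Y n) :
  bar_d (cmap f id c) = cmap f id (bar_d c).
Proof. exact: (@cmap_d K A X X' Y Y f idfun). Qed.
Let cmapl_m X X' n (f : {linear X' -> X}) (c : cochain X Y n) :
  multilinear c -> multilinear (cmap f id c).
Proof. by apply: cmap_multilinear => //; exact: linear_klinear. Qed.
Let cmapl0 X X' n (f : {linear X' -> X}) (c : cochain X Y n) : multilinear c ->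
  (forall x, f x = 0) -> cmap f id c = 0.
Proof.
move=> [m1 _] f0; apply/funext => t; apply/funext => x; rewrite /cmap f0.
exact: (klinear0 (m1 t)).
Qed.
Hypothesis ex : exact2.
Let pd1 v : p (d1 v) = 0. Proof. by have [_ /(_ (d1 v)) h _ _] := ex; apply/h; exists v. Qed.
Let d12 k : d1 (d2 k) = 0. Proof. by have [_ _ /(_ (d2 k)) h _] := ex; apply/h; exists k. Qed.
(** A K-linear extension h of psi to V1 has a coboundary that vanishes on the image of K2, so it
    descends to V0; the coboundary of the result descends once more, to M. *)
Lemma Rep_exists (psi : {linear K2 -> Y}) : exists x, Rep x psi.
Proof.
have [ps pk d1k d2i] := ex.
have [h hl hd2] := @klinear_factor K A V1 K2 Y d2 psi (linear_klinear _) (linear_klinear _)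
  (fun k dk => etrans (congr1 psi (d2i k 0 (etrans dk (esym (linear0 d2))))) (linear0 psi)).
have mh : multilinear (cochain0 h) by exact: cochain0_multilinear.
have [b mb bE] := @cochain_descend K A V0 V1 Y d1 1 (bar_d (cochain0 h))
  (linear_klinear _) (multilinear_bar_d mh)
  (fun t w => fun e : d1 w = 0 => ltac:(move: ((d1k w).1 e) => [k ->];
    by rewrite bar_d_cochain0 -[t ord0 *: d2 k]linearZ_LR !hd2 linearZ_LR subrr)).
have [c mc cE] := @cochain_descend K A M V0 Y p 2 (bar_d b)
  (linear_klinear _) (multilinear_bar_d mb)
  (fun t v => fun e : p v = 0 => ltac:(move: ((pk v).1 e) => [w ->];
    have := congr1 (fun c : cochain V1 Y 2 => c t w) (cmapl_d d1 b);
    by rewrite bE bar_dd => /esym)).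
have dc : bar_d c = 0.
  apply/funext => t; apply/funext => m; have [v <-] := ps m.
  have := congr1 (fun c : cochain V0 Y 3 => c t v) (cmapl_d p c).
  by rewrite cE bar_dd => /esym.
have [x xc] := class_of_exists mc dc; exists x, c => //; exists b, h; split => //.
Qed.
(** The two successive primitives exist because Ext^2(V0, Y) and Ext^1(V1, Y) vanish. *)
Lemma Rep_of_class (x : Ext M Y 2) : xv 1 V0 Y -> xv 0 V1 Y ->
  exists psi : {linear K2 -> Y}, Rep x psi.
Proof.
move=> xV0 xV1; have [c [xc mc dc]] := class_ofP x.
have [||b mb cb] := xV0 (cmap p id c); first exact: cmapl_m.
  by rewrite [LHS]cmapl_d dc.
have db : cmap p id c = bar_d b := cb.
have [||h mh bh] := xV1 (cmap d1 id b); first exact: cmapl_m.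
  rewrite [LHS]cmapl_d -db; apply/funext => t; apply/funext => w.
  rewrite /cmap pd1; have [m1 _] := mc; exact: (klinear0 (m1 t)).
rewrite (cochain0E h) in mh bh.
have dh0 : bar_d (cmap d2 id (cochain0 (h (fun=> 0)))) = 0.
  have bh' : cmap d1 id b = bar_d (cochain0 (h (fun=> 0))) := bh.
  rewrite cmapl_d -bh'; apply/funext => t; apply/funext => k; rewrite /cmap d12.
  by have [m1 _] := mb; exact: (klinear0 (m1 t)).
exists (mklin (cocycle0_linear (cmapl_m d2 mh) dh0)), c => //.
exists b, (h (fun=> 0)); split=> //.
by have [m1 _] := mh; exact: (m1 (fun=> 0)).
Qed.
(** With [Rep0_extends] this shows that, for V0 and V1 acyclic with respect to Y, Ext^2(M, Y) is the
    group of maps K2 -> Y modulo restrictions of maps V1 -> Y. *)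
Lemma Rep_extends_eq0 (x : Ext M Y 2) psi (h' : {linear V1 -> Y}) :
  Rep x psi -> (forall k, psi k = h' (d2 k)) -> x = 0.
Proof.
have [ps pk d1k d2i] := ex.
move=> [c xc [b [h [mb hl cb bh hd2]]]] psiE; apply/(class_of_eq0 xc).
have hl' : klinear (fun w => h w - h' w).
  by move=> k u v; rewrite hl linearP opprD addrACA -scalerBr.
have [e el eE] := @klinear_factor K A V0 V1 Y d1 _ (linear_klinear _) hl'
  (fun w dw => ltac:(move: ((d1k w).1 dw) => [k ->]; by rewrite hd2 psiE subrr)).
have me : multilinear (cochain0 e) by exact: cochain0_multilinear.
have [|||g mg gE] := @cochain_descend K A M V0 Y p 1 (b - bar_d (cochain0 e)).
- exact: linear_klinear.
- by apply: multilinearB => //; exact: multilinear_bar_d.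
- move=> t v /(pk v).1 [w ->]; rewrite cochB.
  have -> : b t (d1 w) = bar_d (cochain0 h) t w by exact: (congr1 (fun c => c t w) bh).
  have cancel (y1 y2 y3 : Y) : y1 - y2 - (y1 - y3 - (y2 - y3)) = 0.
    by rewrite (opprB y2 y3) subrKA subrr.
  by rewrite !bar_d_cochain0 -(linearZ_LR d1) !eE (linearZ_LR h') scalerBr cancel.
exists g => //; apply/funext => t; apply/funext => m; have [v <-] := ps m.
have := congr1 (fun c : cochain V0 Y 2 => c t v) (cmapl_d p g).
rewrite gE bar_dB bar_dd subr0 -cb => e'; exact: e'.
Qed.
Lemma Rep0_extends psi : xv 0 V0 Y -> Rep 0 psi ->
  exists h' : {linear V1 -> Y}, forall k, psi k = h' (d2 k).
Proof.
move=> xV0 [c xc [b [h [mb hl cb bh hd2]]]].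
have [g mg cg] := (class_of_eq0 xc).1 erefl.
have [||e me be] := xV0 (b - cmap p id g).
- by apply: multilinearB => //; exact: cmapl_m.
- by apply: etrans (bar_dB _ _) _; rewrite -cb cmapl_d cg subrr.
rewrite (cochain0E e) in me be; set e0 := e _ in me be.
have be' : b - cmap p id g = bar_d (cochain0 e0) := be.
have hle : klinear (fun w => h w - e0 (d1 w)).
  have [m1 _] := me; have el : klinear e0 := m1 (fun=> 0).
  by move=> k u v; rewrite hl linearP el opprD addrACA -scalerBr.
have dh : bar_d (cochain0 (fun w => h w - e0 (d1 w))) = 0.
  apply/funext => t; apply/funext => w; rewrite bar_d_cochain0 scalerBr.
  have h1 : b t (d1 w) = t ord0 *: h w - h (t ord0 *: w).
    by rewrite -bar_d_cochain0 -bh.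
  have h2 : b t (d1 w) = t ord0 *: e0 (d1 w) - e0 (t ord0 *: d1 w).
    rewrite -bar_d_cochain0 -be' cochB [cmap _ _ _ _ _](_ : _ = 0) ?subr0 //.
    by rewrite /cmap pd1; have [m1 _] := mg; exact: (klinear0 (m1 t)).
  rewrite (linearZ_LR d1) (_ : forall a b c d : Y, a - b - (c - d) = (a - c) - (b - d)).
    by rewrite -h1 -h2 subrr.
  by move=> *; rewrite !opprD !opprK addrACA.
exists (mklin (cocycle0_linear (cochain0_multilinear hle) dh)) => k /=.
rewrite hd2 d12; have [m1 _] := me; have el : klinear e0 := m1 (fun=> 0).
by rewrite (klinear0 el) subr0.
Qed.
End Representation.

Section RepMap.
Variables (K : fieldType) (A : kalgType K).
Implicit Types X Y : lmodType A.
Lemma bar_dD X Y n (c d : cochain X Y n) : bar_d (c + d) = bar_d c + bar_d d.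
Proof.
have dN (e : cochain X Y n) : bar_d (- e) = - bar_d e.
  by rewrite -[LHS](congr1 _ (sub0r e)) bar_dB bar_d0 sub0r.
by rewrite -[d in LHS]opprK bar_dB dN opprK.
Qed.
Lemma multilinearD X Y n (c d : cochain X Y n) :
  multilinear c -> multilinear d -> multilinear (c + d).
Proof.
move=> mc md; rewrite -[d]opprK; apply: multilinearB => //.
by rewrite -sub0r; apply: multilinearB => //; exact: multilinear0.
Qed.

Section Maps.
Variables (K2 V1 V0 M K2' V1' V0' M' : lmodType A).
Variables (d2 : {linear K2 -> V1}) (d1 : {linear V1 -> V0}) (p : {linear V0 -> M}).
Variables (d2' : {linear K2' -> V1'}) (d1' : {linear V1' -> V0'}) (p' : {linear V0' -> M'}).
Variables (f2 : {linear K2' -> K2}) (f1 : {linear V1' -> V1}) (f0 : {linear V0' -> V0})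
  (fM : {linear M' -> M}).
Hypothesis e0 : forall v, fM (p' v) = p (f0 v).
Hypothesis e1 : forall v, f0 (d1' v) = d1 (f1 v).
Hypothesis e2 : forall v, f1 (d2' v) = d2 (f2 v).
Lemma Rep_map Y Y' (g : {linear Y -> Y'}) x psi : Rep d2 d1 p x psi ->
  Rep d2' d1' p' (Ext_map fM g x) (fun k => g (psi (f2 k))).
Proof.
move=> [c xc [b [h [mb hl cb bh hd2]]]]; exists (cmap fM g c); first exact: class_of_map.
exists (cmap f0 g b), (fun v => g (h (f1 v))); split.
- by apply: cmap_multilinear => //; exact: linear_klinear.
- by move=> k u v; rewrite linearP hl linearP.
- rewrite cmap_d -cb; apply/funext => t; apply/funext => v.
  by rewrite /cmap e0.
- rewrite (_ : cochain0 _ = cmap f1 g (cochain0 h)) // cmap_d -bh.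
  by apply/funext => t; apply/funext => v; rewrite /cmap e1.
- by move=> k; rewrite e2 hd2.
Qed.
End Maps.

Section Additive.
Variables (K2 V1 V0 M : lmodType A).
Variables (d2 : {linear K2 -> V1}) (d1 : {linear V1 -> V0}) (p : {linear V0 -> M}).
Lemma RepB Y (x x' : Ext M Y 2) psi psi' : Rep d2 d1 p x psi -> Rep d2 d1 p x' psi' ->
  Rep d2 d1 p (x - x') (fun k => psi k - psi' k).
Proof.
move=> [c xc [b [h [mb hl cb bh hd2]]]] [c' xc' [b' [h' [mb' hl' cb' bh' hd2']]]].
exists (c - c'); first exact: class_ofB.
exists (b - b'), (fun v => h v - h' v); split.
- exact: multilinearB.
- by move=> k u v; rewrite hl hl' opprD addrACA -scalerBr.
- by rewrite bar_dB -cb -cb'.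
- by rewrite (_ : cochain0 _ = cochain0 h - cochain0 h') // bar_dB -bh -bh'.
- by move=> k; rewrite hd2 hd2'.
Qed.
End Additive.
End RepMap.

Section Corepresentation.
Variables (K : fieldType) (A : kalgType K).
Variables (Y I0 I1 I2 X : lmodType A).
Variables (i0 : {linear Y -> I0}) (i1 : {linear I0 -> I1}) (q : {linear I1 -> I2}).
(* The dual of [Rep], along an injective coresolution of the second argument.  *)
Definition Corep (x : Ext X Y 2) (chi : X -> I2) : Prop :=
  exists2 c, class_of x c &
  exists (b : cochain X I0 1) (h : X -> I1), [/\ multilinear b, klinear h,
    cmap id i0 c = bar_d b, cmap id i1 b = bar_d (cochain0 h) &
    forall x, q (h x) = chi x].
Hypothesis i0_inj : injective i0.
Hypothesis i1_ker : forall v, i1 v = 0 <-> exists u, v = i0 u.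
Hypothesis q_ker : forall v, q v = 0 <-> exists u, v = i1 u.
Hypothesis q_surj : surj q.
Let cmapr_d (U V : lmodType A) n (f : {linear U -> V}) (c : cochain X U n) :
  bar_d (cmap id f c) = cmap id f (bar_d c).
Proof. exact: (@cmap_d K A X X U V idfun f). Qed.
Let cmapr_m (U V : lmodType A) n (f : {linear U -> V}) (c : cochain X U n) :
  multilinear c -> multilinear (cmap id f c).
Proof. by apply: cmap_multilinear => //; exact: linear_klinear. Qed.
Let i10 v : i1 (i0 v) = 0. Proof. by apply/i1_ker; exists v. Qed.
Let qi1 v : q (i1 v) = 0. Proof. by apply/q_ker; exists v. Qed.
Let factor (U V W : lmodType A) (f : {linear U -> V}) (g : {linear V -> W}) n
    (c : cochain X V n) : (forall v, g v = 0 -> exists u, v = f u) ->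
  multilinear c -> cmap id g c = 0 -> exists2 c', multilinear c' & cmap id f c' = c.
Proof.
move=> ge mc gc; have [r rl rP] := klinear_ginv (linear_klinear f).
exists (cmap id r c); first exact: cmap_multilinear.
apply/funext => t; apply/funext => y.
have [u xu] := ge _ (congr1 (fun c => c t y) gc).
by rewrite /cmap xu rP.
Qed.
Lemma Corep_exists (chi : {linear X -> I2}) : exists x, Corep x chi.
Proof.
have [s sl sP] := surj_section_klinear q_surj.
have hl : klinear (fun x => s (chi x)).
  by apply: (klinear_comp sl); exact: linear_klinear.
have mh : multilinear (cochain0 (fun x => s (chi x))) by exact: cochain0_multilinear.
have [|||b mb bE] := @factor _ _ _ i1 q 1 (bar_d (cochain0 (fun x => s (chi x)))).
- by move=> v; case: (q_ker v).
- exact: multilinear_bar_d.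
- apply/funext => t; apply/funext => x.
  by rewrite /cmap bar_d_cochain0 linearB linearZ_LR !sP linearZ_LR subrr.
have [|||c mc cE] := @factor _ _ _ i0 i1 2 (bar_d b).
- by move=> v; case: (i1_ker v).
- exact: multilinear_bar_d.
- by rewrite -cmapr_d bE bar_dd.
have dc : bar_d c = 0.
  apply/funext => t; apply/funext => x; apply: i0_inj; rewrite linear0.
  have := congr1 (fun c : cochain X I0 3 => c t x) (cmapr_d i0 c).
  by rewrite cE bar_dd => /esym.
have [x xc] := class_of_exists mc dc; exists x, c => //.
by exists b, (fun x => s (chi x)); split.
Qed.
Lemma Corep_of_class x : xv 1 X I0 -> xv 0 X I1 ->
  exists chi : {linear X -> I2}, Corep x chi.
Proof.
move=> xI0 xI1; have [c [xc mc dc]] := class_ofP x.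
have [||b mb cb] := xI0 (cmap id i0 c); first exact: cmapr_m.
  apply: etrans (cmapr_d _ _) _; rewrite dc.
  by apply/funext => t; apply/funext => y; rewrite /cmap linear0.
have {}cb : cmap id i0 c = bar_d b := cb.
have [||h mh bh] := xI1 (cmap id i1 b); first exact: cmapr_m.
  apply: etrans (cmapr_d _ _) _; rewrite -cb.
  by apply/funext => t; apply/funext => y; rewrite /cmap i10.
rewrite (cochain0E h) in mh bh; set h0 := h _ in mh bh.
have {}bh : cmap id i1 b = bar_d (cochain0 h0) := bh.
have dh0 : bar_d (cmap id q (cochain0 h0)) = 0.
  rewrite cmapr_d -bh; apply/funext => t; apply/funext => k.
  by rewrite /cmap qi1.
have mq : multilinear (cochain0 (fun x => q (h0 x))) := cmapr_m q mh.
have {}dh0 : bar_d (cochain0 (fun x => q (h0 x))) = 0 := dh0.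
exists (mklin (cocycle0_linear mq dh0)), c => //.
by exists b, h0; split=> //; have [m1 _] := mh; exact: (m1 (fun=> 0)).
Qed.
Lemma Corep_lift_eq0 x chi (h' : {linear X -> I1}) : Corep x chi ->
  (forall y, chi y = q (h' y)) -> x = 0.
Proof.
move=> [c xc [b [h [mb hl cb bh qh]]]] chiE; apply/(class_of_eq0 xc).
have mh' : multilinear (cochain0 (fun y => h y - h' y)).
  by apply: cochain0_multilinear => k u v; rewrite hl linearP opprD addrACA -scalerBr.
have [|||e me eE] := @factor _ _ _ i1 q 0 (cochain0 (fun y => h y - h' y)).
- by move=> v; case: (q_ker v).
- exact: mh'.
- by apply/funext => t; apply/funext => y; rewrite /cmap linearB qh chiE subrr.
have [|||g mg gE] := @factor _ _ _ i0 i1 1 (b - bar_d e).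
- by move=> v; case: (i1_ker v).
- by apply: multilinearB => //; exact: multilinear_bar_d.
- rewrite cmapB bh -cmapr_d eE -bar_dB.
  rewrite (_ : _ - _ = cochain0 h'); first by have [_ ->] := linear_cocycle0 h'.
  by apply/funext => t; apply/funext => y; rewrite cochB /cochain0 opprB addrC subrK.
exists g => //; apply/funext => t; apply/funext => y; apply: i0_inj.
have := congr1 (fun c : cochain X I0 2 => c t y) (cmapr_d i0 g).
by rewrite gE bar_dB bar_dd subr0 -cb.
Qed.
Lemma Corep0_lift chi : xv 0 X I0 -> Corep 0 chi ->
  exists h' : {linear X -> I1}, forall y, chi y = q (h' y).
Proof.
move=> xI0 [c xc [b [h [mb hl cb bh qh]]]].
have [g mg cg] := (class_of_eq0 xc).1 erefl.
have [||e me be] := xI0 (b - cmap id i0 g).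
- by apply: multilinearB => //; exact: cmapr_m.
- by apply: etrans (bar_dB _ _) _; rewrite -cb cmapr_d cg subrr.
have {}be : b - cmap id i0 g = bar_d e := be.
have mh' : multilinear (cochain0 h - cmap id i1 e).
  by apply: multilinearB; [exact: cochain0_multilinear | exact: cmapr_m].
have dh' : bar_d (cochain0 h - cmap id i1 e) = 0.
  rewrite bar_dB -bh cmapr_d -be cmapB opprB addrC subrK.
  by apply/funext => t; apply/funext => y; rewrite /cmap i10.
rewrite (cochain0E (_ - _)) in mh' dh'.
exists (mklin (cocycle0_linear mh' dh')) => y.
by rewrite /= cochB linearB /cmap qi1 subr0 qh.
Qed.
End Corepresentation.

Section CorepMap.
Variables (K : fieldType) (A : kalgType K).
Variables (Y I0 I1 I2 : lmodType A).
Variables (i0 : {linear Y -> I0}) (i1 : {linear I0 -> I1}) (q : {linear I1 -> I2}).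
Lemma Corep_map (X X' : lmodType A) (f : {linear X' -> X}) (x : Ext X Y 2) chi :
  Corep i0 i1 q x chi -> Corep i0 i1 q (Ext_map f idfun x) (fun y => chi (f y)).
Proof.
move=> [c xc [b [h [mb hl cb bh qh]]]].
exists (cmap f id c); first exact: (class_of_map f idfun xc).
exists (cmap f id b), (fun y => h (f y)); split.
- by apply: cmap_multilinear => //; exact: linear_klinear.
- by apply: (klinear_comp hl); exact: linear_klinear.
- by rewrite (@cmap_d _ _ X X' I0 I0 f idfun) -cb.
- by rewrite (_ : cochain0 _ = cmap f id (cochain0 h)) // (@cmap_d _ _ X X' I1 I1 f idfun) -bh.
- by move=> y; rewrite qh.
Qed.
Lemma CorepB (X : lmodType A) (x x' : Ext X Y 2) chi chi' :
  Corep i0 i1 q x chi -> Corep i0 i1 q x' chi' ->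
  Corep i0 i1 q (x - x') (fun y => chi y - chi' y).
Proof.
move=> [c xc [b [h [mb hl cb bh qh]]]] [c' xc' [b' [h' [mb' hl' cb' bh' qh']]]].
exists (c - c'); first exact: class_ofB.
exists (b - b'), (fun v => h v - h' v); split.
- exact: multilinearB.
- by move=> k u v; rewrite hl hl' opprD addrACA -scalerBr.
- by rewrite bar_dB -cb -cb' cmapB.
- by rewrite (_ : cochain0 _ = cochain0 h - cochain0 h') // bar_dB -bh -bh' cmapB.
- by move=> y; rewrite linearB qh qh'.
Qed.
End CorepMap.

Section CorepMapRight.
Variables (K : fieldType) (A : kalgType K).
Variables (X Y I0 I1 I2 Y' I0' I1' I2' : lmodType A).
Variables (i0 : {linear Y -> I0}) (i1 : {linear I0 -> I1}) (q : {linear I1 -> I2}).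
Variables (i0' : {linear Y' -> I0'}) (i1' : {linear I0' -> I1'}) (q' : {linear I1' -> I2'}).
Variables (gY : {linear Y -> Y'}) (g0 : {linear I0 -> I0'}) (g1 : {linear I1 -> I1'})
  (g2 : {linear I2 -> I2'}).
Hypothesis e0 : forall y, i0' (gY y) = g0 (i0 y).
Hypothesis e1 : forall y, i1' (g0 y) = g1 (i1 y).
Hypothesis e2 : forall y, q' (g1 y) = g2 (q y).
Lemma Corep_mapr (x : Ext X Y 2) chi : Corep i0 i1 q x chi ->
  Corep i0' i1' q' (Ext_map idfun gY x) (fun y => g2 (chi y)).
Proof.
move=> [c xc [b [h [mb hl cb bh qh]]]].
exists (cmap id gY c); first exact: (class_of_map idfun gY xc).
exists (cmap id g0 b), (fun y => g1 (h y)); split.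
- by apply: cmap_multilinear => //; exact: linear_klinear.
- by apply: (klinear_comp _ hl); exact: linear_klinear.
- rewrite (@cmap_d _ _ X X I0 I0' idfun g0) -cb.
  by apply/funext => t; apply/funext => v; rewrite /cmap e0.
- rewrite (_ : cochain0 _ = cmap id g1 (cochain0 h)) // (@cmap_d _ _ X X I1 I1' idfun g1) -bh.
  by apply/funext => t; apply/funext => v; rewrite /cmap e1.
- by move=> y; rewrite e2 qh.
Qed.
End CorepMapRight.

(** * Duality *)

Section Summands.
Variables (R : pzRingType).
Implicit Types T X Y : lmodType R.
(* X is a direct summand of a finite power of T. *)
Definition summand T X : Prop := exists (I : finType) (i : I -> {linear X -> T})
  (r : I -> {linear T -> X}), forall x, \sum_k r k (i k x) = x.
Lemma summand_self T : summand T T.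
Proof. by exists unit, (fun=> idfun), (fun=> idfun) => x; rewrite big_const card_unit /= addr0. Qed.
Lemma summand_trans T X Y : summand T X -> summand X Y -> summand T Y.
Proof.
move=> [I [i [r ir]]] [J [j [s js]]].
exists (I * J)%type, (fun p => lin_comp (i p.1) (j p.2)), (fun p => lin_comp (s p.2) (r p.1)).
move=> x; rewrite -(pair_big predT predT (fun a b => s b (r a (i a (j b x))))) exchange_big /=.
by rewrite -[RHS]js; apply: eq_bigr => b _; rewrite -[in RHS](ir (j b x)) linear_sum.
Qed.
Lemma summand_retract T X Y (i : {linear X -> Y}) (r : {linear Y -> X}) :
  (forall x, r (i x) = x) -> summand T Y -> summand T X.
Proof.
move=> ri TY; apply: (summand_trans TY); exists unit, (fun=> i), (fun=> r) => x.
by rewrite big_const card_unit /= addr0 ri.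
Qed.
Lemma prod_inl_linear X Y : linear (fun x : X => (x, 0 : Y)).
Proof.
move=> a u v; rewrite [RHS](_ : _ = (a *: u + v, a *: 0 + 0)) //.
by rewrite scaler0 addr0.
Qed.
Lemma prod_inr_linear X Y : linear (fun y : Y => (0 : X, y)).
Proof.
move=> a u v; rewrite [RHS](_ : _ = (a *: 0 + 0, a *: u + v)) //.
by rewrite scaler0 addr0.
Qed.
Lemma prod_fst_linear X Y : linear (fun p : (X * Y)%type => p.1).
Proof. by []. Qed.
Lemma prod_snd_linear X Y : linear (fun p : (X * Y)%type => p.2).
Proof. by []. Qed.
Definition inl_lin X Y : {linear X -> (X * Y)%type} := mklin (@prod_inl_linear X Y).
Definition inr_lin X Y : {linear Y -> (X * Y)%type} := mklin (@prod_inr_linear X Y).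
Definition fst_lin X Y : {linear (X * Y)%type -> X} := mklin (@prod_fst_linear X Y).
Definition snd_lin X Y : {linear (X * Y)%type -> Y} := mklin (@prod_snd_linear X Y).
Lemma prod_addE X Y (p q : (X * Y)%type) : p + q = (p.1 + q.1, p.2 + q.2).
Proof. by []. Qed.
Lemma prod_split X Y (p : (X * Y)%type) : inl_lin X Y p.1 + inr_lin X Y p.2 = p.
Proof. by rewrite /= prod_addE /= addr0 add0r; case: p. Qed.
Lemma summand_prod T X Y : summand T X -> summand T Y -> summand T (X * Y)%type.
Proof.
move=> [I [i [r ir]]] [J [j [s js]]].
exists (I + J)%type, (fun k => match k with
    inl a => lin_comp (i a) (fst_lin X Y) | inr b => lin_comp (j b) (snd_lin X Y) end),
  (fun k => match k with
    inl a => lin_comp (inl_lin X Y) (r a) | inr b => lin_comp (inr_lin X Y) (s b) end).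
move=> p; rewrite big_sumType /= -[RHS]prod_split -[in RHS](ir p.1) -[in RHS](js p.2).
by rewrite !linear_sum.
Qed.

Section Powers.
Variables (I : finType) (T : lmodType R).
Local Notation TI := (dprod (fun _ : I => T)).
Lemma dp_proj_linear i : linear (fun x : TI => x i). Proof. by []. Qed.
Definition dp_proj i : {linear TI -> T} := mklin (dp_proj_linear i).
Lemma dp_inj_linear i : linear (fun (x : T) (j : I) => if j == i then x else 0 : T).
Proof.
move=> a x y; apply/funext => j.
rewrite [RHS](_ : _ = a *: (if j == i then x else 0) + (if j == i then y else 0)) //.
by case: ifP => //; rewrite scaler0 addr0.
Qed.
Definition dp_inj i : {linear T -> TI} := @mklin R T TI _ (dp_inj_linear i).
Lemma dp_split x : \sum_i dp_inj i (x i) = x.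
Proof.
apply: dprodP => j; rewrite dp_sumE (bigD1 j) //= eqxx big1 ?addr0 // => i ij.
by rewrite eq_sym (negbTE ij).
Qed.
Lemma summand_power : summand T TI.
Proof. by exists I, dp_proj, dp_inj => x; rewrite -[RHS]dp_split. Qed.
Variable X : lmodType R.
Lemma dp_pair_linear (f : I -> {linear X -> T}) : linear ((fun x i => f i x) : X -> TI).
Proof. by move=> a x y; apply: dprodP => i; rewrite linearP. Qed.
Definition dp_pair (f : I -> {linear X -> T}) : {linear X -> TI} := mklin (dp_pair_linear f).
Lemma dp_copair_linear (f : I -> {linear T -> X}) : linear (fun x : TI => \sum_i f i (x i)).
Proof.
move=> a x y; rewrite scaler_sumr -big_split /=; apply: eq_bigr => i _.
exact: (linearP (f i)).
Qed.
Definition dp_copair (f : I -> {linear T -> X}) : {linear TI -> X} := mklin (dp_copair_linear f).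
End Powers.
End Summands.

Section SummandExt.
Variables (K : fieldType) (A : kalgType K).
Implicit Types T X Y : lmodType A.
Lemma Ext_map0r X X' Y Y' (b : {linear X' -> X}) n (x : Ext X Y n.+1) :
  Ext_map b (0 : {linear Y -> Y'}) x = 0.
Proof.
by apply: (addrI (Ext_map b (0 : {linear Y -> Y'}) x)); rewrite -Ext_mapDr !addr0.
Qed.
Lemma Ext_map_sumr X X' Y Y' (b : {linear X' -> X}) n (I : Type) (r : seq I)
    (F : I -> {linear Y -> Y'}) (x : Ext X Y n.+1) :
  Ext_map b (\sum_(i <- r) F i) x = \sum_(i <- r) Ext_map b (F i) x.
Proof.
apply: (big_ind2 (fun g y => Ext_map b g x = y)) => [|x1 x2 y1 y2 <- <-|//].
  exact: Ext_map0r.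
exact: Ext_mapDr.
Qed.
Lemma summand_sum T X (I : finType) (i : I -> {linear X -> T}) (r : I -> {linear T -> X}) :
  (forall x, \sum_k r k (i k x) = x) -> \sum_k lin_comp (r k) (i k) = idfun.
Proof. by move=> ir; apply: linear_ext => x; rewrite lin_sumE; exact: ir. Qed.
Lemma summand_xvl n T X Y : summand T X -> xv n T Y -> xv n X Y.
Proof.
move=> [I [i [r ir]]] /xvP xT; apply/xvP => x.
rewrite -[x]Ext_map_id -(summand_sum ir) Ext_map_suml big1 // => k _.
rewrite [LHS](_ : _ = Ext_map (i k) idfun (Ext_map (r k) idfun x)); last first.
  by rewrite Ext_map_comp; apply: (congr2 (fun b g => Ext_map b g x)); exact: linear_ext.
by rewrite [Ext_map (r k) _ x]xT Ext_map0.
Qed.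
Lemma summand_xvr n T X Y : summand T Y -> xv n X T -> xv n X Y.
Proof.
move=> [I [i [r ir]]] /xvP xT; apply/xvP => x.
rewrite -[x]Ext_map_id -(summand_sum ir) Ext_map_sumr big1 // => k _.
rewrite [LHS](_ : _ = Ext_map idfun (r k) (Ext_map idfun (i k) x)); last first.
  by rewrite Ext_map_comp; apply: (congr2 (fun b g => Ext_map b g x)); exact: linear_ext.
by rewrite [Ext_map _ (i k) x]xT Ext_map0.
Qed.
End SummandExt.

Section HomBimodule.
Variables (K : fieldType) (A B : kalgType K) (T : bimodule A B).
Lemma ract_linear (b : B) : linear (fun t : T => ract t b).
Proof. by move=> a x y; rewrite ractDl ractZ. Qed.
Definition ract_map (b : B) : {linear T -> T} := mklin (ract_linear b).

Section Object.
Variable Y : lmodType A.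
Definition homB : Type := {linear T -> Y}.
HB.instance Definition _ := GRing.Zmodule.on homB.
Definition hb_fun (g : homB) : {linear T -> Y} := g.
Definition hb_scale (b : B) (g : homB) : homB := lin_comp (hb_fun g) (ract_map b).
Lemma hb_ext (g h : homB) : (forall t, hb_fun g t = hb_fun h t) -> g = h.
Proof. exact: linear_ext. Qed.
Lemma hb_scaleA a b g : hb_scale a (hb_scale b g) = hb_scale (a * b) g.
Proof. by apply: hb_ext => t /=; rewrite ractM. Qed.
Lemma hb_scale1 : left_id 1 hb_scale.
Proof. by move=> g; apply: hb_ext => t /=; rewrite ract1. Qed.
Lemma hb_scaleDr : right_distributive hb_scale +%R.
Proof. by move=> b g h; apply: hb_ext. Qed.
Lemma hb_scaleDl g : {morph hb_scale^~ g : a b / a + b}.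
Proof. by move=> a b; apply: hb_ext => t /=; rewrite ractDr linearD. Qed.
HB.instance Definition _ := GRing.Zmodule_isLmodule.Build B homB
  hb_scaleA hb_scale1 hb_scaleDr hb_scaleDl.
Lemma hb_scaleE (b : B) (g : homB) t : hb_fun (b *: g) t = hb_fun g (ract t b).
Proof. by []. Qed.
Lemma hb_addE (g h : homB) t : hb_fun (g + h) t = hb_fun g t + hb_fun h t.
Proof. by []. Qed.
Lemma hb_sumE (I : finType) (F : I -> homB) t :
  hb_fun (\sum_i F i) t = \sum_i hb_fun (F i) t.
Proof. by apply: (big_morph (fun g : homB => hb_fun g t)). Qed.
End Object.
Lemma homB_map_linear (X Y : lmodType A) (f : {linear X -> Y}) :
  linear (fun g : homB X => lin_comp f (hb_fun g) : homB Y).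
Proof. by move=> b g h; apply: hb_ext => t /=; rewrite linearD. Qed.
Definition homB_map (X Y : lmodType A) (f : {linear X -> Y}) : {linear homB X -> homB Y} :=
  mklin (homB_map_linear f).
Lemma homB_mapE (X Y : lmodType A) (f : {linear X -> Y}) (g : homB X) t :
  hb_fun (homB_map f g) t = f (hb_fun g t).
Proof. by []. Qed.
End HomBimodule.

Section DualModule.
Variables (K : fieldType) (A : kalgType K).
Local Notation DA := (dual_mod A).
Lemma dual_bim_scal (k : K) (f : DA) : dual_ract (scal k) f = (scal k : A) *: f.
Proof. exact: dual_ract_scal. Qed.
Definition dual_bim : bimodule A A := @Bimodule K A A DA (fun f a => dual_ract a f)
  (fun x y b => linearD (dual_ract b : {linear DA -> DA}) x y)
  (fun x b c => dual_ractD b c x) (@dual_ract1 K A) (fun x b c => dual_ractM b c x)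
  (fun a x b => linearZ_LR (dual_ract b : {linear DA -> DA}) a x) dual_bim_scal.

Section Functional.
Variables (V : lmodType A) (F : {linear restr_scal V -> K^o}).
Lemma dual_of_sub_linear v : linear (fun x : kspace A => F (((x : A) *: (v : V)) : V)).
Proof.
move=> k x y; rewrite -(linearP F) /=; congr (F _).
by rewrite [RHS](_ : _ = (scal k : A) *: ((x : A) *: v) + (y : A) *: v) //
  scalerA -scalerDl.
Qed.
Definition dual_of_fun (v : V) : DA := mklin (dual_of_sub_linear v).
Lemma dual_of_linear : linear dual_of_fun.
Proof.
move=> a u v; apply: dual_ext => x.
rewrite dual_add_fun dual_scaleE [LHS](_ : _ = F ((x *: (a *: u + v)) : V)) //.
by rewrite scalerDr scalerA [LHS](linearD F).
Qed.
(** The adjunction between functionals on V and A-linear maps V -> DA; [dual_ev1] goes back by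
    evaluation at 1. *)
Definition dual_of : {linear V -> DA} := mklin dual_of_linear.
Lemma dual_ofE v x : dual_fun (dual_of v) x = F ((x *: v) : V). Proof. by []. Qed.
End Functional.
Lemma dual_fun0 (x : A) : dual_fun (0 : DA) x = 0. Proof. by []. Qed.
Lemma dual_fun_sum (I : finType) (F : I -> DA) x :
  dual_fun (\sum_i F i) x = \sum_i dual_fun (F i) x.
Proof. by apply: (big_morph (fun g : DA => dual_fun g x)). Qed.
Lemma dual_funS (I : finType) (F : I -> A) (f : DA) :
  dual_fun f (\sum_i F i) = \sum_i dual_fun f (F i).
Proof. by apply: (big_morph _ (dual_funD f)); exact: (linear0 f). Qed.
Lemma dual_fun1 (f : DA) x : dual_fun (x *: f) 1 = dual_fun f x.
Proof. by rewrite dual_scaleE mul1r. Qed.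
Lemma dual_fun_scal (k : K) (f : DA) x :
  dual_fun ((scal k : A) *: f) x = k * dual_fun f x.
Proof. by rewrite dual_scaleE -scalC dual_funZ. Qed.
Lemma dual_ev1_linear (V : lmodType A) (f : {linear V -> DA}) :
  linear ((fun v => dual_fun (f v) 1) : restr_scal V -> K^o).
Proof.
move=> k u v; rewrite [f _](linearP f (scal k) (u : V) (v : V)) dual_add_fun.
by rewrite dual_fun_scal.
Qed.
Definition dual_ev1 (V : lmodType A) (f : {linear V -> DA}) : {linear restr_scal V -> K^o} :=
  mklin (dual_ev1_linear f).
Lemma dual_of_ev1 (V : lmodType A) (f : {linear V -> DA}) : dual_of (dual_ev1 f) = f.
Proof.
apply: linear_ext => v; apply: dual_ext => x.
by rewrite dual_ofE /= linearZ_LR dual_fun1.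
Qed.
Lemma restr_linear (U V : lmodType A) (f : {linear U -> V}) :
  linear (f : restr_scal U -> restr_scal V).
Proof. by move=> k u v; exact: (linearP f (scal k)). Qed.
Definition restr_map (U V : lmodType A) (f : {linear U -> V}) :
  {linear restr_scal U -> restr_scal V} := mklin (restr_linear f).
Lemma dual_injective : injective_mod DA.
Proof.
move=> U V i f inj; have [r rP] := kginv (restr_map i).
pose F : {linear restr_scal V -> K^o} := lin_comp (dual_ev1 f) r.
exists (dual_of F) => u; rewrite -[f in RHS]dual_of_ev1.
apply: dual_ext => x; rewrite !dual_ofE /F /lin_comp /=.
have e : r (x *: i u : V) = (x *: u : U) :> restr_scal U.
  by apply: inj; rewrite -linearZ_LR; exact: (rP (x *: u : U)).
by rewrite e.
Qed.
Lemma dual_basis_expand n (v : 'I_n -> kspace A) a (f : DA) : dual_basis v a ->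
  f = \sum_i (scal (dual_fun f (v i)) : A) *: (a i : DA).
Proof.
move=> va; have va' (x : A) : x = \sum_(j < n) (scal (a j x : K) : A) * (v j : A) := va x.
apply: dual_ext => x; rewrite dual_fun_sum {1}(va' x) dual_funS; apply: eq_bigr => i _.
by rewrite dual_fun_scal mulrC dual_funZ.
Qed.
Hypothesis fdA : findim (kspace A).
Lemma dual_reflexive (F : DA -> K) : (forall f g, F (f + g) = F f + F g) ->
  (forall (k : K) f, F ((scal k : A) *: f) = k * F f) ->
  exists a, forall f, F f = dual_fun f a.
Proof.
move=> FD FZ; have [n [v [a va]]] := findim_dual_basis fdA.
have F0 : F 0 = 0 by apply: (addrI (F 0)); rewrite -FD !addr0.
exists (\sum_i scal (F (a i)) * (v i : A)) => f.
have fE : f = \sum_i (scal (dual_fun f (v i)) : A) *: (a i : DA).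
  exact: (dual_basis_expand f va).
rewrite {1}fE (big_morph _ FD F0) dual_funS.
apply: eq_bigr => i _; rewrite FZ mulrC.
by rewrite [RHS]dual_funZ.
Qed.
(** Evaluating h at 1 is a functional on DA, hence by reflexivity the evaluation at some a in A;
    linearity of h does the rest. *)
Lemma dual_end (h : {linear DA -> DA}) : exists a, forall f, h f = dual_ract a f.
Proof.
have [||a aP] := @dual_reflexive (fun f => dual_fun (h f) 1).
- by move=> f g; rewrite linearD dual_add_fun.
- by move=> k f; rewrite linearZ_LR dual_fun_scal.
exists a => f; apply: dual_ext => x.
by rewrite -dual_fun1 -linearZ_LR aP dual_scaleE dual_ract_fun.
Qed.
Lemma dual_findim : findim (restr_scal DA).
Proof.
have [n [v [a va]]] := findim_dual_basis fdA; exists n, (fun i => a i : DA) => f.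
exists (fun i => dual_fun f (v i)).
exact: (dual_basis_expand f va).
Qed.
(** The coordinates of x - r x, for a K-linear retraction r onto S, become A-linear maps through
    [dual_of]. In effect V/S embeds into a finite power of DA. *)
Lemma cogenerator (V : lmodType A) (S : submodule V) : findim (restr_scal V) ->
  exists (I : finType) (h : I -> {linear V -> DA}),
    forall v, (forall i, h i v = 0) <-> S v.
Proof.
move=> /findim_dual_basis[n [v [a va]]].
have [r rP] := kginv (restr_map (sm_incl S)).
have pl i : linear ((fun x => a i (x - (val (r x) : V) : V)) : restr_scal V -> K^o).
  move=> k x y; rewrite -[RHS](linearP (a i)) /=; congr (a i _).
  rewrite [r _](linearP r) [val _](linearP (restr_map (sm_incl S))) /=.
  by rewrite scalerBr opprD addrACA.
exists 'I_n, (fun i => dual_of (mklin (pl i))) => x; split => [h|Sx i].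
  suff -> : x = val (r x) by exact: smodP.
  apply/eqP; rewrite -subr_eq0; apply/eqP.
  rewrite (va (x - _ : V)) big1 // => i _.
  have := congr1 (fun f : DA => dual_fun f 1) (h i).
  by rewrite dual_ofE /= scale1r => ->; rewrite scale0r.
apply: dual_ext => y; rewrite dual_ofE /=.
have := rP (smk (smodZ y Sx)); rewrite /= => ->.
by rewrite subrr; exact: linear0.
Qed.
(* A nonzero functional on a division corner c A c identifies c A c with its   *)
(* dual.                                                                       *)
Lemma corner_form (c : A) (u : DA) :
  (forall x, c * x * c = x -> x <> 0 -> exists y, x * y = c) ->
  c * c = c -> (forall y, dual_fun u (c * y * c) = dual_fun u y) -> u <> 0 ->
  forall w : DA, (forall y, dual_fun w (c * y * c) = dual_fun w y) ->
  exists x, forall y, dual_fun w y = dual_fun u (y * (c * x * c)).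
Proof.
move=> inv cc uc u0 w wc.
have ml : linear ((fun x => (c * (x : A) * c) *: u) : kspace A -> restr_scal DA).
  move=> k x y; rewrite [RHS](_ : _ = (scal k : A) *: ((c * x * c) *: u) + (c * y * c) *: u) //.
  have e : c * (scal k * x + y) * c = scal k * (c * x * c) + c * y * c.
    by rewrite mulrDr mulrDl !mulrA -scalC.
  by rewrite scalerA -scalerDl -e.
have [[x xw]|nw] := pselect (exists x, mklin ml x = w).
  by exists x => y; rewrite -xw.
have [x|a [a0 aw]] := @kseparate _ _ _ (mklin ml) w.
  by apply/eqP => h; apply: nw; exists x.
have [||b bP] := @dual_reflexive a.
- by move=> f g; exact: (linearD a).
- by move=> k f; exact: (linearZ_LR a k f).
case: aw; rewrite bP -wc.
have [->|/eqP bn] := eqVneq (c * b * c) 0; first by exact: (linear0 w).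
have [y yb] := inv (c * b * c) (etrans (congr2 *%R (etrans (mulrA _ _ _) (congr1 ( *%R^~ c) (etrans (mulrA _ _ _) (congr1 ( *%R^~ b) cc)))) erefl) (etrans (esym (mulrA _ _ _)) (congr1 _ cc))) bn.
case: u0; apply: dual_ext => z; rewrite dual_fun0 -uc -{1}yb.
have := a0 (y * z); rewrite bP => e.
rewrite -[RHS](e : dual_fun u (b * (c * (y * z) * c)) = 0) -[RHS]uc; congr (dual_fun u _).
by rewrite -!mulrA cc.
Qed.
End DualModule.

Section Factorization.
Variable R : pzRingType.
Implicit Types X Y Z : lmodType R.
Lemma lin_factor_inj X Y Z (i : {linear X -> Y}) (g : {linear Z -> Y}) :
  injective i -> (forall z, exists x, g z = i x) ->
  exists h : {linear Z -> X}, forall z, i (h z) = g z.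
Proof.
move=> inj gi; have [h hP] := choice gi.
have hl : linear h by move=> a u v; apply: inj; rewrite linearP -!hP linearP.
by exists (mklin hl) => z; rewrite -hP.
Qed.
Lemma lin_factor_surj X Y Z (p : {linear X -> Y}) (g : {linear X -> Z}) :
  surj p -> (forall x, p x = 0 -> g x = 0) ->
  exists h : {linear Y -> Z}, forall x, h (p x) = g x.
Proof.
move=> ps pg; have [s sP] := choice ps.
have gE x y : p x = p y -> g x = g y.
  move=> e; apply/eqP; rewrite -subr_eq0 -linearB; apply/eqP/pg.
  by rewrite linearB e subrr.
have hl : linear (fun y => g (s y)).
  by move=> a u v; rewrite -linearP; apply: gE; rewrite linearP !sP.
by exists (mklin hl) => x /=; apply: gE; rewrite sP.
Qed.
Lemma linear_inverse X Y (f : {linear X -> Y}) : injective f -> surj f ->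
  exists g : {linear Y -> X}, (forall x, g (f x) = x) /\ (forall y, f (g y) = y).
Proof.
move=> inj fs; have [|g gP] := @lin_factor_inj _ _ _ f (idfun : {linear Y -> Y}) inj.
  by move=> y; have [x <-] := fs y; exists x.
by exists g; split=> // x; apply: inj; rewrite gP.
Qed.
End Factorization.

(** * The inverse Nakayama functor *)

Section Nakayama.
Variables (K : fieldType) (A : kalgType K).
Local Notation DA := (dual_mod A).
Local Notation homDA := (homB (dual_bim A)).
Implicit Types (I X W : lmodType A).
(** On add DA the functor Hom(DA, -) is the inverse Nakayama functor. Pulling x back along maps DA
    -> I realises Ext^2(I, W) as the group of maps from Hom(DA, I) to tau W; see [nak_map_surj] and
    [nak_map_inj]. *)
Definition nak_map_fun I W (x : Ext I W 2) (chi : homDA I) : tau2 W :=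
  Ext_map (hb_fun chi) idfun x.
Lemma nak_map_linear I W (x : Ext I W 2) : linear (nak_map_fun x).
Proof.
move=> a u v; rewrite /nak_map_fun [hb_fun _](_ : _ =
  lin_comp (hb_fun u) (dual_ract a : {linear DA -> DA}) + hb_fun v); last exact: linear_ext.
rewrite Ext_mapDl; congr (_ + _).
rewrite [RHS]/GRing.scale /= /tau2_scale Ext_map_comp.
by apply: (congr2 (fun b g => Ext_map b g x)); exact: linear_ext.
Qed.
Definition nak_map I W (x : Ext I W 2) : {linear homDA I -> tau2 W} :=
  mklin (nak_map_linear x).
Lemma nak_mapE I W (x : Ext I W 2) chi : nak_map x chi = Ext_map (hb_fun chi) idfun x.
Proof. by []. Qed.
Lemma homB_sum (B : kalgType K) (T : bimodule A B) (X Y : lmodType A) (J : finType)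
    (F : J -> {linear X -> Y}) (chi : homB T X) :
  homB_map T (\sum_j F j) chi = \sum_j homB_map T (F j) chi.
Proof.
by apply: hb_ext => t; rewrite hb_sumE homB_mapE lin_sumE.
Qed.
Hypothesis fdA : findim (kspace A).
Lemma dual_funB (g : DA) (x y : A) : dual_fun g (x - y) = dual_fun g x - dual_fun g y.
Proof. exact: (linearB g). Qed.
Lemma dual_separates (x : A) : (forall g : DA, dual_fun g x = 0) -> x = 0.
Proof.
have [n [v [a va]]] := findim_dual_basis fdA => gx.
by rewrite (va x) big1 // => i _; rewrite [a i x](gx (a i)) scale0r.
Qed.
Lemma dual_ract_inj (a b : A) : (forall g, dual_ract a g = dual_ract b g) -> a = b.
Proof.
move=> ab; apply/eqP; rewrite -subr_eq0; apply/eqP; apply: dual_separates => g.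
have := congr1 (fun f => dual_fun f 1) (ab g); rewrite !dual_ract_fun !mulr1 => e.
by rewrite dual_funB e subrr.
Qed.

Section Data.
Variables (I : lmodType A) (J : finType) (i : J -> {linear I -> DA})
  (r : J -> {linear DA -> I}).
Hypothesis ir : forall x, \sum_k r k (i k x) = x.
Lemma nak_coord (chi : homDA I) k : exists a, forall f, i k (hb_fun chi f) = dual_ract a f.
Proof. exact: (dual_end fdA (lin_comp (i k) (hb_fun chi))). Qed.
Lemma nak_expand (chi : homDA I) (a : J -> A) :
  (forall k f, i k (hb_fun chi f) = dual_ract (a k) f) ->
  chi = \sum_k a k *: (r k : homDA I).
Proof.
move=> ca; apply: hb_ext => f; rewrite hb_sumE -[LHS]ir; apply: eq_bigr => k _.
by rewrite hb_scaleE /= ca.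
Qed.
Lemma nak_map_surj W (u : {linear homDA I -> tau2 W}) : exists x, u = nak_map x.
Proof.
exists (\sum_k Ext_map (i k) idfun (u (r k : homDA I))).
apply: linear_ext => chi; have [a ca] := choice (nak_coord chi).
rewrite nak_mapE Ext_map_sum {1}(nak_expand ca) linear_sum; apply: eq_bigr => k _.
rewrite linearZ_LR [LHS]/GRing.scale /= /tau2_scale Ext_map_comp.
by apply: (congr2 (fun b g => Ext_map b g _)); apply: linear_ext => f /=; rewrite ?ca.
Qed.
Lemma nak_map_inj W (x : Ext I W 2) : (forall chi, nak_map x chi = 0) -> x = 0.
Proof.
move=> x0; rewrite -[x]Ext_map_id -(summand_sum ir) Ext_map_suml big1 // => k _.
have := x0 (r k); rewrite nak_mapE => e.
rewrite [LHS](_ : _ = Ext_map (i k) idfun (Ext_map (r k) idfun x)); last first.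
  by rewrite Ext_map_comp; apply: (congr2 (fun b g => Ext_map b g x)); exact: linear_ext.
by rewrite [Ext_map (r k) _ x]e Ext_map0.
Qed.
(** Maps from Hom(DA, I) to A correspond to functionals on I, since DA is reflexive and End(DA) is
    A; the converse is [functional_nak]. *)
Lemma nak_functional (u : {linear homDA I -> A^o}) :
  exists mu : {linear restr_scal I -> K^o},
    forall chi g, dual_fun g (u chi) = mu (hb_fun chi g).
Proof.
have ml : linear ((fun x => \sum_k dual_fun (i k x) (u (r k : homDA I))) : restr_scal I -> K^o).
  move=> k x y; rewrite scaler_sumr -big_split /=; apply: eq_bigr => j _.
  rewrite [i j _](linearP (i j) (scal k) (x : I) (y : I)) dual_add_fun.
  by rewrite dual_fun_scal.
exists (mklin ml) => chi g; have [a ca] := choice (nak_coord chi).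
rewrite {1}(nak_expand ca) linear_sum dual_funS /=; apply: eq_bigr => k _.
by rewrite linearZ_LR ca dual_ract_fun.
Qed.
Lemma functional_ext (mu nu : {linear restr_scal I -> K^o}) :
  (forall (chi : homDA I) g, mu (hb_fun chi g) = nu (hb_fun chi g)) -> mu = nu.
Proof.
move=> h; apply: linear_ext => x; rewrite -[x]ir.
rewrite [LHS](linear_sum mu) [RHS](linear_sum nu); apply: eq_bigr => k _.
exact: (h (r k)).
Qed.
Lemma functional_nak (mu : {linear restr_scal I -> K^o}) :
  exists u : {linear homDA I -> A^o},
    forall chi g, dual_fun g (u chi) = mu (hb_fun chi g).
Proof.
have ex (chi : homDA I) : exists a : A, forall g, dual_fun g a = mu (hb_fun chi g).
  have [||a aP] := @dual_reflexive _ _ fdA (fun g => mu (hb_fun chi g)).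
  - by move=> f g; rewrite linearD; exact: (linearD mu).
  - by move=> k f; rewrite linearZ_LR; exact: (linearZ_LR mu).
  by exists a => g; rewrite aP.
have [u uP] := choice ex.
have ul : linear (u : homDA I -> A^o).
  move=> a x y; apply/eqP; rewrite -subr_eq0; apply/eqP; apply: dual_separates => g.
  have e1 : dual_fun g (u (a *: x + y)) = mu (hb_fun x (dual_ract a g)) + mu (hb_fun y g).
    by rewrite uP hb_addE hb_scaleE; exact: (linearD mu).
  have e2 : dual_fun g (a * u x + u y) = mu (hb_fun x (dual_ract a g)) + mu (hb_fun y g).
    by rewrite dual_funD -dual_ract_fun !uP.
  exact: etrans (dual_funB g _ _) (etrans (congr2 (fun x y => x - y) e1 e2) (subrr _)).
by exists (mklin ul).
Qed.
(* A map w : Hom(DA, I) -> I has a trace, its value under the pairing of I     *)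
(* with the dual Hom(DA, I).                                                   *)
Definition nak_trace (w : homDA I -> I) : K :=
  \sum_k dual_fun (i k (w (r k : homDA I))) 1.
(** The trace of a map that factors through DA; this becomes the property [ad_Tr_pt] of the trace
    form. *)
Lemma nak_trace_pt (y : {linear homDA I -> DA}) (chi : homDA I) :
  nak_trace (fun v => hb_fun chi (y v)) = dual_fun (y chi) 1.
Proof.
have [a ca] := choice (nak_coord chi).
rewrite {2}(nak_expand ca) linear_sum dual_fun_sum; apply: eq_bigr => k _.
by rewrite linearZ_LR ca dual_ract_fun mulr1 dual_fun1.
Qed.
Lemma homDA_summand (c : A) : (forall k x, dual_ract c (i k x) = i k x) ->
  summand (princ c) (homDA I).
Proof.
move=> ci.
have rl : linear ((fun a : princ c => dual_ract (val a)) : princ c -> homDA DA).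
  move=> b x y; apply: hb_ext => f; rewrite hb_addE hb_scaleE.
  by rewrite -[LHS]/(dual_ract (b * val x + val y) f) dual_ractD dual_ractM.
pose rho := mklin rl.
have rinj : injective rho.
  move=> x y e; apply: val_inj; apply: dual_ract_inj => g.
  exact: (congr1 (fun h : homDA DA => hb_fun h g) e).
have ex k : exists F : {linear homDA I -> princ c}, forall chi,
    rho (F chi) = homB_map (dual_bim A) (i k) chi.
  apply: lin_factor_inj => // chi; have [a ca] := nak_coord chi k.
  have ac : a = a * c.
    by apply: dual_ract_inj => g; rewrite dual_ractM -ca ci.
  have ap : (a : A^o) \in princ_mem c by apply/asboolP; exists a.
  exists (exist (fun a : A^o => a \in princ_mem c) (a : A^o) ap : princ c); apply: hb_ext => f; exact: ca.
have [F FP] := choice ex.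
exists J, F, (fun k => lin_comp (homB_map (dual_bim A) (r k)) rho) => chi.
rewrite -[RHS](_ : homB_map (dual_bim A) (\sum_k lin_comp (r k) (i k)) chi = chi).
  rewrite homB_sum; apply: eq_bigr => k _; rewrite -[LHS]/(homB_map (dual_bim A) (r k) (rho (F k chi))) FP.
  exact: hb_ext.
by rewrite (summand_sum ir); exact: hb_ext.
Qed.
End Data.
(** Cyclicity of the trace, m being replaced by its image under the inverse Nakayama functor. For m
    the identity it shows that the trace does not depend on how I is presented as a summand. *)
Lemma nak_trace_comp I I' (J J' : finType) (i : J -> {linear I -> DA})
    (r : J -> {linear DA -> I}) (i' : J' -> {linear I' -> DA}) (r' : J' -> {linear DA -> I'}) (m : {linear I -> I'})
    (w : {linear homDA I' -> I}) :
  (forall x, \sum_k r k (i k x) = x) -> (forall x, \sum_k r' k (i' k x) = x) ->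
  nak_trace i' r' (fun v => m (w v)) =
  nak_trace i r (fun v => w (homB_map (dual_bim A) m v)).
Proof.
move=> ir ir'.
rewrite /nak_trace.
transitivity (\sum_k' \sum_j dual_fun (i' k' (m (r j (i j (w (r' k' : homDA I')))))) 1).
  by apply: eq_bigr => k' _; rewrite -{1}[w _]ir !linear_sum dual_fun_sum.
rewrite exchange_big /=; apply: eq_bigr => j _.
have [a ca] := choice (nak_coord i' (homB_map (dual_bim A) m (r j))).
transitivity (dual_fun (i j (w (\sum_k a k *: (r' k : homDA I')))) 1); last first.
  exact: (congr1 (fun v => dual_fun (i j (w v)) 1) (esym (nak_expand ir' ca))).
rewrite linear_sum linear_sum dual_fun_sum; apply: eq_bigr => k _.
rewrite !linearZ_LR dual_fun1.
by have -> := ca k (i j (w (r' k : homDA I'))); rewrite dual_ract_fun mulr1.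
Qed.
End Nakayama.

(** * The almost split sequence of A e *)

Section ExactPieces.
Variables (K : fieldType) (A : kalgType K).
Variables (K2 V1 V0 M : lmodType A).
Variables (d2 : {linear K2 -> V1}) (d1 : {linear V1 -> V0}) (p : {linear V0 -> M}).
Hypothesis ex : exact2 d2 d1 p.
Lemma exact2_top : short_exact d2 (im_corestr d1).
Proof.
have [_ _ d1k inj] := ex; split=> //; first exact: im_corestr_surj.
by move=> v; rewrite im_corestr_eq0.
Qed.
Lemma exact2_bottom : short_exact (@sm_incl _ _ (imsm d1)) p.
Proof.
have [ps pk _ _] := ex; split; [exact: (@sm_incl_inj _ _ (imsm d1)) | exact: ps |].
move=> v; rewrite pk; split=> [h|[u ->]]; last exact: (smodP u).
by exists (@smk _ _ (imsm d1) v h).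
Qed.
Variable Y : lmodType A.
(** [lift1] and [lift2] express that Hom(-, Y) is exact at K2 and at V1. By dimension shift they
    amount to the vanishing of Ext^2(M, Y) and of Ext^1(M, Y) respectively, as soon as V0 and V1 are
    acyclic. *)
Definition lift1 := forall u : {linear K2 -> Y}, exists u1 : {linear V1 -> Y},
  forall x, u1 (d2 x) = u x.
Definition lift2 := forall u : {linear V1 -> Y}, (forall x, u (d2 x) = 0) ->
  exists u2 : {linear V0 -> Y}, forall x, u2 (d1 x) = u x.
Lemma lift2_xv0 : xv 0 V0 Y -> lift2 -> xv 0 M Y.
Proof.
have [_ _ d1k _] := ex => xV0 l2; apply: (xvl_quo0 exact2_bottom) => // h.
have [|u2 u2E] := l2 (lin_comp h (im_corestr d1)).
  move=> x; have e : im_corestr d1 (d2 x) = 0 by apply/im_corestr_eq0/d1k; exists x.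
  exact: etrans (congr1 h e) (linear0 h).
exists u2 => u; have [v <-] := im_corestr_surj u; exact: u2E.
Qed.
Lemma lift1_xv1 : xv 0 V1 Y -> xv 1 V0 Y -> lift1 -> xv 1 M Y.
Proof.
move=> xV1 xV0 l1; apply: (xvl_quo exact2_bottom) => //.
by apply: (xvl_quo0 exact2_top).
Qed.
Lemma xv1_lift1 : xv 0 V0 Y -> xv 1 M Y -> lift1.
Proof.
move=> xV0 xM u; apply: (xvl_ext exact2_top).
exact: (xvl_sub exact2_bottom).
Qed.
Lemma xv0_lift2 : xv 0 M Y -> lift2.
Proof.
have [_ _ d1k _] := ex => xM u ud2.
have [x|h hE] := lin_factor_surj (@im_corestr_surj _ _ _ d1) (g := u).
  by move/im_corestr_eq0/d1k => [k ->].
have [h' h'E] := xvl_ext exact2_bottom h xM.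
by exists h' => x; rewrite -hE -h'E.
Qed.
End ExactPieces.

Section Injectives.
Variables (K : fieldType) (A : kalgType K).
Local Notation DA := (dual_mod A).
Implicit Types (I X : lmodType A).
Lemma summand_injective I : summand DA I -> injective_mod I.
Proof.
move=> [J [i [r ir]]] U V j f jinj.
have ex k : exists h : {linear V -> DA}, forall u, h (j u) = i k (f u).
  exact: (dual_injective (lin_comp (i k) f) jinj).
have [h hP] := choice ex.
exists (\sum_k lin_comp (r k) (h k)) => u; rewrite lin_sumE -[RHS]ir.
by apply: eq_bigr => k _; rewrite /= hP.
Qed.
Lemma summand_injective_xv n I X : summand DA I -> xv n X I.
Proof. by move=> /summand_injective; exact: injective_xv. Qed.
End Injectives.

Section CorepUniq.
Variables (K : fieldType) (A : kalgType K).
Variables (Y I0 I1 I2 X : lmodType A).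
Variables (i0 : {linear Y -> I0}) (i1 : {linear I0 -> I1}) (q : {linear I1 -> I2}).
Hypothesis i0_inj : injective i0.
Hypothesis i1_ker : forall v, i1 v = 0 <-> exists u, v = i0 u.
Hypothesis q_ker : forall v, q v = 0 <-> exists u, v = i1 u.
Lemma Corep_uniq (x x' : Ext X Y 2) chi :
  Corep i0 i1 q x chi -> Corep i0 i1 q x' chi -> x = x'.
Proof.
move=> cx cx'; apply/eqP; rewrite -subr_eq0; apply/eqP.
apply: (Corep_lift_eq0 i0_inj i1_ker q_ker (h' := 0) (CorepB cx cx')) => y.
by rewrite subrr linear0.
Qed.
End CorepUniq.

Section AprSequence.
Variables (K : fieldType) (A : kalgType K).
Hypothesis fdA : findim (kspace A).
Local Notation DA := (dual_mod A).
Local Notation homDA := (homB (dual_bim A)).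
Hypothesis gl : forall X Y : lmodType A, xv 2 X Y.
Variables (P I0 I1 I2 : lmodType A).
Variables (i0 : {linear P -> I0}) (i1 : {linear I0 -> I1}) (q : {linear I1 -> I2}).
Hypothesis i0_inj : injective i0.
Hypothesis i1_ker : forall v, i1 v = 0 <-> exists u, v = i0 u.
Hypothesis q_ker : forall v, q v = 0 <-> exists u, v = i1 u.
Hypothesis q_surj : surj q.
Hypothesis sI0 : summand DA I0.
Hypothesis sI1 : summand DA I1.
Hypothesis sI2 : summand DA I2.
Hypothesis P_proj : projective_mod P.
Hypothesis homP0 : forall h : {linear DA -> P}, h = 0.
Hypothesis xDAP : xv 0 DA P.
Let ex_i : exact2 i0 i1 q. Proof. by split. Qed.
Local Notation d0 := (homB_map (dual_bim A) i1).
Local Notation d1 := (homB_map (dual_bim A) q).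
Let i10 x : i1 (i0 x) = 0. Proof. by apply/i1_ker; exists x. Qed.
Let qi1 x : q (i1 x) = 0. Proof. by apply/q_ker; exists x. Qed.
Variable c : Ext I2 P 2.
Hypothesis cE : Corep i0 i1 q c idfun.
Local Notation Z := (tau2 P).
(** The class [c] is corepresented by the identity of I2, so it is the class of the coresolution
    itself; [varpi] is the connecting map from Hom(DA, I2) to Ext^2(DA, P). *)
Definition varpi : {linear homDA I2 -> Z} := nak_map c.
Lemma varpi_Corep chi : Corep i0 i1 q (varpi chi) (hb_fun chi).
Proof. exact: (Corep_map (hb_fun chi) cE). Qed.
(** Applying Hom(DA, -) to the injective coresolution of P computes Ext^i(DA, P), which vanishes for
    i = 0 and i = 1 and is tau P for i = 2. *)
Lemma apr_exact : exact2 d0 d1 varpi.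
Proof.
split.
- move=> x; have [chi xchi] := @Corep_of_class _ _ _ _ _ _ _ i0 i1 q i1_ker q_ker x
    (summand_injective_xv sI0) (summand_injective_xv sI1).
  exists (chi : homDA I2); apply: (Corep_uniq i0_inj i1_ker q_ker (varpi_Corep _) xchi).
- move=> chi; split=> [v0|[w ->]].
    have := varpi_Corep chi; rewrite v0 => /(Corep0_lift i1_ker q_ker (summand_injective_xv sI0)).
    by move=> [h hE]; exists (h : homDA I1); apply: hb_ext => t; rewrite hE.
  apply: (Corep_lift_eq0 i0_inj i1_ker q_ker (h' := hb_fun w) (varpi_Corep _)) => y.
  exact: homB_mapE.
- move=> chi; split=> [v0|[w ->]]; last by apply: hb_ext => t; exact: qi1.
  have [z|h hE] := lin_factor_inj (@sm_incl_inj _ _ (imsm i1)) (g := hb_fun chi).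
    have /q_ker[u ue] : q (hb_fun chi z) = 0.
      exact: (congr1 (fun h : homDA I2 => hb_fun h z) v0).
    by exists (im_corestr i1 u).
  have [h' h'E] := xvr_lift (exact2_top ex_i) h xDAP.
  exists (h' : homDA I0); apply: hb_ext => t; rewrite homB_mapE -hE -h'E //.
- move=> x y e; apply/eqP; rewrite -subr_eq0; apply/eqP.
  have e' t : i1 (hb_fun (x - y) t) = 0.
    have := congr1 (fun h : homDA I1 => hb_fun h t) e.
    rewrite !homB_mapE => e2; rewrite [hb_fun _ _](_ : _ = hb_fun x t - hb_fun y t) //.
    by rewrite linearB e2 subrr.
  have [z|h hE] := lin_factor_inj i0_inj (g := hb_fun (x - y)).
    by apply/i1_ker.
  by apply: hb_ext => t; rewrite -hE (homP0 h) linear0.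
Qed.
(** Through [nak_map] the claim is that Ext^2(I1, W) -> Ext^2(I0, W) is onto. The obstructions lie
    in Ext^2(P, W), zero as P is projective, and in Ext^3(I2, W), zero by the global dimension. *)
Lemma lift1_tau W : lift1 d0 (tau2 W).
Proof.
move=> u; have [J [i [r ir]]] := sI0; have [x0 ->] := nak_map_surj fdA ir u.
have [|x' x'E] := Ext_restrict_ker (exact2_top ex_i) (x := x0).
  exact: (iffLR (@xvP K A P W 1) (projective_xv P_proj)).
have [x1 x1E] := Ext_restrict_surj (exact2_bottom ex_i) x' (@gl I2 W).
exists (nak_map x1) => chi; rewrite !nak_mapE -x'E -x1E !Ext_map_comp.
by apply: (congr2 (fun b g => Ext_map b g x1)); exact: linear_ext.
Qed.
(** Through [nak_map] the claim is exactness of Ext^2(I2, W) -> Ext^2(I1, W) -> Ext^2(I0, W) in the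
    middle, which follows from Ext^1(P, W) = 0. *)
Lemma lift2_tau W : lift2 d0 d1 (tau2 W).
Proof.
move=> u ud0; have [J [i [r ir]]] := sI1; have [x1 ux1] := nak_map_surj fdA ir u.
have [J0 [j0 [r0 ir0]]] := sI0.
have e : Ext_map i1 idfun x1 = 0.
  apply: (nak_map_inj ir0) => chi; rewrite -[RHS](ud0 chi) ux1 !nak_mapE Ext_map_comp.
  by apply: (congr2 (fun b g => Ext_map b g x1)); exact: linear_ext.
have [|x2 x2E] := Ext_restrict_ker (exact2_bottom ex_i) (x := x1).
  apply: (Ext_pull_inj (exact2_top ex_i)); first exact: projective_xv.
  rewrite -[RHS]e Ext_map_comp.
  by apply: (congr2 (fun b g => Ext_map b g x1)); exact: linear_ext.
exists (nak_map x2) => chi; rewrite ux1 !nak_mapE -x2E !Ext_map_comp.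
by apply: (congr2 (fun b g => Ext_map b g x2)); exact: linear_ext.
Qed.

Section RegularTargets.
Variable f : A.
Hypothesis ff : f * f = f.
Hypothesis fP : forall x : P, f *: x = 0.
Lemma princ_val (x : princ f) : (val x : A) * f = val x.
Proof. by have /asboolP[y ->] := valP x; rewrite -mulrA ff. Qed.
Lemma princ_lift (X : lmodType A) (u : {linear X -> A^o}) :
  (forall x, (u x : A) * f = u x) -> exists u' : {linear X -> princ f}, forall x, val (u' x) = u x.
Proof.
move=> uf; pose v : {linear princ f -> A^o} := val.
have vi : injective v by exact: val_inj.
have [x|h hE] := lin_factor_inj vi (g := u); last by exists h.
have p : (u x : A^o) \in princ_mem f by apply/asboolP; exists (u x); rewrite uf.
by exists (exist (fun a : A^o => a \in princ_mem f) _ p).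
Qed.
Let fmap_linear (I : lmodType A) :
  linear ((fun x : restr_scal I => f *: (x : I)) : restr_scal I -> restr_scal I).
Proof. by move=> k x y; rewrite scalerDr scalerA -scalC -scalerA. Qed.
Let fmap I := mklin (@fmap_linear I).
Lemma princ_functional (I : lmodType A) (u : {linear homDA I -> princ f}) :
  summand DA I -> exists mu : {linear restr_scal I -> K^o},
  (forall x, mu (f *: (x : I)) = mu x) /\
  forall chi g, dual_fun g (val (u chi)) = mu (hb_fun chi g).
Proof.
move=> [J [i [r ir]]]; pose v : {linear princ f -> A^o} := val.
have [mu muE] := nak_functional fdA ir (lin_comp v u).
exists mu; split=> // x.
suff -> : mu = lin_comp mu (fmap I) by rewrite /= scalerA ff.
apply: (functional_ext ir) => chi g; rewrite -muE /= -linearZ_LR -[RHS]muE.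
by rewrite dual_scaleE princ_val.
Qed.
Lemma functional_princ (I : lmodType A) (mu : {linear restr_scal I -> K^o}) :
  summand DA I -> (forall x, mu (f *: (x : I)) = mu x) ->
  exists u : {linear homDA I -> princ f},
  forall chi g, dual_fun g (val (u chi)) = mu (hb_fun chi g).
Proof.
move=> [J [i [r ir]]] muf; have [u uE] := functional_nak fdA mu.
have [|u' u'E] := princ_lift (u := u).
  move=> chi; apply/eqP; rewrite -subr_eq0; apply/eqP; apply: (dual_separates fdA) => g.
  by rewrite dual_funB -dual_scaleE !uE linearZ_LR muf subrr.
by exists u' => chi g; rewrite u'E.
Qed.
Let homDA_ext (I : lmodType A) (u u' : {linear homDA I -> princ f}) :
  (forall chi g, dual_fun g (val (u chi)) = dual_fun g (val (u' chi))) -> u =1 u'.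
Proof.
move=> h chi; apply: val_inj; apply/eqP; rewrite -subr_eq0; apply/eqP.
by apply: (dual_separates fdA) => g; rewrite dual_funB h subrr.
Qed.
(** Maps from Hom(DA, I) to A f are functionals on f I. As f P = 0, the map f I0 -> f I1 is
    injective, and functionals extend along it. *)
Lemma lift1_princ : lift1 d0 (princ f).
Proof.
move=> u; have [mu [muf muE]] := princ_functional u sI0.
have [r rP'] := kginv (restr_map i1); have rP x : i1 (r (i1 x)) = i1 x := rP' x.
have ri x : mu (r (i1 x)) = mu x.
  apply: subr0_eq; rewrite -[LHS](linearB mu) -muf.
  have /i1_ker[p ->] : i1 (r (i1 x) - x : I0) = 0 by rewrite linearB rP subrr.
  by rewrite -linearZ_LR fP !linear0.
have [|u1 u1E] := @functional_princ I1 (lin_comp mu (lin_comp r (fmap I1))) sI1.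
  by move=> x /=; rewrite scalerA ff.
exists u1; apply: (@homDA_ext I0 (lin_comp u1 d0) u) => chi g.
by rewrite muE [LHS]u1E /= -linearZ_LR ri muf.
Qed.
Lemma lift2_princ : lift2 d0 d1 (princ f).
Proof.
move=> u ud0; have [mu [muf muE]] := princ_functional u sI1.
have [r rP'] := kginv (restr_map q); have rP x : q (r (q x)) = q x := rP' x.
have mui : lin_comp mu (restr_map i1) = 0.
  have [J [i [s js]]] := sI0; apply: (functional_ext js) => chi g.
  by rewrite /= -[i1 _]homB_mapE -muE ud0; exact: (linear0 g).
have ri x : mu (r (q x)) = mu x.
  apply: subr0_eq; rewrite -[LHS](linearB mu).
  have /q_ker[p ->] : q (r (q x) - x : I1) = 0 by rewrite linearB rP subrr.
  exact: (congr1 (fun m : {linear restr_scal I0 -> K^o} => m p) mui).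
have [|u2 u2E] := @functional_princ I2 (lin_comp mu (lin_comp r (fmap I2))) sI2.
  by move=> x /=; rewrite scalerA ff.
exists u2; apply: (@homDA_ext I1 (lin_comp u2 d1) u) => chi g.
by rewrite muE [LHS]u2E /= -linearZ_LR ri muf.
Qed.
End RegularTargets.
(** A map tau P -> A amounts to a functional on I2 that vanishes on the image of I1, and q is
    onto. *)
Lemma hom_tau_regular (h : {linear Z -> A^o}) : h = 0.
Proof.
have [J [i [r ir]]] := sI2; have [J1 [j1 [r1 ir1]]] := sI1.
have [mu muE] := nak_functional fdA ir (lin_comp h varpi).
have [vs vk _ _] := apr_exact.
have hv chi : h (varpi (d1 chi)) = 0.
  by rewrite (_ : varpi (d1 chi) = 0) ?linear0 //; apply/vk; exists chi.
have mq : lin_comp mu (restr_map q) = 0.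
  apply: (functional_ext ir1) => chi g; rewrite /= -[q _]homB_mapE -muE.
  exact: etrans (congr1 (dual_fun g) (hv chi)) (linear0 g).
apply: linear_ext => z; have [chi <-] := vs z.
apply: (dual_separates fdA) => g; rewrite [LHS]muE.
have [y <-] := q_surj (hb_fun chi g).
exact: (congr1 (fun m : {linear restr_scal I1 -> K^o} => m y) mq).
Qed.
Lemma hom_coresolution (rho : {linear P -> P}) : exists (h0 : {linear I0 -> I0})
    (h1 : {linear I1 -> I1}) (h2 : {linear I2 -> I2}),
  [/\ forall x, i0 (rho x) = h0 (i0 x), forall x, i1 (h0 x) = h1 (i1 x) &
      forall x, q (h1 x) = h2 (q x)].
Proof.
have [h0 e0] := summand_injective sI0 (lin_comp i0 rho) i0_inj.
have [x|g gE] := lin_factor_surj (@im_corestr_surj _ _ _ i1) (g := lin_comp i1 h0).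
  move/im_corestr_eq0/i1_ker => [y ->]; rewrite /= e0; exact: i10.
have [h1 e1] := summand_injective sI1 g (@sm_incl_inj _ _ (imsm i1)).
have e1' x : h1 (i1 x) = i1 (h0 x) by rewrite -[RHS]gE -e1.
have [x|h2 e2] := lin_factor_surj q_surj (g := lin_comp q h1).
  by move/q_ker => [y ->]; rewrite /= e1' qi1.
by exists h0, h1, h2; split=> x; rewrite ?e0 ?e1' ?e2.
Qed.
Lemma varpi_natural (rho : {linear P -> P}) (h0 : {linear I0 -> I0})
    (h1 : {linear I1 -> I1}) (h2 : {linear I2 -> I2}) chi :
  (forall x, i0 (rho x) = h0 (i0 x)) -> (forall x, i1 (h0 x) = h1 (i1 x)) ->
  (forall x, q (h1 x) = h2 (q x)) ->
  varpi (homB_map (dual_bim A) h2 chi) = tau2_map rho (varpi chi).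
Proof.
move=> e0 e1 e2; apply: (Corep_uniq i0_inj i1_ker q_ker (varpi_Corep _)).
exact: (Corep_mapr e0 e1 e2 (varpi_Corep chi)).
Qed.
(** The composite of h and [varpi] is a class in Ext^2(I2, P) killed by q. Its corepresenting map I2
    -> I2 therefore lifts back along the coresolution, step by step down to an endomorphism rho of
    P, and the class is the image of [c] under rho. *)
Lemma tau_end (h : {linear Z -> Z}) : exists rho : {linear P -> P}, h = tau2_map rho.
Proof.
have [J [i [r ir]]] := sI2; have [J1 [j1 [r1 ir1]]] := sI1.
have [vs vk _ _] := apr_exact.
have [x2 hx2] := nak_map_surj fdA ir (lin_comp h varpi).
have qx : Ext_map q idfun x2 = 0.
  apply: (nak_map_inj ir1) => chi.
  have e : h (varpi (d1 chi)) = 0.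
    by rewrite (_ : varpi (d1 chi) = 0) ?linear0 //; apply/vk; exists chi.
  rewrite -[RHS]e -[h _]/(lin_comp h varpi (d1 chi)) hx2 !nak_mapE Ext_map_comp.
  by apply: (congr2 (fun b g => Ext_map b g x2)); exact: linear_ext.
have [chi xchi] := @Corep_of_class _ _ _ _ _ _ _ i0 i1 q i1_ker q_ker x2
    (summand_injective_xv sI0) (summand_injective_xv sI1).
have := Corep_map q xchi; rewrite qx.
move=> /(Corep0_lift i1_ker q_ker (summand_injective_xv sI0))[h1 h1E].
have [x|g gE] := lin_factor_inj (@sm_incl_inj _ _ (imsm i1)) (g := lin_comp h1 i1).
  have /q_ker[u ue] : q (h1 (i1 x)) = 0 by rewrite -h1E qi1 linear0.
  by exists (im_corestr i1 u).
have [h0 h0E] := xvr_lift (exact2_top ex_i) g (summand_xvl sI0 xDAP).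
have e1 x : i1 (h0 x) = h1 (i1 x) by rewrite -[RHS]gE -h0E.
have [x|rho rhoE] := lin_factor_inj i0_inj (g := lin_comp h0 i0).
  by apply/i1_ker; rewrite /= e1 i10 linear0.
have x2E : x2 = Ext_map idfun rho c.
  apply: (Corep_uniq i0_inj i1_ker q_ker xchi).
  exact: (Corep_mapr rhoE e1 (fun x => esym (h1E x)) cE).
exists rho; apply: linear_ext => z; have [v <-] := vs z.
rewrite -[LHS]/(lin_comp h varpi v) hx2 nak_mapE x2E.
rewrite -[RHS]/(Ext_map (idfun : {linear DA -> DA}) rho (Ext_map (hb_fun v) idfun c)) !Ext_map_comp.
by apply: (congr2 (fun b g => Ext_map b g c)); exact: linear_ext.
Qed.
(** The corepresenting map w is determined up to maps q h, and the trace of q h [varpi] equals that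
    of h [varpi] [d1], which is zero. *)
Lemma Tr_exists (J : finType) (i : J -> {linear I2 -> DA})
    (r : J -> {linear DA -> I2}) :
  (forall x, \sum_k r k (i k x) = x) -> exists Tr : Ext Z P 2 -> K,
  forall x (w : {linear Z -> I2}), Corep i0 i1 q x w ->
    Tr x = nak_trace i r (fun v => w (varpi v)).
Proof.
move=> ir; have [J1 [j1 [r1 ir1]]] := sI1; have [_ vk _ _] := apr_exact.
have uniq x (w w' : {linear Z -> I2}) : Corep i0 i1 q x w -> Corep i0 i1 q x w' ->
    nak_trace i r (fun v => w (varpi v)) = nak_trace i r (fun v => w' (varpi v)).
  move=> cw cw'; have := CorepB cw cw'; rewrite subrr.
  move=> /(Corep0_lift i1_ker q_ker (summand_injective_xv sI0))[h hE].
  apply/eqP; rewrite -subr_eq0; apply/eqP; rewrite -sumrB.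
  transitivity (nak_trace i r (fun v => q (lin_comp h varpi v))).
    by apply: eq_bigr => k _; rewrite /= -hE linearB.
  rewrite (nak_trace_comp fdA _ _ ir1 ir) /nak_trace big1 // => k _.
  have e : h (varpi (d1 (r1 k : homDA I1))) = 0.
    by rewrite (_ : varpi _ = 0) ?linear0 //; apply/vk; exists (r1 k : homDA I1).
  exact: etrans (congr1 (fun y => dual_fun (j1 k y) 1) e)
    (congr1 (fun y : DA => dual_fun y 1) (linear0 (j1 k))).
have ex x : exists w : {linear Z -> I2}, Corep i0 i1 q x w.
  exact: (Corep_of_class i1_ker q_ker x (summand_injective_xv sI0) (summand_injective_xv sI1)).
have [W WP] := choice ex.
by exists (fun x => nak_trace i r (fun v => W x (varpi v))) => x w; exact: uniq.
Qed.
End AprSequence.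

Section FiniteDimensionModules.
Variables (K : fieldType) (A : kalgType K).
Lemma findim_fin (V : lmodType K) (I : finType) (v : I -> V) :
  (forall x, exists c : I -> K, x = \sum_i c i *: v i) -> findim V.
Proof.
move=> h; exists #|I|, (fun i => v (enum_val i)) => x; have [c ->] := h x.
exists (fun i => c (enum_val i)).
by rewrite (reindex (@enum_val I predT)) //=; apply: onW_bij; exact: enum_val_bij.
Qed.
Lemma summand_findim (T X : lmodType A) : summand T X -> findim (restr_scal T) ->
  findim (restr_scal X).
Proof.
move=> [I [i [r ir]]] [n [v vspan]].
refine (@findim_fin (restr_scal X) (I * 'I_n)%type (fun p => r p.1 (v p.2)) _) => x.
have [c cE] := choice (fun k => vspan (i k x)); exists (fun p => c p.1 p.2).
rewrite -(pair_big predT predT (fun a b => c a b *: (r a (v b) : restr_scal X))) /=.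
rewrite -[LHS](ir x); apply: eq_bigr => k _; rewrite [i k x]cE.
rewrite [LHS](linear_sum (restr_map (r k))); apply: eq_bigr => j _.
exact: (linearZ_LR (restr_map (r k))).
Qed.
End FiniteDimensionModules.

Section DualCorner.
Variables (K : fieldType) (A : kalgType K).
Local Notation DA := (dual_mod A).
Local Notation homDA := (homB (dual_bim A)).
Variable c : A.
Hypothesis cc : c * c = c.
Lemma dcorner0 : dual_ract c (0 : DA) = 0. Proof. exact: linear0. Qed.
Lemma dcornerP (a : A) (x y : DA) : dual_ract c x = x -> dual_ract c y = y ->
  dual_ract c (a *: x + y) = a *: x + y.
Proof.
move=> cx cy; exact: etrans (linearP (dual_ract c : {linear DA -> DA}) a x y)
  (congr2 (fun u v => a *: u + v) cx cy).
Qed.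
Definition dcorner_sub : submodule DA :=
  @Submodule A DA (fun x => dual_ract c x = x) dcorner0 dcornerP.
(** The elements of DA fixed by c on the right, that is, the dual D(cA) of the right module c A. *)
Definition dcorner : lmodType A := smod dcorner_sub.
Lemma dcornerE (x : dcorner) : dual_ract c (val x) = val x.
Proof. exact: (smodP x). Qed.
Definition dcorner_ret : {linear DA -> dcorner} :=
  @sm_corestr _ _ dcorner_sub _ (dual_ract c : {linear DA -> DA})
    (fun u => etrans (esym (dual_ractM c c u)) (congr1 (fun b => dual_ract b u) cc)).
Lemma dcorner_retK x : dcorner_ret (val x) = x.
Proof. by apply: val_inj; exact: dcornerE. Qed.
Lemma summand_dcorner : summand DA dcorner.
Proof.
apply: (summand_retract (i := @sm_incl _ _ dcorner_sub) (r := dcorner_ret)).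
  exact: dcorner_retK.
exact: summand_self.
Qed.
Hypothesis fdA : findim (kspace A).
Lemma homDA_dcorner : exists g : {linear princ c -> homDA dcorner}, injective g /\ surj g.
Proof.
have pc (x : princ c) : (val x : A) * c = val x.
  by have /asboolP[y ->] := valP x; rewrite -mulrA cc.
have ml (x : princ c) (phi : DA) : dual_ract c (dual_ract (val x) phi) = dual_ract (val x) phi.
  by rewrite -dual_ractM pc.
pose g (x : princ c) : homDA dcorner :=
  @sm_corestr _ _ dcorner_sub _ (dual_ract (val x) : {linear DA -> DA}) (ml x).
have gl : linear g.
  move=> a x y; apply: hb_ext => f; apply: val_inj; rewrite hb_addE hb_scaleE.
  by rewrite -[LHS]/(dual_ract (a * val x + val y) f) dual_ractD dual_ractM.
exists (mklin gl); split=> [x y e|chi].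
  apply: val_inj; apply: (dual_ract_inj fdA) => f.
  exact: (congr1 (fun h : homDA dcorner => val (hb_fun h f)) e).
have [a aE] := dual_end fdA (lin_comp (@sm_incl _ _ dcorner_sub) (hb_fun chi)).
have ac : a = a * c.
  apply: (dual_ract_inj fdA) => f; rewrite dual_ractM -aE.
  by rewrite /= dcornerE.
have ap : (a : A^o) \in princ_mem c by apply/asboolP; exists a.
exists (exist (fun a : A^o => a \in princ_mem c) (a : A^o) ap : princ c).
by apply: hb_ext => f; apply: val_inj; rewrite [RHS]aE.
Qed.
End DualCorner.
(** All that is used later about P: the sequence from P to tau P through P1 and P2 in add A(1 - e),
    the exactness of Hom out of it, the maps out of tau P, and the linear form on Ext^2(tau P, P).
    [ad_Tr_pt] makes the form nondegenerate, [ad_Tr_tau] makes it a trace. *)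
Record apr_data (K : fieldType) (A : kalgType K) (e : A) := AprData {
  ad_P1 : lmodType A; ad_P2 : lmodType A;
  ad_dP : {linear princ e -> ad_P1};
  ad_d1 : {linear ad_P1 -> ad_P2};
  ad_vp : {linear ad_P2 -> tau2 (princ e)};
  ad_exact : exact2 ad_dP ad_d1 ad_vp;
  ad_s1 : summand (princ (1 - e)) ad_P1;
  ad_s2 : summand (princ (1 - e)) ad_P2;
  ad_l1tau : forall W, lift1 ad_dP (tau2 W);
  ad_l2tau : forall W, lift2 ad_dP ad_d1 (tau2 W);
  ad_l1f : lift1 ad_dP (princ (1 - e));
  ad_l2f : lift2 ad_dP ad_d1 (princ (1 - e));
  ad_homA : forall h : {linear tau2 (princ e) -> A^o}, h = 0;
  ad_end : forall h : {linear tau2 (princ e) -> tau2 (princ e)},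
    exists rho, h = tau2_map rho;
  ad_Tr : Ext (tau2 (princ e)) (princ e) 2 -> K;
  ad_TrB : forall x y, ad_Tr (x - y) = ad_Tr x - ad_Tr y;
  ad_TrZ : forall k x, ad_Tr (Ext_map idfun (scal_map (princ e) k) x) = k * ad_Tr x;
  ad_Tr_pt : forall (phi : {linear tau2 (princ e) -> dual_mod A}) l,
    ad_Tr (Ext_map phi idfun l) = dual_fun (phi l) 1;
  ad_Tr_tau : forall rho x,
    ad_Tr (Ext_map (tau2_map rho) idfun x) = ad_Tr (Ext_map idfun rho x)
}.

Section AprData.
Variables (K : fieldType) (A : kalgType K).
Hypothesis fdA : findim (kspace A).
Local Notation DA := (dual_mod A).
Local Notation homDA := (homB (dual_bim A)).
Hypothesis gl : forall X Y : lmodType A, xv 2 X Y.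
Variable e : A.
Local Notation f := (1 - e).
Hypothesis ee : e * e = e.
Hypothesis e0 : e <> 0.
Hypothesis fe0 : forall a : A, a * e = e * a * e.
Hypothesis inv : forall x, e * x * e = x -> x <> 0 -> exists y, x * y = e /\ y * x = e.
Hypothesis homP0 : forall h : {linear DA -> princ e}, h = 0.
Hypothesis xDAP : xv 0 DA (princ e).
Local Notation P := (princ e).
Let ff : f * f = f.
Proof. by rewrite mulrBr mulr1 mulrBl mul1r ee subrr subr0. Qed.
Let fae a : f * a * e = 0.
Proof. by rewrite mulrBl mul1r mulrBl -fe0 subrr. Qed.
Let pe (x : P) : (val x : A) * e = val x.
Proof. by have /asboolP[y ->] := valP x; rewrite -mulrA ee. Qed.
Let epe (x : P) : e * (val x : A) = val x.
Proof. by rewrite -{2}pe fe0 -mulrA pe. Qed.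
Lemma dcorner_f_act (x : dcorner f) : f *: x = x.
Proof.
apply: val_inj; apply: dual_ext => y; rewrite dual_scaleE.
rewrite -[val x in LHS]dcornerE -[val x in RHS]dcornerE !dual_ract_fun.
by rewrite mulrA mulrBr mulr1 fae subr0.
Qed.
Lemma corner_functional : exists u : DA,
  (forall y, dual_fun u (e * y * e) = dual_fun u y) /\ dual_fun u e <> 0.
Proof.
have [[g ge]|ng] := pselect (exists g : DA, dual_fun g e <> 0).
  exists (dual_ract e (e *: g)); split=> [y|].
    by rewrite !dual_ract_fun !dual_scaleE -!mulrA ee !mulrA ee.
  by rewrite dual_ract_fun dual_scaleE !ee.
case: e0; apply: (dual_separates fdA) => g.
by have [//|h] := pselect (dual_fun g e = 0); case: ng; exists g.
Qed.
(** P embeds into D(eA) through a nonzero form u on the division algebra e A e. The cokernel is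
    detected by maps into D(fA), and the vanishing of Ext^3(-, P) makes the third term injective. *)
Lemma coresolution : exists (I0 I1 I2 : lmodType A) (i0 : {linear P -> I0})
    (i1 : {linear I0 -> I1}) (q : {linear I1 -> I2}) (J1 J2 : finType)
    (a1 : J1 -> {linear I1 -> DA}) (b1 : J1 -> {linear DA -> I1})
    (a2 : J2 -> {linear I2 -> DA}) (b2 : J2 -> {linear DA -> I2})
    (kap : {linear P -> homDA I0}),
  [/\ [/\ injective i0, forall v, i1 v = 0 <-> exists u, v = i0 u,
          forall v, q v = 0 <-> exists u, v = i1 u & surj q],
      summand DA I0,
      (forall x, \sum_k b1 k (a1 k x) = x) /\ (forall k x, dual_ract f (a1 k x) = a1 k x),
      (forall x, \sum_k b2 k (a2 k x) = x) /\ (forall k x, dual_ract f (a2 k x) = a2 k x)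
    & injective kap /\ surj kap].
Proof.
have [u [uc ue]] := corner_functional.
have u0 : u <> 0 by move=> h; apply: ue; rewrite h.
have uf (a : A) : dual_fun u (e * a) = dual_fun u a /\ dual_fun u (a * e) = dual_fun u a.
  by rewrite -[dual_fun u (e * a)]uc -[dual_fun u (a * e)]uc -!mulrA ee !mulrA ee !uc.
have i0s (x : P) : dual_ract e ((val x : A) *: u) = (val x : A) *: u.
  apply: dual_ext => y; rewrite dual_ract_fun !dual_scaleE -mulrA.
  exact: (uf _).1.
have i0l : linear ((fun x => smk (S := dcorner_sub e) (i0s x)) : P -> dcorner e).
  move=> a x y; apply: val_inj; rewrite /= scalerDl scalerA //.
pose i0 : {linear P -> dcorner e} := mklin i0l.
have [n [v [a va]]] := findim_dual_basis fdA.
have i1s k (x : DA) : dual_ract f (dual_ract (e * (v k : A) * f) x) =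
    dual_ract (e * (v k : A) * f) x.
  by rewrite -dual_ractM -!mulrA ff.
(* For the spanning family v_k, the functionals y |-> x (e v_k f y) together detect the restriction
   of x to e A f A. *)
pose i1k k : {linear dcorner e -> dcorner f} :=
  lin_comp (@sm_corestr _ _ (dcorner_sub f) _ (dual_ract (e * (v k : A) * f) : {linear DA -> DA}) (i1s k))
    (@sm_incl _ _ (dcorner_sub e)).
pose I1 : lmodType A := dprod (fun _ : 'I_n => dcorner f).
pose i1 : {linear dcorner e -> I1} := dp_pair i1k.
have I1f (x : I1) : f *: x = x by apply: dprodP => k; exact: dcorner_f_act.
have i1_ker x : i1 x = 0 <-> exists y, x = i0 y.
  split=> [i1x|[y ->]].
    have xk (b y : A) : dual_fun (val x) (e * b * f * y) = 0.
      have bE : b = \sum_(j < n) (scal (a j b : K) : A) * (v j : A) := va b.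
      rewrite bE mulr_sumr !mulr_suml dual_funS big1 // => j _.
      have := congr1 (fun z : I1 => dual_fun (val (z j)) y) i1x.
      rewrite -[LHS]/(dual_fun (val x) (e * (v j : A) * f * y)) -[RHS]/(0 : K) => h.
      by rewrite mulrA -scalC -!mulrA dual_funZ !mulrA h scaler0.
    have xe (y : A) : dual_fun (val x) (e * y) = dual_fun (val x) y.
      by rewrite -dual_ract_fun dcornerE.
    have xc (y : A) : dual_fun (val x) (e * y * e) = dual_fun (val x) y.
      have yE : e * y = e * y * e + e * y * f * 1.
        by rewrite mulr1 -mulrDr addrC subrK mulr1.
      by rewrite -(xe y) [in RHS]yE dual_funD xk addr0.
    have inv' z : e * z * e = z -> z <> 0 -> exists y, z * y = e.
      by move=> ez z0; have [y [zy _]] := inv ez z0; exists y.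
    (* A functional killed by [i1] lives on the corner e A e, where every functional is a multiple
       of u. *)
    have [z zE] := corner_form fdA inv' ee uc u0 xc.
    have zp : (e * z * e : A^o) \in princ_mem e by apply/asboolP; exists (e * z).
    exists (exist (fun a : A^o => a \in princ_mem e) _ zp : princ e).
    by apply: val_inj; apply: dual_ext => y; rewrite zE.
  apply: dprodP => k; apply: val_inj; apply: dual_ext => z.
  rewrite [LHS]dual_ract_fun dual_scaleE -mulrA -[val y]pe mulrA -!mulrA.
  by rewrite (mulrA z) (mulrA f) fae !mulr0; exact: (linear0 u).
have fdI1 : findim (restr_scal I1).
  apply: (summand_findim (T := dcorner f)); first exact: summand_power.
  by apply: (summand_findim (summand_dcorner ff)); exact: dual_findim.
(* The cokernel of [i1] embeds into a power of DA; I2 is taken to be its image there. *)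
have [J2 [h hP]] := cogenerator (imsm i1) fdI1.
pose DJ : lmodType A := dprod (fun _ : J2 => DA).
pose kp : {linear I1 -> DJ} := dp_pair h.
pose I2 : lmodType A := smod (imsm kp).
pose q : {linear I1 -> I2} := im_corestr kp.
have q_ker x : q x = 0 <-> exists y, x = i1 y.
  rewrite im_corestr_eq0; apply: (iff_trans _ (hP x)); split=> [kx i|kx].
    exact: (congr1 (fun z : DJ => z i) kx).
  by apply: dprodP => i; exact: kx.
have q_surj : surj q by exact: im_corestr_surj.
have i0_inj : injective i0.
  move=> x y /(congr1 val) /= xy; apply: val_inj; apply: subr0_eq.
  have [//|nz] := pselect ((val x : A) - val y = 0).
  have [|z [_ zx]] := inv _ nz; first by rewrite mulrBr mulrBl !epe !pe.
  case: ue; rewrite -zx -dual_scaleE scalerBl xy subrr; exact: dual_fun0.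
have ex : exact2 i0 i1 q by split.
have P_proj : projective_mod P.
  apply: xv_projective => Y; apply: (@summand_xvl _ _ 0 (A^o : lmodType A)); last exact: xv_regular.
  pose inc : {linear P -> A^o} := val.
  have rl : linear ((fun x : A^o => ((x : A) * e : A^o)) : A^o -> A^o).
    by move=> b x y; rewrite mulrDl -mulrA.
  have [x|r rE] := lin_factor_inj (i := inc) val_inj (g := mklin rl).
    have p : ((x : A) * e : A^o) \in princ_mem e by apply/asboolP; exists (x : A).
    by exists (exist (fun a : A^o => a \in princ_mem e) _ p).
  apply: (summand_retract (i := inc) (r := r)); last exact: summand_self.
  by move=> x; apply: val_inj; apply: etrans (rE _) (pe x).
have sI0 := summand_dcorner ee.
have sI1 : summand DA I1.
  by apply: (summand_trans (summand_dcorner ff)); exact: summand_power.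
(* Two dimension shifts reduce Ext^1(-, I2) to Ext^3(-, P) = 0, so the inclusion of I2 into the
   power of DA splits. *)
have xI2 X : xv 0 X I2.
  apply: (xvr_quo (exact2_bottom ex)); first exact: summand_injective_xv sI1.
  apply: (xvr_quo (exact2_top ex)); last exact: gl.
  exact: summand_injective_xv sI0.
have fdDJ : findim (restr_scal DJ).
  by apply: (summand_findim (T := DA)); [exact: summand_power | exact: dual_findim].
(* The cokernel of I2 in [DJ] is realised as the image of [k3]. *)
have [J3 [h3 h3P]] := cogenerator (imsm kp) fdDJ.
pose k3 : {linear DJ -> dprod (fun _ : J3 => DA)} := dp_pair h3.
have ex3 : short_exact (@sm_incl _ _ (imsm kp)) (im_corestr k3).
  split; [exact: (@sm_incl_inj _ _ (imsm kp)) | exact: im_corestr_surj |].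
  move=> x; rewrite im_corestr_eq0; split=> [k3x|[y ->]].
    have Sx : imsm kp x by apply/h3P => i; exact: (congr1 (fun z => z i) k3x).
    by exists (smk Sx).
  by apply: dprodP => i; exact: (iffRL (h3P _) (smodP y) i).
have [ret retE] := xvl_ext ex3 (idfun : {linear I2 -> I2}) (xI2 _).
have [kap [kapi kaps]] := homDA_dcorner ee fdA.
exists (dcorner e), I1, I2, i0, i1, q, 'I_n, J2.
exists (fun k => lin_comp (@sm_incl _ _ (dcorner_sub f)) (dp_proj _ k)).
exists (fun k => lin_comp (dp_inj _ k) (dcorner_ret ff)).
exists (fun k => lin_comp (dp_proj DA k) (@sm_incl _ _ (imsm kp))).
exists (fun k => lin_comp ret (dp_inj DA k)), kap.
split=> //.
- split=> [x|k x]; last exact: dcornerE.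
  rewrite -[RHS]dp_split; apply: eq_bigr => k _.
  by rewrite -[RHS](congr1 _ (dcorner_retK ff (x k))).
- split=> [x|k x].
    transitivity (ret (\sum_k dp_inj DA k ((val x : DJ) k))).
      by rewrite linear_sum; exact: eq_bigr.
    by rewrite (dp_split (val x : DJ)); exact: retE.
  have [y <-] := q_surj x; apply: dual_ext => z.
  rewrite dual_ract_fun -[in RHS](I1f y) -[LHS]dual_fun1 -[RHS]dual_fun1.
  rewrite -[X in dual_fun X _ = _]/((f * z) *: h k y) -[X in _ = dual_fun X _]/(z *: h k (f *: y)).
  by rewrite -!linearZ_LR -scalerA I1f (I1f y).
Qed.
Lemma apr_data_exists : inhabited (apr_data e).
Proof.
have [I0 [I1 [I2 [i0 [i1 [q [J1 [J2 [a1 [b1 [a2 [b2 [kap H]]]]]]]]]]]]] := coresolution.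
have [[i0_inj i1_ker q_ker q_surj] sI0 [ab1 a1f] [ab2 a2f] [kapi kaps]] := H.
have sI1 : summand DA I1 by exists J1, a1, b1.
have sI2 : summand DA I2 by exists J2, a2, b2.
have P_proj : projective_mod P.
  apply: xv_projective => Y; apply: (@summand_xvl _ _ 0 (A^o : lmodType A)); last exact: xv_regular.
  pose inc : {linear P -> A^o} := val.
  have rl : linear ((fun x : A^o => ((x : A) * e : A^o)) : A^o -> A^o).
    by move=> b x y; rewrite mulrDl -mulrA.
  have [x|r rE] := lin_factor_inj (i := inc) val_inj (g := mklin rl).
    have p : ((x : A) * e : A^o) \in princ_mem e by apply/asboolP; exists (x : A).
    by exists (exist (fun a : A^o => a \in princ_mem e) _ p).
  apply: (summand_retract (i := inc) (r := r)); last exact: summand_self.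
  by move=> x; apply: val_inj; apply: etrans (rE _) (pe x).
have fP (x : P) : f *: x = 0.
  by apply: val_inj; rewrite -[LHS]/(f * (val x : A)) mulrBl mul1r epe subrr.
have [c cE] := Corep_exists i0_inj i1_ker q_ker q_surj (idfun : {linear I2 -> I2}).
have [vs vk d1k d0i] := apr_exact i0_inj i1_ker q_ker q_surj sI0 sI1 homP0 xDAP cE.
have [Tr TrE] := Tr_exists fdA i0_inj i1_ker q_ker q_surj sI0 sI1 homP0 xDAP cE ab2.
(* Hom(DA, D(eA)) is A e, so the sequence of [apr_exact] can be made to start with P itself. *)
have [pak [pakK kapK]] := linear_inverse kapi kaps.
pose d0 : {linear homDA I0 -> homDA I1} := homB_map (dual_bim A) i1.
have exW x : exists w : {linear tau2 P -> I2}, Corep i0 i1 q x w.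
  exact: (Corep_of_class i1_ker q_ker x (summand_injective_xv sI0) (summand_injective_xv sI1)).
have l1 Y : lift1 d0 Y -> lift1 (lin_comp d0 kap) Y.
  move=> h u; have [u1 u1E] := h (lin_comp u pak); exists u1 => x.
  by rewrite [LHS]u1E /= pakK.
have l2 Y : lift2 d0 (homB_map (dual_bim A) q) Y ->
    lift2 (lin_comp d0 kap) (homB_map (dual_bim A) q) Y.
  by move=> h u ud; apply: h => x; rewrite -(kapK x); exact: ud.
constructor; apply: (@AprData K A e (homDA I1) (homDA I2) (lin_comp d0 kap)
  (homB_map (dual_bim A) q) (varpi c) _ _ _ _ _ _ _ _ _ Tr).
- split=> //; last by move=> x y /d0i; exact: kapi.
  move=> w; rewrite d1k; split=> [[k ->]|[k ->]]; last by exists (kap k).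
  by exists (pak k); rewrite /= kapK.
- exact: (homDA_summand fdA ab1).
- exact: (homDA_summand fdA ab2).
- by move=> W; apply: l1; apply: (lift1_tau fdA gl i0_inj i1_ker q_ker q_surj sI0 P_proj).
- by move=> W; apply: l2; apply: (lift2_tau fdA i0_inj i1_ker q_ker q_surj sI0 sI1 P_proj).
- by apply: l1; apply: (lift1_princ fdA i1_ker sI0 sI1 ff fP).
- by apply: l2; apply: (lift2_princ fdA q_ker sI0 sI1 sI2 ff).
- exact: (hom_tau_regular fdA i0_inj i1_ker q_ker q_surj sI0 sI1 sI2 homP0 xDAP cE).
- exact: (tau_end fdA i0_inj i1_ker q_ker q_surj sI0 sI1 sI2 homP0 xDAP cE).
- move=> x y; have [w xw] := exW x; have [w' yw] := exW y.
  rewrite (TrE _ _ xw) (TrE _ _ yw) (TrE _ (w - w') (CorepB xw yw)) -sumrB.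
  by apply: eq_bigr => k _; rewrite -[LHS]/(dual_fun (a2 k (w _ - w' _)) 1) linearB.
- move=> k x; have [w xw] := exW x; rewrite (TrE _ _ xw).
  rewrite (TrE _ (lin_comp (scal_map I2 k) w)).
    rewrite mulr_sumr; apply: eq_bigr => j _.
    by rewrite /= /scal_fun linearZ_LR dual_fun_scal.
  by apply: (Corep_mapr (g0 := scal_map I0 k) (g1 := scal_map I1 k) _ _ _ xw) => y /=;
    rewrite /scal_fun linearZ_LR.
- move=> phi l; have [chi <-] := vs l.
  rewrite (TrE _ (lin_comp (hb_fun chi) phi) (Corep_map phi (varpi_Corep cE chi))).
  exact: (nak_trace_pt fdA ab2 (lin_comp phi (varpi c)) chi).
- move=> rho x; have [w xw] := exW x.
  have [h0 [h1 [h2 [e0' e1' e2']]]] := hom_coresolution i0_inj i1_ker q_ker q_surj sI0 sI1 rho.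
  rewrite (TrE _ (lin_comp w (tau2_map rho)) (Corep_map (tau2_map rho) xw)).
  rewrite (TrE _ (lin_comp h2 w) (Corep_mapr e0' e1' e2' xw)).
  rewrite [RHS](nak_trace_comp fdA h2 (lin_comp w (varpi c)) ab2 ab2).
  apply: eq_bigr => k _; rewrite -[RHS]/(dual_fun (a2 k (w (varpi c (homB_map _ h2 _)))) 1).
  by rewrite (varpi_natural i0_inj i1_ker q_ker cE _ e0' e1' e2').
Qed.
End AprData.

(** * The tilting module *)

Section Principal.
Variables (K : fieldType) (A : kalgType K) (c : A).
Hypothesis cc : c * c = c.
Implicit Types Y : lmodType A.
Definition princ_incl : {linear princ c -> A^o} := val.
Lemma princ_mulc (x : princ c) : (val x : A) * c = val x.
Proof. by have /asboolP[y ->] := valP x; rewrite -mulrA cc. Qed.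
Lemma princ_mem_mul (a : A) : (a * c : A^o) \in princ_mem c.
Proof. by apply/asboolP; exists a. Qed.
Definition princ_of (a : A) : princ c :=
  exist (fun a : A^o => a \in princ_mem c) (a * c : A^o) (princ_mem_mul a).
Definition princ_gen : princ c := princ_of 1.
Lemma val_princ_gen : val princ_gen = c :> A. Proof. exact: mul1r. Qed.
Lemma princ_genE (x : princ c) : x = (val x : A) *: princ_gen.
Proof. by apply: val_inj; rewrite -[RHS]/((val x : A) * (1 * c)) mul1r princ_mulc. Qed.
Lemma princ_ext Y (u v : {linear princ c -> Y}) : u princ_gen = v princ_gen -> u = v.
Proof.
by move=> e; apply: linear_ext => x; rewrite [x]princ_genE !linearZ_LR e.
Qed.
Lemma princ_pt_linear Y (y : Y) : linear (fun x : princ c => (val x : A) *: y).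
Proof. by move=> a u v; rewrite scalerA -scalerDl. Qed.
Definition princ_pt Y (y : Y) : {linear princ c -> Y} := mklin (princ_pt_linear y).
Lemma princ_pt_gen Y (y : Y) : princ_pt y princ_gen = c *: y.
Proof. by rewrite /= mul1r. Qed.
Lemma princ_gen_fix Y (u : {linear princ c -> Y}) : c *: u princ_gen = u princ_gen.
Proof.
rewrite -linearZ_LR; congr (u _); apply: val_inj.
by rewrite -[LHS]/(c * (1 * c)) mul1r cc -[RHS]/(1 * c) mul1r.
Qed.
Lemma princ_projective : projective_mod (princ c).
Proof.
move=> U V g h gs; have [u uE] := gs (h princ_gen); exists (princ_pt u) => x.
by rewrite [x in RHS]princ_genE /= !linearZ_LR uE.
Qed.
End Principal.

Section LiftSummand.
Variables (K : fieldType) (A : kalgType K).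
Variables (K2 V1 V0 : lmodType A) (d2 : {linear K2 -> V1}) (d1 : {linear V1 -> V0}).
Implicit Types (T Y : lmodType A).
Lemma lift1_summand T Y : summand T Y -> lift1 d2 T -> lift1 d2 Y.
Proof.
move=> [I [i [r ir]]] l u; have [h hP] := choice (fun k => l (lin_comp (i k) u)).
exists (\sum_k lin_comp (r k) (h k)) => x; rewrite lin_sumE -[RHS]ir.
by apply: eq_bigr => k _; rewrite /= hP.
Qed.
Lemma lift2_summand T Y : summand T Y -> lift2 d2 d1 T -> lift2 d2 d1 Y.
Proof.
move=> [I [i [r ir]]] l u ud.
have ex k : exists h : {linear V0 -> T}, forall x, h (d1 x) = i k (u x).
  by apply: (l (lin_comp (i k) u)) => x; rewrite /= ud linear0.
have [h hP] := choice ex.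
exists (\sum_k lin_comp (r k) (h k)) => x; rewrite lin_sumE -[RHS]ir.
by apply: eq_bigr => k _; rewrite /= hP.
Qed.
End LiftSummand.
(* T = tau2 (A e) (+) A (1 - e), with A' the opposite of its endomorphism ring *)
(* and e' the projection on the first summand.                                 *)
Record tilt (K : fieldType) (A A' : kalgType K) (e : A) (e' : A') := Tilt {
  tl_fdA : findim (kspace A);
  tl_fdA' : findim (kspace A');
  tl_gl : forall X Y : lmodType A, xv 2 X Y;
  tl_ee : e * e = e;
  tl_fe0 : forall a : A, a * e = e * a * e;
  tl_inv : forall x, e * x * e = x -> x <> 0 -> exists y, x * y = e /\ y * x = e;
  tl_D : apr_data e;
  tl_T : bimodule A A';
  tl_iP : {linear tau2 (princ e) -> tl_T};
  tl_pP : {linear tl_T -> tau2 (princ e)};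
  tl_iF : {linear princ (1 - e) -> tl_T};
  tl_pF : {linear tl_T -> princ (1 - e)};
  tl_pPK : forall x, tl_pP (tl_iP x) = x;
  tl_pFK : forall x, tl_pF (tl_iF x) = x;
  tl_split : forall t, tl_iP (tl_pP t) + tl_iF (tl_pF t) = t;
  tl_e' : forall t, ract t e' = tl_iP (tl_pP t);
  tl_full : forall h : {linear tl_T -> tl_T}, exists b, forall t, ract t b = h t;
  tl_faith : forall b b', (forall t : tl_T, ract t b = ract t b') -> b = b'
}.

Section TiltBasics.
Variables (K : fieldType) (A A' : kalgType K) (e : A) (e' : A') (H : tilt e e').
Local Notation f := (1 - e).
Local Notation f' := (1 - e').
Local Notation P := (princ e).
Local Notation F := (princ f).
Local Notation Z := (tau2 (princ e)).
Local Notation T := (tl_T H).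
Local Notation D := (tl_D H).
Local Notation iP := (tl_iP H).
Local Notation pP := (tl_pP H).
Local Notation iF := (tl_iF H).
Local Notation pF := (tl_pF H).
Local Notation dP := (ad_dP D).
Local Notation vp := (ad_vp D).
Local Notation fdA := (tl_fdA H).
Local Notation ee := (tl_ee H).
Implicit Types Y X : lmodType A.
Lemma tl_ff : f * f = f.
Proof. by rewrite mulrBr mulr1 mulrBl mul1r ee subrr subr0. Qed.
Lemma tl_fae (a : A) : f * a * e = 0.
Proof. by rewrite mulrBl mul1r mulrBl -(tl_fe0 H) subrr. Qed.
Lemma tl_pFiP x : pF (iP x) = 0.
Proof.
have := tl_split (iP x); rewrite tl_pPK -[RHS]addr0 => /addrI h.
by rewrite -[LHS](@tl_pFK _ _ _ _ _ H) h linear0.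
Qed.
Lemma tl_pPiF x : pP (iF x) = 0.
Proof.
have := tl_split (iF x); rewrite tl_pFK -[RHS]add0r => /addIr h.
by rewrite -[LHS](@tl_pPK _ _ _ _ _ H) h linear0.
Qed.
Lemma ractN1 (t : T) (b : A') : ract t (1 - b) = t - ract t b.
Proof. by apply/eqP; rewrite eq_sym subr_eq -ractDr subrK ract1. Qed.
Lemma ract0 (t : T) : ract t (0 : A') = 0 :> T.
Proof. by apply: (addrI (ract t 0)); rewrite -ractDr !addr0. Qed.
Lemma tl_f' (t : T) : ract t f' = iF (pF t).
Proof. by rewrite ractN1 tl_e' -{1}(tl_split t) addrAC subrr add0r. Qed.
Lemma tl_e'e' : e' * e' = e'.
Proof. by apply: (@tl_faith _ _ _ _ _ H) => t; rewrite ractM !tl_e' tl_pPK. Qed.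
Lemma homZF (h : {linear Z -> F}) : h = 0.
Proof.
apply: linear_ext => z; apply: val_inj.
exact: (congr1 (fun g : {linear Z -> A^o} => g z) (ad_homA D (lin_comp (princ_incl f) h))).
Qed.
Lemma homZP (h : {linear Z -> P}) : h = 0.
Proof.
apply: linear_ext => z; apply: val_inj.
exact: (congr1 (fun g : {linear Z -> A^o} => g z) (ad_homA D (lin_comp (princ_incl e) h))).
Qed.
Lemma homFP (h : {linear F -> P}) : h = 0.
Proof.
apply: (princ_ext tl_ff); rewrite -(princ_gen_fix tl_ff); apply: val_inj.
rewrite -[LHS]/(f * (val (h (princ_gen f)) : A)) -(princ_mulc ee (h _)) mulrA.
exact: tl_fae.
Qed.
Lemma homZ_summand X (h : {linear Z -> X}) : summand F X -> h = 0.
Proof.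
move=> [I [i [r ir]]]; apply: linear_ext => z; rewrite -[LHS]ir big1 // => k _.
by rewrite -[i k _]/(lin_comp (i k) h z) (homZF (lin_comp (i k) h)) linear0.
Qed.
Lemma homTP (h : {linear T -> P}) : h = 0.
Proof.
apply: linear_ext => t; rewrite -(tl_split t) linearD.
rewrite -[h (iP _)]/(lin_comp h iP _) -[h (iF _)]/(lin_comp h iF _).
by rewrite (homZP (lin_comp h iP)) (homFP (lin_comp h iF)) addr0.
Qed.
(** The component tau P -> A f of an endomorphism of T vanishes, hence A' is triangular: e' A' f' =
    0. *)
Lemma tl_e'b (b : A') : e' * b = e' * b * e'.
Proof.
apply: (@tl_faith _ _ _ _ _ H) => t; rewrite !ractM [RHS]tl_e' [ract t e']tl_e'.
rewrite -[LHS]tl_split.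
rewrite -[pF _]/(lin_comp pF (lin_comp (ract_map T b) iP) (pP t)).
by rewrite (homZF (lin_comp pF (lin_comp (ract_map T b) iP))) linear0 addr0.
Qed.
(* Modules killed by Ext^1 and Ext^2 from T.                                   *)
Definition good Y : Prop := xv 0 Z Y /\ xv 1 Z Y.
Lemma xvF n Y : xv n F Y.
Proof. by apply: projective_xv; exact: princ_projective tl_ff. Qed.
Lemma xvF_summand n X Y : summand F X -> xv n X Y.
Proof. by move=> sX; apply: (summand_xvl sX); exact: xvF. Qed.
Lemma summand_TZ : summand T Z.
Proof. by apply: (summand_retract (@tl_pPK _ _ _ _ _ H)); exact: summand_self. Qed.
Lemma summand_TF : summand T F.
Proof. by apply: (summand_retract (@tl_pFK _ _ _ _ _ H)); exact: summand_self. Qed.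
Lemma summand_ZF_T : summand (Z * F)%type T.
Proof.
have il : linear ((fun t => (pP t, pF t)) : T -> (Z * F)%type).
  by move=> a x y; rewrite !linearP.
have rl : linear ((fun p => iP p.1 + iF p.2) : (Z * F)%type -> T).
  by move=> a x y; rewrite /= !linearP scalerDr addrACA.
apply: (summand_retract (i := mklin il) (r := mklin rl)); last exact: summand_self.
exact: (@tl_split _ _ _ _ _ H).
Qed.
Lemma xv_prodl n (X X' : lmodType A) Y : xv n X Y -> xv n X' Y -> xv n (X * X')%type Y.
Proof.
move=> /xvP xX /xvP xX'; apply/xvP => x.
have -> : x = Ext_map (fst_lin X X') idfun (Ext_map (inl_lin X X') idfun x) +
              Ext_map (snd_lin X X') idfun (Ext_map (inr_lin X X') idfun x).
  rewrite !Ext_map_comp [X in X + _](_ : _ =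
     Ext_map (lin_comp (inl_lin X X') (fst_lin X X')) idfun x); last first.
    by apply: (congr2 (fun b g => Ext_map b g x)); exact: linear_ext.
  rewrite [X in _ + X](_ : _ =
     Ext_map (lin_comp (inr_lin X X') (snd_lin X X')) idfun x); last first.
    by apply: (congr2 (fun b g => Ext_map b g x)); exact: linear_ext.
  rewrite -Ext_mapDl -{1}[x]Ext_map_id; apply: (congr2 (fun b g => Ext_map b g x)) => //.
  by apply: linear_ext => p; rewrite -[LHS]prod_split.
by rewrite [Ext_map (inl_lin _ _) _ _]xX [Ext_map (inr_lin _ _) _ _]xX' !Ext_map0 addr0.
Qed.
Lemma xvT n Y : xv n Z Y -> xv n T Y.
Proof.
by move=> xZ; apply: (summand_xvl summand_ZF_T); apply: xv_prodl => //; exact: xvF.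
Qed.
Lemma xvT_summand n X Y : summand T X -> xv n Z Y -> xv n X Y.
Proof. by move=> sX xZ; apply: (summand_xvl sX); exact: xvT. Qed.
Lemma good_tau W : good (tau2 W).
Proof.
have xP2 n := @xvF_summand n _ (tau2 W) (ad_s2 D).
split; first exact: (lift2_xv0 (ad_exact D) (xP2 0%N) (@ad_l2tau _ _ _ D W)).
by apply: (lift1_xv1 (ad_exact D) _ (xP2 1%N) (@ad_l1tau _ _ _ D W)); exact: xvF_summand (ad_s1 D).
Qed.
Lemma good_F : good F.
Proof.
have xP2 n := @xvF_summand n _ F (ad_s2 D).
split; first exact: (lift2_xv0 (ad_exact D) (xP2 0%N) (@ad_l2f _ _ _ D)).
by apply: (lift1_xv1 (ad_exact D) _ (xP2 1%N) (@ad_l1f _ _ _ D)); exact: xvF_summand (ad_s1 D).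
Qed.
Lemma good_summand X Y : summand X Y -> good X -> good Y.
Proof. by move=> sY [g0 g1]; split; apply: (summand_xvr sY). Qed.
Lemma xv_prodr n X (Y Y' : lmodType A) : xv n X Y -> xv n X Y' -> xv n X (Y * Y')%type.
Proof.
move=> /xvP xX /xvP xX'; apply/xvP => x.
have -> : x = Ext_map idfun (inl_lin Y Y') (Ext_map idfun (fst_lin Y Y') x) +
              Ext_map idfun (inr_lin Y Y') (Ext_map idfun (snd_lin Y Y') x).
  rewrite !Ext_map_comp [X in X + _](_ : _ =
     Ext_map idfun (lin_comp (inl_lin Y Y') (fst_lin Y Y')) x); last first.
    by apply: (congr2 (fun b g => Ext_map b g x)); exact: linear_ext.
  rewrite [X in _ + X](_ : _ =
     Ext_map idfun (lin_comp (inr_lin Y Y') (snd_lin Y Y')) x); last first.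
    by apply: (congr2 (fun b g => Ext_map b g x)); exact: linear_ext.
  rewrite -Ext_mapDr -{1}[x]Ext_map_id; apply: (congr2 (fun b g => Ext_map b g x)) => //.
  by apply: linear_ext => p; rewrite -[LHS]prod_split.
by rewrite [Ext_map _ (fst_lin _ _) _]xX [Ext_map _ (snd_lin _ _) _]xX' !Ext_map0 addr0.
Qed.
Lemma good_prod X Y : good X -> good Y -> good (X * Y)%type.
Proof. by move=> [x0 x1] [y0 y1]; split; exact: xv_prodr. Qed.
Lemma good_T : good T.
Proof.
by apply: (good_summand summand_ZF_T); apply: good_prod; [exact: good_tau | exact: good_F].
Qed.
(** A map from P1 to P is zero, because P1 is in add A f and f A e = 0; so nothing has to be
    lifted. *)
Lemma xvZP : xv 0 Z P.
Proof.
apply: (lift2_xv0 (ad_exact D)); first exact: xvF_summand (ad_s2 D).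
move=> u _; exists 0 => x; have [I [i [r ir]]] := ad_s1 D.
rewrite -[in RHS](ir x) linear_sum big1 // => k _.
by rewrite -[u _]/(lin_comp u (r k) (i k x)) (homFP (lin_comp u (r k))).
Qed.
(* A good module is generated by T: a map P -> Y extends to P1, a summand of a *)
(* power of A f.                                                               *)
Definition generated Y : Prop := forall S : submodule Y,
  (forall (g : {linear T -> Y}) t, S (g t)) -> forall y, S y.
Lemma good_generated Y : good Y -> generated Y.
Proof.
move=> [g0 g1] S ST y.
have SF (g : {linear F -> Y}) x : S (g x).
  by have := ST (lin_comp g pF) (iF x); rewrite /= tl_pFK.
rewrite -(scale1r y) -(subrK e 1) scalerDl; apply: smodD.
  by have := SF (princ_pt f y) (princ_gen f); rewrite princ_pt_gen.
have [u1 u1E] := xv1_lift1 (ad_exact D) (@xvF_summand 0 _ Y (ad_s2 D)) g1 (princ_pt e y).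
rewrite -(princ_pt_gen e y) -u1E; have [I [i [r ir]]] := ad_s1 D.
rewrite -[dP _]ir linear_sum; apply: (big_ind (sm_set S)); [exact: sm0 | exact: smodD | move=> k _].
exact: (SF (lin_comp u1 (r k)) (i k (dP (princ_gen e)))).
Qed.
Lemma generated_eq0 X Y (s : {linear X -> Y}) : generated X ->
  (forall (g : {linear T -> X}) t, s (g t) = 0) -> s = 0.
Proof. by move=> gX s0; apply: linear_ext => x; apply: (gX (kersm s)) => g t; exact: s0. Qed.
Local Notation G := (homB T).
Local Notation Gmap := (homB_map T).
Lemma homT_ract (g : {linear T -> T}) : exists b, g = ract_map T b.
Proof. by have [b bE] := tl_full g; exists b; apply: linear_ext => t; exact: esym (bE t). Qed.
(** Hom(T, T) is A' by [tl_full] and [tl_faith], and for a summand X the coordinates of a map T -> X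
    are elements of A'. *)
Lemma Gproj X : summand T X -> projective_mod (G X).
Proof.
move=> [I [i [r ir]]] U V p h ps.
have bex k : exists b : G X -> A', forall g, lin_comp (i k) (hb_fun g) = ract_map T (b g).
  have [b bE] := choice (fun g : G X => homT_ract (lin_comp (i k) (hb_fun g))).
  by exists b.
have [b bE] := choice bex.
have gE (g : G X) : g = \sum_k b k g *: (r k : G X).
  apply: hb_ext => t; rewrite hb_sumE -[LHS]ir; apply: eq_bigr => k _.
  by rewrite hb_scaleE; congr (r k _); exact: (congr1 (fun h : {linear T -> T} => h t) (bE k g)).
have bl k a g g' : b k (a *: g + g') = a * b k g + b k g'.
  apply: (@tl_faith _ _ _ _ _ H) => t; rewrite -[LHS]/(ract_map T _ t) -bE ractDr ractM.
  rewrite -[X in _ = X + _]/(ract_map T _ _) -[X in _ = _ + X]/(ract_map T _ t) -!bE.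
  by rewrite -[LHS]/(i k (hb_fun (a *: g + g') t)) hb_addE linearD.
have [u uE] := choice (fun k => ps (h (r k : G X))).
have hl : linear (fun g => \sum_k b k g *: u k).
  move=> a g g'; rewrite scaler_sumr -big_split; apply: eq_bigr => k _.
  by rewrite bl scalerDl scalerA.
exists (mklin hl) => g; rewrite [in RHS](gE g) !linear_sum; apply: eq_bigr => k _.
by rewrite !linearZ_LR uE.
Qed.
Lemma Gfull_summand X Y (h : {linear G X -> G Y}) : summand T X ->
  exists s : {linear X -> Y}, h = Gmap s.
Proof.
move=> [I [i [r ir]]]; exists (\sum_k lin_comp (hb_fun (h (r k : G X))) (i k)).
apply: linear_ext => g.
have [b bE] := choice (fun k => homT_ract (lin_comp (i k) (hb_fun g))).
have gE : g = \sum_k b k *: (r k : G X).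
  apply: hb_ext => t; rewrite hb_sumE -[LHS]ir; apply: eq_bigr => k _.
  by rewrite hb_scaleE; congr (r k _); exact: (congr1 (fun h : {linear T -> T} => h t) (bE k)).
apply: hb_ext => t; rewrite homB_mapE lin_sumE {1}gE linear_sum hb_sumE.
apply: eq_bigr => k _; rewrite linearZ_LR hb_scaleE /=; congr (hb_fun _ _).
by apply: esym; exact: (congr1 (fun h : {linear T -> T} => h t) (bE k)).
Qed.
Lemma Gfaithful X Y (s s' : {linear X -> Y}) : generated X ->
  (forall g : G X, Gmap s g = Gmap s' g) -> s = s'.
Proof.
move=> gX e0; apply: linear_ext => x; apply: subr0_eq.
have e1 : s - s' = 0.
  apply: (generated_eq0 gX) => g t; apply: etrans (_ : s (g t) - s' (g t) = 0) => //.
  have e2 := congr1 (fun h : G Y => hb_fun h t) (e0 g); rewrite !homB_mapE in e2.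
  by apply/eqP; rewrite subr_eq0; apply/eqP.
exact: (congr1 (fun h : {linear X -> Y} => h x) e1).
Qed.
Lemma Glift_summand (X V M : lmodType A) (p : {linear V -> M}) (h : {linear X -> M}) : summand T X ->
  surj (Gmap p) -> exists h' : {linear X -> V}, forall x, p (h' x) = h x.
Proof.
move=> [I [i [r ir]]] Gp.
have [u uE] := choice (fun k => Gp (lin_comp h (r k) : G M)).
exists (\sum_k lin_comp (hb_fun (u k)) (i k)) => x; rewrite lin_sumE linear_sum -[in RHS](ir x).
rewrite [RHS]linear_sum; apply: eq_bigr => k _.
exact: (congr1 (fun g : G M => hb_fun g (i k x)) (uE k)).
Qed.
Lemma findim_F : findim (restr_scal F).
Proof. exact: (findim_inj (f := restr_map (princ_incl f)) val_inj fdA). Qed.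
Lemma findim_Z : findim (restr_scal Z).
Proof.
have [vs _ _ _] := ad_exact D; apply: (findim_surj (f := restr_map vp) vs).
exact: (summand_findim (ad_s2 D) findim_F).
Qed.
Lemma findim_prod (X Y : lmodType A) : findim (restr_scal X) -> findim (restr_scal Y) ->
  findim (restr_scal (X * Y)%type).
Proof.
move=> [n [v vP]] [m [w wP]].
refine (@findim_fin _ (restr_scal (X * Y)%type) ('I_n + 'I_m)%type (fun k => match k with
  inl i => (v i : X, 0 : Y) | inr j => (0 : X, w j : Y) end) _) => -[x y].
have [c cE] := vP x; have [d dE] := wP y.
exists (fun k => match k with inl i => c i | inr j => d j end).
rewrite big_sumType /=.
rewrite -[LHS]/((x, y) : (X * Y)%type) -[LHS]prod_split cE dE; congr (_ + _).
  rewrite [LHS](linear_sum (restr_map (inl_lin X Y))); apply: eq_bigr => i _.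
  exact: (linearZ_LR (restr_map (inl_lin X Y))).
rewrite [LHS](linear_sum (restr_map (inr_lin X Y))); apply: eq_bigr => i _.
exact: (linearZ_LR (restr_map (inr_lin X Y))).
Qed.
Lemma findim_T : findim (restr_scal T).
Proof.
by apply: (summand_findim summand_ZF_T); apply: findim_prod; [exact: findim_Z | exact: findim_F].
Qed.
Lemma findim_G M : findim (restr_scal M) -> findim (restr_scal (G M)).
Proof.
move=> fM; have [n [v vP]] := findim_T.
pose Mn : lmodType A := dprod (fun _ : 'I_n => M).
have fMn : findim (restr_scal Mn) by apply: (summand_findim _ fM); exact: summand_power.
have el : linear ((fun g => (fun i => hb_fun g (v i)) : Mn) : restr_scal (G M) -> restr_scal Mn).
  move=> k g h; apply: dprodP => i; rewrite [LHS]hb_addE hb_scaleE ract_scal.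
  by rewrite linearZ_LR.
apply: (findim_inj (f := mklin el) _ fMn) => g h gh; apply: hb_ext => t.
have [c ->] := vP t; rewrite (linear_sum (hb_fun g)) (linear_sum (hb_fun h)).
apply: eq_bigr => i _.
rewrite [LHS](linearZ_LR (restr_map (hb_fun g))) [RHS](linearZ_LR (restr_map (hb_fun h))).
by congr (_ *: _); exact: (congr1 (fun z : Mn => z i) gh).
Qed.
(** Generators of the finite-dimensional space Hom(T, M) assemble to a right add T-approximation of
    M. *)
Lemma Gcover M : findim (restr_scal M) -> exists (V : lmodType A) (p : {linear V -> M}),
  [/\ summand T V, surj (Gmap p) & findim (restr_scal V)].
Proof.
move=> fM; have [n [g gP]] := findim_G fM.
pose V : lmodType A := dprod (fun _ : 'I_n => T : lmodType A).
exists V, (dp_copair (fun i => hb_fun (g i))); split.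
- exact: summand_power.
- move=> h; have [c cE] := gP h.
  exists (dp_pair (fun i => ract_map T (scal (c i))) : G V).
  apply: hb_ext => t; rewrite homB_mapE cE [RHS](hb_sumE (fun i => (scal (c i) : A') *: (g i : G M))).
  exact: eq_bigr.
- by apply: (summand_findim _ findim_T); exact: summand_power.
Qed.
(** The approximation is onto because T generates M. Maps from tau P to M lift through it, which
    kills Ext^1(tau P, -) of the kernel; Ext^2 is killed by the long exact sequence. *)
Lemma Gcover_ker (V M : lmodType A) (p : {linear V -> M}) : summand T V -> surj (Gmap p) -> good M ->
  surj p /\ good (smod (kersm p)).
Proof.
move=> sV Gp gM; have [m0 m1] := gM; have [v0 v1] := good_summand sV good_T.
have ps : surj p.
  move=> y; have [|x ->] := good_generated gM (S := imsm p) _ y; last by exists x.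
  move=> g t; have [g' <-] := Gp (g : G M); by exists (hb_fun g' t).
split=> //; have ex := ker_exact ps; split; last exact: (xvr_sub ex).
by apply: (xvr_sub0 ex) => // h; exact: (Glift_summand h summand_TZ Gp).
Qed.
(** On an approximation V of X the map comes from s' by [Gfull_summand]; s' vanishes on the kernel,
    which is again generated by T, so it descends to X. *)
Lemma Gfull X Y (h : {linear G X -> G Y}) : good X -> findim (restr_scal X) ->
  exists s : {linear X -> Y}, h = Gmap s.
Proof.
move=> gX fX; have [V [p [sV Gp _]]] := Gcover fX.
have [ps gK] := Gcover_ker sV Gp gX.
have [s' s'E] := Gfull_summand (lin_comp h (Gmap p)) sV.
have s'K : lin_comp s' (@sm_incl _ _ (kersm p)) = 0.
  apply: (generated_eq0 (good_generated gK)) => g t.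
  have e1 : Gmap p (lin_comp (@sm_incl _ _ (kersm p)) g : G V) = 0.
    by apply: hb_ext => x; exact: (smodP (g x)).
  have e2 := congr1 (fun k : {linear G V -> G Y} => k (lin_comp (@sm_incl _ _ (kersm p)) g : G V)) s'E.
  exact: (congr1 (fun k : G Y => hb_fun k t) (etrans (esym e2) (etrans (congr1 h e1) (linear0 h)))).
have [x px|s sE] := lin_factor_surj ps (g := s').
  exact: (congr1 (fun k : {linear smod (kersm p) -> Y} => k (@smk _ _ (kersm p) x px)) s'K).
exists s; apply: linear_ext => g; have [g' <-] := Gp g.
rewrite -[LHS]/(lin_comp h (Gmap p) g') s'E; apply: hb_ext => t.
by rewrite !homB_mapE sE.
Qed.
Lemma Gexact (V M : lmodType A) (p : {linear V -> M}) (g : G V) : Gmap p g = 0 ->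
  exists g' : {linear T -> smod (kersm p)}, hb_fun g = lin_comp (@sm_incl _ _ (kersm p)) g'.
Proof.
move=> pg; have [t|g' g'E] := lin_factor_inj (@sm_incl_inj _ _ (kersm p)) (g := hb_fun g).
  have pt : kersm p (hb_fun g t) by exact: (congr1 (fun k : G M => hb_fun k t) pg).
  by exists (smk pt).
by exists g'; apply: linear_ext => t; rewrite -g'E.
Qed.
End TiltBasics.

Section ProdMaps.
Variables (R : pzRingType) (X Y X' Y' Z : lmodType R).
Lemma prod_lin_linear (u : {linear X -> X'}) (v : {linear Y -> Y'}) :
  linear (fun p : (X * Y)%type => (u p.1, v p.2)).
Proof. by move=> a p q; rewrite !linearP. Qed.
Definition prod_lin u v : {linear (X * Y)%type -> (X' * Y')%type} :=
  mklin (prod_lin_linear u v).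
Lemma copair_linear (u : {linear X -> Z}) (v : {linear Y -> Z}) :
  linear (fun p : (X * Y)%type => u p.1 + v p.2).
Proof. by move=> a p q; rewrite /= !linearP scalerDr addrACA. Qed.
Definition copair u v : {linear (X * Y)%type -> Z} := mklin (copair_linear u v).
Lemma pair_linear (u : {linear Z -> X}) (v : {linear Z -> Y}) :
  linear (fun z => (u z, v z)).
Proof. by move=> a p q; rewrite !linearP. Qed.
Definition pair_lin u v : {linear Z -> (X * Y)%type} := mklin (pair_linear u v).
Lemma copairE (s : {linear (X * Y)%type -> Z}) :
  s = copair (lin_comp s (inl_lin X Y)) (lin_comp s (inr_lin X Y)).
Proof.
by apply: linear_ext => p; rewrite -{1}[p]prod_split linearD.
Qed.
End ProdMaps.

(** * The trace form on the endomorphisms of tau P *)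

Section Trace.
Variables (K : fieldType) (A A' : kalgType K) (e : A) (e' : A') (H : tilt e e').
Local Notation f := (1 - e).
Local Notation f' := (1 - e').
Local Notation P := (princ e).
Local Notation F := (princ f).
Local Notation Z := (tau2 (princ e)).
Local Notation T := (tl_T H).
Local Notation D := (tl_D H).
Local Notation iP := (tl_iP H).
Local Notation pP := (tl_pP H).
Local Notation iF := (tl_iF H).
Local Notation pF := (tl_pF H).
Local Notation P1 := (ad_P1 D).
Local Notation P2 := (ad_P2 D).
Local Notation dP := (ad_dP D).
Local Notation d1P := (ad_d1 D).
Local Notation vp := (ad_vp D).
Local Notation ee := (tl_ee H).
Local Notation ff := (tl_ff H).
Local Notation CoP := (Corep dP d1P vp).
Local Notation scalZ k := (scal_map Z k).
Let dPi : injective dP. Proof. by have [_ _ _] := ad_exact D. Qed.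
Let d1k w : d1P w = 0 <-> exists k, w = dP k. Proof. by have [_ _] := ad_exact D. Qed.
Let vk w : vp w = 0 <-> exists k, w = d1P k. Proof. by have [_] := ad_exact D. Qed.
Let vs : surj vp. Proof. by have [] := ad_exact D. Qed.
Lemma tr_class (h : {linear Z -> Z}) : exists x, CoP x h.
Proof. exact: (Corep_exists dPi d1k vk vs). Qed.
(** An endomorphism of tau P corepresents a class in Ext^2(tau P, P) along the sequence of P, to
    which [ad_Tr] is applied. The class is unique, and [trE] removes the choice. *)
Definition tr (h : {linear Z -> Z}) : K := ad_Tr D (sval (cid (tr_class h))).
Lemma trE x (h : {linear Z -> Z}) : CoP x h -> tr h = ad_Tr D x.
Proof.
move=> xh; rewrite /tr; case: cid => y yh /=; congr (ad_Tr D _).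
exact: (Corep_uniq dPi d1k vk yh xh).
Qed.
Lemma good_P1 : good e P1. Proof. exact: (good_summand (ad_s1 D) (good_F H)). Qed.
Lemma good_P2 : good e P2. Proof. exact: (good_summand (ad_s2 D) (good_F H)). Qed.
Lemma class_tr x : exists h : {linear Z -> Z}, CoP x h.
Proof. exact: (Corep_of_class d1k vk x good_P1.2 good_P2.1). Qed.
Lemma trB (h h' : {linear Z -> Z}) : tr (h - h') = tr h - tr h'.
Proof.
have [x xh] := tr_class h; have [x' xh'] := tr_class h'.
by rewrite (trE xh) (trE xh') -ad_TrB; apply: trE; exact: (CorepB xh xh').
Qed.
Lemma tr0 : tr 0 = 0.
Proof. by rewrite -[0 in LHS](subrr 0) trB subrr. Qed.
Lemma trD (h h' : {linear Z -> Z}) : tr (h + h') = tr h + tr h'.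
Proof. by rewrite -[h' in LHS]opprK trB -[- h']sub0r trB tr0 sub0r opprK. Qed.
Lemma tr_comp (V : lmodType A) (y : Ext V P 2) (th : {linear V -> Z}) (k : {linear Z -> V}) :
  CoP y th -> tr (lin_comp th k) = ad_Tr D (Ext_map k idfun y).
Proof. by move=> yth; apply: trE; exact: (Corep_map k yth). Qed.
Lemma tr_tau rho (h : {linear Z -> Z}) x : CoP x h ->
  tr (lin_comp h (tau2_map rho)) = ad_Tr D (Ext_map idfun rho x).
Proof. by move=> xh; rewrite (tr_comp _ xh) ad_Tr_tau. Qed.
Lemma tr_scal (k : K) (h : {linear Z -> Z}) : tr (lin_comp h (scalZ k)) = k * tr h.
Proof.
have [x xh] := tr_class h.
by rewrite (trE xh) -tau2_map_scal (tr_tau _ xh) ad_TrZ.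
Qed.
(** R0 is induced by rho through the exact sequence, [tau2_map rho] through the functor. Both traces
    equal the trace of the image under rho of the class of h. *)
Lemma tr_induced (rho : {linear P -> P}) (R1 : {linear P1 -> P1}) (R2 : {linear P2 -> P2})
    (R0 h : {linear Z -> Z}) :
  (forall x, dP (rho x) = R1 (dP x)) -> (forall x, d1P (R1 x) = R2 (d1P x)) ->
  (forall x, vp (R2 x) = R0 (vp x)) ->
  tr (lin_comp R0 h) = tr (lin_comp h (tau2_map rho)).
Proof.
move=> e0 e1 e2; have [x xh] := tr_class h; rewrite (tr_tau _ xh).
by apply: trE; exact: (Corep_mapr e0 e1 e2 xh).
Qed.
(** By [ad_Tr_pt], a functional a on tau P turns an element l into a class of trace a(l), and
    functionals separate points. *)
Lemma tr_eq0 : (forall h, tr h = 0) -> forall z : Z, z = 0.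
Proof.
move=> tr0' l; have [//|nl] := pselect (l = 0).
have [x|a [_ al]] := @kseparate K (restr_scal Z) (restr_scal Z) 0 l.
  by apply/eqP => h; apply: nl; rewrite -h.
case: al; have [h xh] := class_tr (Ext_map (dual_of a) idfun l).
have := ad_Tr_pt D (dual_of a) l; rewrite -(trE xh) tr0' dual_ofE scale1r.
by move=> <-.
Qed.
Lemma endP_inv (rho : {linear P -> P}) : rho <> 0 ->
  exists rho' : {linear P -> P}, lin_comp rho rho' = idfun /\ lin_comp rho' rho = idfun.
Proof.
move=> r0; pose g := princ_gen e; pose d : A := val (rho g).
have de : d * e = d by exact: princ_mulc ee _.
have ed : e * d = d by exact: (congr1 val (princ_gen_fix ee rho)).
have d0 : d <> 0.
  move=> h; apply: r0; apply: (princ_ext ee); apply: val_inj; exact: h.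
have [|y [dy yd]] := tl_inv H _ d0; first by rewrite ed de.
exists (princ_pt e (princ_of e (e * y))).
have gv : (val g : A) = e by exact: val_princ_gen.
split; apply: (princ_ext ee); rewrite -/g.
  rewrite -[LHS]/(rho ((val g : A) *: princ_of e (e * y))) gv linearZ_LR; apply: val_inj.
  rewrite -[LHS]/(e * (val (rho (princ_of e (e * y))) : A)).
  rewrite [princ_of e _](princ_genE ee) linearZ_LR.
  rewrite -[LHS]/(e * ((e * y * e) * d)) -[RHS]/(1 * e) mul1r.
  by rewrite -!mulrA ed yd !ee.
apply: val_inj; rewrite -[LHS]/(d * (e * y * e)) -[RHS]/(1 * e) mul1r.
by rewrite !mulrA de dy ee.
Qed.
Lemma endZ_inv (h : {linear Z -> Z}) : h <> 0 ->
  exists h' : {linear Z -> Z}, lin_comp h h' = idfun /\ lin_comp h' h = idfun.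
Proof.
have [rho ->] := ad_end D h => n0.
have [|rho' [r1 r2]] := @endP_inv rho; first by move=> h0; apply: n0; rewrite h0 tau2_map0.
by exists (tau2_map rho'); rewrite -!tau2_map_comp r1 r2 tau2_map_id.
Qed.
(** A nonzero h is invertible, as End(tau P) is a division ring; then every endomorphism would have
    trace zero. *)
Lemma tr_nondeg (h : {linear Z -> Z}) : (forall h', tr (lin_comp h h') = 0) -> h = 0.
Proof.
move=> th; have [//|/endZ_inv[k [hk _]]] := pselect (h = 0).
apply: linear_ext => z; apply: tr_eq0 => h'.
rewrite -(th (lin_comp k h')); congr tr; apply: linear_ext => x.
exact: (esym (congr1 (fun u : {linear Z -> Z} => u (h' x)) hk)).
Qed.
Lemma corner_inv' (x : A') : e' * x * e' = x -> x <> 0 ->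
  exists y, x * y = e' /\ y * x = e'.
Proof.
move=> ex x0; pose h := lin_comp pP (lin_comp (ract_map T x) iP).
have xE t : ract t x = iP (h (pP t)).
  by rewrite -{1}ex -mulrA ractM [ract t e']tl_e' ractM tl_e'.
have [|h' [hh1 hh2]] := @endZ_inv h.
  move=> h0; apply: x0; apply: (@tl_faith _ _ _ _ _ H) => t.
  by rewrite xE h0 linear0 ract0.
have [y yE] := tl_full (lin_comp iP (lin_comp h' pP)).
have yE' t : ract t y = iP (h' (pP t)) := yE t.
have a1 z : h' (h z) = z := congr1 (fun u : {linear Z -> Z} => u z) hh2.
have a2 z : h (h' z) = z := congr1 (fun u : {linear Z -> Z} => u z) hh1.
by exists y; split; apply: (@tl_faith _ _ _ _ _ H) => t;
  rewrite ractM tl_e' ?xE yE' ?xE tl_pPK ?a1 ?a2.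
Qed.
(** The restriction of g to tau P is zero because the trace form is nondegenerate, and on the
    projective summand A f the map lifts anyway. *)
Lemma tr_lift (g : {linear T -> Z}) : (forall h : {linear Z -> T}, tr (lin_comp g h) = 0) ->
  exists g' : {linear T -> P2}, forall t, vp (g' t) = g t.
Proof.
move=> tg; have [u uE] := princ_projective ff (lin_comp g iF) vs.
have g0 : lin_comp g iP = 0.
  apply: tr_nondeg => h; rewrite -[RHS](tg (lin_comp iP h)); congr tr; exact: linear_ext.
exists (lin_comp u pF) => t; rewrite /= uE -[t in RHS]tl_split linearD.
by rewrite -[g (iP _)]/(lin_comp g iP _) g0 add0r.
Qed.
Lemma liftP1 (g : {linear T -> P2}) : (forall t, vp (g t) = 0) ->
  exists g' : {linear T -> P1}, forall t, d1P (g' t) = g t.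
Proof.
move=> vg; have [t|h hE] := lin_factor_inj (@sm_incl_inj _ _ (imsm d1P)) (g := g).
  by have /vk[w wE] := vg t; exists (im_corestr d1P w).
have [g' g'E] := xvr_lift (exact2_top (ad_exact D)) h (xvT (xvZP H)).
by exists g' => t; rewrite -hE -g'E.
Qed.
Lemma d1P_inj (g : {linear T -> P1}) : (forall t, d1P (g t) = 0) -> g = 0.
Proof.
move=> dg; have [t|h hE] := lin_factor_inj dPi (g := g); first by apply/d1k.
by apply: linear_ext => t; rewrite -hE (homTP h) linear0.
Qed.
Definition endo (b : A') : {linear Z -> Z} := lin_comp pP (lin_comp (ract_map T b) iP).
Lemma hom_ZT (g : {linear Z -> T}) : exists b, g = lin_comp (ract_map T b) iP.
Proof.
have [b bE] := tl_full (lin_comp g pP); exists b; apply: linear_ext => z.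
by rewrite /= bE /= tl_pPK.
Qed.
Lemma ract_linB (k : K) (x y : A') (t : T) :
  ract t (scal k * x + y) = (scal k : A) *: ract t x + ract t y.
Proof. by rewrite ractDr ractM ract_scal ractZ. Qed.
Lemma tr_ract_linear (X : {linear T -> Z}) (k : K) x y :
  tr (lin_comp X (lin_comp (ract_map T (scal k * x + y)) iP)) =
  k * tr (lin_comp X (lin_comp (ract_map T x) iP)) + tr (lin_comp X (lin_comp (ract_map T y) iP)).
Proof.
rewrite -tr_scal -trD; congr tr; apply: linear_ext => z.
rewrite /= ract_linB linearD; congr (X _ + _).
by rewrite /scal_fun linearZ_LR ractZ.
Qed.
Lemma iP_f' z (y : A') : ract (iP z) (f' * y) = 0 :> T.
Proof. by rewrite ractM tl_f' tl_pFiP linear0 -[RHS](linear0 (ract_map T y)). Qed.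
Lemma iP_e' z (y : A') : ract (iP z) (e' * y) = ract (iP z) y :> T.
Proof. by rewrite ractM tl_e' tl_pPK. Qed.
(** Unless tau P = 0, the trace is a nonzero form on the division ring e' A' e', so by [corner_form]
    it represents every functional there; triangularity extends this to e' A'. *)
Lemma tr_functional (xi : dual_mod A') : exists g : {linear T -> Z}, forall y,
  tr (lin_comp g (lin_comp (ract_map T y) iP)) = dual_fun xi (e' * y).
Proof.
have [Z0|nZ] := pselect (forall z : Z, z = 0).
  exists 0 => y; rewrite [lin_comp _ _](_ : _ = 0); last exact: linear_ext.
  rewrite tr0 (_ : e' * y = 0); first by rewrite -[0 in RHS](subrr 0) dual_funB subrr.
  apply: (@tl_faith _ _ _ _ _ H) => t.
  by rewrite ractM tl_e' (Z0 (pP t)) linear0 ract0; exact: (linear0 (ract_map T y)).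
have ul : linear ((fun y => tr (endo y)) : kspace A' -> K^o).
  by move=> k x y; exact: tr_ract_linear.
pose u : dual_mod A' := mklin ul.
have uE y : dual_fun u y = tr (endo y) by [].
have uc y : dual_fun u (e' * y * e') = dual_fun u y.
  rewrite !uE; congr tr; apply: linear_ext => z.
  by rewrite /= -mulrA iP_e' ractM tl_e' tl_pPK.
have u0 : u <> 0.
  move=> u0; apply: nZ; apply: tr_eq0 => h.
  have [b bE] := hom_ZT (lin_comp iP h).
  have -> : h = endo b.
    apply: linear_ext => z; rewrite -[LHS](@tl_pPK _ _ _ _ _ H).
    exact: (congr1 (fun g : {linear Z -> T} => pP (g z)) bE).
  by rewrite -uE u0 dual_fun0.
have [||x xE] := corner_form (tl_fdA' H) (c := e') (u := u) _ (tl_e'e' H) uc u0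
    (w := dual_ract e' xi).
- by move=> x ex x0; have [y [xy _]] := corner_inv' ex x0; exists y.
- move=> y; rewrite !dual_ract_fun; congr dual_fun.
  by rewrite !mulrA (tl_e'e' H) -(tl_e'b H).
exists (lin_comp pP (ract_map T (e' * x * e'))) => y.
rewrite -dual_ract_fun xE uE; congr tr; apply: linear_ext => z.
exact: (congr1 pP (esym (ractM (iP z) y (e' * x * e')))).
Qed.
(** The generator f of the summand A f, seen in T; [tbeta t] is the endomorphism through A f that
    sends it to f t. *)
Definition tf : T := iF (princ_gen f).
Lemma tf_act (x : F) : (val x : A) *: tf = iF x.
Proof. by rewrite /tf -linearZ_LR -(princ_genE ff). Qed.
Lemma f_tf : f *: tf = tf.
Proof. by rewrite -{1}(val_princ_gen f) tf_act. Qed.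
Lemma tf_f' : ract tf f' = tf.
Proof. by rewrite tl_f' tl_pFK. Qed.
Lemma tf_e'b b : ract tf (e' * b) = 0 :> T.
Proof. by rewrite ractM tl_e' tl_pPiF linear0 -[RHS](linear0 (ract_map T b)). Qed.
Lemma tf_f'b b : ract tf (f' * b) = ract tf b :> T.
Proof. by rewrite ractM tf_f'. Qed.
Lemma tbeta_ex (t : T) : exists b : A', forall x, ract x b = (val (pF x) : A) *: t.
Proof. by have [b bE] := tl_full (lin_comp (princ_pt f t) pF); exists b. Qed.
Definition tbeta (t : T) : A' := sval (cid (tbeta_ex t)).
Lemma tbetaE t (x : T) : ract x (tbeta t) = (val (pF x) : A) *: t.
Proof. by rewrite /tbeta; case: cid. Qed.
Lemma tbeta_linear : linear (tbeta : restr_scal T -> kspace A').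
Proof.
move=> k s t; apply: (@tl_faith _ _ _ _ _ H) => x.
rewrite [RHS](ract_linB k (tbeta s) (tbeta t) x) !tbetaE.
apply: etrans (scalerDr (val (pF x) : A) ((scal k : A) *: (s : T)) t) _.
by rewrite !scalerA -scalC.
Qed.
Lemma tf_tbeta t : ract tf (tbeta t) = f *: t.
Proof. by rewrite tbetaE tl_pFK val_princ_gen. Qed.
Lemma tbeta_f t : tbeta (f *: t) = tbeta t.
Proof.
by apply: (@tl_faith _ _ _ _ _ H) => x; rewrite !tbetaE scalerA (princ_mulc ff).
Qed.
Lemma tbeta_tf y : tbeta (ract tf y) = f' * y.
Proof.
apply: (@tl_faith _ _ _ _ _ H) => x.
by rewrite tbetaE -ractZ tf_act ractM tl_f'.
Qed.
End Trace.
(* A T-resolution of M that stays exact under Hom(T, -).                       *)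
Record tres (K : fieldType) (A A' : kalgType K) (e : A) (e' : A') (H : tilt e e')
    (M : lmodType A) := TRes {
  tr_K2 : lmodType A; tr_V1 : lmodType A; tr_V0 : lmodType A;
  tr_d2 : {linear tr_K2 -> tr_V1}; tr_d1 : {linear tr_V1 -> tr_V0};
  tr_p : {linear tr_V0 -> M};
  tr_exact : exact2 tr_d2 tr_d1 tr_p;
  tr_s1 : summand (tl_T H) tr_V1; tr_s0 : summand (tl_T H) tr_V0;
  tr_Gp : surj (homB_map (tl_T H) tr_p);
  tr_Gk : forall g, homB_map (tl_T H) tr_p g = 0 -> exists g', g = homB_map (tl_T H) tr_d1 g';
  tr_Gk1 : forall g, homB_map (tl_T H) tr_d1 g = 0 -> exists g', g = homB_map (tl_T H) tr_d2 g';
  tr_gK2 : good e tr_K2; tr_fK2 : findim (restr_scal tr_K2);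
  tr_Vlift : forall (X : lmodType A) (h : {linear X -> tr_V0}), summand (tl_T H) X ->
    (forall x, tr_p (h x) = 0) -> exists h' : {linear X -> tr_V1}, forall x, tr_d1 (h' x) = h x
}.

Section Resolution.
Variables (K : fieldType) (A A' : kalgType K) (e : A) (e' : A') (H : tilt e e').
(** Take an approximation of M and then one of its kernel; [Gcover_ker] keeps the kernels good. *)
Lemma tres_exists (M : lmodType A) : good e M -> findim (restr_scal M) -> inhabited (tres H M).
Proof.
move=> gM fM; have [V0 [p0 [s0 Gp0 f0]]] := Gcover H fM.
have [p0s gN0] := Gcover_ker s0 Gp0 gM.
have fN0 : findim (restr_scal (smod (kersm p0))).
  exact: (findim_inj (f := restr_map (@sm_incl _ _ (kersm p0))) (@sm_incl_inj _ _ (kersm p0)) f0).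
have [V1 [p1 [s1 Gp1 f1]]] := Gcover H fN0.
have [p1s gN1] := Gcover_ker s1 Gp1 gN0.
have fN1 : findim (restr_scal (smod (kersm p1))).
  exact: (findim_inj (f := restr_map (@sm_incl _ _ (kersm p1))) (@sm_incl_inj _ _ (kersm p1)) f1).
pose i0 := @sm_incl _ _ (kersm p0).
constructor; apply: (@TRes _ _ _ _ _ H M _ _ _ (@sm_incl _ _ (kersm p1)) (lin_comp i0 p1) p0) => //.
- split; [exact: p0s | | | exact: (@sm_incl_inj _ _ (kersm p1))].
    move=> v; split=> [pv|[w ->]]; last exact: (smodP (p1 w)).
    by have [w wE] := p1s (@smk _ _ (kersm p0) v pv); exists w; rewrite /= wE.
  move=> w; split=> [pw|[k ->]].
    have p1w : p1 w = 0 by apply: (@sm_incl_inj _ _ (kersm p0)); rewrite linear0.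
    by exists (@smk _ _ (kersm p1) w p1w).
  exact: etrans (congr1 i0 (smodP k : p1 _ = 0)) (linear0 i0).
- move=> g pg; have [g' g'E] := Gexact pg; have [g1 g1E] := Gp1 (g' : homB (tl_T H) _).
  exists g1; apply: hb_ext => t; rewrite g'E /=.
  by rewrite -[g' t]/(hb_fun (g' : homB (tl_T H) _) t) -g1E.
- move=> g pg; have [|g' g'E] := @Gexact _ _ _ _ _ H _ _ p1 g.
    apply: hb_ext => t; apply: (@sm_incl_inj _ _ (kersm p0)); rewrite linear0.
    exact: (congr1 (fun k : homB (tl_T H) V0 => hb_fun k t) pg).
  exists (g' : homB (tl_T H) _); apply: hb_ext => t; by rewrite g'E.
- move=> X h sX ph.
  have [x|h0 h0E] := lin_factor_inj (@sm_incl_inj _ _ (kersm p0)) (g := h).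
    by exists (@smk _ _ (kersm p0) (h x) (ph x)).
  have [h1 h1E] := Glift_summand h0 sX Gp1.
  by exists h1 => x; rewrite /= h1E -h0E.
Qed.
End Resolution.

(** * A resolution of the dual of the endomorphism algebra *)

Section Xi.
Variables (K : fieldType) (A A' : kalgType K) (e : A) (e' : A') (H : tilt e e').
Local Notation f := (1 - e).
Local Notation f' := (1 - e').
Local Notation M := (dcorner f).
Variable R : tres H M.
Local Notation Z := (tau2 (princ e)).
Local Notation T := (tl_T H).
Local Notation D := (tl_D H).
Local Notation iP := (tl_iP H).
Local Notation G := (homB T).
Local Notation Gmap := (homB_map T).
Local Notation V0 := (tr_V0 R).
Local Notation p0 := (tr_p R).
Local Notation DA' := (dual_mod A').
Local Notation tf := (tf H).
Definition Xi1 (g : G (V0 * Z)%type) : {linear T -> V0} := lin_comp (fst_lin V0 Z) (hb_fun g).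
Definition Xi2 (g : G (V0 * Z)%type) : {linear T -> Z} := lin_comp (snd_lin V0 Z) (hb_fun g).
(** A functional on A' has a part on f' A' and a part on e' A'. The first is obtained from a map T
    -> D(fA), evaluated along the orbit of [tf]; the second from a map T -> tau P through the trace
    form. *)
Definition Xi_val (g : G (V0 * Z)%type) (y : A') : K :=
  dual_fun (val (p0 (Xi1 g (ract tf y)))) 1 +
  tr H (lin_comp (Xi2 g) (lin_comp (ract_map T y) iP)).
Lemma Xi_sub_linear g : linear (Xi_val g : kspace A' -> K^o).
Proof.
move=> k x y; rewrite /Xi_val -[_ *: _ + _ : kspace A']/(scal k * (x : A') + (y : A')).
rewrite tr_ract_linear ract_linB !linearP.
rewrite -[dual_fun _ _]/(dual_fun ((scal k : A) *: val (p0 (Xi1 g (ract tf x))) + val (p0 (Xi1 g (ract tf y)))) 1).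
rewrite dual_add_fun dual_fun_scal addrACA -mulrDr //.
Qed.
Definition Xi_fun (g : G (V0 * Z)%type) : DA' := mklin (Xi_sub_linear g).
Lemma Xi_funE g y : dual_fun (Xi_fun g) y = Xi_val g y. Proof. by []. Qed.
Lemma Xi_linear : linear Xi_fun.
Proof.
move=> b g h; apply: dual_ext => y; rewrite dual_add_fun dual_scaleE !Xi_funE /Xi_val.
rewrite [Xi1 _ _](_ : _ = Xi1 g (ract tf (y * b)) + Xi1 h (ract tf y)); last first.
  by rewrite ractM.
rewrite !linearD -[dual_fun (_ + _) _]/(dual_fun (val (p0 (Xi1 g (ract tf (y * b)))) + val (p0 (Xi1 h (ract tf y)))) 1).
rewrite dual_add_fun [X in _ + _ + tr _ X](_ : _ =
   lin_comp (Xi2 g) (lin_comp (ract_map T (y * b)) iP) +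
   lin_comp (Xi2 h) (lin_comp (ract_map T y) iP)); last first.
  by apply: linear_ext => z; rewrite /= ractM.
by rewrite trD addrACA.
Qed.
Definition Xi : {linear G (V0 * Z)%type -> DA'} := mklin Xi_linear.
Lemma XiE g y : dual_fun (Xi g) y = Xi_val g y. Proof. by []. Qed.
Lemma Xi_surj : surj Xi.
Proof.
move=> xi; have [g1 g1E] := tr_functional H xi.
pose xl : {linear kspace A' -> K^o} := xi.
pose phi : {linear restr_scal T -> K^o} := lin_comp xl (mklin (@tbeta_linear _ _ _ _ _ H)).
have ml t : dual_ract f (dual_of phi t) = dual_of phi t.
  apply: dual_ext => a; rewrite dual_ract_fun !dual_ofE /= -[LHS]/(dual_fun xi (tbeta _)).
  by rewrite -scalerA tbeta_f.
pose m : {linear T -> M} := @sm_corestr _ _ (dcorner_sub f) _ (dual_of phi) ml.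
have [g0 g0E] := tr_Gp R (m : G M).
exists (pair_lin (hb_fun g0) g1 : G (V0 * Z)%type); apply: dual_ext => y.
rewrite XiE /Xi_val [Xi2 _](_ : _ = g1); last exact: linear_ext.
rewrite g1E -[Xi1 _ _]/(hb_fun g0 (ract tf y)) -homB_mapE g0E.
rewrite -[val _]/(dual_of phi (ract tf y)) dual_ofE scale1r.
rewrite -[X in X + _]/(dual_fun xi (tbeta (ract tf y))) tbeta_tf -dual_funD.
by rewrite -mulrDl subrK mul1r.
Qed.
(** The T-resolution of D(fA) gives exactness on the first summands. On the second, Hom(T, P) and
    Ext^1(T, P) vanish, and by [tr_lift] the maps T -> tau P that lift to P2 are exactly those
    invisible to the trace. *)
Lemma Xi_exact :
  exact2 (Gmap (prod_lin (tr_d2 R) (ad_d1 D))) (Gmap (prod_lin (tr_d1 R) (ad_vp D))) Xi.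
Proof.
have [vs vk _ _] := ad_exact D; have [ps pk d1k d2i] := tr_exact R.
split; first exact: Xi_surj.
- move=> g; split=> [Xg|[g' ->]].
    (* Testing on f' y isolates the first part of the functional, testing on e' b below isolates the
       second. *)
    have X0 y : dual_fun (val (p0 (Xi1 g (ract tf y)))) 1 = 0.
      have := congr1 (fun x : DA' => dual_fun x (f' * y)) Xg.
      rewrite XiE /Xi_val tf_f'b [lin_comp (Xi2 g) _](_ : _ = 0); last first.
        by apply: linear_ext => z; rewrite /= iP_f' linear0.
      by rewrite tr0 addr0.
    have p0g : Gmap p0 (Xi1 g : G V0) = 0.
      apply: hb_ext => t; rewrite homB_mapE; apply: val_inj; apply: dual_ext => a.
      rewrite -[X in dual_fun X a]dcornerE dual_ract_fun -dual_fun1.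
      rewrite -[X in dual_fun X 1]/(val ((f * a) *: p0 (Xi1 g t))) -!linearZ_LR.
      by rewrite -scalerA -tf_tbeta X0.
    have [g0 g0E] := tr_Gk p0g.
    have [|g1 g1E] := @tr_lift _ _ _ _ _ H (Xi2 g).
      move=> h; have [b ->] := hom_ZT h.
      have := congr1 (fun x : DA' => dual_fun x (e' * b)) Xg.
      rewrite XiE /Xi_val tf_e'b !linear0 add0r => e0.
      rewrite -[RHS]e0; congr (tr H); apply: linear_ext => z.
      by rewrite /= iP_e'.
    exists (pair_lin (hb_fun g0) g1 : G _); apply: hb_ext => t; rewrite homB_mapE /= g1E.
    rewrite -[tr_d1 R _]/(hb_fun (Gmap (tr_d1 R) g0) t) -g0E.
    by rewrite [LHS]surjective_pairing.
  apply: dual_ext => y; rewrite XiE /Xi_val.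
  have -> : p0 (Xi1 (Gmap (prod_lin (tr_d1 R) (ad_vp D)) g') (ract tf y)) = 0.
    by apply/pk; eexists; reflexivity.
  rewrite [lin_comp _ _](_ : _ = lin_comp (ad_vp D)
     (lin_comp (lin_comp (snd_lin (tr_V1 R) (ad_P2 D)) (hb_fun g')) (lin_comp (ract_map T y) iP))); last exact: linear_ext.
  rewrite [lin_comp (lin_comp (snd_lin _ _) _) _](homZ_summand H _ (ad_s2 D)) lin_comp0r tr0 addr0.
  exact: dual_fun0.
- move=> g; split=> [dg|[g' ->]].
    have e1 t : tr_d1 R (hb_fun g t).1 = 0 /\ ad_vp D (hb_fun g t).2 = 0.
      have := congr1 (fun k : G (V0 * Z)%type => hb_fun k t) dg; rewrite homB_mapE /=.
      by move=> /(congr1 (fun p => (p.1, p.2))) [-> ->].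
    have [|g0 g0E] := @tr_Gk1 _ _ _ _ _ H _ R (lin_comp (fst_lin _ _) (hb_fun g) : G (tr_V1 R)).
      by apply: hb_ext => t; exact: (e1 t).1.
    have [|g1 g1E] := @liftP1 _ _ _ _ _ H (lin_comp (snd_lin _ _) (hb_fun g)).
      by move=> t; exact: (e1 t).2.
    exists (pair_lin (hb_fun g0) g1 : G _); apply: hb_ext => t; rewrite homB_mapE /= g1E.
    rewrite -[tr_d2 R _]/(hb_fun (Gmap (tr_d2 R) g0) t) -g0E.
    by rewrite [LHS]surjective_pairing.
  apply: hb_ext => t; rewrite !homB_mapE /=.
  have -> : tr_d1 R (tr_d2 R (hb_fun g' t).1) = 0 by apply/d1k; eexists; reflexivity.
  by have -> : ad_vp D (ad_d1 D (hb_fun g' t).2) = 0 by apply/vk; eexists; reflexivity.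
- move=> g g' gg; have e1 t : tr_d2 R (hb_fun g t).1 = tr_d2 R (hb_fun g' t).1 /\
      ad_d1 D (hb_fun g t).2 = ad_d1 D (hb_fun g' t).2.
    have := congr1 (fun k : G (tr_V1 R * ad_P2 D)%type => hb_fun k t) gg; rewrite !homB_mapE /=.
    by move=> /(congr1 (fun p => (p.1, p.2))) [-> ->].
  have z : lin_comp (snd_lin _ _) (hb_fun g) - lin_comp (snd_lin _ _) (hb_fun g') = 0.
    apply: (d1P_inj (H := H)) => t.
    apply: etrans (_ : ad_d1 D ((hb_fun g t).2 - (hb_fun g' t).2) = 0) => //.
    by rewrite linearB (e1 t).2 subrr.
  apply: hb_ext => t; rewrite [LHS]surjective_pairing [RHS]surjective_pairing.
  rewrite (d2i _ _ (e1 t).1); congr (_, _); apply: subr0_eq.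
  exact: (congr1 (fun k : {linear T -> ad_P1 D} => k t) z).
Qed.
End Xi.

(** * The functor tau2 of the endomorphism algebra *)

Section Splice.
Variables (K : fieldType) (A : kalgType K).
Variables (K2 V1 V0 M P P1 P2 Z : lmodType A).
Variables (d2 : {linear K2 -> V1}) (d1 : {linear V1 -> V0}) (p0 : {linear V0 -> M}).
Variables (dP : {linear P -> P1}) (d1P : {linear P1 -> P2}) (vp : {linear P2 -> Z}).
Hypothesis ex : exact2 d2 d1 p0.
Hypothesis exP : exact2 dP d1P vp.
Hypothesis xVP : xv 0 V1 P.
Hypothesis homKP : forall h : {linear K2 -> P}, h = 0.
(* The sign comes from moving the cochain from the resolution of M to that of  *)
(* Z.                                                                          *)
Lemma splice_Rep (y : Ext M P 2) (th0 : {linear V0 -> Z}) (th1 : {linear V1 -> P2})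
    (th2 : {linear K2 -> P1}) : Corep dP d1P vp (Ext_map p0 idfun y) th0 ->
  (forall v, vp (th1 v) = th0 (d1 v)) -> (forall k, d1P (th2 k) = th1 (d2 k)) ->
  Rep d2 d1 p0 (Ext_map idfun dP y) (fun k => - th2 k).
Proof.
have [_ vk d1k dPi] := exP; have [ps pk d1ker d2i] := ex.
move=> [c xc [b [h [mb hl cb bh qh]]]] e1 e2.
have [lam [ylam mlam dlam]] := class_ofP y.
have [eta meta etaE] := (class_of_eq (class_of_map p0 idfun ylam) xc).1 erefl.
have lamE : cmap p0 id lam = c + bar_d eta.
  by rewrite -etaE addrC; apply/esym/subrK.
have dd x : d1P (dP x) = 0 by apply/d1k; exists x.
have pd x : p0 (d1 x) = 0 by apply/pk; exists x.
have dd2 x : d1 (d2 x) = 0 by apply/d1ker; exists x.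
have md (U V : lmodType A) n (g : {linear U -> V}) (X : lmodType A) (c' : cochain X U n) :
    bar_d (cmap id g c') = cmap id g (bar_d c').
  exact: (@cmap_d K A X X U V idfun g).
have ml (X X' U : lmodType A) n (g : {linear X' -> X}) (c' : cochain X U n) :
    bar_d (cmap g id c') = cmap g id (bar_d c').
  exact: (@cmap_d K A X X' U U g idfun).
(* [lam] represents y on M, whereas the corepresentation concerns the pull-back to V0; [eta]
   measures the difference and corrects the primitive. *)
pose b' := b + cmap id dP eta.
have mb' : multilinear b'.
  by apply: multilinearD => //; apply: cmap_multilinear => //; exact: linear_klinear.
have b'E : bar_d b' = cmap p0 id (cmap id dP lam).
  rewrite bar_dD -cb md; apply/funext => t; apply/funext => x.
  rewrite -[RHS]/(dP (cmap p0 id lam t x)) lamE.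
  by rewrite -[LHS]/(dP (c t x) + dP (bar_d eta t x)) -linearD.
have db' : cmap id d1P b' = bar_d (cochain0 h).
  rewrite -bh; apply/funext => t; apply/funext => x.
  rewrite -[LHS]/(d1P (b t x + dP (eta t x))) linearD dd addr0 //.
have [r rl rP] := klinear_ginv (linear_klinear d1P).
(* h d1 and th1 agree after [vp], so they differ by d1P k with k only K-linear. *)
pose k v := r (h (d1 v) - th1 v).
have kl : klinear k.
  move=> a u v; rewrite /k -rl; congr (r _).
  by rewrite (linearP d1) (linearP th1) hl opprD addrACA -scalerBr.
have kE v : d1P (k v) = h (d1 v) - th1 v.
  have /vk[w wE] : vp (h (d1 v) - th1 v) = 0 by rewrite linearB qh e1 subrr.
  by rewrite /k wE rP.
pose g := cmap d1 id b' - bar_d (cochain0 k).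
have mg : multilinear g.
  apply: multilinearB; first by apply: cmap_multilinear => //; exact: linear_klinear.
  by apply: multilinear_bar_d; exact: cochain0_multilinear.
have dg : cmap id d1P g = 0.
  rewrite cmapB -md.
  have -> : cmap id d1P (cmap d1 id b') = bar_d (cochain0 (fun v => h (d1 v))).
    transitivity (cmap d1 id (cmap id d1P b')) => //.
    by rewrite db' -ml.
  rewrite -bar_dB (_ : _ - _ = cochain0 th1); first by have [_ ->] := linear_cocycle0 th1.
  apply/funext => t; apply/funext => v; rewrite cochB /cmap /cochain0 kE.
  by rewrite opprB addrC subrK.
have [s sl sP] := klinear_ginv (linear_klinear dP).
pose g' := cmap id s g.
have g'E : cmap id dP g' = g.
  apply/funext => t; apply/funext => v.
  have /d1k[w wE] : d1P (g t v) = 0 by exact: (congr1 (fun c => c t v) dg).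
  by rewrite /g' /cmap wE sP.
have mg' : multilinear g' by exact: cmap_multilinear.
have dg' : bar_d g' = 0.
  apply/funext => t; apply/funext => v; apply: dPi; rewrite linear0.
  have := congr1 (fun c : cochain V1 P1 2 => c t v) (md _ _ _ dP _ g').
  rewrite g'E bar_dB bar_dd subr0 ml b'E => e3.
  apply: etrans (esym e3) _; rewrite /cmap pd.
  by have [m1 _] := mlam; rewrite (klinear0 (m1 t)) linear0.
(* The remaining defect is a 1-cocycle with values in P, a coboundary because Ext^1(V1, P) = 0. *)
have [nu mnu nuE] := xVP mg' dg'; rewrite (cochain0E nu) in mnu nuE.
set n0 := nu _ in mnu nuE.
have n0l : klinear n0 by have [m1 _] := mnu; exact: (m1 (fun=> 0)).
have {}nuE : g' = bar_d (cochain0 n0) := nuE.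
pose h' v := k v + dP (n0 v).
have hl' : klinear h'.
  by move=> a u v; rewrite /h' kl n0l linearP scalerDr addrACA.
have h'E : cmap d1 id b' = bar_d (cochain0 h').
  rewrite (_ : cochain0 h' = cochain0 k + cmap id dP (cochain0 n0)) // bar_dD md -nuE g'E.
  by rewrite addrC subrK.
have ul : linear (fun x => h' (d2 x)).
  apply: cocycle0_linear.
    by apply: cochain0_multilinear; apply: (klinear_comp hl'); exact: linear_klinear.
  rewrite (_ : cochain0 _ = cmap d2 id (cochain0 h')) // ml -h'E.
  apply/funext => t; apply/funext => x; rewrite /cmap dd2.
  by have [m1 _] := mb'; exact: (klinear0 (m1 t)).
(* The sum of the restriction of h' to K2 and th2 factors through [dP], and Hom(K2, P) = 0. *)
have uE x : h' (d2 x) = - th2 x.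
  have [z|v vE] := lin_factor_inj dPi (g := mklin ul + th2).
    apply/d1k; rewrite -[X in d1P X]/(h' (d2 z) + th2 z) /h' !linearD dd addr0 kE dd2.
    by rewrite (klinear0 hl) sub0r e2 addNr.
  have := vE x; rewrite (homKP v) linear0 => /esym/eqP.
  by rewrite -[_ x]/(h' (d2 x) + th2 x) addr_eq0 => /eqP.
exists (cmap id dP lam); first exact: (class_of_map idfun dP ylam).
by exists b', h'.
Qed.
End Splice.

Section RepExtra.
Variables (K : fieldType) (A : kalgType K).
Variables (K2 V1 V0 M Y : lmodType A).
Variables (d2 : {linear K2 -> V1}) (d1 : {linear V1 -> V0}) (p0 : {linear V0 -> M}).
Lemma Rep_ext (x : Ext M Y 2) psi psi' : psi =1 psi' -> Rep d2 d1 p0 x psi ->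
  Rep d2 d1 p0 x psi'.
Proof. by move=> /funext ->. Qed.
Lemma Rep_zero : Rep d2 d1 p0 (0 : Ext M Y 2) (fun=> 0).
Proof.
exists 0; first exact: class_of0.
exists 0, (fun=> 0); split=> //.
- exact: multilinear0.
- by move=> k u v; rewrite scaler0 addr0.
- by rewrite bar_d0.
- by rewrite (_ : cochain0 _ = 0) // bar_d0.
Qed.
Lemma Rep_push (Y' : lmodType A) (g : {linear Y -> Y'}) (x : Ext M Y 2) psi : Rep d2 d1 p0 x psi ->
  Rep d2 d1 p0 (Ext_map idfun g x) (fun k => g (psi k)).
Proof.
exact: (@Rep_map _ _ _ _ _ _ _ _ _ _ d2 d1 p0 d2 d1 p0 idfun idfun idfun idfun).
Qed.
End RepExtra.

(** * Computing tau2 of Hom(T, Y) *)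

Section Theta.
Variables (K : fieldType) (A A' : kalgType K) (e : A) (e' : A') (H : tilt e e').
Local Notation f := (1 - e).
Local Notation f' := (1 - e').
Local Notation M := (dcorner f).
Variable R : tres H M.
Local Notation P := (princ e).
Local Notation Z := (tau2 (princ e)).
Local Notation T := (tl_T H).
Local Notation D := (tl_D H).
Local Notation iP := (tl_iP H).
Local Notation pP := (tl_pP H).
Local Notation pF := (tl_pF H).
Local Notation G := (homB T).
Local Notation Gmap := (homB_map T).
Local Notation K2 := (tr_K2 R).
Local Notation V1 := (tr_V1 R).
Local Notation V0 := (tr_V0 R).
Local Notation d2 := (tr_d2 R).
Local Notation d1 := (tr_d1 R).
Local Notation p0 := (tr_p R).
Local Notation P1 := (ad_P1 D).
Local Notation P2 := (ad_P2 D).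
Local Notation dP := (ad_dP D).
Local Notation d1P := (ad_d1 D).
Local Notation vp := (ad_vp D).
Local Notation DA' := (dual_mod A').
Local Notation tf := (tf H).
Local Notation ff := (tl_ff H).
Local Notation inM := (@sm_incl _ _ (dcorner_sub f)).
Local Notation D2 := (Gmap (prod_lin d2 d1P)).
Local Notation D1 := (Gmap (prod_lin d1 vp)).
Local Notation Xi := (Xi R).
Local Notation pg := (princ_gen e).
Implicit Types Y : lmodType A.
(** The graph of an isomorphism from tau' Hom(T, Y) to e Y (+) f tau Y, for good Y. Along [Xi_exact]
    a class is a map K2 (+) P1 -> Y: its second component modulo maps from P2 is a map P -> Y, that
    is, an element of e Y, and the first modulo maps from V1 is a class in Ext^2(D(fA), Y) = f tau
    Y. The components are only determined up to such maps, hence a relation; the sign agrees with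
    [splice_Rep]. *)
Definition theta Y (z : tau2 (G Y)) (y : Y) (w : tau2 Y) : Prop :=
  exists (s1 : {linear K2 -> Y}) (s2 : {linear P1 -> Y}),
  [/\ Rep D2 D1 Xi z (Gmap (copair s1 s2)),
      Rep d2 d1 p0 (Ext_map inM idfun w) (fun k => - s1 k),
      y = s2 (dP pg) & f *: w = w].
Lemma inM_ret Y (w : tau2 Y) : Ext_map (dcorner_ret ff) idfun (Ext_map inM idfun w) = f *: w.
Proof.
rewrite Ext_map_comp; apply: (congr2 (fun b g => Ext_map b g w)); exact: linear_ext.
Qed.
Lemma inM_inj Y (w : tau2 Y) : f *: w = w -> Ext_map inM idfun w = 0 -> w = 0.
Proof. by move=> fw h; rewrite -fw -inM_ret h Ext_map0. Qed.
Lemma xvV1 n Y : xv n Z Y -> xv n V1 Y. Proof. exact: xvT_summand (tr_s1 R). Qed.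
Lemma xvV0 n Y : xv n Z Y -> xv n V0 Y. Proof. exact: xvT_summand (tr_s0 R). Qed.
Lemma xvGV1 n (U : lmodType A') : xv n (G (V1 * P2)%type) U.
Proof.
apply: projective_xv; apply: Gproj; apply: summand_prod; first exact: tr_s1.
by apply: summand_trans (ad_s2 D); exact: summand_TF.
Qed.
Lemma xvGV0 n (U : lmodType A') : xv n (G (V0 * Z)%type) U.
Proof.
apply: projective_xv; apply: Gproj; apply: summand_prod; first exact: tr_s0.
exact: summand_TZ.
Qed.
Lemma sV1P2 : summand T (V1 * P2)%type.
Proof.
apply: summand_prod; first exact: tr_s1.
by apply: summand_trans (ad_s2 D); exact: summand_TF.
Qed.
Lemma findim_P1 : findim (restr_scal P1).
Proof. exact: (summand_findim (ad_s1 D) (findim_F H)). Qed.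
Lemma gK2P1 : good e (K2 * P1)%type.
Proof. by apply: good_prod; [exact: tr_gK2 | exact: good_P1]. Qed.
Lemma exP_dd x : d1P (dP x) = 0.
Proof. by have [_ _ h _] := ad_exact D; apply/h; exists x. Qed.
Lemma theta_total Y (z : tau2 (G Y)) : exists y w, theta z y w.
Proof.
have [psi zpsi] := Rep_of_class (Xi_exact R) z (@xvGV0 1%N _) (@xvGV1 0%N _).
(* Fullness of Hom(T, -) on good modules turns the representing A'-linear map into an A-linear map
   K2 (+) P1 -> Y. *)
have [|s sE] := Gfull psi gK2P1.
  by apply: findim_prod; [exact: tr_fK2 | exact: findim_P1].
pose s1 := lin_comp s (inl_lin K2 P1).
have [y yE] := Rep_exists (tr_exact R) (- s1).
exists (s (0, dP pg)), (Ext_map (dcorner_ret ff) idfun y), s1, (lin_comp s (inr_lin K2 P1)).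
split=> //.
- by rewrite -copairE -sE.
- rewrite Ext_map_comp (_ : Ext_map _ _ y = y) //.
  rewrite -[RHS]Ext_map_id; apply: (congr2 (fun b g => Ext_map b g y)); apply: linear_ext => // x.
  exact: dcorner_retK.
- rewrite -[LHS]/(Ext_map (dual_ract f : {linear dual_mod A -> dual_mod A}) idfun _) Ext_map_comp.
  apply: (congr2 (fun b g => Ext_map b g y)); apply: linear_ext => // x; apply: val_inj.
  by rewrite /= -dual_ractM ff.
Qed.
Lemma theta_onto Y y w : good e Y -> e *: y = y -> f *: w = w ->
  exists z : tau2 (G Y), theta z y w.
Proof.
move=> [g0 g1] ey fw.
have [s2 s2E] := xv1_lift1 (ad_exact D) (xvF_summand H (ad_s2 D)) g1 (princ_pt e y).
have [s1 s1E] := Rep_of_class (tr_exact R) (Ext_map inM idfun w) (xvV0 g1) (xvV1 g0).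
have [z zE] := Rep_exists (Xi_exact R) (Gmap (copair (- s1) s2)).
exists z, (- s1), s2; split=> //; last by rewrite s2E princ_pt_gen ey.
by apply: Rep_ext s1E => k; rewrite -[(- s1) k]/(- s1 k) opprK.
Qed.
Lemma thetaB Y (z z' : tau2 (G Y)) y y' w w' :
  theta z y w -> theta z' y' w' -> theta (z - z') (y - y') (w - w').
Proof.
move=> [s1 [s2 [r1 r2 -> fw]]] [t1 [t2 [q1 q2 -> fw']]].
exists (s1 - t1), (s2 - t2); split=> //.
- apply: Rep_ext (RepB r1 q1) => g; apply: hb_ext => t.
  rewrite -[LHS]/(s1 (hb_fun g t).1 + s2 (hb_fun g t).2 - (t1 (hb_fun g t).1 + t2 (hb_fun g t).2)).
  by rewrite opprD addrACA.
- have -> : Ext_map inM idfun (w - w') = Ext_map inM idfun w - Ext_map inM idfun w'.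
    by rewrite Ext_mapD Ext_mapN.
  by apply: Rep_ext (RepB r2 q2) => k; rewrite -[(s1 - t1) k]/(s1 k - t1 k) opprB opprK addrC.
- by rewrite scalerBr fw fw'.
Qed.
Lemma theta_uniq0 Y y w : good e Y -> theta (0 : tau2 (G Y)) y w -> y = 0 /\ w = 0.
Proof.
move=> [g0 g1] [s1 [s2 [r1 r2 -> fw]]].
have [h hE] := Rep0_extends (Xi_exact R) (@xvGV0 0%N _) r1.
have [s sE] := Gfull_summand h sV1P2.
have e1 : copair s1 s2 = lin_comp s (prod_lin d2 d1P).
  apply: (Gfaithful (H := H) (good_generated gK2P1)) => g; rewrite hE sE.
  exact: hb_ext.
have e2 k : s1 k = s (d2 k, 0).
  have := congr1 (fun u : {linear (K2 * P1)%type -> Y} => u (k, 0)) e1.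
  by rewrite /= !linear0 addr0.
have e3 x : s2 x = s (0, d1P x).
  have := congr1 (fun u : {linear (K2 * P1)%type -> Y} => u (0, x)) e1.
  by rewrite /= !linear0 add0r.
split; first by rewrite e3 exP_dd linear0.
apply: inM_inj => //.
apply: (Rep_extends_eq0 (tr_exact R) (h' := - lin_comp s (inl_lin V1 P2)) r2) => k.
by rewrite e2.
Qed.
Lemma theta_inj Y (z : tau2 (G Y)) : good e Y -> theta z 0 0 -> z = 0.
Proof.
move=> [g0 g1] [s1 [s2 [r1 r2 s20 _]]].
have [|h2 h2E] := xv0_lift2 (ad_exact D) g0 (u := s2).
  move=> x; rewrite [x](princ_genE (tl_ee H)) !linearZ_LR -s20; exact: scaler0.
rewrite Ext_map0 in r2.
have [h1 h1E] := Rep0_extends (tr_exact R) (xvV0 g0) r2.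
apply: (Rep_extends_eq0 (Xi_exact R) (h' := Gmap (copair (- h1) h2)) r1) => g.
have h1E' k : s1 k = (- h1) (d2 k) by rewrite -[RHS]/(- h1 (d2 k)) -h1E opprK.
by apply: hb_ext => t; rewrite !homB_mapE /= h1E' h2E.
Qed.
Lemma theta_nat (Y Y' : lmodType A) (g : {linear Y -> Y'}) (z : tau2 (G Y)) y w :
  theta z y w -> theta (tau2_map (Gmap g) z) (g y) (tau2_map g w).
Proof.
move=> [s1 [s2 [r1 r2 -> fw]]]; exists (lin_comp g s1), (lin_comp g s2); split=> //.
- apply: Rep_ext (Rep_push (Gmap g) r1) => k; apply: hb_ext => t.
  by rewrite !homB_mapE /= linearD.
- have -> : Ext_map inM idfun (tau2_map g w) = Ext_map idfun g (Ext_map inM idfun w).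
    rewrite -[tau2_map g w]/(Ext_map idfun g w) !Ext_map_comp.
    by apply: (congr2 (fun b g => Ext_map b g w)); exact: linear_ext.
  by apply: Rep_ext (Rep_push g r2) => k; rewrite linearN.
- by rewrite -linearZ_LR fw.
Qed.
(** rho extends to an endomorphism R1, R2, R0 of the sequence of P. By [tr_induced], acting with it
    on the second summands of the resolution covers the right action of e' b e' on DA'. *)
Lemma theta_act_e Y (z : tau2 (G Y)) y w b (rho : {linear P -> P}) :
  endo H b = tau2_map rho -> theta z y w ->
  theta ((e' * b * e') *: z) ((val (rho pg) : A) *: y) 0.
Proof.
move=> bE [s1 [s2 [r1 r2 -> fw]]].
have [R1 R1E] := lift1_summand (ad_s1 D) (@ad_l1f _ _ _ D) (lin_comp dP rho).
have [|R2 R2E] := lift2_summand (ad_s2 D) (@ad_l2f _ _ _ D) (u := lin_comp d1P R1).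
  by move=> x; rewrite /= R1E exP_dd.
have [vs vk _ _] := ad_exact D.
have [x|R0 R0E] := lin_factor_surj vs (g := lin_comp vp R2).
  by move/vk => [u ->]; rewrite /= R2E; apply/vk; exists (R1 u).
exists 0, (lin_comp s2 R1); split.
- have := @Rep_map _ _ _ _ _ _ _ _ _ _ D2 D1 Xi D2 D1 Xi (Gmap (prod_lin 0 R1))
    (Gmap (prod_lin 0 R2)) (Gmap (prod_lin 0 R0)) (dual_ract (e' * b * e') : {linear DA' -> DA'})
    _ _ _ _ _ idfun z _ r1.
  move=> h; apply: Rep_ext (h _ _ _).
  + move=> g; apply: hb_ext => t; rewrite !homB_mapE /=.
    by rewrite linear0.
  + move=> g; apply: dual_ext => x; rewrite dual_ract_fun !XiE /Xi_val.
    rewrite -!mulrA.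
    have zL : dual_fun (val (p0 (Xi1 g (ract tf (e' * (b * (e' * x))))))) 1 = 0.
      by rewrite tf_e'b !linear0; exact: dual_fun0.
    have zR : dual_fun (val (p0 (Xi1 (Gmap (prod_lin 0 R0) g : G (V0 * Z)%type) (ract tf x)))) 1 = 0.
      apply: etrans (dual_fun0 (1 : A)); congr (dual_fun _ 1); exact: (congr1 val (linear0 p0)).
    rewrite zL zR !add0r.
    transitivity (tr H (lin_comp R0 (lin_comp (Xi2 g) (lin_comp (ract_map T x) iP)))); last first.
      by congr (tr H); exact: linear_ext.
    rewrite (@tr_induced _ _ _ _ _ H rho R1 R2 R0).
    * congr (tr H); apply: linear_ext => u; rewrite -bE /=; congr (Xi2 g _).
      by rewrite iP_e' ractM ractM tl_e'.
    * by move=> u; rewrite R1E.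
    * by move=> u; rewrite R2E.
    * by move=> u; rewrite R0E.
  + move=> g; apply: hb_ext => t; rewrite !homB_mapE /=; congr (_, _); first by rewrite linear0.
    by rewrite R0E.
  + move=> g; apply: hb_ext => t; rewrite !homB_mapE /=; congr (_, _); first by rewrite linear0.
    by rewrite R2E.
- rewrite Ext_map0; apply: Rep_ext (Rep_zero _ _ _ _) => k.
  by rewrite -[LHS]oppr0.
- rewrite -[RHS]/(s2 (R1 (dP pg))) R1E -[RHS]/(s2 (dP (rho pg))).
  by rewrite [in RHS](princ_genE (tl_ee H) (rho pg)) !linearZ_LR.
- exact: scaler0.
Qed.
Lemma act_f_elt b : f *: ract tf b = ract tf b.
Proof. by rewrite -ractZ f_tf. Qed.
(** f' b f' corresponds to an element of f A f, whose action on D(fA) lifts to the T-resolution and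
    covers the right action on DA'. *)
Lemma theta_act_f Y (z : tau2 (G Y)) y w b : theta z y w ->
  theta ((f' * b * f') *: z) 0 ((val (pF (ract tf b)) : A) *: w).
Proof.
move=> [s1 [s2 [r1 r2 _ fw]]]; pose a : A := val (pF (ract tf b)).
have af : a * f = a := princ_mulc ff _.
have fa : f * a = a.
  exact: (congr1 val (etrans (esym (linearZ_LR pF f (ract tf b))) (congr1 pF (act_f_elt b)))).
have ms (x : M) : dual_ract f (dual_ract a (val x)) = dual_ract a (val x).
  by rewrite -dual_ractM af.
pose be : {linear M -> M} := @sm_corestr _ _ (dcorner_sub f) _
  (lin_comp (dual_ract a : {linear dual_mod A -> dual_mod A}) inM) ms.
have [ps pk d1k d2i] := tr_exact R.
have pd x : p0 (d1 x) = 0 by apply/pk; exists x.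
have dd2 x : d1 (d2 x) = 0 by apply/d1k; exists x.
have [F0 F0E] := Glift_summand (lin_comp be p0) (tr_s0 R) (@tr_Gp _ _ _ _ _ _ _ R).
have [|F1 F1E] := @tr_Vlift _ _ _ _ _ _ _ R _ (lin_comp F0 d1) (tr_s1 R).
  by move=> x; rewrite /= F0E -[LHS]/(be (p0 (d1 x))) pd linear0.
have [x|F2 F2E] := lin_factor_inj d2i (g := lin_comp F1 d2).
  by apply/d1k; rewrite /= F1E /= dd2 linear0.
exists (lin_comp s1 F2), 0; split=> //.
- have := @Rep_map _ _ _ _ _ _ _ _ _ _ D2 D1 Xi D2 D1 Xi (Gmap (prod_lin F2 0))
    (Gmap (prod_lin F1 0)) (Gmap (prod_lin F0 0)) (dual_ract (f' * b * f') : {linear DA' -> DA'})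
    _ _ _ _ _ idfun z _ r1.
  move=> h; apply: Rep_ext (h _ _ _).
  + by move=> g; apply: hb_ext => t; rewrite !homB_mapE /= linear0.
  + move=> g; apply: dual_ext => x; rewrite dual_ract_fun !XiE /Xi_val.
    rewrite [X in _ + X](_ : _ = 0); last first.
      rewrite -[RHS](tr0 H); congr (tr H); apply: linear_ext => u.
      by rewrite /= -!mulrA iP_f' linear0.
    rewrite [X in _ = _ + X](_ : _ = 0); last first.
      by rewrite -[RHS](tr0 H); congr (tr H); exact: linear_ext.
    congr (_ + _).
    have -> : ract tf (f' * b * f' * x) = a *: ract tf x.
      by rewrite -!mulrA tf_f'b ractM ractM tl_f' -tf_act ractZ.
    rewrite linearZ_LR linearZ_LR -[LHS]/(dual_fun (a *: val (p0 (Xi1 g (ract tf x)))) 1) dual_fun1.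
    rewrite -[X in _ = dual_fun (val X) _]/(p0 (F0 (Xi1 g (ract tf x)))) F0E.
    by rewrite -[RHS]/(dual_fun (dual_ract a (val (p0 (Xi1 g (ract tf x))))) 1) dual_ract_fun mulr1.
  + move=> g; apply: hb_ext => t; rewrite !homB_mapE /=; congr (_, _); last by rewrite linear0.
    by rewrite F1E.
  + move=> g; apply: hb_ext => t; rewrite !homB_mapE /=; congr (_, _); last by rewrite linear0.
    by rewrite F2E.
- have -> : Ext_map inM idfun (a *: w) = Ext_map be idfun (Ext_map inM idfun w).
    rewrite -[a *: w]/(Ext_map (dual_ract a : {linear dual_mod A -> dual_mod A}) idfun w) !Ext_map_comp.
    by apply: (congr2 (fun b g => Ext_map b g w)); exact: linear_ext.
  have := @Rep_map _ _ _ _ _ _ _ _ _ _ d2 d1 p0 d2 d1 p0 F2 F1 F0 be _ _ _ _ _ idfun _ _ r2.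
  by apply=> x; rewrite ?F0E ?F1E ?F2E.
- by rewrite scalerA fa.
Qed.
Lemma Glift_ex (X V N : lmodType A) (p : {linear V -> N}) (h : {linear X -> N}) :
  summand T X -> (forall g : {linear T -> X}, exists u : {linear T -> V}, forall t, p (u t) = h (g t)) ->
  exists h' : {linear X -> V}, forall x, p (h' x) = h x.
Proof.
move=> [I [i [r ir]]] lh; have [u uE] := choice (fun k => lh (r k)).
exists (\sum_k lin_comp (u k) (i k)) => x; rewrite lin_sumE linear_sum -[in RHS](ir x).
by rewrite [RHS]linear_sum; apply: eq_bigr => k _; rewrite /= uE.
Qed.
(** The action of f' b e' links the two resolutions: the class l in tau P is corepresented by a map
    from the T-resolution of D(fA) to the sequence of P, which covers this action. [splice_Rep]
    identifies the resulting class in Ext^2(D(fA), Y). *)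
Lemma theta_act_l Y (z : tau2 (G Y)) y w b : theta z y w ->
  theta ((f' * b * e') *: z) 0 (tau2_map (princ_pt e y) (pP (ract tf b))).
Proof.
move=> [s1 [s2 [r1 r2 yE fw]]]; pose l := pP (ract tf b).
have fl : f *: l = l by rewrite -linearZ_LR act_f_elt.
have [ps pk d1k d2i] := tr_exact R; have [vs vk d1Pk dPi] := ad_exact D.
have pd x : p0 (d1 x) = 0 by apply/pk; exists x.
have dd2 x : d1 (d2 x) = 0 by apply/d1k; exists x.
pose yl := Ext_map inM idfun l.
have [th0 th0E] := Corep_of_class d1Pk vk (Ext_map p0 idfun yl)
  (xvV0 (good_P1 H).2) (xvV0 (good_P2 H).1).
have Tr0 : ad_Tr D 0 = 0 by rewrite -[0 in LHS](subrr 0) ad_TrB subrr.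
(* By [tr_lift] the map th0 d1 lifts to P2: the traces in question come from pull-backs along p0 d1
   = 0. *)
have [g|th1 th1E] := Glift_ex (p := vp) (h := lin_comp th0 d1) (tr_s1 R).
  have [|u uE] := @tr_lift _ _ _ _ _ H (lin_comp (lin_comp th0 d1) g); last by exists u.
  move=> k; transitivity (tr H (lin_comp th0 (lin_comp (lin_comp d1 g) k))).
    by congr (tr H); exact: linear_ext.
  rewrite (tr_comp _ th0E) !Ext_map_comp.
  transitivity (ad_Tr D (Ext_map (0 : {linear Z -> dual_mod A}) (idfun : {linear P -> P}) l)).
    congr (ad_Tr D _); apply: (congr2 (fun b g => Ext_map b g l)); last exact: linear_ext.
    by apply: linear_ext => x; exact: etrans (congr1 inM (pd _)) (linear0 inM).
  by rewrite Ext_map0l Tr0.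
have ginj : injective (Gmap d1P).
  move=> g g' gg; have z0 : hb_fun g - hb_fun g' = 0.
    apply: (d1P_inj (H := H)) => t; apply: etrans (linearB d1P _ _) _.
    by rewrite -[d1P _]homB_mapE gg subrr.
  apply: hb_ext => t; apply: subr0_eq.
  exact: (congr1 (fun k : {linear T -> P1} => k t) z0).
(* K2 is only known to be good, so the map K2 -> P1 is constructed after applying Hom(T, -) and
   recovered by fullness. *)
have [g|th hE] := lin_factor_inj ginj (g := Gmap (lin_comp th1 d2)).
  have [|g' g'E] := @liftP1 _ _ _ _ _ H (hb_fun (Gmap (lin_comp th1 d2) g)).
    by move=> t; rewrite homB_mapE /= th1E /= dd2 linear0.
  by exists (g' : G P1); apply: hb_ext => t; rewrite [RHS]homB_mapE g'E.
have [th2 th2E] := Gfull th (tr_gK2 R) (tr_fK2 R).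
have th2E' k : d1P (th2 k) = th1 (d2 k).
  have e1 : lin_comp d1P th2 = lin_comp th1 d2.
    apply: (Gfaithful (H := H) (good_generated (tr_gK2 R))) => g; rewrite -hE th2E.
    exact: hb_ext.
  exact: (congr1 (fun u : {linear K2 -> P2} => u k) e1).
have homKP (h : {linear K2 -> P}) : h = 0.
  apply: (generated_eq0 (H := H) (good_generated (tr_gK2 R))) => g t.
  by rewrite -[h (g t)]/(lin_comp h g t) (homTP (lin_comp h g)).
have sp := splice_Rep (tr_exact R) (ad_exact D) (xvV1 (xvZP H)) homKP th0E th1E th2E'.
exists (lin_comp s2 th2), 0; split=> //.
- have := @Rep_map _ _ _ _ _ _ _ _ _ _ D2 D1 Xi D2 D1 Xi
    (Gmap (lin_comp (inr_lin K2 P1) (lin_comp th2 (fst_lin K2 P1))))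
    (Gmap (lin_comp (inr_lin V1 P2) (lin_comp th1 (fst_lin V1 P2))))
    (Gmap (lin_comp (inr_lin V0 Z) (lin_comp th0 (fst_lin V0 Z))))
    (dual_ract (f' * b * e') : {linear DA' -> DA'})
    _ _ _ _ _ idfun z _ r1.
  move=> h; apply: Rep_ext (h _ _ _).
  + by move=> g; apply: hb_ext => t; rewrite !homB_mapE /= linear0 add0r addr0.
  + move=> g; apply: dual_ext => x; rewrite dual_ract_fun !XiE /Xi_val.
    rewrite [X in _ + X](_ : _ = 0); last first.
      rewrite -[RHS](tr0 H); congr (tr H); apply: linear_ext => u.
      by rewrite /= -!mulrA iP_f' linear0.
    rewrite [X in _ = X + _](_ : _ = 0); last first.
      apply: etrans (dual_fun0 (1 : A)); congr (dual_fun _ 1); exact: (congr1 val (linear0 p0)).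
    rewrite addr0 add0r.
    have -> : ract tf (f' * b * e' * x) = ract (iP l) x.
      by rewrite -!mulrA tf_f'b ractM ractM tl_e'.
    pose k := lin_comp (Xi1 g) (lin_comp (ract_map T x) iP).
    transitivity (tr H (lin_comp th0 k)); last by congr (tr H); exact: linear_ext.
    rewrite (tr_comp _ th0E) !Ext_map_comp.
    transitivity (ad_Tr D (Ext_map (lin_comp inM (lin_comp p0 k)) idfun l)); last first.
      by congr (ad_Tr D _); apply: (congr2 (fun b g => Ext_map b g l)); exact: linear_ext.
    by rewrite ad_Tr_pt.
  + move=> g; apply: hb_ext => t; rewrite !homB_mapE /=; congr (_, _); first by rewrite linear0.
    by rewrite th1E.
  + move=> g; apply: hb_ext => t; rewrite !homB_mapE /=; congr (_, _); first by rewrite linear0.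
    by rewrite th2E'.
- have -> : Ext_map inM idfun (tau2_map (princ_pt e y) l) =
    Ext_map idfun s2 (Ext_map idfun dP yl).
    rewrite -[tau2_map _ l]/(Ext_map idfun (princ_pt e y) l) !Ext_map_comp.
    apply: (congr2 (fun b g => Ext_map b g l)); first exact: linear_ext.
    apply: linear_ext => x; rewrite /= yE -!linearZ_LR.
    by rewrite -(princ_genE (tl_ee H)).
  by apply: Rep_ext (Rep_push s2 sp) => k; rewrite linearN.
- by rewrite -linearZ_LR fl.
Qed.
End Theta.

(** * Global dimension of the endomorphism algebra *)

Section ExtPushKer.
Variables (K : fieldType) (A : kalgType K).
Variables (U V W : lmodType A) (u : {linear U -> V}) (v : {linear V -> W}).
Hypothesis uv : short_exact u v.
Lemma Ext_push_ker (X : lmodType A) n (x : Ext X V n.+1) : Ext_map idfun v x = 0 ->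
  exists x', Ext_map idfun u x' = x.
Proof.
move=> vx; have [c [xc mc dc]] := class_ofP x.
have [b mb cb] := (class_of_eq0 (class_of_map idfun v xc)).1 vx.
have [c1 [b2 [mc1 dc1 mb2 cE]]] := cocycle_factorr uv mc dc mb cb.
have [x' xc'] := class_of_exists mc1 dc1; exists x'.
apply/(class_of_eq (class_of_map idfun u xc') xc).
exists (0 - b2); first by apply: multilinearB => //; exact: multilinear0.
by rewrite [cmap _ _ _]cE addrAC subrr sub0r bar_dB bar_d0 sub0r.
Qed.
End ExtPushKer.

(* Triangular algebras: c B (1 - c) = 0 and c B c is a division ring.          *)
Section EPart.
Variables (K : fieldType) (B : kalgType K) (c : B).
Hypothesis cc : c * c = c.
Hypothesis cB : forall b, c * b = c * b * c.
Hypothesis cinv : forall x, c * x * c = x -> x <> 0 -> exists y, x * y = c /\ y * x = c.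
Implicit Types X Y U V W : lmodType B.

Section Object.
Variable X : lmodType B.
Lemma ep0 : c *: (0 : X) = 0. Proof. exact: scaler0. Qed.
Lemma epB (x y : X) : c *: x = x -> c *: y = y -> c *: (x - y) = x - y.
Proof. by move=> cx cy; rewrite scalerBr cx cy. Qed.
Definition ep_sub : addsub X := @AddSub X (fun x => c *: x = x) ep0 epB.
(** c X as the quotient of X by the submodule (1 - c) X. The hypotheses on c are arguments because
    the module structure depends on them. *)
Definition epart_of (h1 : c * c = c) (h2 : forall b, c * b = c * b * c) : Type :=
  subgrp ep_sub.
Local Notation epart := (epart_of cc cB).
HB.instance Definition _ := GRing.Zmodule.on epart.
Definition ep_val (x : epart) : X := val x.
Lemma ep_valP (x : epart) : c *: ep_val x = ep_val x.
Proof. exact: (elimT (as_memP ep_sub _) (valP x)). Qed.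
Definition ep_mk (x : X) (cx : c *: x = x) : epart :=
  exist _ x (introT (as_memP ep_sub x) cx).
Lemma ep_ext (x y : epart) : ep_val x = ep_val y -> x = y.
Proof. exact: val_inj. Qed.
Lemma ep_valD (x y : epart) : ep_val (x + y) = ep_val x + ep_val y.
Proof. by []. Qed.
Lemma ep_scaleP (b : B) (x : X) : c *: (c *: (b *: x)) = c *: (b *: x).
Proof. by rewrite scalerA cc. Qed.
Definition ep_scale (b : B) (x : epart) : epart := ep_mk (ep_scaleP b (ep_val x)).
Lemma ep_scaleA a b x : ep_scale a (ep_scale b x) = ep_scale (a * b) x.
Proof.
by apply: ep_ext; rewrite -[LHS]/(c *: (a *: (c *: (b *: ep_val x))))
  -[RHS]/(c *: ((a * b) *: ep_val x)) !scalerA !mulrA -cB.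
Qed.
Lemma ep_scale1 : left_id 1 ep_scale.
Proof.
by move=> x; apply: ep_ext; rewrite -[LHS]/(c *: (1 *: ep_val x)) scale1r ep_valP.
Qed.
Lemma ep_scaleDr : right_distributive ep_scale +%R.
Proof.
move=> b x y; apply: ep_ext.
by rewrite -[LHS]/(c *: (b *: (ep_val x + ep_val y))) !scalerDr.
Qed.
Lemma ep_scaleDl x : {morph ep_scale^~ x : a b / a + b}.
Proof.
move=> a b; apply: ep_ext.
by rewrite -[LHS]/(c *: ((a + b) *: ep_val x)) scalerDl scalerDr.
Qed.
HB.instance Definition _ := GRing.Zmodule_isLmodule.Build B epart
  ep_scaleA ep_scale1 ep_scaleDr ep_scaleDl.
Lemma ep_scaleE (b : B) (x : epart) : ep_val (b *: x) = c *: (b *: ep_val x).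
Proof. by []. Qed.
Lemma ep_projP (x : X) : c *: (c *: x) = c *: x.
Proof. by rewrite scalerA cc. Qed.
Lemma ep_proj_linear : linear (fun x => ep_mk (ep_projP x)).
Proof.
move=> b x y; apply: ep_ext; rewrite ep_valD ep_scaleE.
by rewrite -[LHS]/(c *: (b *: x + y)) -[ep_val (ep_mk (ep_projP x))]/(c *: x)
  -[ep_val (ep_mk _)]/(c *: y) scalerDr !scalerA -cB.
Qed.
Definition ep_proj : {linear X -> epart} := mklin ep_proj_linear.
Lemma ep_projE x : ep_val (ep_proj x) = c *: x. Proof. by []. Qed.
Lemma ep_proj_surj : surj ep_proj.
Proof. by move=> x; exists (ep_val x); apply: ep_ext; exact: ep_valP. Qed.
Lemma ep_proj_eq0 x : ep_proj x = 0 <-> c *: x = 0.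
Proof.
by split=> [h|h]; [exact: (congr1 ep_val h) | apply: ep_ext; exact: h].
Qed.
End Object.
Local Notation epart X := (epart_of X cc cB).
Definition efixed X := forall x : X, c *: x = x.
Lemma epart_fixed X : efixed (epart X).
Proof. by move=> x; apply: ep_ext; rewrite ep_scaleE !ep_valP. Qed.
Lemma efixed_acts X Y : efixed X -> efixed Y -> forall b : B,
  ((forall x : X, b *: x = 0) /\ (forall y : Y, b *: y = 0)) \/
  exists l, (forall x : X, l *: (b *: x) = x) /\ (forall y : Y, l *: (b *: y) = y).
Proof.
move=> fX fY b.
have act (Z : lmodType B) (z : Z) : efixed Z -> b *: z = (c * b * c) *: z.
  by move=> fZ; rewrite -!scalerA fZ fZ.
have [b0|b0] := pselect (c * b * c = 0).
  by left; split=> [x|y]; rewrite act // b0 scale0r.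
right; have [|l [_ lb]] := cinv _ b0; first by rewrite !mulrA cc -!mulrA cc.
by exists l; split=> [x|y]; rewrite act // scalerA lb ?fX ?fY.
Qed.
Lemma efixed_ginv X Y (h : {linear X -> Y}) : efixed X -> efixed Y ->
  exists g : {linear Y -> X}, forall x, h (g (h x)) = h x.
Proof. by move=> fX fY; apply: ginv; exact: efixed_acts. Qed.

Section EMap.
Variables (X Y : lmodType B) (h : {linear X -> Y}).
Lemma ep_mapP (x : epart X) : c *: h (ep_val x) = h (ep_val x).
Proof. by rewrite -linearZ_LR ep_valP. Qed.
Lemma ep_map_linear : linear (fun x => ep_mk (ep_mapP x)).
Proof.
move=> b x y; apply: ep_ext.
rewrite -[LHS]/(h (ep_val (b *: x + y))) -[RHS]/(c *: (b *: h (ep_val x)) + h (ep_val y)).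
by rewrite ep_valD ep_scaleE linearD !linearZ_LR.
Qed.
Definition ep_map : {linear epart X -> epart Y} := mklin ep_map_linear.
Lemma ep_mapE x : ep_val (ep_map x) = h (ep_val x). Proof. by []. Qed.
End EMap.
Lemma ep_fixed_val X : efixed X -> exists g : {linear epart X -> X}, forall x, g x = ep_val x.
Proof.
move=> fX; have gl : linear (@ep_val X).
  by move=> b x y; rewrite ep_valD ep_scaleE fX.
by exists (mklin gl).
Qed.
(** A map U -> W factors through c U, and an injection c U -> c V splits over the division ring c B
    c. *)
Lemma efixed_injective W : efixed W -> injective_mod W.
Proof.
move=> fW U V i h inj.
have [r rP] := efixed_ginv (ep_map i) (@epart_fixed U) (@epart_fixed V).
have [g gE] := ep_fixed_val fW.
exists (lin_comp g (lin_comp (ep_map h) (lin_comp r (ep_proj V)))) => u.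
have e1 : ep_proj V (i u) = ep_map i (ep_proj U u).
  by apply: ep_ext; rewrite ep_mapE !ep_projE linearZ_LR.
have rK x : r (ep_map i x) = x.
  apply: ep_ext; apply: inj; exact: (congr1 (@ep_val V) (rP x)).
apply: etrans (congr1 (fun x => g (ep_map h (r x))) e1) _.
by rewrite rK gE ep_mapE ep_projE linearZ_LR fW.
Qed.
Lemma efixed_sub X (S : submodule X) : efixed X -> efixed (smod S).
Proof. by move=> fX x; apply: val_inj; exact: fX. Qed.

(* A map which is an isomorphism on (1 - c)-parts induces isomorphisms on      *)
(* tau2, its kernel and cokernel being injective.                              *)
Section FIso.
Variables (U V : lmodType B) (phi : {linear U -> V}).
Hypothesis phi_inj : forall u, c *: u = 0 -> phi u = 0 -> u = 0.
Hypothesis phi_surj : forall v, c *: v = 0 -> exists u, phi u = v.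
Lemma fiso_tau2 : injective (tau2_map phi) /\ surj (tau2_map phi).
Proof.
have fker : efixed (smod (kersm phi)).
  move=> x; apply: val_inj; have px : phi (val x) = 0 := smodP x.
  have e1 : c *: val x - val x = 0 :> U.
    apply: phi_inj; first by rewrite scalerBr scalerA cc subrr.
    by rewrite linearB linearZ_LR px scaler0 subrr.
  exact: subr0_eq e1.
have [r rP] := efixed_ginv (ep_map phi) (@epart_fixed U) (@epart_fixed V).
(* [q] projects c V away from the image of c U. Since phi is onto on (1 - c)-parts, the kernel of
   [q] is the image of phi, so the cokernel of phi is fixed by c. *)
pose q : {linear V -> epart V} :=
  lin_comp (idfun - lin_comp (ep_map phi) r) (ep_proj V).
have qE v : q v = ep_proj V v - ep_map phi (r (ep_proj V v)) by [].
have qk v : q v = 0 <-> exists u, v = phi u.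
  split=> [|[u ->]]; last first.
    have -> : q (phi u) = ep_proj V (phi u) - ep_map phi (r (ep_proj V (phi u))) by [].
    have -> : ep_proj V (phi u) = ep_map phi (ep_proj U u).
      by apply: ep_ext; rewrite ep_mapE !ep_projE linearZ_LR.
    by rewrite rP subrr.
  rewrite qE => /eqP; rewrite subr_eq0 => /eqP/(congr1 (@ep_val V)).
  rewrite ep_mapE ep_projE => cv.
  have [u uE] : exists u, phi u = v - c *: v.
    by apply: phi_surj; rewrite scalerBr scalerA cc subrr.
  by exists (u + ep_val (r (ep_proj V v))); rewrite linearD uE -cv subrK.
have fq : efixed (smod (imsm q)) by apply: efixed_sub; exact: epart_fixed.
have ex1 : short_exact (@sm_incl _ _ (kersm phi)) (im_corestr phi).
  split; [exact: (@sm_incl_inj _ _ (kersm phi)) | exact: im_corestr_surj |].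
  move=> u; rewrite im_corestr_eq0; split=> [pu|[x ->]]; last exact: (smodP x).
  by exists (@smk _ _ (kersm phi) u pu).
have ex2 : short_exact (@sm_incl _ _ (imsm phi)) (im_corestr q).
  split; [exact: (@sm_incl_inj _ _ (imsm phi)) | exact: im_corestr_surj |].
  move=> v; rewrite im_corestr_eq0 qk; split=> [h|[x ->]]; last exact: (smodP x).
  by exists (@smk _ _ (imsm phi) v h).
have xker n X := @injective_xv K B n X _ (efixed_injective fker).
have xq n X := @injective_xv K B n X _ (efixed_injective fq).
have phiE x : tau2_map phi x = Ext_map idfun (@sm_incl _ _ (imsm phi)) (Ext_map idfun (im_corestr phi) x).
  rewrite Ext_map_comp -[LHS]/(Ext_map idfun phi x).
  by apply: (congr2 (fun b g => Ext_map b g x)); exact: linear_ext.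
split.
  have inj0 x : tau2_map phi x = 0 -> x = 0.
    rewrite phiE => /(Ext_push_inj ex2 (xq 0%N _)) h.
    have [y <-] := Ext_push_ker ex1 h.
    by have /xvP x0 := xker 1%N (dual_mod B); rewrite [y]x0 Ext_map0.
  by move=> x y e; apply: subr0_eq; apply: inj0; rewrite linearB e subrr.
move=> y; have [|x' x'E] := Ext_push_ker ex2 (x := y).
  by have /xvP := xq 1%N (dual_mod B); apply.
have [x xE] := Ext_push_surj ex1 x' (xker 2%N _).
by exists x; rewrite phiE xE.
Qed.
End FIso.
End EPart.

Section TiltGlobalDimension.
Variables (K : fieldType) (A A' : kalgType K) (e : A) (e' : A') (H : tilt e e').
Local Notation f := (1 - e).
Local Notation f' := (1 - e').
Local Notation Z := (tau2 (princ e)).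
Local Notation T := (tl_T H).
Local Notation D := (tl_D H).
Local Notation iP := (tl_iP H).
Local Notation pP := (tl_pP H).
Local Notation pF := (tl_pF H).
Local Notation iF := (tl_iF H).
Local Notation G := (homB T).
Local Notation Gmap := (homB_map T).
Local Notation tf := (tf H).
Local Notation ff := (tl_ff H).
Local Notation ep X := (epart_of X (tl_e'e' H) (tl_e'b H)).
Local Notation ep_proj := (ep_proj (tl_e'e' H) (tl_e'b H)).
(** f A f and f' A' f' are the same algebra, the opposite endomorphism ring of A f. [alpha] and
    [sigma] map A' and A to these corners, multiplicatively because both algebras are triangular. *)
Definition alpha (b : A') : A := val (pF (ract tf b)).
Lemma f_alpha b : f * alpha b = alpha b.
Proof.
exact: (congr1 val (etrans (esym (linearZ_LR pF f (ract tf b))) (congr1 pF (act_f_elt H b)))).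
Qed.
Lemma alphaD a b : alpha (a + b) = alpha a + alpha b.
Proof. by rewrite /alpha ractDr linearD. Qed.
Lemma alpha1 : alpha 1 = f.
Proof. by rewrite /alpha ract1 tl_pFK val_princ_gen. Qed.
Lemma alpha_e' : alpha e' = 0.
Proof. by have := tf_e'b H 1; rewrite mulr1 /alpha => ->; rewrite linear0. Qed.
Lemma alphaM a b : alpha (a * b) = alpha a * alpha b.
Proof.
rewrite /alpha ractM -{1}(tl_split (ract tf a)) ractDl linearD.
rewrite -[pF (ract (iP _) b)]/(lin_comp pF (lin_comp (ract_map T b) iP) _).
rewrite (homZF H (lin_comp pF (lin_comp (ract_map T b) iP))) add0r.
by rewrite -(tf_act _ (pF (ract tf a))) ractZ linearZ_LR.
Qed.
Definition sigma (a : A) : A' := tbeta (a *: tf).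
Lemma sigmaE a (x : T) : ract x (sigma a) = ((val (pF x) : A) * a) *: tf.
Proof. by rewrite tbetaE scalerA. Qed.
Lemma f_mid (x y : A) : f * x * y = f * x * f * y.
Proof. by rewrite [in RHS]mulrBr mulr1 (tl_fae H) subr0. Qed.
Lemma f_midr (x y : A) : f * (x * (f * y)) = f * (x * y).
Proof. by rewrite !mulrA -f_mid. Qed.
Lemma sigmaD a b : sigma (a + b) = sigma a + sigma b.
Proof. by apply: (@tl_faith _ _ _ _ _ H) => x; rewrite ractDr !sigmaE mulrDr scalerDl. Qed.
Lemma sigmaM a b : sigma (a * b) = sigma a * sigma b.
Proof.
apply: (@tl_faith _ _ _ _ _ H) => x; rewrite ractM !sigmaE linearZ_LR /tf tl_pFK.
rewrite -[val (_ *: _)]/((val (pF x) : A) * a * val (princ_gen f)) val_princ_gen.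
have := princ_mulc ff (pF x); set v : A := val _ => vf.
by rewrite -vf -!mulrA f_midr.
Qed.
Lemma sigma1 : sigma 1 = f'.
Proof.
apply: (@tl_faith _ _ _ _ _ H) => x.
by rewrite sigmaE mulr1 tf_act tl_f'.
Qed.
Lemma sigma_alpha b : sigma (alpha b) = f' * b * f'.
Proof.
apply: (@tl_faith _ _ _ _ _ H) => x; rewrite sigmaE -scalerA tf_act !ractM [RHS]tl_f' tl_f'.
by rewrite -(tf_act _ (pF x)) ractZ !linearZ_LR.
Qed.
Lemma alpha_sigma a : alpha (sigma a) = f * a * f.
Proof.
rewrite /alpha sigmaE tl_pFK val_princ_gen linearZ_LR /tf tl_pFK.
by rewrite -[LHS]/(f * a * val (princ_gen f)) val_princ_gen.
Qed.

(* Modules over A' supported at f', as A-modules, and conversely.              *)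
Section FPart.
Variable N : lmodType A.
Lemma fp0 : f *: (0 : N) = 0. Proof. exact: scaler0. Qed.
Lemma fpB (x y : N) : f *: x = x -> f *: y = y -> f *: (x - y) = x - y.
Proof. by move=> fx fy; rewrite scalerBr fx fy. Qed.
Definition fp_sub : addsub N := @AddSub N (fun x => f *: x = x) fp0 fpB.
Definition fpart_of (h : tilt e e') : Type := subgrp fp_sub.
Local Notation fpart := (fpart_of H).
HB.instance Definition _ := GRing.Zmodule.on fpart.
Definition fp_val (x : fpart) : N := val x.
Lemma fp_valP (x : fpart) : f *: fp_val x = fp_val x.
Proof. exact: (elimT (as_memP fp_sub _) (valP x)). Qed.
Definition fp_mk (x : N) (fx : f *: x = x) : fpart :=
  exist _ x (introT (as_memP fp_sub x) fx).
Lemma fp_ext (x y : fpart) : fp_val x = fp_val y -> x = y.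
Proof. exact: val_inj. Qed.
Lemma fp_scaleP (b : A') (x : N) : f *: (alpha b *: x) = alpha b *: x.
Proof. by rewrite scalerA f_alpha. Qed.
Definition fp_scale (b : A') (x : fpart) : fpart := fp_mk (fp_scaleP b (fp_val x)).
Lemma fp_scaleA a b x : fp_scale a (fp_scale b x) = fp_scale (a * b) x.
Proof.
by apply: fp_ext; rewrite -[LHS]/(alpha a *: (alpha b *: fp_val x)) scalerA -alphaM.
Qed.
Lemma fp_scale1 : left_id 1 fp_scale.
Proof.
by move=> x; apply: fp_ext; rewrite -[LHS]/(alpha 1 *: fp_val x) alpha1 fp_valP.
Qed.
Lemma fp_scaleDr : right_distributive fp_scale +%R.
Proof.
move=> b x y; apply: fp_ext.
by rewrite -[LHS]/(alpha b *: (fp_val x + fp_val y)) scalerDr.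
Qed.
Lemma fp_scaleDl x : {morph fp_scale^~ x : a b / a + b}.
Proof.
move=> a b; apply: fp_ext.
by rewrite -[LHS]/(alpha (a + b) *: fp_val x) alphaD scalerDl.
Qed.
HB.instance Definition _ := GRing.Zmodule_isLmodule.Build A' fpart
  fp_scaleA fp_scale1 fp_scaleDr fp_scaleDl.
Lemma fp_scaleE (b : A') (x : fpart) : fp_val (b *: x) = alpha b *: fp_val x.
Proof. by []. Qed.
Lemma fp_valD (x y : fpart) : fp_val (x + y) = fp_val x + fp_val y.
Proof. by []. Qed.
Lemma fp_projP (x : N) : f *: (f *: x) = f *: x.
Proof. by rewrite scalerA ff. Qed.
End FPart.
Local Notation Ff N := (fpart_of N H).

Section FpMap.
Variables (N N' : lmodType A) (h : {linear N -> N'}).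
Lemma fp_mapP (x : Ff N) : f *: h (fp_val x) = h (fp_val x).
Proof. by rewrite -linearZ_LR fp_valP. Qed.
Lemma fp_map_linear : linear (fun x : Ff N => fp_mk (fp_mapP x)).
Proof.
move=> b x y; apply: fp_ext.
by rewrite -[LHS]/(h (alpha b *: fp_val x + fp_val y)) linearP.
Qed.
Definition fp_map : {linear Ff N -> Ff N'} := mklin fp_map_linear.
Lemma fp_mapE x : fp_val (fp_map x) = h (fp_val x). Proof. by []. Qed.
End FpMap.
Lemma fp_exact (U V W : lmodType A) (u : {linear U -> V}) (v : {linear V -> W}) :
  short_exact u v -> short_exact (fp_map u) (fp_map v).
Proof.
move=> [ui vs vk]; split.
- by move=> x y /(congr1 (@fp_val _)) h; apply: fp_ext; exact: ui.
- move=> w; have [x xE] := vs (fp_val w); exists (fp_mk (fp_projP x)).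
  by apply: fp_ext; rewrite fp_mapE -[fp_val _]/(f *: x) linearZ_LR xE fp_valP.
- move=> x; split=> [/(congr1 (@fp_val _)) vx|[y ->]]; last first.
    by apply: fp_ext; apply/vk; exists (fp_val y).
  have /vk[y yE] : v (fp_val x) = 0 := vx.
  exists (fp_mk (fp_projP y)); apply: fp_ext.
  by rewrite fp_mapE -[fp_val (fp_mk _)]/(f *: y) linearZ_LR -yE fp_valP.
Qed.

Section Inflate.
Variable X : lmodType A'.
Lemma if0 : e' *: (0 : X) = 0. Proof. exact: scaler0. Qed.
Lemma ifB (x y : X) : e' *: x = 0 -> e' *: y = 0 -> e' *: (x - y) = 0.
Proof. by move=> fx fy; rewrite scalerBr fx fy subrr. Qed.
Definition if_sub : addsub X := @AddSub X (fun x => e' *: x = 0) if0 ifB.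
Definition inflate_of (h : tilt e e') : Type := subgrp if_sub.
Local Notation inflate := (inflate_of H).
HB.instance Definition _ := GRing.Zmodule.on inflate.
Definition if_val (x : inflate) : X := val x.
Lemma if_valP (x : inflate) : e' *: if_val x = 0.
Proof. exact: (elimT (as_memP if_sub _) (valP x)). Qed.
Definition if_mk (x : X) (fx : e' *: x = 0) : inflate :=
  exist _ x (introT (as_memP if_sub x) fx).
Lemma if_ext (x y : inflate) : if_val x = if_val y -> x = y.
Proof. exact: val_inj. Qed.
Lemma if_scaleP (b : A') (x : X) : e' *: x = 0 -> e' *: (b *: x) = 0.
Proof. by move=> ex; rewrite scalerA (tl_e'b H) -scalerA ex scaler0. Qed.
Lemma if_fix (x : inflate) : f' *: if_val x = if_val x.
Proof. by rewrite scalerBl scale1r if_valP subr0. Qed.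
Definition if_scale (a : A) (x : inflate) : inflate :=
  if_mk (if_scaleP (sigma a) (if_valP x)).
Lemma if_scaleA a b x : if_scale a (if_scale b x) = if_scale (a * b) x.
Proof.
by apply: if_ext; rewrite -[LHS]/(sigma a *: (sigma b *: if_val x)) scalerA -sigmaM.
Qed.
Lemma if_scale1 : left_id 1 if_scale.
Proof.
by move=> x; apply: if_ext; rewrite -[LHS]/(sigma 1 *: if_val x) sigma1 if_fix.
Qed.
Lemma if_scaleDr : right_distributive if_scale +%R.
Proof.
move=> b x y; apply: if_ext.
by rewrite -[LHS]/(sigma b *: (if_val x + if_val y)) scalerDr.
Qed.
Lemma if_scaleDl x : {morph if_scale^~ x : a b / a + b}.
Proof.
move=> a b; apply: if_ext.
by rewrite -[LHS]/(sigma (a + b) *: if_val x) sigmaD scalerDl.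
Qed.
HB.instance Definition _ := GRing.Zmodule_isLmodule.Build A inflate
  if_scaleA if_scale1 if_scaleDr if_scaleDl.
Lemma if_scaleE (a : A) (x : inflate) : if_val (a *: x) = sigma a *: if_val x.
Proof. by []. Qed.
Lemma if_valD (x y : inflate) : if_val (x + y) = if_val x + if_val y.
Proof. by []. Qed.
Lemma e'f' : e' * f' = 0. Proof. by rewrite mulrBr mulr1 (tl_e'e' H) subrr. Qed.
Lemma if_projP (x : X) : e' *: (f' *: x) = 0.
Proof. by rewrite scalerA e'f' scale0r. Qed.
End Inflate.
Local Notation Hf X := (inflate_of X H).

Section InflateMap.
Variables (X Y : lmodType A') (h : {linear X -> Y}).
Lemma if_mapP (x : Hf X) : e' *: h (if_val x) = 0.
Proof. by rewrite -linearZ_LR if_valP linear0. Qed.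
Lemma if_map_linear : linear (fun x : Hf X => if_mk (if_mapP x)).
Proof.
move=> b x y; apply: if_ext.
by rewrite -[LHS]/(h (sigma b *: if_val x + if_val y)) linearP.
Qed.
Definition if_map : {linear Hf X -> Hf Y} := mklin if_map_linear.
Lemma if_mapE x : if_val (if_map x) = h (if_val x). Proof. by []. Qed.
End InflateMap.
Lemma f_act_fp (N : lmodType A) (a : A) (n : N) : f *: (a *: n) = (f * a * f) *: n.
Proof. by rewrite scalerA -[f * a in LHS]mulr1 f_mid mulr1. Qed.
(** By adjunction: A'-linear maps from f N to V correspond to A-linear maps from N to the inflation
    of the f'-part of V, and inflation preserves surjections. *)
Lemma fp_projective (N : lmodType A) : projective_mod N -> projective_mod (Ff N).
Proof.
move=> pN U V p phi ps.
have ps' : surj (if_map p).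
  move=> v; have [u uE] := ps (if_val v); exists (if_mk (if_projP u)).
  by apply: if_ext; rewrite if_mapE -[if_val _]/(f' *: u) linearZ_LR uE if_fix.
have phiP (n : N) : e' *: phi (fp_mk (fp_projP n)) = 0.
  rewrite -linearZ_LR (_ : e' *: _ = 0) ?linear0 //; apply: fp_ext.
  by rewrite fp_scaleE alpha_e' scale0r.
have pl : linear (fun n : N => if_mk (phiP n)).
  move=> a x y; apply: if_ext; rewrite if_valD if_scaleE.
  rewrite -[LHS]/(phi (fp_mk (fp_projP (a *: x + y)))) -linearP; congr (phi _).
  apply: fp_ext; rewrite fp_valD fp_scaleE alpha_sigma.
  rewrite -[LHS]/(f *: (a *: x + y)) -[fp_val (fp_mk _)]/(f *: x) scalerDr f_act_fp.
  by rewrite -[in RHS]scalerA [f *: (f *: x)]scalerA ff scalerA.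
have [psi psiE] := pN _ _ (if_map p) (mklin pl) ps'.
have ql : linear (fun n : Ff N => if_val (psi (fp_val n))).
  move=> b x y; rewrite fp_valD fp_scaleE linearP if_valD if_scaleE; congr (_ + _).
  rewrite sigma_alpha -!scalerA if_fix scalerBl scale1r.
  by rewrite if_scaleP ?if_valP // subr0.
exists (mklin ql) => n.
have := congr1 (@if_val _) (psiE (fp_val n)); rewrite if_mapE => h.
rewrite [LHS]h -[LHS]/(phi (fp_mk (fp_projP (fp_val n)))); congr (phi _).
by apply: fp_ext; exact: fp_valP.
Qed.
Lemma fp_projdim n (N : lmodType A) : projdim_le n N -> projdim_le n (Ff N).
Proof.
elim: n N => [|n IHn] N; first exact: fp_projective.
move=> [U [V [u [v [pV uv pU]]]]].
exists (Ff U), (Ff V), (fp_map u), (fp_map v); split; [|exact: fp_exact|exact: IHn].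
exact: fp_projective.
Qed.
Lemma fsub_smP (X : lmodType A') (a : A') (x y : X) :
  e' *: x = 0 -> e' *: y = 0 -> e' *: (a *: x + y) = 0.
Proof. by move=> ex ey; rewrite scalerDr ey if_scaleP // addr0. Qed.
Definition fsub (X : lmodType A') : submodule X :=
  @Submodule A' X (fun x => e' *: x = 0) (if0 X) (@fsub_smP X).
(** A module killed by e' is the f-part of its own inflation to A, and taking f-parts does not raise
    projective dimension. *)
Lemma xv_fsub (X Y : lmodType A') : xv 2 (smod (fsub X)) Y.
Proof.
have x2 : xv 2 (Ff (Hf X)) Y.
  by apply: projdim_xv; apply: fp_projdim; apply: xv_projdim => N; exact: tl_gl H _ _.
have iP' (x : smod (fsub X)) : f *: if_mk (smodP x) = if_mk (smodP x) :> Hf X.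
  apply: if_ext; rewrite if_scaleE -[RHS]if_fix; congr (_ *: _).
  rewrite /sigma f_tf -[tf]scale1r; exact: sigma1.
have il : linear (fun x : smod (fsub X) => fp_mk (iP' x) : Ff (Hf X)).
  move=> b x y; apply: fp_ext; apply: if_ext; rewrite fp_valD fp_scaleE if_valD if_scaleE.
  rewrite -[LHS]/(b *: val x + val y) -[if_val (fp_val _)]/(val x) sigma_alpha.
  rewrite -!scalerA (_ : f' *: val x = val x); last exact: (if_fix (if_mk (smodP x))).
  by rewrite scalerBl scale1r if_scaleP ?subr0 //; exact: (smodP x).
have rl : linear (fun x : Ff (Hf X) => smk (S := fsub X) (if_valP (fp_val x))).
  move=> b x y; apply: val_inj; rewrite /= .
  rewrite -[LHS]/(if_val (fp_val (b *: x + y))) fp_valD fp_scaleE if_valD if_scaleE sigma_alpha.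
  rewrite -!scalerA if_fix scalerBl scale1r if_scaleP ?if_valP // subr0 //.
apply: (xv_retractl (i := mklin il) (r := mklin rl)) x2 => x.
exact: val_inj.
Qed.
(** Maps A f -> tau P lift to P2, while maps tau P -> P2 are zero; so the cokernel of Hom(T, P2) ->
    Hom(T, tau P) is the e'-part, which thus has projective dimension at most 2. *)
Lemma Gmap_exact_epart :
  exact2 (Gmap (ad_d1 D)) (Gmap (ad_vp D)) (ep_proj (G Z)).
Proof.
have [vs vk _ _] := ad_exact D.
split; first exact: ep_proj_surj.
- move=> g; rewrite ep_proj_eq0; split=> [eg|[g' ->]].
    have [u uE] := princ_projective ff (lin_comp (hb_fun g) iF) vs.
    exists (lin_comp u pF : G _); apply: hb_ext => t; rewrite homB_mapE /= uE.
    rewrite -{1}(tl_split t) linearD -[hb_fun g (iP _)]/(hb_fun g (iP (pP t))).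
    have := congr1 (fun k : G Z => hb_fun k t) eg; rewrite hb_scaleE tl_e' => ->.
    by rewrite add0r.
  apply: hb_ext => t; rewrite hb_scaleE homB_mapE tl_e'.
  rewrite -[hb_fun g' (iP _)]/(lin_comp (hb_fun g') iP (pP t)).
  by rewrite (homZ_summand H (lin_comp (hb_fun g') iP) (ad_s2 D)) linear0.
- move=> g; split=> [vg|[g' ->]].
    have [|g' g'E] := @liftP1 _ _ _ _ _ H (hb_fun g).
      by move=> t; exact: (congr1 (fun k : G Z => hb_fun k t) vg).
    by exists (g' : G _); apply: hb_ext => t; rewrite homB_mapE g'E.
  by apply: hb_ext => t; rewrite !homB_mapE; apply/vk; eexists; reflexivity.
- move=> g g' gg; have z0 : hb_fun g - hb_fun g' = 0.
    apply: (d1P_inj (H := H)) => t; apply: etrans (linearB (ad_d1 D) _ _) _.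
    by rewrite -[ad_d1 D _]homB_mapE gg subrr.
  apply: hb_ext => t; apply: subr0_eq.
  exact: (congr1 (fun k : {linear T -> ad_P1 D} => k t) z0).
Qed.
Lemma xv_epG (Y : lmodType A') : xv 2 (ep (G Z)) Y.
Proof.
have sTP : summand T (ad_P1 D) by apply: summand_trans (ad_s1 D); exact: summand_TF.
have sTP2 : summand T (ad_P2 D) by apply: summand_trans (ad_s2 D); exact: summand_TF.
have p1 := Gproj sTP; have p2 := Gproj sTP2; have pZ := Gproj (summand_TZ H).
apply: (xvl_quo (exact2_bottom Gmap_exact_epart)); last exact: projective_xv.
by apply: (xvl_quo (exact2_top Gmap_exact_epart)); exact: projective_xv.
Qed.
(** X is an extension of its e'-part by the submodule killed by e'. The e'-part W is a vector space
    over the division ring e' A' e', hence a direct summand of S0 (x)_K W, where S0 is the module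
    resolved in [Gmap_exact_epart]. *)
Lemma tilt_gldim (X Y : lmodType A') : xv 2 X Y.
Proof.
pose W : lmodType A' := ep X.
have fW := @epart_fixed _ _ e' (tl_e'e' H) (tl_e'b H) X.
pose S0 : lmodType A' := ep (G Z).
have fS := @epart_fixed _ _ e' (tl_e'e' H) (tl_e'b H) (G Z).
have ex : short_exact (@sm_incl _ _ (fsub X)) (ep_proj X).
  split; [exact: (@sm_incl_inj _ _ (fsub X)) | exact: ep_proj_surj |].
  move=> x; rewrite ep_proj_eq0; split=> [h|[y ->]]; last exact: (smodP y).
  by exists (@smk _ _ (fsub X) x h).
apply: (xvl_mid ex); first exact: xv_fsub.
(* Hom(T, T) is the regular A'-module; through it, elements of Hom(T, tau P) can be multiplied with
   elements of W. *)
have jl : linear (fun b : A'^o => ract_map T b : G T).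
  by move=> a b b'; apply: hb_ext => t; rewrite hb_addE hb_scaleE /= ractDr ractM.
have [||j [jK Kj]] := @linear_inverse _ _ _ (mklin jl).
- by move=> b b' bb; apply: (@tl_faith _ _ _ _ _ H) => t; exact: (congr1 (fun k : G T => hb_fun k t) bb).
- by move=> g; have [b bE] := homT_ract (hb_fun g); exists b; rewrite [RHS]bE.
pose jZ : {linear G Z -> A'^o} := lin_comp j (Gmap iP).
pose h (s : S0) (w : restr_scal W) : W := (jZ (ep_val (s : ep (G Z))) : A') *: (w : W).
have hA (b : A') s w : h (b *: s) w = b *: h s w.
  rewrite /h ep_scaleE !linearZ_LR -!scalerA.
  by rewrite -[RHS]fW.
have hX w : klinear (h^~ w).
  move=> k s s'; rewrite -[RHS]/(_ *: h s w + h s' w) -hA.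
  by rewrite /h ep_valD linearD scalerDl.
have hV s (k : K) (u v : restr_scal W) : h s (k *: u + v) = (scal k : A') *: h s u + h s v.
  by rewrite /h scalerDr !scalerA -scalC -scalerA.
pose act : {linear ktens S0 (restr_scal W) -> W} := 
  mklin (@kt_lift_linear _ _ _ _ _ h hX hV hA).
have fST : efixed e' (ktens S0 (restr_scal W)).
  move=> x; elim/kpt_ind: x => [|s w|p q hp hq]; first exact: scaler0.
    by rewrite kptZ fS.
  by rewrite scalerDr hp hq.
have [r rP] := efixed_ginv (tl_e'e' H) (@corner_inv' _ _ _ _ _ H) act fST fW.
have act_s : surj act.
  move=> w; have ps : e' *: (pP : G Z) = pP.
    by apply: hb_ext => t; rewrite hb_scaleE tl_e' tl_pPK.
  exists (kpt (ep_mk (tl_e'e' H) (tl_e'b H) ps : S0) (w : restr_scal W)).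
  apply: etrans (@kt_liftE _ _ _ _ _ h hX hV _ _) _; rewrite /h.
  have -> : jZ (ep_val (ep_mk (tl_e'e' H) (tl_e'b H) ps)) = e'.
    rewrite -[RHS]jK; congr (j _); apply: hb_ext => t.
    by rewrite homB_mapE /= tl_e'.
  exact: fW.
apply: (xv_retractl (i := r) (r := act)); last by apply: xv_ktens; exact: xv_epG.
by move=> w; have [x <-] := act_s w; rewrite rP.
Qed.
End TiltGlobalDimension.

(** * The preprojective algebra *)

Section Via.
Variables (K : fieldType) (B R : kalgType K) (i : B -> R) (hi : kalg_hom i).
Lemma hom_add x y : i (x + y) = i x + i y. Proof. by have [h _ _] := hi. Qed.
Lemma hom_mul x y : i (x * y) = i x * i y. Proof. by have [_ h _] := hi. Qed.
Lemma hom_scal (k : K) : i (scal k) = scal k. Proof. by have [_ _ h] := hi. Qed.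
Lemma hom_1 : i 1 = 1. Proof. by rewrite -(@scal1 K B) hom_scal scal1. Qed.
Lemma hom_0 : i 0 = 0. Proof. by apply: (addrI (i 0)); rewrite -hom_add !addr0. Qed.
Lemma hom_opp x : i (- x) = - i x.
Proof. by apply: (addrI (i x)); rewrite -hom_add !subrr hom_0. Qed.
Lemma hom_sub x y : i (x - y) = i x - i y. Proof. by rewrite hom_add hom_opp. Qed.
Definition via_of (h : kalg_hom i) : Type := R.
Local Notation via := (via_of hi).
HB.instance Definition _ := GRing.Zmodule.on via.
Definition via_scale (b : B) (u : via) : via := i b * (u : R).
Lemma via_scaleA a b u : via_scale a (via_scale b u) = via_scale (a * b) u.
Proof. by rewrite /via_scale hom_mul mulrA. Qed.
Lemma via_scale1 : left_id 1 via_scale.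
Proof. by move=> u; rewrite /via_scale hom_1 mul1r. Qed.
Lemma via_scaleDr : right_distributive via_scale +%R.
Proof. by move=> b u v; exact: mulrDr. Qed.
Lemma via_scaleDl u : {morph via_scale^~ u : a b / a + b}.
Proof. by move=> a b; rewrite /via_scale hom_add; exact: mulrDl. Qed.
HB.instance Definition _ := GRing.Zmodule_isLmodule.Build B via
  via_scaleA via_scale1 via_scaleDr via_scaleDl.
Lemma via_scaleE (b : B) (u : via) : b *: u = i b * (u : R) :> R. Proof. by []. Qed.
End Via.

Section PiDegrees.
Variables (K : fieldType) (A : kalgType K).
Local Notation Tn n := (tau2_iter n (A^o : lmodType A)).
Local Notation R := (pi3 A).
Implicit Types u v w : R.
(** A map out of A is its value at 1, so R_n is identified with tau^n A. *)
Definition ev n u : Tn n := u n (1 : A^o).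
Lemma pi3_ptE n u (a : A) : u n (a : A^o) = a *: ev n u.
Proof. by rewrite -linearZ_LR /=; congr (u n _); rewrite -[RHS]/(a * 1) mulr1. Qed.
Lemma pi3_ext u v : (forall n, ev n u = ev n v) -> u = v.
Proof.
move=> h; apply: dprodP => n; apply: linear_ext => a; rewrite !(pi3_ptE n _ (a : A)).
by rewrite h.
Qed.
Lemma evD n u v : ev n (u + v) = ev n u + ev n v. Proof. by []. Qed.
Lemma evB n u v : ev n (u - v) = ev n u - ev n v. Proof. by []. Qed.
Lemma ev_sum n (I : Type) (r : seq I) (P : pred I) (F : I -> R) :
  ev n (\sum_(k <- r | P k) F k) = \sum_(k <- r | P k) ev n (F k).
Proof. by apply: (big_morph (ev n)). Qed.
Lemma ev_mul n u v : ev n (u * v) = \sum_(i < n.+1) tau2_comp v i n (ev i u).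
Proof. exact: lin_sumE. Qed.
Lemma pt_linear n (x : Tn n) : linear (fun a : A^o => (a : A) *: x).
Proof. by move=> a b c; rewrite scalerDl scalerA. Qed.
Definition pin n (x : Tn n) : R := fun m =>
  match n =P m with
  | ReflectT E => eq_rect n (fun k => {linear A^o -> Tn k}) (mklin (pt_linear x)) m E
  | ReflectF _ => 0
  end.
Lemma ev_pin n (x : Tn n) : ev n (pin x) = x.
Proof.
rewrite /ev /pin; case: eqP => // E; rewrite (eq_axiomK E) /=; exact: scale1r.
Qed.
Lemma ev_pin0 n m (x : Tn n) : n <> m -> ev m (pin x) = 0.
Proof. by move=> nm; rewrite /ev /pin; case: eqP. Qed.
Definition homog n u := forall m, m <> n -> ev m u = 0.
Lemma homog_pin n x : homog n (@pin n x).
Proof. by move=> m mn; apply: ev_pin0 => h; apply: mn. Qed.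
Lemma homogE n u : homog n u -> u = pin (ev n u).
Proof.
move=> hu; apply: pi3_ext => m; case: (eqVneq m n) => [->|/eqP mn]; first by rewrite ev_pin.
by rewrite hu // ev_pin0 // => h; apply: mn.
Qed.
Lemma homogD n u v : homog n u -> homog n v -> homog n (u + v).
Proof. by move=> hu hv m mn; rewrite evD hu // hv // addr0. Qed.
Lemma pin_linear n : forall (a : A) (x y : Tn n) m,
  ev m (pin (a *: x + y)) = a *: ev m (pin x) + ev m (pin y).
Proof.
move=> a x y m; case: (eqVneq n m) => [<-|/eqP nm]; first by rewrite !ev_pin.
by rewrite !ev_pin0 // scaler0 addr0.
Qed.
(* Elements of degree n - 1, hence 0 for n = 0.                                *)
Definition homogp n u := forall m, m.+1 <> n -> ev m u = 0.
Lemma homogp_pred n u : homogp n.+1 u <-> homog n u.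
Proof. by split=> h m mn; apply: h; [move=> [] | move=> E; apply: mn; rewrite E]. Qed.
Lemma homogp0 u : homogp 0 u -> u = 0.
Proof. by move=> h; apply: pi3_ext => m; apply: h. Qed.
Lemma ev_homog_mul i k u v : homog i u -> ev k (u * v) = tau2_comp v i k (ev i u).
Proof.
move=> hu; rewrite ev_mul; case: (ltnP k i) => ik.
  rewrite tau2_comp_low // big1 // => j _; rewrite hu ?linear0 //.
  by move=> E; have := ltn_ord j; rewrite E ltnS leqNgt ik.
rewrite (bigD1 (Ordinal (ik : (i < k.+1)%N))) //= big1 ?addr0 // => j ji.
by rewrite hu ?linear0 // => E; case/eqP: ji; exact: val_inj.
Qed.
Lemma tau2_comp_eq0 v i k : (forall m, (m + i)%N = k -> v m = 0) -> tau2_comp v i k = 0.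
Proof.
elim: i k => [|i IHi] k h; first by case: k h => [|k] h; apply: h; rewrite addn0.
case: k h => [|k] h //=.
by rewrite IHi ?tau2_map0 // => m mk; apply: h; rewrite addnS mk.
Qed.
Lemma homog_eq0 j v m : homog j v -> m <> j -> v m = 0.
Proof.
move=> hv mj; apply: linear_ext => a; rewrite (pi3_ptE m v (a : A)) hv //.
exact: scaler0.
Qed.
Lemma homog_mul i j u v : homog i u -> homog j v -> homog (i + j) (u * v).
Proof.
move=> hu hv k kij; rewrite (ev_homog_mul _ _ hu) tau2_comp_eq0 // => m mk.
by apply: (homog_eq0 hv) => E; apply: kij; rewrite -mk E addnC.
Qed.
Lemma homogp_mul i j u v : homog i u -> homogp j v -> homogp (i + j) (u * v).
Proof.
case: j => [|j] hu; first by move/homogp0 ->; rewrite mulr0.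
by move/homogp_pred => hv; rewrite addnS; apply/homogp_pred; exact: homog_mul.
Qed.
Lemma homogp_mull i j u v : homogp i u -> homog j v -> homogp (i + j) (u * v).
Proof.
case: i => [|i]; first by move/homogp0 -> => _; rewrite mul0r.
by move/homogp_pred => hu hv; rewrite addSn; apply/homogp_pred; exact: homog_mul.
Qed.
Lemma homogp_mulS i j u v : homog i.+1 u -> homogp j v -> homog (i + j) (u * v).
Proof. by move=> hu hv; apply/homogp_pred; rewrite -addSn; exact: homogp_mul. Qed.
Lemma homogp_mulSl i j u v : homogp i u -> homog j.+1 v -> homog (i + j) (u * v).
Proof. by move=> hu hv; apply/homogp_pred; rewrite -addnS; exact: homogp_mull. Qed.
Lemma homogpD n u v : homogp n u -> homogp n v -> homogp n (u + v).
Proof. by move=> hu hv m mn; rewrite evD hu // hv // addr0. Qed.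
Lemma rmulA_linear (a : A) : linear (fun x : A^o => (x : A) * a : A^o).
Proof. by move=> b x y; rewrite [LHS]mulrDl -mulrA. Qed.
Definition rmulA a : {linear A^o -> A^o} := mklin (rmulA_linear a).
(** The product reverses composition, so right multiplications embed A as the degree 0 part. *)
Definition iA (a : A) : R := pi3_deg0 (rmulA a).
Lemma iA_mulE a u n : ev n (iA a * u) = a *: ev n u.
Proof.
rewrite /ev; have -> : (iA a * u) n = lin_comp (u n) (rmulA a) := pi3_mul_deg0 _ u n.
by rewrite -[LHS]/(u n (1 * a : A^o)) mul1r (pi3_ptE n u a).
Qed.
Lemma iA_ev0 a : ev 0 (iA a) = a. Proof. exact: mul1r. Qed.
Lemma homog_iA a : homog 0 (iA a). Proof. by case. Qed.
Lemma iAE u : homog 0 u -> u = iA (ev 0 u).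
Proof. by move=> hu; apply: pi3_ext => -[|n]; [rewrite iA_ev0 | rewrite hu]. Qed.
Lemma iA_hom : kalg_hom iA.
Proof.
split=> [x y|x y|k].
- by apply: pi3_ext => -[|n]; [exact: mulrDr | exact: (esym (addr0 _))].
- apply: pi3_ext => n; rewrite iA_mulE; case: n => [|n]; last exact: (esym (scaler0 _ _)).
  by rewrite !iA_ev0.
- by apply: pi3_ext => -[|n] //; rewrite iA_ev0 /ev /= /scal_fun -[RHS]/(scal k * 1) mulr1.
Qed.
Lemma homog_iA_mul n a u : homog n u -> homog n (iA a * u).
Proof. by move=> hu; rewrite -[n]add0n; apply: homog_mul => //; exact: homog_iA. Qed.
Lemma homog_mul_iA n a u : homog n u -> homog n (u * iA a).
Proof. by move=> hu; rewrite -[n]addn0; apply: homog_mul => //; exact: homog_iA. Qed.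
Lemma pin_mul_iA n x a : @pin n x * iA a = pin (tau2_comp (iA a) n n x).
Proof.
rewrite [LHS](homogE (homog_mul_iA a (@homog_pin n x))); congr pin.
by rewrite (ev_homog_mul _ _ (@homog_pin n x)) ev_pin.
Qed.
Lemma ev_mul_local n u u' v v' : (forall m, (m <= n)%N -> ev m u = ev m u') ->
  (forall m, (m <= n)%N -> ev m v = ev m v') -> ev n (u * v) = ev n (u' * v').
Proof.
move=> uu vv; have comp j k : (k <= n)%N -> tau2_comp v j k = tau2_comp v' j k.
  elim: j k => [|j IHj] [|k] kn //=; last by rewrite IHj // ltnW.
  - by apply: linear_ext => a; rewrite [LHS](pi3_ptE 0 v (a : A)) [RHS](pi3_ptE 0 v' (a : A)) vv.
  - by apply: linear_ext => a; rewrite [LHS](pi3_ptE k.+1 v (a : A)) [RHS](pi3_ptE k.+1 v' (a : A)) vv.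
rewrite !ev_mul; apply: eq_bigr => i _; rewrite comp // uu // -ltnS.
exact: ltn_ord.
Qed.
End PiDegrees.

(** * The regraded preprojective algebra and the modules Y_n *)

Section PiHalf.
Variables (K : fieldType) (A : kalgType K) (e : A).
Hypothesis ee : e * e = e.
Hypothesis fe0 : forall a : A, a * e = e * a * e.
Local Notation f := (1 - e).
Local Notation Tn n := (tau2_iter n (A^o : lmodType A)).
Local Notation R := (pi3 A).
Local Notation E := (iA e : pi3 A).
Local Notation F := (1 - iA e : pi3 A).
Implicit Types u v : R.
Lemma piEE : E * E = E. Proof. by rewrite -(hom_mul (iA_hom A)) ee. Qed.
Lemma piEF : E * F = 0. Proof. by rewrite mulrBr mulr1 piEE subrr. Qed.
Lemma piFE : F * E = 0. Proof. by rewrite mulrBl mul1r piEE subrr. Qed.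
Lemma piFF : F * F = F. Proof. by rewrite mulrBr piFE subr0 mulr1. Qed.
Lemma pi1 : E + F = 1. Proof. by rewrite addrC subrK. Qed.
Lemma piF : F = iA f. Proof. by rewrite (hom_sub (iA_hom A)) (hom_1 (iA_hom A)). Qed.
Lemma homog_mulE n u : homog n u -> homog n (u * E). Proof. exact: homog_mul_iA. Qed.
Lemma homog_mulF n u : homog n u -> homog n (u * F).
Proof. by rewrite piF; exact: homog_mul_iA. Qed.
Lemma homog_Emul n u : homog n u -> homog n (E * u). Proof. exact: homog_iA_mul. Qed.
Lemma homog_Fmul n u : homog n u -> homog n (F * u).
Proof. by rewrite piF; exact: homog_iA_mul. Qed.
(* The A-module Y_n = R_(n+1) e (+) R_n (1 - e).                               *)
Definition inY n u := homog n.+1 (u * E) /\ homog n (u * F).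
(* The part of R that has degree n for the mutated cut, which raises the degree *)
(* of E R (1 - E) and lowers that of (1 - E) R E by one.                        *)
Definition inU n u := [/\ homog n (E * u * E), homog n (F * u * F),
  homog n.+1 (F * u * E) & homogp n (E * u * F)].
Lemma pi_split_r u v : u * v = u * E * v + u * F * v.
Proof. by rewrite -mulrDl -mulrDr pi1 mulr1. Qed.
Lemma pi_mid u v w x : (u * v * E) * (E * w * x) + (u * v * F) * (F * w * x) = u * (v * w) * x.
Proof.
rewrite !mulrA -(mulrA _ E E) piEE -(mulrA _ F F) piFF -!mulrA -mulrDr -mulrDr.
by rewrite -mulrDl pi1 mul1r.
Qed.
Lemma inY_mul n m u v : inY n u -> inU m v -> inY (n + m) (u * v).
Proof.
move=> [uE uF] [EE FF FE EF].
have spl x : u * v * x = u * E * (E * v * x) + u * F * (F * v * x).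
  by have := pi_mid 1 u v x; rewrite !mul1r.
split; rewrite spl.
- by apply: homogD; [rewrite -addSn; exact: homog_mul | rewrite -addnS; exact: homog_mul].
- by apply: homogD; [exact: homogp_mulS | exact: homog_mul].
Qed.
Lemma inU_mul n m u v : inU n u -> inU m v -> inU (n + m) (u * v).
Proof.
move=> [EE FF FE EF] [EE' FF' FE' EF']; split; rewrite -pi_mid.
- by apply: homogD; [exact: homog_mul | exact: homogp_mulSl].
- by apply: homogD; [exact: homogp_mulS | exact: homog_mul].
- by apply: homogD; [rewrite -addSn; exact: homog_mul | rewrite -addnS; exact: homog_mul].
- by apply: homogpD; [exact: homogp_mul | exact: homogp_mull].
Qed.
Lemma inU_E n u : inY n (E * u) -> inU n.+1 (E * u).
Proof.
move=> [uE uF]; split; first by rewrite mulrA piEE.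
- by rewrite mulrA piFE !mul0r.
- by rewrite mulrA piFE !mul0r.
- by apply/homogp_pred; rewrite mulrA piEE.
Qed.
Lemma inU_F n u : inY n (F * u) -> inU n (F * u).
Proof.
move=> [uE uF]; split; rewrite mulrA ?piEF ?piFF ?mul0r //.
Qed.
Lemma inUD n u v : inU n u -> inU n v -> inU n (u + v).
Proof.
move=> [a b c d] [a' b' c' d']; split; rewrite (mulrDr _ u v) mulrDl;
  by [exact: homogD | exact: homogpD].
Qed.
Lemma inU_Y n u : inU n u -> inY n (F * u).
Proof. by move=> [EE FF FE EF]; split. Qed.
Lemma inUS_Y n u : inU n.+1 u -> inY n (E * u).
Proof. by move=> [EE FF FE EF]; split=> //; apply/homogp_pred. Qed.
Local Notation V := (via_of (iA_hom A)).
Lemma inY0 n : inY n 0. Proof. by split; rewrite mul0r. Qed.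
Lemma inYP n (a : A) (x y : V) : inY n x -> inY n y -> inY n (a *: x + y).
Proof.
move=> [xE xF] [yE yF]; split; rewrite mulrDl via_scaleE -mulrA; apply: homogD => //;
  exact: homog_iA_mul.
Qed.
Definition Ysub n : submodule V := @Submodule A V (inY n) (inY0 n) (@inYP n).
Definition Ym n : lmodType A := smod (Ysub n).
Definition yv n (y : Ym n) : R := val y.
Lemma yvP n (y : Ym n) : inY n (yv y). Proof. exact: (smodP y). Qed.
Definition ymk n u (h : inY n u) : Ym n := @smk _ _ (Ysub n) u h.
Lemma yv_inj n : injective (@yv n). Proof. exact: val_inj. Qed.
Lemma yvD n (x y : Ym n) : yv (x + y) = yv x + yv y. Proof. by []. Qed.
Lemma yvZ n (a : A) (y : Ym n) : yv (a *: y) = iA a * yv y. Proof. by []. Qed.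
Lemma yv0 n : yv (0 : Ym n) = 0. Proof. by []. Qed.
Lemma rmY_linear n m v (h : inU m v) : linear (fun y : Ym n => ymk (inY_mul (yvP y) h)).
Proof. by move=> a x y; apply: val_inj; rewrite [LHS]mulrDl -mulrA. Qed.
Definition rmY n m v (h : inU m v) : {linear Ym n -> Ym (n + m)} := mklin (@rmY_linear n m v h).
Lemma rmYE n m v (h : inU m v) (y : Ym n) : yv (rmY n h y) = yv y * v. Proof. by []. Qed.
Lemma evm_linear n j v : linear (fun y : Ym n => ev j (yv y * v)).
Proof. by move=> a x y; rewrite yvD yvZ mulrDl evD -mulrA iA_mulE. Qed.
(** For v = E and v = F, in degrees n + 1 and n, these are the two coordinates [al] and [be] of
    Y_n. *)
Definition evm n j v : {linear Ym n -> Tn j} := mklin (@evm_linear n j v).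
Local Notation al n := (evm n n.+1 E).
Local Notation be n := (evm n n F).
Lemma evmE n j v (y : Ym n) : evm n j v y = tau2_comp v n.+1 j (al n y) + tau2_comp v n j (be n y).
Proof.
have [yE yF] := yvP y.
by rewrite -[LHS]/(ev j (yv y * v)) pi_split_r evD (ev_homog_mul _ _ yE) (ev_homog_mul _ _ yF).
Qed.
Lemma ym_ext n (x y : Ym n) : al n x = al n y -> be n x = be n y -> x = y.
Proof.
move=> ha hb; apply: yv_inj; apply: pi3_ext => j.
have := evmE j 1 x; have := evmE j 1 y; rewrite ha hb => <-.
by rewrite -[evm _ _ _ x]/(ev j (yv x * 1)) -[evm _ _ _ y]/(ev j (yv y * 1)) !mulr1.
Qed.
Lemma pin_mulE n (x : Tn n) : pin x * E = pin (tau2_comp E n n x). Proof. exact: pin_mul_iA. Qed.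
Lemma pin_mulF n (x : Tn n) : pin x * F = pin (x - tau2_comp E n n x).
Proof.
apply: pi3_ext => m; rewrite mulrBr mulr1 pin_mulE evB.
have [<-|/eqP nm] := eqVneq n m; first by rewrite !ev_pin.
by rewrite !ev_pin0 // subr0.
Qed.
Lemma al_fix n (y : Ym n) : tau2_comp E n.+1 n.+1 (al n y) = al n y.
Proof.
have [yE _] := yvP y; rewrite -[al n y]/(ev n.+1 (yv y * E)).
by rewrite -(ev_homog_mul _ _ yE) -mulrA piEE.
Qed.
Lemma be_fix n (y : Ym n) : tau2_comp E n n (be n y) = 0.
Proof.
have [_ yF] := yvP y; rewrite -[be n y]/(ev n (yv y * F)).
by rewrite -(ev_homog_mul _ _ yF) -mulrA piFE mulr0.
Qed.
Lemma inY_pinE n (x : Tn n.+1) : inY n (pin x * E).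
Proof.
split; first by apply: homog_mulE; apply: homog_mulE; exact: homog_pin.
by rewrite -mulrA piEF mulr0.
Qed.
Lemma inY_pinF n (x : Tn n) : inY n (pin x * F).
Proof.
split; first by rewrite -mulrA piFE mulr0.
by apply: homog_mulF; apply: homog_mulF; exact: homog_pin.
Qed.
Lemma pin_lin n (a : A) (x y : Tn n) : pin (a *: x + y) = iA a * pin x + pin y.
Proof. by apply: pi3_ext => m; rewrite evD iA_mulE pin_linear. Qed.
Lemma injE_linear n : linear (fun x : Tn n.+1 => ymk (inY_pinE x)).
Proof. by move=> a x y; apply: yv_inj; rewrite yvD yvZ /yv /= pin_lin mulrDl mulrA. Qed.
Definition injE n : {linear Tn n.+1 -> Ym n} := mklin (@injE_linear n).
Lemma injF_linear n : linear (fun x : Tn n => ymk (inY_pinF x)).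
Proof. by move=> a x y; apply: yv_inj; rewrite yvD yvZ /yv /= pin_lin mulrDl mulrA. Qed.
Definition injF n : {linear Tn n -> Ym n} := mklin (@injF_linear n).
Lemma al_injE n x : al n (injE n x) = tau2_comp E n.+1 n.+1 x.
Proof. by rewrite -[LHS]/(ev n.+1 (pin x * E * E)) -mulrA piEE pin_mulE ev_pin. Qed.
Lemma be_injE n x : be n (injE n x) = 0.
Proof. by rewrite -[LHS]/(ev n (pin x * E * F)) -mulrA piEF mulr0. Qed.
Lemma al_injF n x : al n (injF n x) = 0.
Proof. by rewrite -[LHS]/(ev n.+1 (pin x * F * E)) -mulrA piFE mulr0. Qed.
Lemma be_injF n x : be n (injF n x) = x - tau2_comp E n n x.
Proof. by rewrite -[LHS]/(ev n (pin x * F * F)) -mulrA piFF pin_mulF ev_pin. Qed.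
Lemma inj_al_be n (y : Ym n) : injE n (al n y) + injF n (be n y) = y.
Proof.
apply: ym_ext; rewrite linearD ?al_injE ?be_injE ?al_injF ?be_injF ?al_fix ?be_fix.
  by rewrite addr0.
by rewrite add0r subr0.
Qed.
(** tau is applied to each of the two coordinates: it takes R_(n+1) e to R_(n+2) e and R_n f to
    R_(n+1) f. The inverse is [thYi]. *)
Definition thY n : {linear tau2 (Ym n) -> Ym n.+1} :=
  lin_comp (injE n.+1) (tau2_map (al n)) + lin_comp (injF n.+1) (tau2_map (be n)).
Lemma thYE n w :
  thY n w = injE n.+1 (tau2_map (al n) w) + injF n.+1 (tau2_map (be n) w).
Proof. by []. Qed.
Lemma tau_al_fix n w : tau2_comp E n.+2 n.+2 (tau2_map (al n) w) = tau2_map (al n) w.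
Proof.
rewrite -[LHS]/(lin_comp (tau2_map (tau2_comp E n.+1 n.+1)) (tau2_map (al n)) w).
rewrite -tau2_map_comp; congr (tau2_map _ w); apply: linear_ext => y; exact: al_fix.
Qed.
Lemma tau_be_fix n w : tau2_comp E n.+1 n.+1 (tau2_map (be n) w) = 0.
Proof.
rewrite -[LHS]/(lin_comp (tau2_map (tau2_comp E n n)) (tau2_map (be n)) w).
rewrite -tau2_map_comp (_ : lin_comp _ _ = 0) ?tau2_map0 //.
apply: linear_ext => y; exact: be_fix.
Qed.
Lemma al_thY n w : al n.+1 (thY n w) = tau2_map (al n) w.
Proof. by rewrite thYE linearD al_injE al_injF addr0 tau_al_fix. Qed.
Lemma be_thY n w : be n.+1 (thY n w) = tau2_map (be n) w.
Proof. by rewrite thYE linearD be_injE be_injF add0r tau_be_fix subr0. Qed.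
(** Applying tau to the right multiplication by v raises its degrees by one; this is why [thY]
    commutes with right multiplication. *)
Lemma evm_thY n j v w : evm n.+1 j.+1 v (thY n w) = tau2_map (evm n j v) w.
Proof.
rewrite evmE al_thY be_thY.
rewrite -[LHS]/((lin_comp (tau2_map (tau2_comp v n.+1 j)) (tau2_map (al n)) +
  lin_comp (tau2_map (tau2_comp v n j)) (tau2_map (be n)) : {linear _ -> _}) w).
rewrite -!tau2_map_comp -tau2_mapD; congr (tau2_map _ w).
by apply: linear_ext => y; rewrite evmE.
Qed.
Lemma ev_thY0 n v w : ev 0 (yv (thY n w) * v) = 0.
Proof. by have := evmE 0 v (thY n w); rewrite /= addr0. Qed.
Lemma thY_nat n m v (h : inU m v) w : thY (n + m) (tau2_map (rmY n h) w) = rmY n.+1 h (thY n w).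
Proof.
apply: ym_ext; rewrite ?al_thY ?be_thY.
  rewrite -[LHS]/(lin_comp (tau2_map (al (n + m))) (tau2_map (rmY n h)) w) -tau2_map_comp.
  rewrite -[RHS]/(ev (n + m).+2 (yv (thY n w) * v * E)) -mulrA.
  rewrite -[RHS]/(evm n.+1 (n + m).+2 (v * E) (thY n w)) evm_thY; congr (tau2_map _ w).
  by apply: linear_ext => y; rewrite /= rmYE mulrA.
rewrite -[LHS]/(lin_comp (tau2_map (be (n + m))) (tau2_map (rmY n h)) w) -tau2_map_comp.
rewrite -[RHS]/(ev (n + m).+1 (yv (thY n w) * v * F)) -mulrA.
rewrite -[RHS]/(evm n.+1 (n + m).+1 (v * F) (thY n w)) evm_thY; congr (tau2_map _ w).
by apply: linear_ext => y; rewrite /= rmYE mulrA.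
Qed.
Lemma thY_inj n w : thY n w = 0 -> w = 0.
Proof.
move=> h; have ha : tau2_map (al n) w = 0 by rewrite -al_thY h linear0.
have hb : tau2_map (be n) w = 0 by rewrite -be_thY h linear0.
have e1 : lin_comp (injE n) (al n) + lin_comp (injF n) (be n) = idfun :> {linear Ym n -> Ym n}.
  by apply: linear_ext => y; exact: inj_al_be.
have := congr1 (fun g => tau2_map g w) e1; rewrite tau2_mapD !tau2_map_comp tau2_map_id.
by move=> /= <-; rewrite -[LHS]/(tau2_map (injE n) (tau2_map (al n) w) +
  tau2_map (injF n) (tau2_map (be n) w)) ha hb !linear0 addr0.
Qed.
Definition thYi n : {linear Ym n.+1 -> tau2 (Ym n)} :=
  lin_comp (tau2_map (injE n)) (al n.+1) + lin_comp (tau2_map (injF n)) (be n.+1).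
Lemma tau_al_injE n x : tau2_map (al n) (tau2_map (injE n) x) = tau2_comp E n.+2 n.+2 x.
Proof.
rewrite -[LHS]/(lin_comp (tau2_map (al n)) (tau2_map (injE n)) x) -tau2_map_comp.
by congr (tau2_map _ x); apply: linear_ext => y; exact: al_injE.
Qed.
Lemma tau_al_injF n x : tau2_map (al n) (tau2_map (injF n) x) = 0.
Proof.
rewrite -[LHS]/(lin_comp (tau2_map (al n)) (tau2_map (injF n)) x) -tau2_map_comp.
by rewrite (_ : lin_comp _ _ = 0) ?tau2_map0 //; apply: linear_ext => y; exact: al_injF.
Qed.
Lemma tau_be_injE n x : tau2_map (be n) (tau2_map (injE n) x) = 0.
Proof.
rewrite -[LHS]/(lin_comp (tau2_map (be n)) (tau2_map (injE n)) x) -tau2_map_comp.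
by rewrite (_ : lin_comp _ _ = 0) ?tau2_map0 //; apply: linear_ext => y; exact: be_injE.
Qed.
Lemma tau_be_injF n x : tau2_comp E n.+1 n.+1 x = 0 ->
  tau2_map (be n) (tau2_map (injF n) x) = x.
Proof.
move=> Ex; rewrite -[LHS]/(lin_comp (tau2_map (be n)) (tau2_map (injF n)) x) -tau2_map_comp.
rewrite (_ : lin_comp _ _ = (idfun : {linear _ -> _}) - tau2_comp E n n); last first.
  by apply: linear_ext => y; exact: be_injF.
have e1 := tau2_mapD ((idfun : {linear _ -> _}) - tau2_comp E n n) (tau2_comp E n n).
rewrite subrK tau2_map_id in e1.
have e2 := congr1 (fun g : {linear _ -> _} => g x) e1.
apply: etrans (esym e2); rewrite -[RHS]/(_ + tau2_comp E n.+1 n.+1 x) Ex addr0 //.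
Qed.
Lemma thYiE n y :
  thYi n y = tau2_map (injE n) (al n.+1 y) + tau2_map (injF n) (be n.+1 y).
Proof. by []. Qed.
Lemma thYiK n y : thY n (thYi n y) = y.
Proof.
apply: ym_ext; rewrite ?al_thY ?be_thY thYiE linearD.
  by rewrite tau_al_injE tau_al_injF addr0; exact: al_fix.
by rewrite tau_be_injE tau_be_injF ?add0r //; exact: be_fix.
Qed.
Lemma summand_YS n : summand (tau2 (Ym n)) (Ym n.+1).
Proof. by apply: (summand_retract (@thYiK n)); exact: summand_self. Qed.
End PiHalf.

Section AprExtra.
Variables (K : fieldType) (A : kalgType K) (e : A).
Hypothesis ee : e * e = e.
Hypothesis fe0 : forall a : A, a * e = e * a * e.
Variable D : apr_data e.
Local Notation f := (1 - e).
Local Notation Z := (tau2 (princ e)).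
Lemma apr_homZ (h : {linear Z -> princ f}) : h = 0.
Proof.
apply: linear_ext => z; apply: val_inj.
exact: (congr1 (fun g : {linear Z -> A^o} => g z) (ad_homA D (lin_comp (princ_incl f) h))).
Qed.
Lemma idem_ff : f * f = f.
Proof. by rewrite mulrBr mulr1 mulrBl mul1r ee subrr subr0. Qed.
Lemma apr_homFP (h : {linear princ f -> princ e}) : h = 0.
Proof.
apply: (princ_ext idem_ff); rewrite -(princ_gen_fix idem_ff); apply: val_inj.
rewrite -[LHS]/(f * (val (h (princ_gen f)) : A)) -(princ_mulc ee (h _)) mulrA.
by rewrite mulrBl mul1r mulrBl -fe0 subrr.
Qed.
(** If tau P were zero, the identity of P would extend along P -> P1; but every map P1 -> P is
    zero. *)
Lemma apr_tau_neq0 : (forall z : Z, z = 0) -> e = 0.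
Proof.
move=> Z0; have x1 : xv 1 Z (princ e).
  apply/xvP => x; rewrite -[x]Ext_map_id.
  have -> : (idfun : {linear Z -> Z}) = 0 by apply: linear_ext => z; rewrite [LHS]Z0.
  by rewrite Ext_map0l.
have x2 : xv 0 (ad_P2 D) (princ e).
  by apply: (summand_xvl (ad_s2 D)); apply: projective_xv; exact: princ_projective idem_ff.
have [h hE] := xv1_lift1 (ad_exact D) x2 x1 idfun.
have h0 : h = 0.
  have [I [i [r ir]]] := ad_s1 D; apply: linear_ext => x; rewrite -[x in LHS]ir linear_sum.
  apply: big1 => k _; rewrite -[LHS]/(lin_comp h (r k) (i k x)).
  by rewrite (apr_homFP (lin_comp h (r k))).
have := hE (princ_gen e); rewrite h0 => /(congr1 val) e1.
exact: etrans (esym (val_princ_gen e)) (esym e1).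
Qed.
Lemma apr_findim_tau : findim (kspace A) -> findim (restr_scal Z).
Proof.
move=> fdA; have [vs _ _ _] := ad_exact D; apply: (findim_surj (f := restr_map (ad_vp D)) vs).
apply: (summand_findim (ad_s2 D)).
exact: (findim_inj (f := restr_map (princ_incl f)) val_inj fdA).
Qed.
End AprExtra.

Section PrincRet.
Variables (K : fieldType) (A : kalgType K) (c : A).
Lemma princ_ret_linear : linear ((fun a : A^o => princ_of c a) : A^o -> princ c).
Proof. by move=> a x y; apply: val_inj; rewrite [LHS]mulrDl -mulrA. Qed.
Definition princ_ret : {linear A^o -> princ c} := mklin princ_ret_linear.
Lemma val_princ_ret a : val (princ_ret a) = (a : A) * c :> A. Proof. by []. Qed.
Lemma princ_retK (x : princ c) : c * c = c -> princ_ret (val x) = x.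
Proof. by move=> cc; apply: val_inj; rewrite val_princ_ret princ_mulc. Qed.
End PrincRet.

Section EndOp.
Variables (K : fieldType) (A A' : kalgType K) (e : A) (e' : A') (H : tilt e e').
Local Notation T := (tl_T H).
Local Notation M := (tau2 (princ e) * princ (1 - e))%type.
Definition tl_J : {linear M -> T} := copair (tl_iP H) (tl_iF H).
Definition tl_J' : {linear T -> M} := pair_lin (tl_pP H) (tl_pF H).
Lemma tl_JK t : tl_J (tl_J' t) = t. Proof. exact: tl_split. Qed.
Lemma tl_J'K m : tl_J' (tl_J m) = m.
Proof.
case: m => z x; rewrite -[LHS]/(tl_pP H (tl_iP H z + tl_iF H x), tl_pF H (tl_iP H z + tl_iF H x)).
rewrite !linearD (@tl_pPK _ _ _ _ _ H) (@tl_pFK _ _ _ _ _ H) tl_pFiP tl_pPiF.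
by rewrite addr0 add0r.
Qed.
Definition tl_end (b : A') : end_op (apr2_module e) :=
  lin_comp tl_J' (lin_comp (ract_map T b) tl_J).
Lemma tl_endE (b : A') m : tl_J (tl_end b m) = ract (tl_J m) b. Proof. exact: tl_JK. Qed.
Lemma tl_J_inj : injective tl_J. Proof. exact: can_inj tl_J'K. Qed.
Lemma end_op_iso : alg_iso (end_op (apr2_module e)) A'.
Proof.
have hom : kalg_hom tl_end.
  split=> [x y|x y|k]; apply: linear_ext => m; apply: tl_J_inj.
  - by rewrite tl_endE ractDr -!tl_endE -linearD.
  - by rewrite tl_endE ractM -!tl_endE.
  - by rewrite tl_endE ract_scal -linearZ_LR.
have inj : injective tl_end.
  move=> b b' bb; apply: (@tl_faith _ _ _ _ _ H) => t.
  by rewrite -(tl_JK t) -!tl_endE bb.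
have surj_end : forall g, exists b, tl_end b = g.
  move=> g; have [b bE] := @tl_full _ _ _ _ _ H (lin_comp tl_J (lin_comp (g : {linear _ -> _}) tl_J')).
  exists b; apply: linear_ext => m; apply: tl_J_inj; rewrite tl_endE bE.
  exact: (congr1 (fun x => tl_J ((g : {linear M -> M}) x)) (tl_J'K m)).
have [s sE] := choice surj_end.
have sK : cancel tl_end s by move=> b; apply: inj; rewrite sE.
exists s; last by exists tl_end.
have [hD hM hS] := hom; split=> [x y|x y|k]; apply: inj; rewrite ?hD ?hM ?hS ?sE //.
Qed.
End EndOp.

(** * The tilting module and its endomorphism algebra inside Pi_3(A) *)

Section TiltPi.
Variables (K : fieldType) (A B : kalgType K) (e : A).
Hypothesis fdA : findim (kspace A).
Hypothesis gl : forall X Y : lmodType A, xv 2 X Y.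
Hypothesis ee : e * e = e.
Hypothesis e0 : e <> 0.
Hypothesis fe0 : forall a : A, a * e = e * a * e.
Hypothesis inv : forall x, e * x * e = x -> x <> 0 -> exists y, x * y = e /\ y * x = e.
Variable D : apr_data e.
Variable io : B -> pi3 A.
Hypothesis hio : kalg_hom io.
Hypothesis io_inj : injective io.
Hypothesis io_im : forall u, inU e 0 u <-> exists b, io b = u.
Local Notation f := (1 - e).
Local Notation Tn n := (tau2_iter n (A^o : lmodType A)).
Local Notation E := (iA e : pi3 A).
Local Notation F := (1 - iA e : pi3 A).
Local Notation P := (princ e).
Local Notation Z := (tau2 (princ e)).
Local Notation EE := (piEE ee).
Local Notation EF := (piEF ee).
Local Notation FE := (piFE ee).
Local Notation FF := (piFF ee).
Lemma io_U b : inU e 0 (io b). Proof. by apply/io_im; exists b. Qed.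
Lemma inU_E0 : inU e 0 E.
Proof.
split; rewrite ?EE ?FE ?mul0r -?mulrA ?EF ?mulr0 //; exact: homog_iA.
Qed.
Definition e' : B := sval (cid (let: conj h _ := io_im E in h inU_E0)).
Lemma io_e' : io e' = E. Proof. by rewrite /e'; case: cid. Qed.
Lemma EUF u : inU e 0 u -> E * u * F = 0.
Proof. by move=> [_ _ _]; exact: homogp0. Qed.
Lemma E_io b : E * io b = E * io b * E.
Proof. by rewrite -[LHS]mulr1 -{1}(pi1 e) mulrDr (EUF (io_U b)) addr0. Qed.
Local Notation T0 := (Ym e 0).
Definition T_ract (t : T0) (b : B) : T0 := rmY ee 0 (io_U b) t.
Lemma T_ractE t b : yv (T_ract t b) = yv t * io b. Proof. by []. Qed.
Lemma T_ractDl x y b : T_ract (x + y) b = T_ract x b + T_ract y b. Proof. exact: linearD. Qed.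
Lemma T_ractDr x b c : T_ract x (b + c) = T_ract x b + T_ract x c.
Proof. by apply: yv_inj; rewrite T_ractE (hom_add hio) mulrDr. Qed.
Lemma T_ract1 x : T_ract x 1 = x.
Proof. by apply: yv_inj; rewrite T_ractE (hom_1 hio) mulr1. Qed.
Lemma T_ractM x b c : T_ract x (b * c) = T_ract (T_ract x b) c.
Proof. by apply: yv_inj; rewrite !T_ractE (hom_mul hio) mulrA. Qed.
Lemma T_ractZ (a : A) x b : T_ract (a *: x) b = a *: T_ract x b. Proof. exact: linearZ_LR. Qed.
Lemma T_ract_scal (k : K) x : T_ract x (scal k) = scal k *: x.
Proof. by apply: yv_inj; rewrite T_ractE yvZ (hom_scal hio) (hom_scal (iA_hom A)) scalC. Qed.
Definition Tb : bimodule A B :=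
  Bimodule T_ractDl T_ractDr T_ract1 T_ractM T_ractZ T_ract_scal.
Local Notation al n := (evm e n n.+1 E).
Local Notation be n := (evm e n n F).
Local Notation ff := (idem_ff ee).
Local Notation inc := (princ_incl e).
Local Notation ret := (princ_ret e).
(** Y_0 = R_1 e (+) R_0 f is a copy of T, since e cuts the summand tau P out of tau A = R_1. *)
Definition tiP : {linear Z -> T0} := lin_comp (injE ee 0) (tau2_map inc).
Definition tpP : {linear T0 -> Z} := lin_comp (tau2_map ret) (al 0).
Definition tiF : {linear princ f -> T0} := lin_comp (injF ee 0) (princ_incl f).
Definition tpF : {linear T0 -> princ f} := lin_comp (princ_ret f) (be 0).
Lemma comp_iA1 (a : A) (x : tau2 (A^o : lmodType A)) : tau2_comp (iA a) 1 1 x = tau2_map (rmulA a) x. Proof. by []. Qed.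
Lemma comp_iA0 (a : A) (x : A^o) : tau2_comp (iA a) 0 0 x = (x : A) * a :> A. Proof. by []. Qed.
Lemma tau_inc a (rho : {linear P -> P}) z : val (rho (princ_gen e)) = a :> A ->
  tau2_map (rmulA a) (tau2_map inc z) = tau2_map inc (tau2_map rho z).
Proof.
move=> ra; rewrite -[LHS]/(lin_comp (tau2_map (rmulA a)) (tau2_map inc) z).
rewrite -[RHS]/(lin_comp (tau2_map inc) (tau2_map rho) z) -!tau2_map_comp.
congr (tau2_map _ z); apply: linear_ext => p.
by rewrite /= [in RHS](princ_genE ee p) linearZ_LR -ra.
Qed.
Lemma al_iP z : al 0 (tiP z) = tau2_map inc z.
Proof.
rewrite [LHS]al_injE comp_iA1 (tau_inc (rho := idfun)) ?tau2_map_id //.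
exact: val_princ_gen.
Qed.
Lemma be_iP z : be 0 (tiP z) = 0. Proof. exact: be_injE. Qed.
Lemma tau_ret_inc z : tau2_map ret (tau2_map inc z) = z.
Proof.
rewrite -[LHS]/(lin_comp (tau2_map ret) (tau2_map inc) z) -tau2_map_comp.
rewrite (_ : lin_comp ret inc = idfun) ?tau2_map_id //.
by apply: linear_ext => p; exact: princ_retK.
Qed.
Lemma tau_inc_ret (x : tau2 (A^o : lmodType A)) : tau2_map inc (tau2_map ret x) = tau2_map (rmulA e) x.
Proof.
rewrite -[LHS]/(lin_comp (tau2_map inc) (tau2_map ret) x) -tau2_map_comp.
by congr (tau2_map _ x); exact: linear_ext.
Qed.
Lemma al_pP t : tau2_map inc (tpP t) = al 0 t.
Proof. by rewrite [LHS]tau_inc_ret -[RHS](al_fix ee). Qed.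
Lemma tpPK z : tpP (tiP z) = z.
Proof. by rewrite -[LHS]/(tau2_map ret (al 0 (tiP z))) al_iP tau_ret_inc. Qed.
Lemma be_pF t : val (tpF t) = be 0 t :> A.
Proof.
rewrite -[LHS]/((be 0 t : A) * f) mulrBr mulr1.
by have := be_fix ee t; rewrite comp_iA0 => ->; rewrite subr0.
Qed.
Lemma be_iF x : be 0 (tiF x) = val x :> A.
Proof.
rewrite [LHS]be_injF [tau2_comp _ _ _ _]comp_iA0 -[X in X * e](princ_mulc ff x).
by rewrite -mulrA mulrBl mul1r ee subrr mulr0 subr0.
Qed.
Lemma tpFK x : tpF (tiF x) = x.
Proof. by apply: val_inj; rewrite [LHS]be_pF [LHS]be_iF. Qed.
Lemma ti_split t : tiP (tpP t) + tiF (tpF t) = t.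
Proof.
rewrite -[RHS](inj_al_be ee) -[tiP _]/(injE ee 0 (tau2_map inc (tpP t))) al_pP.
by rewrite -[tiF _]/(injF ee 0 (val (tpF t))) [val _]be_pF.
Qed.
Lemma ti_e' t : T_ract t e' = tiP (tpP t).
Proof.
apply: (ym_ext (e := e)); rewrite ?al_iP ?be_iP ?al_pP.
  by rewrite -[LHS]/(ev 1 (yv (T_ract t e') * E)) T_ractE io_e' -mulrA EE.
by rewrite -[LHS]/(ev 0 (yv (T_ract t e') * F)) T_ractE io_e' -mulrA EF mulr0.
Qed.
Lemma inY_F : inY e 0 F.
Proof. by split; rewrite ?FE // FF piF; exact: homog_iA. Qed.
Definition tF : T0 := ymk inY_F.
Lemma tiF_tF x : tiF x = (val x : A) *: tF.
Proof.
apply: yv_inj; rewrite -[LHS]/(pin (val x : Tn 0) * F) yvZ; congr (_ * _).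
by rewrite [LHS](iAE (@homog_pin _ _ 0 _)) ev_pin.
Qed.
Lemma inU_iA d : e * d * e = d -> inU e 0 (iA d).
Proof.
move=> <-; rewrite !(hom_mul (iA_hom A)); split.
- by rewrite -!(hom_mul (iA_hom A)); exact: homog_iA.
- by rewrite !mulrA FE !mul0r.
- by rewrite !mulrA FE !mul0r.
- by rewrite -!mulrA EF !mulr0.
Qed.
(** h is determined by the image x of the generator of A f and by its component on tau P, as maps
    tau P -> A f vanish. That component is tau of the right multiplication by some d in e A e, and b
    is x + d. *)
Lemma t_full (h : {linear T0 -> T0}) : exists b, forall t, T_ract t b = h t.
Proof.
pose x := yv (h tF); have Fx : F * x = x.
  rewrite piF /x -yvZ -linearZ_LR; congr (yv (h _)); apply: yv_inj.
  by rewrite yvZ -piF FF.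
have [rho rhoE] := ad_end D (lin_comp tpP (lin_comp h tiP)).
pose d : A := val (rho (princ_gen e)).
have de : d * e = d := princ_mulc ee _.
have ed : e * d = d by have := congr1 val (princ_gen_fix ee rho).
have [b bE] : exists b, io b = x + iA d.
  apply/io_im; apply: inUD; last by apply: inU_iA; rewrite ed.
  by rewrite -Fx; apply: (inU_F ee); rewrite Fx; exact: yvP.
exists b => t; rewrite -(ti_split t) T_ractDl [RHS]linearD; congr (_ + _); last first.
  rewrite tiF_tF T_ractZ linearZ_LR; congr (_ *: _); apply: yv_inj.
  rewrite T_ractE bE mulrDr Fx -ed (hom_mul (iA_hom A)) mulrA FE mul0r addr0 //.
move: (tpP t) => a; rewrite -[RHS]ti_split.
have -> : tpF (h (tiP a)) = 0.
  by rewrite -[LHS]/(lin_comp tpF (lin_comp h tiP) a) (apr_homZ D (lin_comp tpF _)).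
rewrite linear0 addr0.
have -> : tpP (h (tiP a)) = tau2_map rho a by rewrite -rhoE.
have e1 : yv (T_ract (tiP a) b) = pin (tau2_map inc a : Tn 1) * iA d.
  rewrite T_ractE -[yv (tiP a)]/(pin (tau2_map inc a : Tn 1) * E) bE -mulrA mulrDr.
  by rewrite -Fx mulrA EF mul0r add0r -(hom_mul (iA_hom A)) ed.
apply: (ym_ext (e := e)); rewrite ?al_iP ?be_iP.
  rewrite -[LHS]/(ev 1 (yv (T_ract (tiP a) b) * E)) e1 -mulrA -(hom_mul (iA_hom A)) de.
  by rewrite (ev_homog_mul _ _ (@homog_pin _ _ 1 _)) ev_pin comp_iA1; exact: tau_inc.
rewrite -[LHS]/(ev 0 (yv (T_ract (tiP a) b) * F)) e1 -de (hom_mul (iA_hom A)) -!mulrA.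
by rewrite EF !mulr0.
Qed.
(** An element v that kills T has F v = 0, because F lies in Y_0, so v is in the division ring e A
    e. If v were nonzero, E would be a right multiple of it and would kill tau P. *)
Lemma t_faith b b' : (forall t, T_ract t b = T_ract t b') -> b = b'.
Proof.
move=> tb; apply: io_inj; apply: subr0_eq; rewrite -(hom_sub hio).
set v := io _; have Uv : inU e 0 v := io_U _.
have tv (t : T0) : yv t * v = 0.
  by rewrite /v (hom_sub hio) mulrBr -!T_ractE tb subrr.
have Fv : F * v = 0 := tv tF.
have EvE : E * v * E = v.
  have e1 : v = E * v + F * v by rewrite -mulrDl pi1 mul1r.
  have e2 : E * v = E * v * E + E * v * F by rewrite -mulrDr pi1 mulr1.
  by rewrite [RHS]e1 Fv addr0 [RHS]e2 (EUF Uv) addr0.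
have [h _ _ _] := Uv; rewrite EvE in h.
have vd := iAE h; set d := ev 0 v in vd.
have dE : e * d * e = d.
  have := EvE; rewrite vd -!(hom_mul (iA_hom A)) => /(congr1 (ev 0)); by rewrite !iA_ev0.
apply: contrapT => v0; have [|y [dy _]] := inv dE.
  by move=> d0; apply: v0; rewrite vd d0; exact: hom_0 (iA_hom A).
apply: e0; apply: (apr_tau_neq0 ee fe0 D) => z; rewrite -(tpPK z).
have -> : tiP z = 0; last by rewrite linear0.
have eE : E = v * iA y by rewrite vd -(hom_mul (iA_hom A)) dy.
apply: yv_inj; transitivity (yv (tiP z) * v * iA y); last by rewrite tv mul0r.
by rewrite -[yv (tiP z)]/(pin (tau2_map inc z : Tn 1) * E) -!mulrA -eE EE.
Qed.
(** io b is determined by its degree 0 part, in A, and by its corner F (io b) E, in tau P; both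
    spaces are finite-dimensional. *)
Lemma B_findim : findim (kspace B).
Proof.
have hY (b : B) : inY e 0 (F * io b) by apply: inU_Y; exact: io_U.
pose g (b : B) : (Z * A^o)%type := (tpP (ymk (hY b)), ev 0 (io b)).
have gl0 : linear (g : kspace B -> restr_scal ((Z * A^o)%type : lmodType A)).
  move=> k x y; congr pair.
    have -> : ymk (hY (k *: x + y)) = (scal k : A) *: ymk (hY x) + ymk (hY y); last exact: linearP.
    apply: yv_inj; rewrite yvD yvZ /yv /=.
    rewrite (hom_add hio) (hom_mul hio) (hom_scal hio) (hom_scal (iA_hom A)).
    by rewrite mulrDr !mulrA -scalC.
  by rewrite (hom_add hio) (hom_mul hio) (hom_scal hio) -(hom_scal (iA_hom A)) evD iA_mulE.
apply: (findim_inj (f := mklin gl0)); last first.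
  have [n [u uP]] := apr_findim_tau D fdA; have [m [w wP]] := fdA.
  refine (@findim_fin _ (restr_scal ((Z * A^o)%type : lmodType A)) ('I_n + 'I_m)%type (fun k => match k with
    inl i => (u i : Z, 0 : A^o) | inr j => (0 : Z, w j : A^o) end) _) => -[x y].
  have [c cE] := uP x; have [d dE] := wP y.
  exists (fun k => match k with inl i => c i | inr j => d j end).
  rewrite big_sumType /=.
  rewrite -[LHS]/((x, y) : (Z * A^o)%type) -[LHS]prod_split cE dE; congr (_ + _).
    rewrite [LHS](linear_sum (restr_map (inl_lin Z (A^o : lmodType A)))); apply: eq_bigr => i _.
    exact: (linearZ_LR (restr_map (inl_lin Z (A^o : lmodType A)))).
  rewrite [LHS](linear_sum (restr_map (inr_lin Z (A^o : lmodType A)))); apply: eq_bigr => i _.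
  exact: (linearZ_LR (restr_map (inr_lin Z (A^o : lmodType A)))).
move=> b b' /= gb; apply: io_inj.
have g1 : tpP (ymk (hY b)) = tpP (ymk (hY b')) := congr1 fst gb.
have g2 : ev 0 (io b) = ev 0 (io b') := congr1 snd gb.
have spl (c : B) : io c = iA (ev 0 (io c)) + yv (tiP (tpP (ymk (hY c)))).
  have [a1 a2 a3 a4] := io_U c.
  have e1 : yv (tiP (tpP (ymk (hY c)))) = F * io c * E by rewrite -ti_e' T_ractE io_e'.
  have e2 : io c = E * io c * E + F * io c * F + F * io c * E.
    rewrite -E_io -addrA -mulrDr addrC (addrC F) pi1 mulr1 addrC -mulrDl pi1 mul1r //.
  rewrite e1 {1}e2; congr (_ + _).
  have h := iAE (homogD a1 a2); rewrite [LHS]h; congr iA.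
  by rewrite {3}e2 !evD a3 // addr0.
by rewrite spl [RHS]spl g2 g1.
Qed.
Definition tilt_pi : tilt e e' := @Tilt K A B e e' fdA B_findim gl ee fe0 inv D Tb
  tiP tpP tiF tpF tpPK tpFK ti_split ti_e' t_full t_faith.
End TiltPi.

Section ThetaFix.
Variables (K : fieldType) (A A' : kalgType K) (e : A) (e' : A') (H : tilt e e').
Variable Rs : tres H (dcorner (1 - e)).
Variable Y : lmodType A.
Hypothesis gY : good e Y.
Implicit Types (y : Y).
Lemma theta_fix (z : tau2 (homB (tl_T H) Y)) y w : theta Rs z y w ->
  e *: y = y /\ (1 - e) *: w = w.
Proof.
move=> [s1 [s2 [_ _ -> fw]]]; split=> //.
exact: (princ_gen_fix (tl_ee H) (lin_comp s2 (ad_dP (tl_D H)))).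
Qed.
Lemma theta0 : theta Rs (0 : tau2 (homB (tl_T H) Y)) 0 0.
Proof.
have [y [w h]] := theta_total Rs (0 : tau2 (homB (tl_T H) Y)).
by have [y0 w0] := theta_uniq0 gY h; rewrite y0 w0 in h.
Qed.
Lemma thetaD (z z' : tau2 (homB (tl_T H) Y)) y y' w w' :
  theta Rs z y w -> theta Rs z' y' w' -> theta Rs (z + z') (y + y') (w + w').
Proof.
move=> h h'; rewrite -[z']opprK -[y']opprK -[w']opprK; apply: thetaB => //.
by rewrite -sub0r -[- y']sub0r -[- w']sub0r; apply: thetaB => //; exact: theta0.
Qed.
Lemma theta_uniq (z : tau2 (homB (tl_T H) Y)) y y' w w' :
  theta Rs z y w -> theta Rs z y' w' -> y = y' /\ w = w'.
Proof.
move=> h h'; have := thetaB h h'; rewrite subrr => /(theta_uniq0 gY)[hy hw].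
by split; exact: subr0_eq.
Qed.
End ThetaFix.

Section ThetaPoint.
Variables (K : fieldType) (A : kalgType K) (e : A) (ee : e * e = e) (n : nat).
Lemma ev_thY0' (w : tau2 (Ym e n)) : ev 0 (yv (thY ee n w)) = 0.
Proof. by have := ev_thY0 ee 1 w; rewrite mulr1. Qed.
Lemma ev_thY_pt (y : Ym e n) j (x : tau2 (A^o : lmodType A)) : e *: y = y ->
  ev j.+1 (yv (thY ee n (tau2_map (princ_pt e y) (tau2_map (princ_ret e) x)))) =
  tau2_map (yv y j) x.
Proof.
move=> ey; set w := tau2_map (princ_pt e y) _.
have -> : ev j.+1 (yv (thY ee n w)) = evm e n.+1 j.+1 1 (thY ee n w).
  by rewrite -[RHS]/(ev j.+1 (yv (thY ee n w) * 1)) mulr1.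
rewrite evm_thY /w -[LHS]/(lin_comp (tau2_map (evm e n j 1))
  (lin_comp (tau2_map (princ_pt e y)) (tau2_map (princ_ret e))) x).
rewrite -!tau2_map_comp; congr (tau2_map _ x); apply: linear_ext => a.
rewrite (pi3_ptE j (yv y) (a : A)) -[LHS]/(ev j (yv (((a : A) * e) *: y) * 1)) mulr1.
by rewrite -scalerA ey yvZ iA_mulE.
Qed.
End ThetaPoint.

(** * The isomorphisms from tau2 of U_n to U_(n+1) *)

Section Omega.
Variables (K : fieldType) (A B : kalgType K) (e : A).
Hypothesis fdA : findim (kspace A).
Hypothesis gl : forall X Y : lmodType A, xv 2 X Y.
Hypothesis ee : e * e = e.
Hypothesis e0 : e <> 0.
Hypothesis fe0 : forall a : A, a * e = e * a * e.
Hypothesis inv : forall x, e * x * e = x -> x <> 0 -> exists y, x * y = e /\ y * x = e.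
Variable D : apr_data e.
Variable io : B -> pi3 A.
Hypothesis hio : kalg_hom io.
Hypothesis io_inj : injective io.
Hypothesis io_im : forall u, inU e 0 u <-> exists b, io b = u.
Local Notation H := (tilt_pi fdA gl ee e0 fe0 inv D hio io_inj io_im).
Variable Rs : tres H (dcorner (1 - e)).
Local Notation f := (1 - e).
Local Notation Tn n := (tau2_iter n (A^o : lmodType A)).
Local Notation R := (pi3 A).
Local Notation E := (iA e : pi3 A).
Local Notation F := (1 - iA e : pi3 A).
Local Notation e' := (e' ee io_im).
Local Notation f' := (1 - e').
Local Notation EE := (piEE ee).
Local Notation EF := (piEF ee).
Local Notation FF := (piFF ee).
Local Notation io_U := (io_U io_im).
Local Notation Y n := (Ym e n).
Local Notation V := (via_of hio).
Lemma inU0 n : inU e n 0.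
Proof. by split; rewrite !(mulr0, mul0r). Qed.
Lemma inUP n (b : B) (x y : V) : inU e n x -> inU e n y -> inU e n (b *: x + y).
Proof. by move=> Ux Uy; apply: inUD => //; exact: (inU_mul ee (io_U b) Ux). Qed.
Definition Usub n : submodule V := @Submodule B V (inU e n) (inU0 n) (@inUP n).
Definition Um n : lmodType B := smod (Usub n).
Definition uv n (u : Um n) : R := sm_incl (Usub n) u.
Lemma uvP n (u : Um n) : inU e n (uv u). Proof. exact: (smodP u). Qed.
Definition umk n u (h : inU e n u) : Um n := @smk _ _ (Usub n) u h.
Lemma uv_inj n : injective (@uv n). Proof. exact: sm_incl_inj. Qed.
Lemma uvD n (x y : Um n) : uv (x + y) = uv x + uv y. Proof. exact: (linearD (@sm_incl _ _ (Usub n))). Qed.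
Lemma uvZ n (b : B) (y : Um n) : uv (b *: y) = io b * uv y.
Proof.
have e1 : sm_incl (Usub n) (b *: y) = b *: sm_incl (Usub n) y := linearZ_LR _ b y.
have e2 := via_scaleE b (sm_incl (Usub n) y).
exact: etrans e1 e2.
Qed.
Lemma rmU_linear n m v (h : inU e m v) : linear (fun u : Um n => umk (inU_mul ee (uvP u) h)).
Proof.
move=> b x y.
apply: uv_inj.
set X := umk _; set Z0 := umk _; set Z1 := umk _.
have -> : uv (b *: Z0 + Z1) = uv (b *: Z0) + uv Z1 := uvD _ _.
rewrite (uvZ b Z0).
by rewrite -[LHS]/(uv (b *: x + y) * v) (uvD (b *: x)) (uvZ b x) mulrDl -mulrA.
Qed.
Definition rmU n m v (h : inU e m v) : {linear Um n -> Um (n + m)} := mklin (@rmU_linear n m v h).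
Lemma rmUE n m v (h : inU e m v) (u : Um n) : uv (rmU n h u) = uv u * v. Proof. by []. Qed.
Local Notation T := (tl_T H).
Definition ph_fun n (u : Um n) : homB T (Y n) := rmY ee 0 (uvP u).
Lemma ph_funE n (u : Um n) (t : Y 0) : yv (hb_fun (ph_fun u) t) = yv t * uv u. Proof. by []. Qed.
Lemma ph_linear n : linear (@ph_fun n).
Proof.
move=> b x y; apply: hb_ext => t; rewrite hb_addE hb_scaleE; apply: yv_inj.
by rewrite yvD !ph_funE uvD uvZ mulrDr mulrA.
Qed.
Definition ph n : {linear Um n -> homB T (Y n)} := mklin (@ph_linear n).
(** A map T -> Y_n that vanishes on tau P is right multiplication by the image of F, so [ph] is
    bijective on f'-parts, and [fiso_tau2] applies. *)
Lemma ph_bij n : injective (tau2_map (ph n)) /\ surj (tau2_map (ph n)).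
Proof.
apply: (fiso_tau2 (tl_e'e' H) (tl_e'b H) (@corner_inv' _ _ _ _ _ H)).
- move=> u eu pu; apply: uv_inj; have := congr1 (@uv n) eu; rewrite uvZ io_e' => Eu.
  have := congr1 (fun g : homB T (Y n) => yv (hb_fun g (tF ee))) pu.
  rewrite [LHS]ph_funE => Fu.
  by rewrite -[LHS]mul1r -(pi1 e) mulrDl Eu Fu addr0.
- move=> g eg; pose u := yv (hb_fun g (tF ee)).
  have Fu : F * u = u.
    rewrite piF /u -yvZ -linearZ_LR; congr (yv (hb_fun g _)); apply: yv_inj.
    by rewrite yvZ -piF FF.
  have Uu : inU e n u.
    by rewrite -Fu; apply: (inU_F ee); rewrite Fu; exact: yvP.
  exists (umk Uu); apply: hb_ext => t; apply: yv_inj; rewrite [LHS]ph_funE (_ : uv (umk Uu) = u) //.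
  have geq : hb_fun g (tiP ee (tpP e t)) = 0.
    have e2 : hb_fun (e' *: g) t = 0 by rewrite eg.
    rewrite hb_scaleE in e2; rewrite -[RHS]e2.
    by congr (hb_fun g _); apply: esym; apply: ti_e'.
  rewrite -[in RHS](ti_split ee t) linearD geq add0r tiF_tF linearZ_LR yvZ -/u.
  rewrite -[in LHS](ti_split ee t) yvD mulrDl tiF_tF yvZ -mulrA -[X in _ + _ * (X * _)]/F.
  rewrite Fu -Fu mulrA.
  by rewrite -[yv (tiP _ _)]/(pin _ * E) -[_ * E * F]mulrA EF mulr0 mul0r add0r.
Qed.
Lemma good_Y n : good e (Y n).
Proof.
case: n => [|n]; first exact: (good_T H).
by apply: (good_summand (summand_YS ee n)); exact: (good_tau H).
Qed.
Local Notation th n := (thY ee n).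
Definition om_rel n (z : tau2 (Um n)) (r : R) : Prop :=
  exists y w, theta Rs (tau2_map (ph n) z) y w /\ r = yv y + yv (th n w).
Lemma th_Efix n (y : Y n) : e *: y = y -> E * yv y = yv y.
Proof. by move=> ey; rewrite -yvZ ey. Qed.
Lemma th_Ffix n (w : tau2 (Y n)) : f *: w = w -> F * yv (th n w) = yv (th n w).
Proof. by move=> fw; rewrite piF -yvZ -linearZ_LR fw. Qed.
Lemma om_U n z r : @om_rel n z r -> inU e n.+1 r.
Proof.
move=> [y [w [h ->]]]; have [/th_Efix ey /th_Ffix fw] := theta_fix h.
apply: inUD; first by rewrite -ey; apply: (inU_E ee); rewrite ey; exact: yvP.
by rewrite -fw; apply: (inU_F ee); rewrite fw; exact: yvP.
Qed.
Lemma om_total n (z : tau2 (Um n)) : exists r, om_rel z r.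
Proof.
have [y [w h]] := theta_total Rs (tau2_map (ph n) z).
by exists (yv y + yv (th n w)), y, w.
Qed.
Lemma om_uniq n (z : tau2 (Um n)) r r' : om_rel z r -> om_rel z r' -> r = r'.
Proof.
move=> [y [w [h ->]]] [y' [w' [h' ->]]].
by have [-> ->] := theta_uniq (good_Y n) h h'.
Qed.
Lemma om_relD n (z z' : tau2 (Um n)) r r' :
  om_rel z r -> om_rel z' r' -> om_rel (z + z') (r + r').
Proof.
move=> [y [w [h ->]]] [y' [w' [h' ->]]]; exists (y + y'), (w + w'); split.
  by rewrite linearD; exact: (thetaD (good_Y n) h h').
by rewrite linearD !yvD addrACA.
Qed.
Lemma endo_io b : endo H b = tau2_map (lin_comp (princ_ret e)
  (lin_comp (rmulA (ev 0 (E * io b * E))) (princ_incl e))).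
Proof.
apply: linear_ext => z; have [h _ _ _] := io_U b.
rewrite -[LHS]/(tau2_map (princ_ret e) (ev 1 (pin (tau2_map (princ_incl e) z : Tn 1) * E * io b * E))).
rewrite -!mulrA (mulrA E) {1}(iAE h) (ev_homog_mul _ _ (@homog_pin _ _ 1 _)) ev_pin comp_iA1.
by rewrite !tau2_map_comp.
Qed.
Lemma yv_tf b : yv (ract (tf H) b : Y 0) = F * io b.
Proof.
rewrite -[LHS]/(yv (tiF ee (princ_gen f)) * io b) tiF_tF yvZ val_princ_gen -piF.
by rewrite -[yv _]/F FF.
Qed.
(** For u of degree 1, u v is tau(v) applied to u; this matches the off-diagonal action in
    [theta_act_l] with left multiplication in R. *)
Lemma th_pt n (y : Y n) b : e *: y = y ->
  yv (th n (tau2_map (princ_pt e y) (tl_pP H (ract (tf H) b)))) = F * io b * E * yv y.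
Proof.
move=> ey; have [_ _ h _] := io_U b.
have -> : tl_pP H (ract (tf H) b) = tau2_map (princ_ret e) (ev 1 (F * io b * E)).
  by rewrite -[LHS]/(tau2_map (princ_ret e) (ev 1 (yv (ract (tf H) b : Y 0) * E))) yv_tf.
apply: pi3_ext => -[|j]; rewrite (ev_homog_mul _ _ h).
  by rewrite (tau2_comp_low (yv y) (ltnSn 0)); exact: ev_thY0'.
exact: ev_thY_pt.
Qed.
(** b has three corners, since e' b f' = 0. The three action lemmas for [theta] compute each of
    them, and together they give left multiplication by io b. *)
Lemma om_relZ n b (z : tau2 (Um n)) r : om_rel z r -> om_rel (b *: z) (io b * r).
Proof.
move=> [y [w [h ->]]]; have [ey fw] := theta_fix h.
have bE : b = e' * b * e' + f' * b * e' + f' * b * f'.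
  have -> : e' * b * e' = e' * b := esym (tl_e'b H b).
  rewrite -addrA -mulrDr (addrC e') subrK mulr1 -mulrDl (addrC e') subrK mul1r //.
have h1 := theta_act_e (endo_io b) h; have h2 := theta_act_l b h; have h3 := theta_act_f b h.
have hD := thetaD (good_Y n) (thetaD (good_Y n) h1 h2) h3.
rewrite -!scalerDl -bE -linearZ_LR in hD.
eexists; eexists; split; first exact: hD.
set d : A := (X in X *: y); set l := tau2_map _ (tl_pP H _); set a : A := (X in X *: w).
rewrite !addr0 add0r; have -> : th n (l + a *: w) = th n l + a *: th n w.
  by rewrite (linearD (th n)) (linearZ_LR (th n)).
have -> : yv (th n l + a *: th n w) = yv (th n l) + yv (a *: th n w) := yvD _ _.
rewrite (yvZ d y) (yvZ a (th n w)) (th_pt b ey : yv (th n l) = _).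
have -> : iA a = F * io b * F.
  have [_ hF _ _] := io_U b.
  rewrite [RHS](iAE hF); congr iA.
  rewrite -[LHS]/(val (tpF e (ract (tf H) b : Y 0)) : A) (be_pF ee).
  by rewrite -[LHS]/(ev 0 (yv (ract (tf H) b : Y 0) * F)) yv_tf.
have -> : iA d = E * io b * E.
  have [hE _ _ _] := io_U b.
  have -> : d = e * ev 0 (E * io b * E) * e by rewrite /d /= mul1r.
  by rewrite !(hom_mul (iA_hom A)) -(iAE hE) -!mulrA EE !mulrA EE.
have Ey := th_Efix ey; have Fw := th_Ffix fw.
have e1 : io b * yv y = E * io b * E * yv y + F * io b * E * yv y.
  by rewrite -!(mulrA _ E (yv y)) Ey -!mulrDl pi1 mul1r.
have e2 : io b * yv (th n w) = F * io b * F * yv (th n w).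
  have e3 : io b = E * io b + F * io b by rewrite -mulrDl pi1 mul1r.
  have e4 : E * io b * yv (th n w) = 0 by rewrite -Fw mulrA (EUF (io_U b)) mul0r.
  by rewrite -(mulrA _ F) Fw {1}e3 mulrDl e4 add0r.
by rewrite mulrDr e1 e2 addrA.
Qed.
Definition om_fun n (z : tau2 (Um n)) : Um n.+1 :=
  umk (om_U (svalP (cid (om_total z)))).
Lemma om_funP n (z : tau2 (Um n)) : om_rel z (uv (om_fun z)).
Proof. exact: (svalP (cid (om_total z))). Qed.
Lemma om_linear n : linear (@om_fun n).
Proof.
move=> b z z'; apply: uv_inj; apply: (om_uniq (om_funP _)); rewrite uvD uvZ.
by apply: om_relD; [apply: om_relZ|]; exact: om_funP.
Qed.
Definition om n : {linear tau2 (Um n) -> Um n.+1} := mklin (@om_linear n).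
Lemma omP n (z : tau2 (Um n)) : om_rel z (uv (om n z)). Proof. exact: om_funP. Qed.
Lemma om_nat n m v (h : inU e m v) z :
  om (n + m) (tau2_map (rmU n h) z) = rmU n.+1 h (om n z).
Proof.
apply: uv_inj; apply: (om_uniq (omP _)).
have -> : uv (rmU n.+1 h (om n z)) = uv (om n z) * v := erefl.
have [y [w [t ->]]] := omP z.
exists (rmY ee n h y), (tau2_map (rmY ee n h) w); split; last first.
  by rewrite thY_nat !rmYE mulrDl.
have := theta_nat (rmY ee n h) t; congr (theta Rs _ _ _).
rewrite -[LHS]/(lin_comp (tau2_map (homB_map T (rmY ee n h))) (tau2_map (ph n)) z).
rewrite -[RHS]/(lin_comp (tau2_map (ph (n + m))) (tau2_map (rmU n h)) z) -!tau2_map_comp.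
congr (tau2_map _ z); apply: linear_ext => u; apply: hb_ext => t'; apply: yv_inj.
by rewrite homB_mapE /= [LHS]rmYE !ph_funE mulrA.
Qed.
Lemma om_inj n : injective (om n).
Proof.
move=> z z' zz; apply: subr0_eq; move: (z - z') (linearB (om n) z z') => x.
rewrite zz subrr => x0; have [y [w [t e1]]] := omP x; rewrite x0 in e1.
have {}e1 : 0 = yv y + yv (th n w) := e1.
have [ey fw] := theta_fix t; have Ey := th_Efix ey; have Fw := th_Ffix fw.
have y0 : y = 0.
  apply: yv_inj; rewrite yv0 -Ey -[RHS](mulr0 E) [in RHS]e1 mulrDr -Fw.
  by rewrite [X in _ + X]mulrA EF mul0r addr0 Ey.
have w0 : w = 0.
  have hw : th n w = 0; last exact: (thY_inj hw).
  apply: yv_inj; rewrite yv0.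
  by move: e1; rewrite y0 yv0 add0r => <-.
rewrite y0 w0 in t; have [ti _] := ph_bij n; apply: ti; rewrite linear0.
exact: (theta_inj (good_Y n) t).
Qed.
Lemma om_surj n : surj (om n).
Proof.
move=> u; have Yy := inUS_Y (uvP u); have Yw := inU_Y (uvP u).
pose y := ymk Yy; pose yw := ymk Yw; pose w := thYi ee n yw.
have ey : e *: y = y by apply: yv_inj; rewrite yvZ mulrA EE.
have fw : f *: w = w.
  rewrite -linearZ_LR; congr (thYi ee n _); apply: yv_inj.
  by rewrite yvZ -piF mulrA FF.
have [z' t] := theta_onto Rs (good_Y n) ey fw.
have [_ ps] := ph_bij n; have [z zE] := ps z'; exists z.
apply: uv_inj; apply: (om_uniq (omP z)); exists y, w; split; first by rewrite zE.
rewrite (thYiK ee yw).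
by rewrite -[yv y]/(E * uv u) -[yv yw]/(F * uv u) -mulrDl pi1 mul1r.
Qed.
End Omega.

(** * Assembling the isomorphism of preprojective algebras *)

Section Triangle.
Variables (V : zmodType) (f : nat -> nat -> V).
Lemma triangle_sum M : \sum_(n < M) \sum_(i < n.+1) f i (n - i) =
  \sum_(i < M) \sum_(l < M - i) f i l.
Proof.
elim: M => [|M IHM]; first by rewrite !big_ord0.
rewrite big_ord_recr IHM [RHS]big_ord_recr /= subSnn big_ord1.
rewrite [X in _ + X]big_ord_recr /= subnn addrA -big_split; congr (_ + _).
by apply: eq_bigr => i _; rewrite subSn 1?ltnW // big_ord_recr.
Qed.
(** Compares a truncated Cauchy product with the product of truncated sums; the terms outside the
    triangle vanish. *)
Lemma triangle_square M : (forall i l, (M <= i + l)%N -> f i l = 0) ->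
  \sum_(n < M) \sum_(i < n.+1) f i (n - i) = \sum_(i < M) \sum_(l < M) f i l.
Proof.
move=> f0; rewrite triangle_sum; apply: eq_bigr => i _.
rewrite -(big_mkord xpredT (f i)) -(big_mkord xpredT (f i)).
rewrite [RHS](big_cat_nat (n := M - i)) ?leq_subr //= [X in _ = _ + X]big1_seq ?addr0 // => l.
by rewrite mem_index_iota => /andP[_ /andP[h _]]; apply: f0; rewrite -leq_subLR.
Qed.
End Triangle.

Section Corners.
Variables (R : pzRingType) (p q x y z w : R).
Hypotheses (pp : p * p = p) (qq : q * q = q) (pq : p * q = 0) (qp : q * p = 0).
Hypothesis pwq : p * w * q = w.
Lemma corner_sum :
  [/\ p * (p * x * p + q * y * q + q * z * p + w) * p = p * x * p,
      q * (p * x * p + q * y * q + q * z * p + w) * q = q * y * q,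
      q * (p * x * p + q * y * q + q * z * p + w) * p = q * z * p &
      p * (p * x * p + q * y * q + q * z * p + w) * q = w].
Proof.
have wp : w * p = 0 by rewrite -pwq -mulrA qp mulr0.
have qw : q * w = 0 by rewrite -pwq !mulrA qp !mul0r.
split; rewrite !mulrDr !mulrDl !mulrA ?pp ?qq ?pq ?qp ?qw ?pwq ?mul0r ?addr0 ?add0r;
  rewrite -!mulrA ?pp ?qq ?pq ?qp ?wp ?mulr0 ?addr0 ?add0r //.
Qed.
End Corners.

Section TauBijective.
Variables (K : fieldType) (A : kalgType K) (X Y : lmodType A) (g : {linear X -> Y}).
Lemma tau2_map_bij : injective g -> surj g ->
  injective (tau2_map g) /\ surj (tau2_map g).
Proof.
move=> gi gs; have [h [hg gh]] := linear_inverse gi gs.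
have e1 x : tau2_map h (tau2_map g x) = x.
  rewrite -[LHS]/(lin_comp (tau2_map h) (tau2_map g) x) -tau2_map_comp.
  by rewrite (_ : lin_comp h g = idfun) ?tau2_map_id //; exact: linear_ext.
have e2 y : tau2_map g (tau2_map h y) = y.
  rewrite -[LHS]/(lin_comp (tau2_map g) (tau2_map h) y) -tau2_map_comp.
  by rewrite (_ : lin_comp g h = idfun) ?tau2_map_id //; exact: linear_ext.
by split; [exact: can_inj e1 | move=> y; exists (tau2_map h y)].
Qed.
End TauBijective.

Section Assemble.
Variables (K : fieldType) (A B : kalgType K) (e : A).
Hypothesis ee : e * e = e.
Hypothesis fe0 : forall a : A, a * e = e * a * e.
Variable io : B -> pi3 A.
Hypothesis hio : kalg_hom io.
Hypothesis io_inj : injective io.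
Hypothesis io_im : forall u, inU e 0 u <-> exists b, io b = u.
Local Notation Un n := (Um ee hio io_im n).
Local Notation R := (pi3 A).
Local Notation E := (iA e : pi3 A).
Local Notation F := (1 - iA e : pi3 A).
Local Notation EE := (piEE ee).
Local Notation EF := (piEF ee).
Local Notation FE := (piFE ee).
Local Notation FF := (piFF ee).
Local Notation io_U := (io_U io_im).
Local Notation Bn n := (tau2_iter n (B^o : lmodType B)).
Variable omg : forall n, {linear tau2 (Un n) -> Un n.+1}.
Hypothesis omg_nat : forall n m v (h : inU e m v) z,
  omg (n + m) (tau2_map (rmU ee hio io_im n h) z) =
  rmU ee hio io_im n.+1 h (omg n z).
Hypothesis omg_inj : forall n, injective (omg n).
Hypothesis omg_surj : forall n, surj (omg n).
Lemma Om0_linear : linear ((fun b : B^o => umk ee hio io_im (io_U b)) : B^o -> Un 0).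
Proof.
move=> a x y; apply: uv_inj; rewrite [RHS]uvD (uvZ a (umk _ _ _ (io_U x))).
by rewrite -[LHS]/(io ((a : B) * x + y)) (hom_add hio) (hom_mul hio).
Qed.
Fixpoint Om n : {linear Bn n -> Un n} :=
  match n return {linear Bn n -> Un n} with
  | 0 => mklin Om0_linear
  | m.+1 => lin_comp (omg m) (tau2_map (Om m))
  end.
Lemma Om0E b : uv (Om 0 b) = io b. Proof. by []. Qed.
Lemma OmS n (x : Bn n.+1) : Om n.+1 x = omg n (tau2_map (Om n) x). Proof. by []. Qed.
Lemma Om_bij n : injective (Om n) /\ surj (Om n).
Proof.
elim: n => [|n [IHi IHs]].
  split=> [x y xy|u]; first by apply: io_inj; rewrite -!Om0E xy.
  by have [b bE] := (io_im _).1 (uvP u); exists b; apply: uv_inj; rewrite Om0E.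
have [ti ts] := tau2_map_bij IHi IHs; split=> [x y xy|u].
  by apply: ti; apply: (omg_inj); rewrite -!OmS.
by have [z <-] := omg_surj u; have [x <-] := ts z; exists x; rewrite OmS.
Qed.
Implicit Types u v : pi3 B.
Definition hat v n : R := uv (Om n (ev n v)).
Lemma hatU v n : inU e n (hat v n). Proof. exact: uvP. Qed.
(** Since [omg] commutes with right multiplication, tau'^i of the k-th component of v becomes right
    multiplication by [hat v k]; hence composition in Pi_3(A') becomes the product of R. *)
Lemma Om_comp v i k (x : Bn i) :
  Om (i + k) (tau2_comp v i (i + k) x) = rmU ee hio io_im i (hatU v k) (Om i x).
Proof.
elim: i x => [|i IHi] x.
  apply: uv_inj; have -> : tau2_comp v 0 (0 + k) x = (x : B) *: ev k v by exact: pi3_ptE.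
  by rewrite (linearZ_LR (Om k)) (uvZ (x : B)) rmUE Om0E.
rewrite [RHS](_ : _ = rmU ee hio io_im i.+1 (hatU v k) (omg i (tau2_map (Om i) x))) //.
rewrite -omg_nat [LHS](_ : _ = omg (i + k) (tau2_map (Om (i + k))
  (tau2_map (tau2_comp v i (i + k)) x))) //; congr (omg _ _).
rewrite -[LHS]/(lin_comp (tau2_map (Om (i + k))) (tau2_map (tau2_comp v i (i + k))) x).
rewrite -[RHS]/(lin_comp (tau2_map (rmU ee hio io_im i (hatU v k))) (tau2_map (Om i)) x) -!tau2_map_comp.
congr (tau2_map _ x); apply: linear_ext => z; exact: IHi.
Qed.
Lemma uv_sum n (I : Type) (r : seq I) (G : I -> Un n) :
  uv (\sum_(k <- r) G k) = \sum_(k <- r) uv (G k).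
Proof. by apply: (big_morph (fun x : Un n => uv x)) => // x y; rewrite uvD. Qed.
Lemma hat_mul u v n : hat (u * v) n = \sum_(i < n.+1) hat u i * hat v (n - i).
Proof.
rewrite /hat ev_mul linear_sum uv_sum; apply: eq_bigr => i _.
have := ltn_ord i; rewrite ltnS => /subnKC; move: (n - i)%N => k.
move: (i : nat) (ev i u) => {}i x; case: _ / => {n}.
by rewrite Om_comp rmUE.
Qed.
Lemma hatD u v n : hat (u + v) n = hat u n + hat v n.
Proof. by rewrite /hat evD linearD uvD. Qed.
Lemma hat_inj u v : (forall n, hat u n = hat v n) -> u = v.
Proof.
move=> h; apply: pi3_ext => n; have [i _] := Om_bij n; apply: i; apply: uv_inj; exact: h.
Qed.
Lemma hat_eq0 v n : hat v n = 0 <-> v n = 0.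
Proof.
rewrite /hat; split=> [h|h].
  have e1 : ev n v = 0.
    by have [i _] := Om_bij n; apply: i; apply: uv_inj; rewrite h linear0.
  by apply: linear_ext => a; rewrite (pi3_ptE n v (a : B)) e1; exact: scaler0.
by have -> : ev n v = 0; [rewrite /ev h | rewrite linear0].
Qed.
Lemma pi4 (u : R) : u = E * u * E + F * u * F + F * u * E + E * u * F.
Proof.
have e1 : u = E * u + F * u by rewrite -mulrDl pi1 mul1r.
have e2 x : x = x * E + x * F :> R by rewrite -mulrDr pi1 mulr1.
rewrite [LHS]e1 [E * u in LHS]e2 [F * u in LHS]e2 -!addrA; congr (_ + _).
by rewrite addrC -addrA addrCA.
Qed.
Lemma inU_low k (u : R) j : inU e k u -> (j.+1 < k)%N -> ev j u = 0.
Proof.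
move=> [h1 h2 h3 h4] jk; rewrite [u]pi4 !evD h1 ?h2 ?h3 ?h4 ?addr0 //.
- by move=> E1; rewrite E1 ltnn in jk.
- by move=> E1; rewrite E1 ltnNge leqW in jk.
- by move=> E1; rewrite E1 ltnNge leqnSn in jk.
- by move=> E1; rewrite E1 ltnNge leqnSn in jk.
Qed.
Lemma ev_mul_iA (u : R) b j : ev j (u * iA b) = tau2_comp (iA b) j j (ev j u).
Proof.
have e1 : (u * iA b) j = lin_comp (tau2_comp (iA b) j j) (u j) := pi3_mulr_deg0 u _ j.
by rewrite /ev e1.
Qed.
Lemma ev_corner (u w : R) a b j : ev j u = ev j w ->
  ev j (iA a * u * iA b) = ev j (iA a * w * iA b).
Proof. by move=> h; rewrite !ev_mul_iA !iA_mulE h. Qed.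
Lemma ev0_FuE (u : R) : ev 0 (F * u * E) = 0.
Proof.
rewrite piF ev_mul_iA iA_mulE -[LHS]/((1 - e) * (ev 0 u : A) * e) mulrBl mul1r mulrBl.
by rewrite -fe0 subrr.
Qed.
(** The corner F u E is compared in positive degrees only, as in degree 0 it is zero by (1 - e) A e
    = 0. *)
Definition same (u w : R) := [/\ forall j, ev j (E * u * E) = ev j (E * w * E),
  forall j, ev j (F * u * F) = ev j (F * w * F),
  forall j, ev j.+1 (F * u * E) = ev j.+1 (F * w * E) &
  forall j, ev j (E * u * F) = ev j (E * w * F)].
Lemma same_eq (u w : R) : same u w -> u = w.
Proof.
move=> [h1 h2 h3 h4]; apply: pi3_ext => j; rewrite [u]pi4 [w]pi4 !evD h1 h2 h4.
by case: j => [|j]; [rewrite !ev0_FuE | rewrite h3].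
Qed.
Definition hsum v M : R := \sum_(k < M) hat v k.
(** The infinite sum of all [hat v k]. U_k starts in degree k - 1 ([inU_low]), so only k <= j + 1
    contributes in degree j, whence the bound [j.+2]. *)
Definition Ph v : R := fun j => hsum v j.+2 j.
Lemma ev_Ph v j M : (j.+2 <= M)%N -> ev j (hsum v M) = ev j (Ph v).
Proof.
move=> /subnK <-; elim: (M - j.+2)%N => [//|m IHm].
rewrite addSn [hsum v _]big_ord_recr evD IHm (inU_low (hatU v _)) ?addr0 //.
exact: leq_addl.
Qed.
Lemma ev_Ph_corner v a b j M : (j.+2 <= M)%N ->
  ev j (iA a * Ph v * iA b) = \sum_(k < M) ev j (iA a * hat v k * iA b).
Proof.
move=> jM; rewrite (ev_corner a b (esym (ev_Ph v jM))) mulr_sumr mulr_suml.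
exact: ev_sum.
Qed.
Lemma sum_single (V : zmodType) M (i : nat) (G : nat -> V) : (i < M)%N ->
  (forall k, k <> i -> G k = 0) -> \sum_(k < M) G k = G i.
Proof.
move=> iM G0; rewrite (bigD1 (Ordinal iM)) //= big1 ?addr0 // => k ki.
by apply: G0 => E1; case/eqP: ki; exact: val_inj.
Qed.
Lemma Ph_EE v j : ev j (E * Ph v * E) = ev j (E * hat v j * E).
Proof.
rewrite (ev_Ph_corner _ _ _ (leqnn _)); apply: (@sum_single _ _ j (fun k => ev j (E * hat v k * E))) => // k kj.
by have [h _ _ _] := hatU v k; apply: h => E1; apply: kj.
Qed.
Lemma Ph_FF v j : ev j (F * Ph v * F) = ev j (F * hat v j * F).
Proof.
rewrite piF (ev_Ph_corner _ _ _ (leqnn _)) -piF.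
apply: (@sum_single _ _ j (fun k => ev j (F * hat v k * F))) => // k kj.
by have [_ h _ _] := hatU v k; apply: h => E1; apply: kj.
Qed.
Lemma Ph_FE v j : ev j.+1 (F * Ph v * E) = ev j.+1 (F * hat v j * E).
Proof.
rewrite piF (ev_Ph_corner _ _ _ (leqnn _)) -piF.
apply: (@sum_single _ j.+3 j (fun k => ev j.+1 (F * hat v k * E))) => [|k kj]; first by rewrite ltnS -addn2 leq_addr.
by have [_ _ h _] := hatU v k; apply: h => -[E1]; apply: kj.
Qed.
Lemma Ph_EF v j : ev j (E * Ph v * F) = ev j (E * hat v j.+1 * F).
Proof.
rewrite piF (ev_Ph_corner _ _ _ (leqnn _)) -piF.
apply: (@sum_single _ _ j.+1 (fun k => ev j (E * hat v k * F))) => // k kj.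
by have [_ _ _ h] := hatU v k; apply: h => E1; apply: kj.
Qed.
Lemma PhD u v : Ph (u + v) = Ph u + Ph v.
Proof.
apply: pi3_ext => j; rewrite evD -[LHS]/(ev j (hsum (u + v) j.+2)) /hsum.
under eq_bigr do rewrite hatD.
by rewrite big_split.
Qed.
Lemma PhM u v : Ph (u * v) = Ph u * Ph v.
Proof.
apply: pi3_ext => j; rewrite -[LHS]/(ev j (hsum (u * v) j.+2)).
rewrite (_ : ev j (Ph u * Ph v) = ev j (hsum u j.+2 * hsum v j.+2)); last first.
  by apply: ev_mul_local => m mj; rewrite ev_Ph.
rewrite /hsum mulr_suml !ev_sum.
under eq_bigr do rewrite hat_mul ev_sum.
under [RHS]eq_bigr do rewrite mulr_sumr ev_sum.
apply: (triangle_square (f := fun i l => ev j (hat u i * hat v l))) => i l jil.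
by apply: inU_low jil; apply: inU_mul => //; exact: hatU.
Qed.
Lemma Ph_deg0 (g : {linear B^o -> B^o}) : Ph (pi3_deg0 g) = io (g 1).
Proof.
apply: pi3_ext => j; rewrite -[LHS]/(ev j (hsum (pi3_deg0 g) j.+2)) /hsum.
rewrite big_ord_recl big1 ?addr0 // => i _.
by rewrite /hat [ev _ _](_ : _ = 0) ?linear0.
Qed.
Lemma Ph_hom : kalg_hom Ph.
Proof.
split; [exact: PhD | exact: PhM | move=> k].
by rewrite -[scal k]/(pi3_deg0 (scal_map B^o k)) Ph_deg0 /= /scal_fun [_ *: _]mulr1 (hom_scal hio).
Qed.
Lemma inU_same k (u w : R) : inU e k u -> inU e k w ->
  ev k (E * u * E) = ev k (E * w * E) -> ev k (F * u * F) = ev k (F * w * F) ->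
  ev k.+1 (F * u * E) = ev k.+1 (F * w * E) ->
  (forall j, k = j.+1 -> ev j (E * u * F) = ev j (E * w * F)) -> u = w.
Proof.
move=> [h1 h2 h3 h4] [g1 g2 g3 g4] q1 q2 q3 q4; apply: same_eq; split=> j.
- by have [->|/eqP n] := eqVneq j k; [| rewrite h1 // g1].
- by have [->|/eqP n] := eqVneq j k; [| rewrite h2 // g2].
- by have [[->]|/eqP n] := eqVneq j.+1 k.+1; [| rewrite h3 // g3].
- by have [E1|/eqP n] := eqVneq j.+1 k; [exact: q4 (esym E1) | rewrite h4 // g4].
Qed.
Lemma Ph_inj : injective Ph.
Proof.
move=> u v uv; apply: hat_inj => n; apply: (inU_same (hatU u n) (hatU v n)).
- by rewrite -!Ph_EE uv.
- by rewrite -!Ph_FF uv.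
- by rewrite -!Ph_FE uv.
- by move=> j ->; rewrite -!Ph_EF uv.
Qed.
Definition cmp k (u : R) : R := pin (ev k u).
Lemma homog_cmp k (u : R) : homog k (cmp k u). Proof. exact: homog_pin. Qed.
Definition low k (u : R) : R := if k is j.+1 then E * cmp j u * F else 0.
(** The projection of R onto U_k, each corner being taken in its own degree: k, k, k + 1 and k -
    1. *)
Definition proj k (u : R) : R :=
  E * cmp k u * E + F * cmp k u * F + F * cmp k.+1 u * E + low k u.
Lemma low_EF k (u : R) : E * low k u * F = low k u.
Proof.
by case: k => [|k]; rewrite /low ?mulr0 ?mul0r // !mulrA EE -!mulrA FF.
Qed.
Lemma proj_corners k (u : R) :
  [/\ E * proj k u * E = E * cmp k u * E, F * proj k u * F = F * cmp k u * F,
      F * proj k u * E = F * cmp k.+1 u * E & E * proj k u * F = low k u].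
Proof. exact: (corner_sum _ _ _ EE FF EF FE (low_EF k u)). Qed.
Lemma proj_U k (u : R) : inU e k (proj k u).
Proof.
have [pE pF pFE pEF] := proj_corners k u; split; rewrite ?pE ?pF ?pFE ?pEF.
- by apply: homog_mulE; apply: homog_Emul; exact: homog_cmp.
- by apply: homog_mulF; apply: homog_Fmul; exact: homog_cmp.
- by apply: homog_mulE; apply: homog_Fmul; exact: homog_cmp.
- case: k {pE pF pFE pEF} => [|k] //; apply/homogp_pred.
  by apply: homog_mulF; apply: homog_Emul; exact: homog_cmp.
Qed.
Lemma Ph_surj : surj Ph.
Proof.
move=> r; pose x k := sval (cid ((Om_bij k).2 (umk ee hio io_im (proj_U k r)))).
have xP k : Om k (x k) = umk ee hio io_im (proj_U k r) .
  exact: (svalP (cid ((Om_bij k).2 (umk ee hio io_im (proj_U k r))))).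
exists (fun k => mklin (pt_linear (x k))).
set v : pi3 B := fun k => _; have hv k : hat v k = proj k r.
  have -> : proj k r = uv (Om k (x k)) by rewrite xP.
  congr (uv (Om k _)); exact: scale1r.
have ec k : ev k (cmp k r) = ev k r by exact: ev_pin.
have pc j := proj_corners j r.
apply: same_eq; split=> j; have [pEE pFF pFE pEF] := pc j.
- by rewrite Ph_EE hv pEE; apply: ev_corner.
- by rewrite Ph_FF hv pFF piF; apply: ev_corner.
- by rewrite Ph_FE hv pFE piF; apply: ev_corner.
- by have [_ _ _ {}pEF] := pc j.+1; rewrite Ph_EF hv pEF /low piF; apply: ev_corner.
Qed.
Lemma Ph_support (L : set nat) v : (forall i, ~ L i -> v i = 0) <->
  [/\ forall i, ~ L i -> ev i (E * Ph v * E) = 0,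
      forall i, ~ L i -> ev i (F * Ph v * F) = 0,
      forall i, ~ L i -> ev i.+1 (F * Ph v * E) = 0 &
      forall i, ~ L i.+1 -> ev i (E * Ph v * F) = 0].
Proof.
split=> [h|[h1 h2 h3 h4] i Li].
  have hh i : ~ L i -> hat v i = 0 by move=> Li; apply/hat_eq0; exact: h.
  by split=> i Li; rewrite ?Ph_EE ?Ph_FF ?Ph_FE ?Ph_EF hh // mulr0 mul0r.
apply/hat_eq0; apply: (inU_same (hatU v i) (inU0 e i)).
- by rewrite -Ph_EE h1 // mulr0 mul0r.
- by rewrite -Ph_FF h2 // mulr0 mul0r.
- by rewrite -Ph_FE h3 // mulr0 mul0r.
- by move=> j E1; rewrite [in LHS]E1 -Ph_EF h4 -?E1 // mulr0 mul0r.
Qed.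
End Assemble.

Section PreprojectiveMutation.
Variables (K : fieldType) (A B : kalgType K) (e : A).
Hypothesis fdA : findim (kspace A).
Hypothesis gl : forall X Y : lmodType A, xv 2 X Y.
Hypothesis ee : e * e = e.
Hypothesis e0 : e <> 0.
Hypothesis fe0 : forall a : A, a * e = e * a * e.
Hypothesis inv : forall x, e * x * e = x -> x <> 0 -> exists y, x * y = e /\ y * x = e.
Hypothesis hom0 : forall h : {linear dual_mod A -> princ e}, h = 0.
Hypothesis ext0 : xv 0 (dual_mod A) (princ e).
Variable io : B -> pi3 A.
Hypothesis hio : kalg_hom io.
Hypothesis io_inj : injective io.
Hypothesis io_im : forall u, inU e 0 u <-> exists b, io b = u.
Local Notation E := (iA e : pi3 A).
Local Notation F := (1 - iA e : pi3 A).
(** The part of the theorem that does not involve species: B is any algebra identified through [io]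
    with the degree 0 part of R for the shifted grading. *)
Lemma pi3_mutation :
  [/\ findim (kspace B), forall X Y : lmodType B, xv 2 X Y,
      alg_iso (end_op (apr2_module e)) B
    & exists Ph : pi3 B -> pi3 A,
      [/\ kalg_hom Ph, bijective Ph, forall g, Ph (pi3_deg0 g) = io (g 1)
        & forall (L : set nat) v, (forall i, ~ L i -> v i = 0) <->
          [/\ forall i, ~ L i -> ev i (E * Ph v * E) = 0,
              forall i, ~ L i -> ev i (F * Ph v * F) = 0,
              forall i, ~ L i -> ev i.+1 (F * Ph v * E) = 0 &
              forall i, ~ L i.+1 -> ev i (E * Ph v * F) = 0]]].
Proof.
have [D] := apr_data_exists fdA gl ee e0 fe0 inv hom0 ext0.
pose H := tilt_pi fdA gl ee e0 fe0 inv D hio io_inj io_im.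
split.
- exact: (tl_fdA' H).
- exact: (tilt_gldim H).
- exact: (end_op_iso H).
have ff := idem_ff ee.
(* D(fA) is injective, so every Ext into it vanishes and it has a T-resolution. *)
have gM : good e (dcorner (1 - e)).
  have inj := summand_injective_xv (summand_dcorner ff).
  by split; exact: inj.
have fM : findim (restr_scal (dcorner (1 - e))).
  by apply: (summand_findim (summand_dcorner ff)); exact: dual_findim.
have [Rs] := tres_exists H gM fM.
pose omg := om Rs.
have on n m v (h : inU e m v) z := om_nat Rs h z : omg (n + m) _ = _.
have oi n : injective (omg n) := @om_inj _ _ _ _ _ _ _ _ _ _ _ _ _ _ _ Rs n.
have os n : surj (omg n) := @om_surj _ _ _ _ _ _ _ _ _ _ _ _ _ _ _ Rs n.
exists (Ph omg); split.
- exact: (Ph_hom on).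
- have inj := Ph_inj fe0 io_inj oi os; have sur := Ph_surj fe0 io_inj oi os.
  have [s sE] := choice sur; exact: (Bijective (fun x => inj _ _ (sE _)) sE).
- exact: Ph_deg0.
- exact: (Ph_support fe0 io_inj oi os).
Qed.
End PreprojectiveMutation.

(** * Species, paths and gradings *)

Section TensorFunctor.
Variables (K : fieldType) (D : kalgType K) (M N : bimodule D D) (h : M -> N).
Hypothesis hD : forall x y, h (x + y) = h x + h y.
Hypothesis hZ : forall (d : D) x, h (d *: x) = d *: h x.
Hypothesis hR : forall x d, h (ract x d) = ract (h x) d.
Fixpoint tmap (n : nat) : tpow M n -> tpow N n :=
  match n return tpow M n -> tpow N n with
  | 0 => fun d => d
  | m.+1 => tens_lift (fun (x : M) (u : tpow M m) => ptens (h x) (tmap u))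
  end.
Lemma tmap_lin n : (forall t u : tpow M n, tmap (t + u) = tmap t + tmap u) /\
  (forall (d : D) (t : tpow M n), tmap (d *: t) = d *: tmap t).
Proof.
elim: n => [|n [IHD IHZ]]; first by [].
have bal : balanced (fun (x : M) (u : tpow M n) => ptens (h x) (tmap u)).
  split=> [x y v|x u v|x d v]; first by rewrite hD ptensDl.
    by rewrite IHD ptensDr.
  by rewrite IHZ hR ptensB.
have hD' (t u : tpow M n.+1) : tmap (t + u) = tmap t + tmap u by exact: tens_liftD.
split=> // d t; elim/ptens_ind: t => [|x v|p q hp hq].
- have h0 : tmap (0 : tpow M n.+1) = 0.
    by apply: (addrI (tmap (0 : tpow M n.+1))); rewrite -hD' !addr0.
  by rewrite scaler0 h0 scaler0.
- by rewrite ptensZ /= !tens_liftE // hZ ptensZ.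
- by rewrite scalerDr !hD' hp hq scalerDr.
Qed.
Lemma tmapD n (t u : tpow M n) : tmap (t + u) = tmap t + tmap u.
Proof. exact: (tmap_lin n).1. Qed.
Lemma tmap0 n : tmap (0 : tpow M n) = 0.
Proof. by apply: (addrI (tmap (0 : tpow M n))); rewrite -tmapD !addr0. Qed.
Lemma tmap_ptens n x (u : tpow M n) : @tmap n.+1 (ptens x u) = ptens (h x) (tmap u).
Proof.
rewrite /= tens_liftE //; split=> [y z v|y v w|y d v]; first by rewrite hD ptensDl.
  by rewrite tmapD ptensDr.
by rewrite (tmap_lin n).2 hR ptensB.
Qed.
Definition ct_map (f : ctens M) : ctens N := fun n => tmap (f n).
Lemma ct_mapD f g : ct_map (f + g) = ct_map f + ct_map g.
Proof. by apply: dprodP => n; exact: tmapD. Qed.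
Lemma ct_map_deg0 d : ct_map (ct_deg0 M d) = ct_deg0 N d.
Proof. by apply: dprodP => -[|n] //; exact: (@tmap0 n.+1). Qed.
Lemma ct_map_shift x f : ct_map (ct_shift x f) = ct_shift (h x) (ct_map f).
Proof. by apply: dprodP => -[|n] //; exact: tmap_ptens. Qed.
Lemma ct_map_deg1 x : ct_map (ct_deg1 x) = ct_deg1 (h x).
Proof.
apply: dprodP => -[|[|n]] //; first exact: tmap_ptens.
exact: (@tmap0 n.+2).
Qed.
Lemma ct_map_act n (t : tpow M n) g : ct_map (ct_act t g) = ct_act (tmap t) (ct_map g).
Proof.
elim: n t => [|n IHn] t.
  by apply: dprodP => m; exact: (tmap_lin m).2.
elim/ptens_ind: t => [|x v|p q hp hq].
- rewrite (@tmap0 n.+1) !(@ct_act0 _ _ _ n.+1); apply: dprodP => m; exact: tmap0.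
- by rewrite tmap_ptens !ct_act_ptens ct_map_shift IHn.
- by rewrite (@tmapD n.+1) !(@ct_actD _ _ _ n.+1) ct_mapD hp hq.
Qed.
Lemma tmap_sum n (I : Type) (r : seq I) (G : I -> tpow M n) :
  tmap (\sum_(k <- r) G k) = \sum_(k <- r) tmap (G k).
Proof. by apply: (big_morph (@tmap n)); [exact: tmapD | exact: tmap0]. Qed.
Lemma ct_mapM f g : ct_map (f * g) = ct_map f * ct_map g.
Proof.
apply: dprodP => n; rewrite [LHS]tmap_sum; apply: eq_bigr => k _.
by rewrite -ct_map_act.
Qed.
Lemma ct_map_hom : kalg_hom ct_map.
Proof.
by split; [exact: ct_mapD | exact: ct_mapM | move=> k; exact: ct_map_deg0].
Qed.
End TensorFunctor.

Section TensorRetract.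
Variables (K : fieldType) (D : kalgType K) (M N : bimodule D D) (h : M -> N) (g : N -> M).
Hypothesis hD : forall x y, h (x + y) = h x + h y.
Hypothesis hZ : forall (d : D) x, h (d *: x) = d *: h x.
Hypothesis hR : forall x d, h (ract x d) = ract (h x) d.
Hypothesis gD : forall x y, g (x + y) = g x + g y.
Hypothesis gZ : forall (d : D) x, g (d *: x) = d *: g x.
Hypothesis gR : forall x d, g (ract x d) = ract (g x) d.
Hypothesis gh : forall x, g (h x) = x.
Lemma ct_map_retract f : ct_map g (ct_map h f) = f.
Proof.
apply: dprodP => n; rewrite /ct_map; move: (f n); elim: n => [|n IHn] t //.
elim/ptens_ind: t => [|x v|p q hp hq].
- by rewrite !(@tmap0 _ _ _ _ h, @tmap0 _ _ _ _ g).
- by rewrite !(@tmap_ptens _ _ _ _ h, @tmap_ptens _ _ _ _ g) // gh IHn.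
- by rewrite (@tmapD _ _ _ _ h) // (@tmapD _ _ _ _ g) // hp hq.
Qed.
End TensorRetract.
Lemma reflect_matchT (P : Prop) b (r : reflect P b) T (f : P -> T) y z :
  P -> (forall q, f q = z) -> match r with ReflectT q => f q | ReflectF _ => y end = z.
Proof. by case: r. Qed.
Lemma reflect_matchF (P : Prop) b (r : reflect P b) T (f : P -> T) y :
  ~ P -> match r with ReflectT q => f q | ReflectF _ => y end = y.
Proof. by case: r. Qed.

Section SpeciesInclusion.
Variables (K : fieldType) (Q : quiver) (S : species K Q) (C : {set arr Q}).
Local Notation SC := (restrict_species S C).
Local Notation D := (totD (sp_D S)).
Local Notation incl := (@totM_incl K Q S C).
Definition totM_restr (x : totM S) : totM SC := fun a => x (val a).
Lemma totM_inclE (x : totM SC) (a : arr (delete_arrows C)) : incl x (val a) = x a.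
Proof.
case: a => b p; apply: reflect_matchT => //= q.
by rewrite (bool_irrelevance q p).
Qed.
Lemma totM_incl0 (x : totM SC) (a : arr Q) : a \in C -> incl x a = 0.
Proof. by move=> aC; apply: reflect_matchF; rewrite aC. Qed.
Lemma totM_incl_ext (x y : totM S) :
  (forall a : arr (delete_arrows C), x (val a) = y (val a)) ->
  (forall a : arr Q, a \in C -> x a = y a) -> x = y.
Proof.
move=> h1 h2; apply: dprodP => a; case: (boolP (a \in C)) => aC; first exact: h2.
exact: (h1 (exist (fun a => a \notin C) a aC)).
Qed.
Lemma totM_inclD x y : incl (x + y) = incl x + incl y.
Proof.
apply: totM_incl_ext => a; last by move=> aC; rewrite -[RHS]/(incl x a + incl y a) !totM_incl0 ?addr0.
by rewrite -[RHS]/(incl x (val a) + incl y (val a)) !totM_inclE.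
Qed.
Lemma totM_inclZ (d : D) x : incl (d *: (x : totM SC)) = d *: incl x.
Proof.
apply: totM_incl_ext => a; last first.
  by move=> aC; rewrite -[RHS]/(d (tgt a) *: incl x a) !totM_incl0 // scaler0.
by rewrite -[RHS]/(d (tgt (val a)) *: incl x (val a)) !totM_inclE.
Qed.
Lemma totM_inclR x (d : D) : incl (ract (x : totM SC) d) = ract (incl x) d.
Proof.
apply: totM_incl_ext => a.
  by rewrite -[RHS]/(ract (incl x (val a)) (d (src (val a)))) !totM_inclE.
move=> aC; rewrite -[RHS]/(ract (incl x a) (d (src a))) !totM_incl0 //.
by apply: (addrI (ract 0 (d (src a)))); rewrite -ractDl !addr0.
Qed.
Lemma totM_inclK x : totM_restr (incl x) = x.
Proof. by apply: dprodP => a; exact: totM_inclE. Qed.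
Lemma totM_restrK (x : totM S) : (forall a, a \in C -> x a = 0) -> incl (totM_restr x) = x.
Proof.
move=> x0; apply: totM_incl_ext => a; first by rewrite totM_inclE.
by move=> aC; rewrite totM_incl0 // x0.
Qed.
Local Notation TS := (That S).
Local Notation TC := (That SC).
Definition That_restr (f : TS) : TC :=
  @ct_map K D (totM S) (totM SC : bimodule D D) (@totM_restr) f.
Lemma That_incl_hom : kalg_hom (@That_incl K Q S C).
Proof. exact: (@ct_map_hom K D (totM SC : bimodule D D) (totM S) incl totM_inclD totM_inclZ totM_inclR). Qed.
Lemma That_restr_hom : kalg_hom That_restr.
Proof. exact: (@ct_map_hom K D (totM S) (totM SC : bimodule D D) totM_restr). Qed.
Lemma That_inclK (f : TC) : That_restr (That_incl f) = f.
Proof.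
exact: (@ct_map_retract K D (totM SC : bimodule D D) (totM S) incl totM_restr
  totM_inclD totM_inclZ totM_inclR _ _ _ totM_inclK).
Qed.
Lemma That_incl_deg1 (x : totM SC) :
  That_incl (ct_deg1 x) = ct_deg1 (incl x) :> ctens (totM S).
Proof. exact: (@ct_map_deg1 K D (totM SC : bimodule D D) (totM S) incl totM_inclD totM_inclZ totM_inclR). Qed.
Lemma That_incl_deg0 (d : D) : That_incl (ct_deg0 (totM SC) d) = ct_deg0 (totM S) d.
Proof. exact: (@ct_map_deg0 K D (totM SC : bimodule D D) (totM S) incl totM_inclD totM_inclZ totM_inclR). Qed.
Lemma That_restr_deg1 (x : totM S) :
  That_restr (ct_deg1 x) = ct_deg1 (totM_restr x) :> ctens (totM SC).
Proof. exact: (@ct_map_deg1 K D (totM S) (totM SC : bimodule D D) totM_restr). Qed.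
End SpeciesInclusion.

Section PathSpan.
Variables (K : fieldType) (Q : quiver) (S : species K Q).
Local Notation D := (totD (sp_D S)).
Local Notation M := (totM S).
Local Notation T := (That S).
Local Notation d0 := (ct_deg0 M).
Implicit Types (f g h : T) (w : seq (arr Q)) (L : set (seq (arr Q))) (d : D) (x : M).
Lemma ct_deg1_shift x g : ct_deg1 x * g = ct_shift x g :> T.
Proof.
have -> : ct_deg1 x = ct_shift x 1 :> T.
  by apply: dprodP => -[|[|n]] //; exact: (esym (ptens0r _ x)).
by rewrite [LHS]ct_mul_shift; congr (ct_shift x _); exact: mul1r.
Qed.
Lemma ct_deg1D x y : ct_deg1 (x + y) = ct_deg1 x + ct_deg1 y :> T.
Proof. by rewrite -[LHS]mulr1 -[ct_deg1 x]mulr1 -[ct_deg1 y]mulr1 !ct_deg1_shift ct_shiftDl. Qed.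
Lemma ct_deg10 : ct_deg1 0 = 0 :> T.
Proof. by apply: (addrI (ct_deg1 0 : T)); rewrite -ct_deg1D !addr0. Qed.
Lemma d0_deg1 d x : d0 d * ct_deg1 x = ct_deg1 (d *: x) :> T.
Proof.
rewrite -[ct_deg1 x]mulr1 -[RHS]mulr1 !ct_deg1_shift -ct_shiftZ; exact: ct_mul0act.
Qed.
Lemma deg1_d0 d x : ct_deg1 x * d0 d = ct_deg1 (ract x d) :> T.
Proof.
rewrite -[RHS]mulr1 !ct_deg1_shift ct_shiftB; congr ct_shift.
by rewrite -[RHS]ct_mul0act; exact: (esym (mulr1 _)).
Qed.
Lemma ps_ind L (P : T -> Prop) : P 0 -> (forall f g, P f -> P g -> P (f + g)) ->
  (forall w f, L w -> path_tensor w f -> P f) -> forall f, path_span L f -> P f.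
Proof.
move=> P0 PD Pw f [s sP ->]; elim: s sP => [|g s IHs] sP; first by rewrite big_nil.
rewrite big_cons; apply: PD; last by apply: IHs => y ys; apply: sP; rewrite in_cons ys orbT.
by have [w Lw wg] := sP g (mem_head _ _); exact: Pw wg.
Qed.
Lemma ps0 L : path_span L (0 : T).
Proof. by exists [::] => //; rewrite big_nil. Qed.
Lemma psD L f g : path_span L f -> path_span L g -> path_span L (f + g).
Proof.
move=> [s sP ->] [r rP ->]; exists (s ++ r); last by rewrite big_cat.
by move=> y; rewrite mem_cat => /orP[/sP|/rP].
Qed.
Lemma ps_in L w f : L w -> path_tensor w f -> path_span L f.
Proof.
move=> Lw wf; exists [:: f]; last by rewrite big_seq1.
by move=> y; rewrite inE => /eqP ->; exists w.
Qed.
Lemma ps_sub L L' f : L `<=` L' -> path_span L f -> path_span L' f.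
Proof.
move=> LL [s sP ->]; exists s => // y /sP[w Lw wy]; exists w => //; exact: LL.
Qed.
Lemma ps_sum L (I : Type) (r : seq I) (G : I -> T) :
  (forall i, path_span L (G i)) -> path_span L (\sum_(i <- r) G i).
Proof. by move=> h; apply: big_ind => //; [exact: ps0 | move=> *; exact: psD]. Qed.
Lemma pt_Z w f d : path_tensor w f -> path_tensor w (d0 d * f).
Proof.
case: w => [[c ->]|a w [x [g [x0 wg ->]]]]; first by exists (d * c); rewrite [RHS]ct_deg0M.
exists (d *: x), g; split=> //; last by rewrite mulrA d0_deg1.
by move=> b /x0 xb; rewrite -[LHS]/(d (tgt b) *: x b) xb scaler0.
Qed.
Lemma pt_M w w' f g : path_tensor w f -> path_tensor w' g -> path_tensor (w ++ w') (f * g).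
Proof.
elim: w f => [|a w IHw] f; first by move=> [d ->]; exact: pt_Z.
move=> [x [h [x0 wh ->]]] wg; exists x, (h * g); split=> //; first exact: IHw.
by rewrite mulrA.
Qed.
Lemma pt_R w f d : path_tensor w f -> path_tensor w (f * d0 d).
Proof. by move=> wf; rewrite -[w]cats0; apply: pt_M => //; exists d. Qed.
Lemma pt_size w f n : path_tensor w f -> n <> size w -> f n = 0.
Proof.
elim: w f n => [|a w IHw] f n; first by move=> [d ->]; case: n.
move=> [x [g [_ wg ->]]]; rewrite ct_deg1_shift; case: n => [|n] //= nw.
by rewrite (IHw _ _ wg) ?ptens0r // => E; apply: nw; rewrite E.
Qed.
Lemma pt_comp w f n : path_tensor w f -> ct_comp n f = if n == size w then f else 0.
Proof.
move=> wf; apply: dprodP => m; rewrite /ct_comp; have [->|/eqP mn] := eqVneq m n.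
  have [//|/eqP nw] := eqVneq n (size w); exact: (pt_size wf nw).
have [nw|nw] := eqVneq n (size w); last by [].
by rewrite (pt_size wf) // -nw.
Qed.
Lemma psM L L' L'' f g : (forall w w', L w -> L' w' -> L'' (w ++ w')) ->
  path_span L f -> path_span L' g -> path_span L'' (f * g).
Proof.
move=> LL hf hg; move: f hf; apply: ps_ind => [|f f' hf hf'|w f Lw wf].
- by rewrite mul0r; exact: ps0.
- by rewrite mulrDl; exact: psD.
move: g hg; apply: ps_ind => [|g g' hg hg'|w' g Lw' wg].
- by rewrite mulr0; exact: ps0.
- by rewrite mulrDr; exact: psD.
by apply: ps_in (pt_M wf wg); exact: LL.
Qed.
Lemma ps_Z L f d : path_span L f -> path_span L (d0 d * f).
Proof.
apply: (@psM [set [::]] L L) => [w w' -> //|]; apply: (@ps_in _ [::]) => //.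
by exists d.
Qed.
Lemma ct_compD n f g : ct_comp n (f + g) = ct_comp n f + ct_comp n g :> T.
Proof.
apply: dprodP => m; rewrite -[RHS]/(ct_comp n f m + ct_comp n g m) /ct_comp.
by case: ifP => // _; rewrite addr0.
Qed.
Lemma ct_comp0 n : ct_comp n 0 = 0 :> T.
Proof. by apply: dprodP => m; rewrite /ct_comp if_same. Qed.
Lemma ct_compE n f m : ct_comp n f m = if m == n then f m else 0. Proof. by []. Qed.
Lemma ct_comp_id n f : ct_comp n (ct_comp n f) = ct_comp n f :> T.
Proof. by apply: dprodP => m; rewrite !ct_compE; case: (m == n). Qed.
Lemma ct_act_comp n (t : tpow M n) g m : ct_act t g (n + m)%N = ct_act t (ct_comp m g) (n + m)%N.
Proof.
elim: n t => [|n IHn] t; first by rewrite -[LHS]/((t : D) *: g m) -[RHS]/((t : D) *: ct_comp m g m) ct_compE eqxx.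
elim/ptens_ind: t => [|x v|p q hp hq].
- by rewrite !(@ct_act0 _ _ _ n.+1).
- rewrite !ct_act_ptens; exact: (congr1 (fun u => ptens x u : tpow M (n + m)%N.+1) (IHn v)).
- by rewrite !(@ct_actDE _ _ _ n.+1) hp hq.
Qed.
Lemma ct_act_comp' n (t : tpow M n) g m : (n <= m)%N ->
  ct_act t g m = ct_act t (ct_comp (m - n) g) m.
Proof. by move=> nm; have := ct_act_comp t g (m - n)%N; rewrite subnKC. Qed.
Lemma ct_act_comp0 n (t : tpow M n) g m k : k <> (n + m)%N -> ct_act t (ct_comp m g) k = 0.
Proof.
elim: n t k => [|n IHn] t k kn.
  rewrite -[LHS]/((t : D) *: ct_comp m g k) ct_compE; case: eqP => [E|]; last by rewrite scaler0.
  by case: kn; rewrite E.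
elim/ptens_ind: t => [|x v|p q hp hq].
- by rewrite !(@ct_act0 _ _ _ n.+1).
- rewrite !ct_act_ptens; case: k kn => [|k] kn //=; rewrite IHn ?ptens0r // => E.
  by apply: kn; rewrite E.
- by rewrite !(@ct_actDE _ _ _ n.+1) hp hq addr0.
Qed.
Lemma ct_compM n f g : ct_comp n (f * g) = \sum_(k < n.+1) ct_comp k f * ct_comp (n - k) g :> T.
Proof.
have e1 k m j : (ct_comp k f * ct_comp m g : T) j = ct_act (f k) (ct_comp m g) j.
  case: (ltnP j k) => jk.
    rewrite ct_act_low // [LHS](_ : _ = \sum_(i < j.+1) ct_act (ct_comp k f i) (ct_comp m g) j) //.
    apply: big1 => i _; rewrite ct_compE ltn_eqF ?ct_act0 //.
    by apply: leq_ltn_trans jk; rewrite -ltnS.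
  rewrite [LHS](_ : _ = \sum_(i < j.+1) ct_act (ct_comp k f i) (ct_comp m g) j) //.
  rewrite (bigD1 (Ordinal (jk : (k < j.+1)%N))) //= ct_compE eqxx big1 ?addr0 // => i ik.
  by rewrite ct_compE (negPf (_ : val i != k)) ?ct_act0.
apply: dprodP => j; rewrite dp_sumE ct_compE; have [->|jn] := eqVneq j n.
  apply: eq_bigr => k _; rewrite e1; have := ltn_ord k; rewrite ltnS => kn.
  exact: ct_act_comp'.
rewrite big1 // => k _; rewrite e1 ct_act_comp0 //; have := ltn_ord k; rewrite ltnS => kn.
by rewrite subnKC //; exact/eqP.
Qed.
Lemma ct_comp_d0 n d : ct_comp n (d0 d) = if n == 0 then d0 d else 0 :> T.
Proof. by apply: (@pt_comp [::]); exists d. Qed.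
Lemma ct_comp_Z n d f : ct_comp n (d0 d * f) = d0 d * ct_comp n f :> T.
Proof.
apply: dprodP => m.
have e1 g j : (d0 d * g : T) j = d *: g j by rewrite [(d0 d * g : T)]ct_mul0act.
by rewrite ct_compE !e1 ct_compE; case: eqP => // _; rewrite scaler0.
Qed.
Lemma d0_R n d f : (f * d0 d : T) n = ct_act (f n) (d0 d) n.
Proof.
rewrite [LHS](_ : _ = \sum_(k < n.+1) ct_act (f k) (d0 d) n) // big_ord_recr /=.
rewrite big1 ?add0r // => k _.
have -> : d0 d = ct_comp 0 (d0 d) :> T by rewrite ct_comp_d0.
by apply: ct_act_comp0; rewrite addn0; apply/eqP; rewrite gtn_eqF.
Qed.
Lemma ct_comp_R n d f : ct_comp n (f * d0 d) = ct_comp n f * d0 d :> T.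
Proof.
apply: dprodP => m; rewrite d0_R !ct_compE d0_R.
by case: eqP => // _; rewrite ct_act0.
Qed.

Section Degrees.
Variable C : {set arr Q}.
Lemma That_degD (L : set nat) f g : That_deg C L f -> That_deg C L g -> That_deg C L (f + g).
Proof. by move=> hf hg n; rewrite ct_compD; exact: psD. Qed.
Lemma That_deg0 (L : set nat) : That_deg C L (0 : T).
Proof. by move=> n; rewrite ct_comp0; exact: ps0. Qed.
Lemma That_deg_sum (L : set nat) (I : Type) (r : seq I) (G : I -> T) :
  (forall i, That_deg C L (G i)) -> That_deg C L (\sum_(i <- r) G i).
Proof. by move=> h; apply: big_ind => //; [exact: That_deg0 | exact: That_degD]. Qed.
Lemma pt_deg (L : set nat) w f : path_tensor w f -> L (cut_deg C w) -> That_deg C L f.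
Proof.
move=> wf Lw n; rewrite (pt_comp _ wf); case: eqP => [E|_]; last exact: ps0.
by apply: ps_in wf; split.
Qed.
Lemma ps_deg (L : set nat) f : path_span [set w | L (cut_deg C w)] f -> That_deg C L f.
Proof.
by apply: ps_ind => [|*|w g Lw wg]; [exact: That_deg0 | exact: That_degD | exact: pt_deg wg _].
Qed.
End Degrees.
End PathSpan.

(** * Comparison of the gradings of the two cuts *)

Section Corners.
Variables (K : fieldType) (Q : quiver) (S : species K Q) (C : {set arr Q}) (k : vert Q).
Hypothesis sink : strict_sink C k.
Local Notation D := (totD (sp_D S)).
Local Notation M := (totM S).
Local Notation T := (That S).
Local Notation d0 := (ct_deg0 M).
Local Notation vu := (vertex_unit S).
Local Notation C' := (mutate_cut C k).
Implicit Types (f g h : T) (w : seq (arr Q)) (d : D) (x : M).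
Let step : rel (arr Q) := fun a b => src a == tgt b.
Lemma vu_same i : vu i i = 1. Proof. by rewrite /vertex_unit eqxx. Qed.
Lemma vu_diff i j : j <> i -> vu i j = 0.
Proof. by rewrite /vertex_unit => /eqP/negPf ->. Qed.
Lemma vuC i d : vu i * d = d * vu i.
Proof.
apply: dprodP => j; rewrite -[LHS]/(vu i j * d j) -[RHS]/(d j * vu i j).
by have [->|/eqP ji] := eqVneq j i; [rewrite vu_same mul1r mulr1 | rewrite vu_diff // mul0r mulr0].
Qed.
Lemma vuvu i : vu i * vu i = vu i.
Proof.
apply: dprodP => j; rewrite -[LHS]/(vu i j * vu i j).
by have [->|/eqP ji] := eqVneq j i; [rewrite vu_same mulr1 | rewrite vu_diff // mul0r].
Qed.
Lemma vu_scale i x a : (forall b, b != a -> x b = 0) ->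
  vu i *: x = if i == tgt a then x else 0.
Proof.
move=> x0; apply: dprodP => b; rewrite -[LHS]/(vu i (tgt b) *: x b).
have [->|/x0 xb] := eqVneq b a; last by rewrite xb scaler0; case: ifP.
have [->|/eqP ia] := eqVneq i (tgt a); first by rewrite vu_same scale1r.
by rewrite vu_diff ?scale0r // => E; apply: ia.
Qed.
Lemma vu_ract i x a : (forall b, b != a -> x b = 0) ->
  ract x (vu i) = if i == src a then x else 0.
Proof.
move=> x0; apply: dprodP => b; rewrite -[LHS]/(ract (x b) (vu i (src b))).
have r0 y (c : sp_D S (src b)) : y = 0 -> ract (y : sp_M S b) c = 0.
  by move=> ->; apply: (addrI (ract 0 c)); rewrite -ractDl !addr0.
have [E|/x0 xb] := eqVneq b a; last by rewrite r0 //; case: ifP; rewrite ?xb.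
rewrite E; have [->|/eqP ia] := eqVneq i (src a); first by rewrite vu_same ract1.
rewrite vu_diff; last by move=> E'; apply: ia.
by apply: (addrI (ract (x a) 0)); rewrite -ractDr !addr0.
Qed.
Lemma pt_tgt a w f i : path_tensor (a :: w) f ->
  d0 (vu i) * f = if i == tgt a then f else 0.
Proof.
move=> [x [g [x0 wg ->]]]; rewrite mulrA d0_deg1 (vu_scale _ x0).
by case: ifP => // _; rewrite ct_deg10 mul0r.
Qed.
Lemma pt_comp0 a b w f : path_tensor (a :: b :: w) f -> src a != tgt b -> f = 0.
Proof.
move=> [x [g [x0 wg ->]]] ab; rewrite -[g]mul1r.
have -> : g = d0 (vu (tgt b)) * g by rewrite (pt_tgt _ wg) eqxx.
rewrite mul1r mulrA deg1_d0 (vu_ract _ x0) eq_sym (negPf ab).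
by rewrite ct_deg10 mul0r.
Qed.
Lemma pt_src a w f i : path_tensor (a :: w) f ->
  f * d0 (vu i) = if i == src (last a w) then f else 0.
Proof.
elim: w a f => [|b w IHw] a f.
  move=> [x [g [x0 [d ->] ->]]]; rewrite -mulrA -ct_deg0M -vuC ct_deg0M mulrA [ct_deg1 x * d0 (vu i)]deg1_d0.
  by rewrite (vu_ract _ x0); case: ifP => // _; rewrite ct_deg10 mul0r.
move=> [x [g [x0 wg ->]]]; rewrite -mulrA (IHw _ _ wg).
by case: ifP => // _; rewrite mulr0.
Qed.
Lemma pt_path a w f : path_tensor (a :: w) f -> f = 0 \/ path step a w.
Proof.
elim: w a f => [|b w IHw] a f; first by right.
move=> h; have [ab|ab] := eqVneq (src a) (tgt b); last by left; exact: pt_comp0 h ab.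
have [x [g [x0 wg fE]]] := h; have [g0|pw] := IHw _ _ wg.
  by left; rewrite fE g0 mulr0.
by right; rewrite /= /step ab eqxx.
Qed.
(** Arrows starting at k leave the cut and arrows ending at k enter it. There is no loop at k, as it
    would have to be both in C and outside C. *)
Lemma arrow_deg a : ((a \in C') + (src a == k) = (a \in C) + (tgt a == k))%N.
Proof.
have [h1 h2] := sink; rewrite !inE.
have [sa|sa] := eqVneq (src a) k; have [ta|ta] := eqVneq (tgt a) k => /=.
- by have := h2 a ta; rewrite h1.
- by rewrite h1.
- by rewrite (negPf (h2 a ta)).
- by rewrite orbF !addn0.
Qed.
Lemma cut_deg_cons (A : {set arr Q}) a w : cut_deg A (a :: w) = ((a \in A) + cut_deg A w)%N.
Proof. by []. Qed.
(** [arrow_deg] telescopes: the corrections at the inner vertices of the path cancel. *)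
Lemma path_deg a w : path step a w ->
  (cut_deg C' (a :: w) + (src (last a w) == k) = cut_deg C (a :: w) + (tgt a == k))%N.
Proof.
elim: w a => [|b w IHw] a; first by rewrite /= !addn0 arrow_deg.
rewrite [path _ _ _]/= => /andP[/eqP ab /IHw IH]; rewrite cut_deg_cons [in RHS]cut_deg_cons.
rewrite [last _ _]/=; move: IH (arrow_deg a); rewrite ab.
move: (nat_of_bool (a \in C')) (nat_of_bool (a \in C)) (nat_of_bool (tgt a == k)).
move: (nat_of_bool (tgt b == k)) (nat_of_bool (src _ == k)) (cut_deg _ _) (cut_deg _ _).
lia.
Qed.
Lemma cut_mutate Q2 : cut Q2 C -> (forall c, Q2 c -> quiver_cycle c) -> cut Q2 C'.
Proof.
move=> hC cyc c Qc; rewrite -(hC c Qc); have := cyc c Qc.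
case: c {Qc} => [//|a p] /andP[_ h]; rewrite [cycle _ _]/= in h.
(* The cycle is read as an open path that repeats its first arrow at the end, so one copy of
   [arrow_deg] is subtracted. *)
have := path_deg h; rewrite last_rcons.
have e1 (A : {set arr Q}) : cut_deg A (a :: rcons p a) = (cut_deg A (a :: p) + (a \in A))%N.
  by rewrite /cut_deg -rcons_cons -cats1 count_cat /= addn0.
rewrite !e1; move: (arrow_deg a).
move: (nat_of_bool (a \in C')) (nat_of_bool (a \in C)) (nat_of_bool (tgt a == k)).
move: (nat_of_bool (src _ == k)) (cut_deg C' _) (cut_deg C _). lia.
Qed.
(** The idempotents e_k and 1 - e_k, indexed by Booleans that also serve as numbers in the degree
    shifts. *)
Definition Xv (b : bool) : T := if b then d0 (vu k) else 1 - d0 (vu k).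
Lemma Xv_d0 b : exists d, Xv b = d0 d.
Proof.
case: b; [by exists (vu k) | exists (1 - vu k)].
apply: (addrI (d0 (vu k))); rewrite -[RHS]ct_deg0D addrC subrK addrC subrK //.
Qed.
Lemma Xv_idem b : Xv b * Xv b = Xv b.
Proof.
have e : d0 (vu k) * d0 (vu k) = d0 (vu k) :> T by rewrite -[LHS]ct_deg0M vuvu.
by case: b => //=; rewrite mulrBr mulr1 mulrBl mul1r e subrr subr0.
Qed.
Lemma Xv_sum f : \sum_(b : bool) \sum_(c : bool) Xv b * f * Xv c = f.
Proof.
have e1 g : \sum_(c : bool) g * Xv c = g.
  by rewrite big_bool /= -mulrDr addrC subrK mulr1.
rewrite (eq_bigr (fun b => Xv b * f)) => [|b _]; last exact: e1.
by rewrite big_bool /= -mulrDl addrC subrK mul1r.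
Qed.
Lemma pt_corner w f b c : path_tensor w f -> Xv b * f * Xv c = 0 \/
  (path_tensor w (Xv b * f * Xv c) /\ (cut_deg C' w + c = cut_deg C w + b)%N).
Proof.
move=> wf; have wX : path_tensor w (Xv b * f * Xv c).
  by have [d ->] := Xv_d0 b; have [d' ->] := Xv_d0 c; apply: pt_R; exact: pt_Z.
case: w wf wX => [|a w] wf wX.
  have [bc|bc] := eqVneq b c; first by right; split=> //; rewrite bc.
  left; have [d ->] := wf.
  have XC b' : Xv b' * d0 d = d0 d * Xv b'.
    have e : d0 (vu k) * d0 d = d0 d * d0 (vu k) by rewrite -[LHS]ct_deg0M vuC [LHS]ct_deg0M.
    by case: b' => //=; rewrite mulrBl mulrBr mul1r mulr1 e.
  rewrite XC -mulrA [X in _ * X](_ : _ = 0) ?mulr0 //.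
  have e : d0 (vu k) * d0 (vu k) = d0 (vu k) :> T by rewrite -[LHS]ct_deg0M vuvu.
  case: b c bc {wX} => [] [] //= _; first by rewrite mulrBr mulr1 e subrr.
  by rewrite mulrBl mul1r e subrr.
have Xl b' : Xv b' * f = if b' == (k == tgt a) then f else 0.
  case: b' => /=; first by rewrite (pt_tgt _ wf); case: (k == tgt a).
  by rewrite mulrBl mul1r (pt_tgt _ wf); case: (k == tgt a); rewrite ?subrr ?subr0.
have Xr c' : f * Xv c' = if c' == (k == src (last a w)) then f else 0.
  case: c' => /=; first by rewrite (pt_src _ wf); case: (k == _).
  by rewrite mulrBr mulr1 (pt_src _ wf); case: (k == _); rewrite ?subrr ?subr0.
rewrite Xl; have [bE|_] := eqVneq b; last by left; rewrite mul0r.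
rewrite Xr; have [cE|_] := eqVneq c; last by left.
have [f0|pw] := pt_path wf; first by left.
right; split=> //; rewrite bE cE !(eq_sym k); exact: path_deg.
Qed.
Definition shift (L : set nat) (b c : bool) : set nat :=
  [set n | exists2 m, L m & (m + c = n + b)%N].
Definition unshift (L : set nat) (b c : bool) : set nat :=
  [set m | exists2 n, L n & (m + c = n + b)%N].
Lemma ct_comp_X n b c f : ct_comp n (Xv b * f * Xv c) = Xv b * ct_comp n f * Xv c.
Proof.
by have [d ->] := Xv_d0 b; have [d' ->] := Xv_d0 c; rewrite ct_comp_R ct_comp_Z.
Qed.
Lemma deg_corner L b c f : That_deg C' L f -> That_deg C (shift L b c) (Xv b * f * Xv c).
Proof.
move=> h n; rewrite ct_comp_X; move: (ct_comp n f) (h n) => g {h f}.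
move: g; apply: ps_ind => [|f g hf hg|w f [sw Lw] wf].
- by rewrite mulr0 mul0r; exact: ps0.
- by rewrite mulrDr mulrDl; exact: psD.
have [->|[wX e]] := pt_corner b c wf; first exact: ps0.
by apply: (ps_in _ wX); split=> //; exists (cut_deg C' w).
Qed.
Lemma deg_uncorner L b c f : That_deg C L f -> That_deg C' (unshift L b c) (Xv b * f * Xv c).
Proof.
move=> h n; rewrite ct_comp_X; move: (ct_comp n f) (h n) => g {h f}.
move: g; apply: ps_ind => [|f g hf hg|w f [sw Lw] wf].
- by rewrite mulr0 mul0r; exact: ps0.
- by rewrite mulrDr mulrDl; exact: psD.
have [->|[wX e]] := pt_corner b c wf; first exact: ps0.
by apply: (ps_in _ wX); split=> //; exists (cut_deg C w).
Qed.
Lemma That_deg_sub (A : {set arr Q}) (L L' : set nat) f : L `<=` L' -> That_deg A L f -> That_deg A L' f.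
Proof. by move=> LL h n; apply: ps_sub (h n) => w [sw Lw]; split=> //; exact: LL. Qed.
Variable t : {linear kspace D -> K^o}.
Variable xs : seq (dualK M * M).
Variable W : T.
Local Notation J := (jacobian t xs W).
Definition clJ (f : T) : J := qcl (jac_ideal t xs W) f.
Lemma clJD f g : clJ (f + g) = clJ f + clJ g. Proof. exact: qclD. Qed.
Lemma clJM f g : clJ (f * g) = clJ f * clJ g. Proof. by rewrite [RHS]qa_mulE. Qed.
Definition XJ (b : bool) : J := clJ (Xv b).
Lemma clJ_sum (I : Type) (r : seq I) (G : I -> T) :
  clJ (\sum_(i <- r) G i) = \sum_(i <- r) clJ (G i).
Proof.
apply: (big_morph clJ clJD); apply: (addrI (clJ 0)); by rewrite -clJD !addr0.
Qed.
Lemma XJ_sum (x : J) : \sum_(b : bool) \sum_(c : bool) XJ b * x * XJ c = x.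
Proof.
move: x; apply: qclP => f; rewrite -[in RHS](Xv_sum f) -/(clJ f) -/(clJ _) clJ_sum.
apply: eq_bigr => b _; rewrite clJ_sum; apply: eq_bigr => c _; by rewrite !clJM.
Qed.
Lemma jac_degD (A : {set arr Q}) L (x y : J) : jac_deg A L x -> jac_deg A L y -> jac_deg A L (x + y).
Proof.
move=> [f hf ->] [g hg ->]; exists (f + g); first exact: That_degD.
exact: esym (clJD f g).
Qed.
Lemma jac_deg0 (A : {set arr Q}) L : jac_deg A L (0 : J).
Proof.
exists 0; first exact: That_deg0.
by apply: (addrI (clJ 0)); rewrite -[RHS]clJD !addr0.
Qed.
(** On each of the four corners cut out by e_k and 1 - e_k the two gradings differ by a constant. *)
Lemma jac_deg_mutate L (x : J) : jac_deg C' L x <->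
  forall b c, jac_deg C (shift L b c) (XJ b * x * XJ c).
Proof.
split=> [[f hf ->] b c|h].
  by exists (Xv b * f * Xv c); [exact: deg_corner | rewrite -/(clJ f) -/(clJ _) !clJM].
rewrite -(XJ_sum x); apply: big_ind => [|u v|b _]; [exact: jac_deg0 | exact: jac_degD |].
apply: big_ind => [|u v|c _]; [exact: jac_deg0 | exact: jac_degD |].
have [f hf fE] := h b c; exists (Xv b * f * Xv c).
  apply: That_deg_sub (deg_uncorner b c hf) => m [n [m' Lm' e1] e2].
  by have -> : m = m' by lia.
rewrite -/(clJ _) !clJM -/(XJ b) -/(XJ c) -[clJ f]fE !mulrA -[XJ b * XJ b]clJM Xv_idem.
by rewrite -(mulrA _ (XJ c)) -[XJ c * XJ c]clJM Xv_idem.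
Qed.
End Corners.

(** * Derivatives of potentials *)

Section Gram.
Variables (K : fieldType) (D : kalgType K) (t : {linear kspace D -> K^o}).
Hypothesis fdD : findim (kspace D).
Hypothesis t_sym : symmetrizing_form t.
Lemma form_sym (a b : D) : t (a * b) = t (b * a). Proof. exact: t_sym.1. Qed.
Lemma formD (a b : D) : t (a + b) = t a + t b. Proof. exact: linearD. Qed.
Lemma form_kernel (d : D) : (forall x, t (d * x) = 0) -> d = 0.
Proof.
move=> h; pose I := fun d : D => forall x, t (d * x) = 0.
have I0 : I 0 by move=> x; rewrite mul0r linear0.
have IB x y : I x -> I y -> I (x - y).
  by move=> Ix Iy z; rewrite mulrBl linearB; rewrite [X in X - _]Ix [X in _ - X]Iy subrr.
have Il a x : I x -> I (a * x) by move=> Ix y; rewrite -mulrA form_sym -mulrA Ix.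
have Ir a x : I x -> I (x * a) by move=> Ix y; rewrite -mulrA Ix.
apply: (t_sym.2 (@Ideal D (AddSub I0 IB) Il Ir)) => // x Ix.
by rewrite -[x]mulr1; exact: Ix.
Qed.
Lemma form_inj (c d : D) : (forall x, t (c * x) = t (d * x)) -> c = d.
Proof.
move=> h; apply: subr0_eq; apply: form_kernel => x.
by rewrite mulrBl (linearB t) /= h subrr.
Qed.
(** A functional outside the submodule generated by t could be separated from it by an element of D,
    by reflexivity, and that element would lie in the kernel of the form. *)
Lemma gram (phi : dual_mod D) : exists d : D, forall x, t (d * x) = dual_fun phi x.
Proof.
have tl : linear ((fun d : D^o => (d : D) *: (t : dual_mod D)) : D^o -> dual_mod D).
  by move=> a x y; rewrite scalerDl scalerA.
apply: contrapT => nex.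
have [|a [a0 aphi]] := @kseparate K _ _ (restr_map (mklin tl)) phi.
  move=> d; apply/negP => /eqP dE; apply: nex; exists d => x.
  by rewrite form_sym -dE.
have [x xE] := dual_reflexive (F := fun g : dual_mod D => a g) fdD (linearD a) (linearZ_LR a).
apply: aphi; rewrite xE (_ : x = 0); first exact: (linear0 (phi : {linear kspace D -> K^o})).
by apply: form_kernel => d; rewrite -[RHS](a0 d) xE.
Qed.
End Gram.

Section FindimTotal.
Variables (K : fieldType) (I : finType) (D : I -> falgType K).
Lemma totD_findim : findim (kspace (totD D)).
Proof.
pose n i := \dim (fullv : {vspace D i}).
pose v (p : {i : I & 'I_(n i)}) : kspace (totD D) :=
  fun j => match tag p =P j with
    | ReflectT E => eq_rect (tag p) (fun j => D j) (vbasis fullv)`_(tagged p) j E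
    | ReflectF _ => 0
    end.
have v_same i (j : 'I_(n i)) : v (Tagged (fun i => 'I_(n i)) j) i = (vbasis (fullv : {vspace D i}))`_j.
  by rewrite /v; case: eqP => //= E; rewrite (eq_axiomK E).
have v_diff i (j : 'I_(n i)) i' : i != i' -> v (Tagged (fun i => 'I_(n i)) j) i' = 0.
  by rewrite /v; case: eqP => //= ->; rewrite eqxx.
apply: (findim_fin (v := v)) => x.
exists (fun p => coord (vbasis (fullv : {vspace D (tag p)})) (tagged p) (x (tag p))).
apply: dprodP => i; rewrite dp_sumE.
rewrite -(@sig_big_dep _ _ _ _ _ xpredT (fun _ _ => true) (fun i0 (j : 'I_(n i0)) =>
  ((coord (vbasis (fullv : {vspace D i0})) j (x i0) *:
    v (Tagged (fun i => 'I_(n i)) j)) : kspace (totD D)) i)).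
rewrite (bigD1 i) //= [X in _ + X]big1 ?addr0 => [|i' i'i]; last first.
  apply: big1 => j _; rewrite -[LHS]/((coord _ j (x i') *: 1) * v _ i) v_diff ?mulr0 //.
rewrite {1}(coord_vbasis (memvf (x i))); apply: eq_bigr => j _.
by rewrite -[RHS]/((coord _ j (x i) *: 1) * v _ i) v_same -scalerAl mul1r.
Qed.
End FindimTotal.

Section Pairings.
Variables (K : fieldType) (D : kalgType K) (M : bimodule D D) (t : {linear kspace D -> K^o}).
Hypothesis fdD : findim (kspace D).
Hypothesis t_sym : symmetrizing_form t.
Implicit Types (xi : dualK M) (x y : M) (c d : D).
Lemma dualKD xi x y : xi (x + y) = xi x + xi y. Proof. exact: linearD. Qed.
Lemma dualKZ xi (k : K) x : xi ((scal k : D) *: x) = k * xi x.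
Proof. exact: (linearZ_LR (xi : {linear restr_scal M -> K^o})). Qed.
Lemma ract_scalM x (k : K) d : ract x (scal k * d) = (scal k : D) *: ract x d.
Proof. by rewrite ractM ract_scal ractZ. Qed.
(** By [gram], the value at x is the element d with t (d c) = xi (x c) for all c; additivity and
    right D-linearity follow from uniqueness. So the choice in [pair_r] is a genuine preimage of
    xi. *)
Lemma pair_r_spec xi : [/\ forall x y, pair_r t xi (x + y) = pair_r t xi x + pair_r t xi y,
  forall d x, pair_r t xi (ract x d) = pair_r t xi x * d & forall x, t (pair_r t xi x) = xi x].
Proof.
have ex x : exists d, forall c, t (d * c) = xi (ract x c).
  have pl : linear ((fun c => xi (ract x c)) : kspace D -> K^o).
    by move=> k a b; rewrite ractDr dualKD ract_scalM dualKZ.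
  by have [d dE] := gram fdD t_sym (mklin pl); exists d.
have [b bE] := choice ex.
apply: (@xgetPex _ (fun=> 0) [set f : M -> D | [/\ forall x y, f (x + y) = f x + f y,
  forall d x, f (ract x d) = f x * d & forall x, t (f x) = xi x]]).
exists b; split=> [x y|d x|x].
- by apply: (form_inj t_sym) => c; rewrite mulrDl formD !bE ractDl dualKD.
- by apply: (form_inj t_sym) => c; rewrite -mulrA !bE ractM.
- by rewrite -[b x]mulr1 bE ract1.
Qed.
Lemma pair_l_spec xi : [/\ forall x y, pair_l t xi (x + y) = pair_l t xi x + pair_l t xi y,
  forall d x, pair_l t xi (d *: x) = d * pair_l t xi x & forall x, t (pair_l t xi x) = xi x].
Proof.
have ex x : exists d, forall c, t (d * c) = xi (c *: x).
  have pl : linear ((fun c => xi ((c : D) *: x)) : kspace D -> K^o).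
    by move=> k a b; rewrite scalerDl dualKD -scalerA dualKZ.
  by have [d dE] := gram fdD t_sym (mklin pl); exists d.
have [b bE] := choice ex.
apply: (@xgetPex _ (fun=> 0) [set f : M -> D | [/\ forall x y, f (x + y) = f x + f y,
  forall d x, f (d *: x) = d * f x & forall x, t (f x) = xi x]]).
exists b; split=> [x y|d x|x].
- by apply: (form_inj t_sym) => c; rewrite mulrDl formD !bE scalerDr dualKD.
- by apply: (form_inj t_sym) => c; rewrite -mulrA (form_sym t_sym d) -mulrA !bE scalerA.
- by rewrite -[b x]mulr1 bE scale1r.
Qed.
Lemma pair_rD xi x y : pair_r t xi (x + y) = pair_r t xi x + pair_r t xi y.
Proof. by have [h _ _] := pair_r_spec xi. Qed.
Lemma pair_rR xi d x : pair_r t xi (ract x d) = pair_r t xi x * d.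
Proof. by have [_ h _] := pair_r_spec xi. Qed.
Lemma pair_lZ xi d x : pair_l t xi (d *: x) = d * pair_l t xi x.
Proof. by have [_ h _] := pair_l_spec xi. Qed.
Lemma pair_rE xi x d : t (pair_r t xi x * d) = xi (ract x d).
Proof. by rewrite -pair_rR; have [_ _ h] := pair_r_spec xi. Qed.
Lemma pair_lE xi x d : t (d * pair_l t xi x) = xi (d *: x).
Proof. by rewrite -pair_lZ; have [_ _ h] := pair_l_spec xi. Qed.
Lemma pair_r_uniq xi x c : (forall d, t (c * d) = xi (ract x d)) -> pair_r t xi x = c.
Proof. by move=> h; apply: (form_inj t_sym) => d; rewrite h pair_rE. Qed.
Lemma pair_l_uniq xi x c : (forall d, t (d * c) = xi (d *: x)) -> pair_l t xi x = c.
Proof.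
move=> h; apply: (form_inj t_sym) => d.
by rewrite (form_sym t_sym) pair_lE -h (form_sym t_sym).
Qed.
Definition dcomp xi (s : {linear M -> M}) : dualK M := lin_comp xi (restr_map s).
Lemma dcompE xi s x : dcomp xi s x = xi (s x). Proof. by []. Qed.
Lemma pair_l_comp xi s x : pair_l t (dcomp xi s) x = pair_l t xi (s x).
Proof. by apply: pair_l_uniq => d; rewrite pair_lE dcompE linearZ_LR. Qed.
Lemma dact_linear xi d : linear ((fun x : restr_scal M => xi (d *: (x : M))) : restr_scal M -> K^o).
Proof.
move=> k x y; rewrite scalerDr dualKD; congr (_ + _).
by rewrite -[LHS]/(xi (d *: ((scal k : D) *: (x : M)))) scalerA -scalC -scalerA dualKZ.
Qed.
Definition dact xi d : dualK M := mklin (dact_linear xi d).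
Lemma dactE xi d x : dact xi d x = xi (d *: x). Proof. by []. Qed.
Lemma pair_r_act xi d x : pair_r t (dact xi d) x = pair_r t xi (d *: x).
Proof. by apply: pair_r_uniq => c; rewrite pair_rE dactE ractZ. Qed.
Lemma bim_ract_linear d : linear ((fun x => ract x d) : M -> M).
Proof. by move=> a x y; rewrite ractDl ractZ. Qed.
Definition ractm d : {linear M -> M} := mklin (bim_ract_linear d).
Lemma pair_r_ract xi d x : pair_r t (dcomp xi (ractm d)) x = d * pair_r t xi x.
Proof.
apply: pair_r_uniq => c; rewrite -mulrA (form_sym t_sym d) -mulrA pair_rE dcompE.
by rewrite -[ractm d _]/(ract (ract x c) d) -ractM.
Qed.
Variable xs : seq (dualK M * M).
Hypothesis cas : casimir t xs.
(** The Casimir expansion of x, tested against xi, expands xi itself in terms of the first tensor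
    factors. *)
Lemma dual_expand xi x : xi x = \sum_(p <- xs) dact p.1 (pair_l t xi p.2) x.
Proof.
have xi_sum (r : seq (dualK M * M)) G : xi (\sum_(p <- r) G p) = \sum_(p <- r) xi (G p).
  exact: (linear_sum (xi : {linear restr_scal M -> K^o})).
rewrite -{1}(cas x) xi_sum; apply: eq_bigr => p _.
by rewrite dactE -!pair_lE (form_sym t_sym).
Qed.
Lemma pair_r_expand xi x :
  pair_r t xi x = \sum_(p <- xs) pair_r t (dact p.1 (pair_l t xi p.2)) x.
Proof.
apply: pair_r_uniq => d; rewrite dual_expand mulr_suml (linear_sum t); apply: eq_bigr => p _.
exact: pair_rE.
Qed.
End Pairings.

Section LeftDerivative.
Variables (K : fieldType) (Q : quiver) (S : species K Q).
Local Notation D := (totD (sp_D S)).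
Local Notation M := (totM S).
Local Notation T := (That S).
Local Notation d0 := (ct_deg0 M).
Variable t : {linear kspace D -> K^o}.
Hypothesis t_sym : symmetrizing_form t.
Implicit Types (f g : T) (xi : dualK M) (x : M) (d : D).
Let fdD : findim (kspace D) := totD_findim (sp_D S).
Local Notation pr := (pair_r t).
Local Notation pl := (pair_l t).
Local Notation pd := (@pderl K D M t).
Definition pdt xi n : tpow M n.+1 -> tpow M n := tens_lift (fun (a : M) (u : tpow M n) => pr xi a *: u).
Lemma pdt_bal xi n : balanced (fun (a : M) (u : tpow M n) => pr xi a *: u).
Proof.
split=> [x y v|x u v|x d v]; first by rewrite (pair_rD fdD t_sym) scalerDl.
  by rewrite scalerDr.
by rewrite (pair_rR fdD t_sym) scalerA.
Qed.
Lemma pdtE xi n x (u : tpow M n) : pdt xi (ptens x u : tpow M n.+1) = pr xi x *: u.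
Proof. by apply: (tens_liftE (f := fun a (u : tpow M n) => pr xi a *: u)); exact: pdt_bal. Qed.
Lemma pdtD xi n (u v : tpow M n.+1) : pdt xi (u + v) = pdt xi u + pdt xi v.
Proof. by apply: tens_liftD; exact: pdt_bal. Qed.
Lemma pdt0 xi n : pdt xi (0 : tpow M n.+1) = 0.
Proof. by apply: (addrI (pdt xi (0 : tpow M n.+1))); rewrite -pdtD !addr0. Qed.
Lemma pderlE xi f n : pd xi f n = pdt xi (f n.+1). Proof. by []. Qed.
Lemma pderlD xi f g : pd xi (f + g) = pd xi f + pd xi g.
Proof. by apply: dprodP => n; exact: pdtD. Qed.
Lemma pderl0 xi : pd xi 0 = 0.
Proof. by apply: (addrI (pd xi 0)); rewrite -pderlD !addr0. Qed.
Lemma pderl_shift xi x g : pd xi (ct_shift x g) = d0 (pr xi x) * g.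
Proof.
rewrite [RHS](ct_mul0act (pr xi x) g); apply: dprodP => n; exact: pdtE.
Qed.
Lemma pderl_comp xi n f : ct_comp n (pd xi f) = pd xi (ct_comp n.+1 f).
Proof.
apply: dprodP => m; rewrite pderlE !ct_compE eqSS pderlE.
by case: ifP => // _; rewrite pdt0.
Qed.
Lemma pderl_sum (I : Type) (r : seq I) (eta : I -> dualK M) xi f :
  (forall x, pr xi x = \sum_(i <- r) pr (eta i) x) -> pd xi f = \sum_(i <- r) pd (eta i) f.
Proof.
move=> h; apply: dprodP => n; rewrite dp_sumE; rewrite pderlE.
under eq_bigr do rewrite pderlE.
elim/ptens_ind: (f n.+1) => [|x v|p q hp hq].
- by rewrite pdt0 big1 // => i _; rewrite pdt0.
- by rewrite pdtE h scaler_suml; apply: eq_bigr => i _; rewrite pdtE.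
- by rewrite pdtD hp hq -big_split; apply: eq_bigr => i _; rewrite pdtD.
Qed.
Lemma pderl_act xi d f : pd (dact xi d) f = pd xi (d0 d * f).
Proof.
rewrite [X in pd xi X](ct_mul0act d f); apply: dprodP => n; rewrite !pderlE.
rewrite -[RHS]/(pdt xi (d *: f n.+1)).
elim/ptens_ind: (f n.+1) => [|x v|p q hp hq].
- by rewrite scaler0 !pdt0.
- by rewrite ptensZ !pdtE (pair_r_act fdD t_sym).
- by rewrite scalerDr !pdtD hp hq.
Qed.
Lemma pderl_R xi d f : pd xi (f * d0 d) = pd xi f * d0 d.
Proof.
apply: dprodP => n; rewrite pderlE !d0_R pderlE.
elim/ptens_ind: (f n.+1) => [|x v|p q hp hq].
- by rewrite pdt0 !ct_act0 pdt0.
- rewrite pdtE ct_actZ -[RHS]/(pr xi x *: (ct_act v (d0 d) n)).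
  by rewrite [ct_act (ptens x v : tpow M n.+1) _]ct_act_ptens -pdtE.
- by rewrite (@ct_actDE _ _ _ n.+1) !pdtD hp hq ct_actDE.
Qed.
Lemma pderl_L xi d f : pd (dcomp xi (ractm M d)) f = d0 d * pd xi f.
Proof.
rewrite [RHS](ct_mul0act d _); apply: dprodP => n; rewrite -[RHS]/(d *: pd xi f n) !pderlE.
elim/ptens_ind: (f n.+1) => [|x v|p q hp hq].
- by rewrite !pdt0 scaler0.
- by rewrite !pdtE (pair_r_ract fdD t_sym) scalerA.
- by rewrite !pdtD hp hq scalerDr.
Qed.
Variable xs : seq (dualK M * M).
Hypothesis cas : casimir t xs.
Definition central f := forall d, d0 d * f = f * d0 d.
(* The Casimir element moves left D-linear maps from M^* to M.                 *)
Lemma casimir_transfer (s1 s2 : {linear M -> M}) f : central f ->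
  \sum_(p <- xs) pd (dcomp p.1 s1) f * ct_deg1 (s2 p.2) =
  \sum_(p <- xs) pd p.1 f * ct_deg1 (s2 (s1 p.2)).
Proof.
move=> cf; pose b (q p : dualK M * M) := pl (dcomp q.1 s1) p.2.
transitivity (\sum_(q <- xs) \sum_(p <- xs) pd p.1 f * ct_deg1 (b q p *: s2 q.2) : T).
  apply: eq_bigr => q _; rewrite (pderl_sum _ (pair_r_expand fdD t_sym cas _)) mulr_suml.
  by apply: eq_bigr => p _; rewrite pderl_act cf pderl_R -mulrA d0_deg1.
rewrite exchange_big; apply: eq_bigr => p _; rewrite -mulr_sumr; congr (_ * _).
rewrite -(big_morph _ (@ct_deg1D _ _ S) (@ct_deg10 _ _ S)); congr ct_deg1.
rewrite -[in RHS](cas (s1 p.2)) linear_sum; apply: eq_bigr => q _.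
by rewrite linearZ_LR /b (pair_l_comp fdD t_sym).
Qed.
(** Left multiplication by d changes the functionals x_i^* by right multiplication on M;
    [casimir_transfer] moves this onto the x_i. *)
Lemma eps_central f : central f -> central (eps_l t xs f).
Proof.
move=> cf d; rewrite mulr_sumr mulr_suml.
transitivity (\sum_(p <- xs) pd (dcomp p.1 (ractm M d)) f * ct_deg1 p.2 : T).
  by apply: eq_bigr => p _; rewrite mulrA pderl_L.
rewrite (casimir_transfer (ractm M d) idfun cf); apply: eq_bigr => p _.
by rewrite -mulrA deg1_d0.
Qed.
Variable C : {set arr Q}.
Definition arr_part (P : pred (arr Q)) (x : M) : M := fun a => if P a then x a else 0.
Lemma arr_part_linear P : linear (arr_part P).
Proof.
move=> d x y; apply: dprodP => a.
rewrite -[RHS]/(d (tgt a) *: arr_part P x a + arr_part P y a) /arr_part.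
by case: (P a) => //; rewrite scaler0 addr0.
Qed.
Definition apart P : {linear M -> M} := mklin (arr_part_linear P).
Lemma apartE P x a : apart P x a = if P a then x a else 0. Proof. by []. Qed.
Definition carried (b : bool) xi := forall x, (forall a, (a \in C) = b -> x a = 0) -> xi x = 0.
Lemma pderl_deg b xi (L : set nat) f : carried b xi -> That_deg C L f ->
  That_deg C [set j | L (b + j)%N] (pd xi f).
Proof.
move=> xib h n; rewrite pderl_comp; move: (ct_comp n.+1 f) (h n.+1) => g {h f}; move: g.
apply: ps_ind => [|f g hf hg|w f [sw Lw] wf].
- by rewrite pderl0; exact: ps0.
- by rewrite pderlD; exact: psD.
case: w sw Lw wf => [//|a w] [sw] Lw [x [g [x0 wg ->]]]; rewrite ct_deg1_shift pderl_shift.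
have [ab|ab] := eqVneq (a \in C) b.
  apply: ps_Z; apply: ps_in wg; split=> //; rewrite cut_deg_cons ab in Lw; exact: Lw.
have -> : pr xi x = 0; last first.
  by rewrite [X in path_span _ X](ct_mul0act 0 g) scale0r; exact: ps0.
apply: (pair_r_uniq fdD t_sym) => d; rewrite mul0r (linear0 t) xib // => c cb.
rewrite -[LHS]/(ract (x c) (d (src c))) x0; last first.
  by apply/eqP => E; case/eqP: ab; rewrite -E.
by apply: (addrI (ract 0 (d (src c)))); rewrite -ractDl !addr0.
Qed.
Lemma carried_apart b xi : carried b (dcomp xi (apart (fun a => (a \in C) == b))).
Proof.
move=> x x0; rewrite dcompE (_ : apart _ x = 0); first exact: (linear0 (xi : {linear _ -> _})).
by apply: dprodP => a; rewrite apartE; case: eqP => // /x0.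
Qed.
Lemma deg1_sum x : x = \sum_(a : arr Q) apart (pred1 a) x.
Proof.
apply: dprodP => a; rewrite dp_sumE (bigD1 a) //= big1 ?addr0; first by rewrite /arr_part /= eqxx.
by move=> b /negPf ba; rewrite /arr_part /= eq_sym ba.
Qed.
Lemma deg1_deg b x : That_deg C [set nat_of_bool b] (ct_deg1 (apart (fun a => (a \in C) == b) x) : T).
Proof.
rewrite [X in ct_deg1 X]deg1_sum (big_morph _ (@ct_deg1D _ _ S) (@ct_deg10 _ _ S)).
apply: That_deg_sum => a; have [ab|ab] := eqVneq (a \in C) b.
  apply: (@pt_deg _ _ S C _ [:: a]); last by rewrite /cut_deg /= ab addn0.
  exists (apart (pred1 a) (apart (fun a => (a \in C) == b) x)), 1; split.
  - by move=> c ca; rewrite apartE /= (negPf ca).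
  - by exists 1.
  - by rewrite mulr1.
rewrite (_ : apart (pred1 a) _ = 0); first by rewrite ct_deg10; exact: That_deg0.
by apply: dprodP => c; rewrite !apartE /=; case: eqP => // ->; rewrite (negPf ab).
Qed.
Lemma That_degMs (L L' L'' : set nat) f g : (forall i j, L i -> L' j -> L'' (i + j)%N) ->
  That_deg C L f -> That_deg C L' g -> That_deg C L'' (f * g).
Proof.
move=> LL hf hg n; rewrite ct_compM; apply: ps_sum => k.
have := ltn_ord k; rewrite ltnS => kn; apply: psM (hf k) (hg (n - k)%N).
move=> w w' [sw cw] [sw' cw']; split; first by rewrite size_cat sw sw' subnKC.
by rewrite /cut_deg count_cat -/(cut_deg C w) -/(cut_deg C w'); exact: LL.
Qed.
(** Project M onto the arrows in C and onto the others. By [casimir_transfer] each projection may be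
    placed on both factors of the Casimir element, so the degree lost by the derivative is regained
    by the multiplication. *)
Lemma eps_deg (L : set nat) f : central f -> That_deg C L f -> That_deg C L (eps_l t xs f).
Proof.
move=> cf hf; pose s b := apart (fun a => (a \in C) == b).
have -> : eps_l t xs f = \sum_(b : bool) \sum_(p <- xs) pd (dcomp p.1 (s b)) f * ct_deg1 (s b p.2).
  transitivity (\sum_(b : bool) \sum_(p <- xs) pd p.1 f * ct_deg1 (s b (s b p.2)) : T); last first.
    by apply: eq_bigr => b _; rewrite casimir_transfer.
  rewrite exchange_big; apply: eq_bigr => p _; rewrite big_bool [RHS]/= -mulrDr -ct_deg1D; congr (_ * ct_deg1 _).
  apply: dprodP => a; rewrite -[RHS]/(s true (s true p.2) a + s false (s false p.2) a) !apartE.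
  by case: (a \in C); rewrite ?addr0 ?add0r.
apply: That_deg_sum => b; apply: That_deg_sum => p.
apply: (That_degMs _ (pderl_deg (@carried_apart b p.1) hf) (deg1_deg b p.2)) => i j Li ->.
by rewrite addnC.
Qed.
Lemma eps_c_deg (L : set nat) f : central f -> That_deg C L f -> That_deg C L (eps_c t xs f).
Proof.
move=> cf hf n; pose g k := iter k (eps_l t xs) (ct_comp n f).
have gP k : central (g k) /\ That_deg C L (g k).
  elim: k => [|k [IH1 IH2]]; last by split; [exact: eps_central | exact: eps_deg].
  split=> [d|m]; first by rewrite -ct_comp_Z cf ct_comp_R.
  have [->|mn] := eqVneq m n; first by rewrite ct_comp_id; exact: hf.
  rewrite (_ : ct_comp m _ = 0); first exact: ps0.
  apply: dprodP => j; rewrite ct_compE -[g 0 j]/(ct_comp n f j) ct_compE.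
  by case: eqP => // ->; rewrite (negPf mn).
have -> : ct_comp n (eps_c t xs f) = ct_comp n (\sum_(k < n) g k).
  by apply: dprodP => m; rewrite !ct_compE; case: eqP => // ->.
have h : That_deg C L (\sum_(k < n) g k) by apply: That_deg_sum => k; exact: (gP k).2.
exact: (h n).
Qed.
Lemma pder_deg b xi (L : set nat) f : central f -> carried b xi -> That_deg C L f ->
  That_deg C [set j | L (b + j)%N] (pder t xs xi f).
Proof. by move=> cf xib hf; apply: pderl_deg => //; exact: eps_c_deg. Qed.
Lemma pder_split xi f : pder t xs xi f = \sum_(a : arr Q) pder t xs (dcomp xi (apart (pred1 a))) f.
Proof.
apply: pderl_sum => x; apply: (pair_r_uniq fdD t_sym) => d.
rewrite mulr_suml (linear_sum t) [RHS](_ : _ = xi (\sum_a apart (pred1 a) (ract x d))).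
  rewrite [RHS](linear_sum (xi : {linear restr_scal M -> K^o})); apply: eq_bigr => a _.
  exact: (pair_rE fdD t_sym).
by rewrite -deg1_sum.
Qed.
End LeftDerivative.

(** * Truncated Jacobian algebras *)

Section AllPaths.
Variables (K : fieldType) (Q : quiver) (S : species K Q).
Local Notation M := (totM S).
Local Notation T := (That S).
Lemma ps_tpow n (u : tpow M n) : path_span [set w | size w = n] (ct_act u (1 : T)).
Proof.
elim: n u => [|n IHn] u.
  apply: (@ps_in _ _ _ _ [::]) => //; exists u.
  exact: etrans (esym (ct_mul0act (u : totD (sp_D S)) (1 : T))) (mulr1 _).
elim/ptens_ind: u => [|x v|p q hp hq].
- by rewrite (@ct_act0 _ _ _ n.+1); exact: ps0.
- rewrite ct_act_ptens -ct_deg1_shift [x]deg1_sum.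
  rewrite (big_morph _ (@ct_deg1D _ _ S) (@ct_deg10 _ _ S)) mulr_suml.
  apply: ps_sum => a; apply: (@psM _ _ S [set [:: a]] _ _ _ _ _ _ (IHn v)) => [w w' -> sw'|]; first by rewrite /= sw'.
  apply: (@ps_in _ _ _ [set [:: a]] [:: a]) => //.
  exists (apart S (pred1 a) x), 1; split; last by rewrite mulr1.
    by move=> c ca; rewrite apartE /= (negPf ca).
  by exists 1.
- by rewrite (@ct_actD _ _ _ n.+1); exact: psD.
Qed.
Lemma ct_comp_tpow n (f : T) : ct_comp n f = ct_act (f n) (1 : T).
Proof.
apply: dprodP => m; rewrite ct_compE; have [h1 h2] := ct_act_deg0 (f n).
by have [->|mn] := eqVneq m n; [rewrite [RHS]h1 | rewrite [RHS]h2].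
Qed.
End AllPaths.

Section Truncation.
Variables (K : fieldType) (Q : quiver) (S : species K Q).
Local Notation D := (totD (sp_D S)).
Local Notation M := (totM S).
Local Notation T := (That S).
Variable t : {linear kspace D -> K^o}.
Hypothesis t_sym : symmetrizing_form t.
Variable xs : seq (dualK M * M).
Hypothesis cas : casimir t xs.
Variable W : T.
Hypothesis W_pot : potential W.
Variable Q2 : set (seq (arr Q)).
Hypothesis Q2W : cycles_of_potential W Q2.
Variable C : {set arr Q}.
Hypothesis cutC : cut Q2 C.
Local Notation SC := (restrict_species S C).
Local Notation TC := (That SC).
Local Notation J := (jacobian t xs W).
Local Notation incl := (@That_incl K Q S C).
Local Notation restr := (@That_restr K Q S C).
Implicit Types (f g : T) (r : TC).
(** Each cycle of Q2 has one arrow in C, and rotating a cycle does not change this number. *)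
Lemma potential_deg : That_deg C [set 1%N] W.
Proof.
have [[_ Wp] _] := Q2W; apply: ps_deg; apply: ps_sub Wp => w [c [i [Qc ->]]].
have /permP e : perm_eq (rot i c) c by rewrite perm_rot.
by rewrite /= /cut_deg e; exact: cutC.
Qed.
(** A path of positive degree contains an arrow of C, which restriction sends to zero. *)
Lemma restr_kill f : That_deg C [set j | j <> 0%N] f -> restr f = 0.
Proof.
move=> h; apply: dprodP => n; have -> : restr f n = restr (ct_comp n f) n.
  by rewrite /That_restr /ct_map ct_compE eqxx.
rewrite (_ : restr (ct_comp n f) = 0) //; move: (ct_comp n f) (h n) => {h}f; move: f.
have hr := That_restr_hom S C.
apply: ps_ind => [|f g hf hg|w f [_ cw] wf]; first exact: hom_0 hr.
  by rewrite (hom_add hr) hf hg addr0.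
elim: w f cw wf => [//|a w IHw] f cw [x [g [x0 wg ->]]].
rewrite (hom_mul hr); have [aC|aC] := boolP (a \in C).
  rewrite That_restr_deg1 (_ : totM_restr x = 0); first by rewrite (@ct_deg10 _ _ SC) mul0r.
  apply: dprodP => b; apply: x0; apply: contraTneq aC => <-; exact: (valP b).
by rewrite (IHw g) ?mulr0 // => E; apply: cw; rewrite cut_deg_cons (negPf aC) E.
Qed.
Lemma restr_fix f : That_deg C [set 0%N] f -> incl (restr f) = f.
Proof.
move=> h; apply: dprodP => n; have -> : incl (restr f) n = incl (restr (ct_comp n f)) n.
  have e : ct_comp n f n = f n by rewrite ct_compE eqxx.
  by rewrite /That_incl /That_restr /ct_map e.
rewrite (_ : incl (restr (ct_comp n f)) = ct_comp n f); first by rewrite ct_compE eqxx.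
move: (ct_comp n f) (h n) => {h}f; move: f.
have hr := That_restr_hom S C; have hi := That_incl_hom S C.
apply: ps_ind => [|f g hf hg|w f [_ cw] wf]; first by rewrite (hom_0 hr) (hom_0 hi).
  by rewrite (hom_add hr) (hom_add hi) hf hg.
elim: w f cw wf => [|a w IHw] f cw; first by move=> [d ->]; rewrite -{2}(That_incl_deg0 C d) -[X in restr X](That_incl_deg0 C d) That_inclK.
move=> [x [g [x0 wg ->]]]; rewrite (hom_mul hr) (hom_mul hi).
have {}cw : cut_deg C (a :: w) = 0%N := cw; rewrite cut_deg_cons in cw.
have aC : a \notin C.
  by apply/negP => aC; rewrite aC in cw.
rewrite (IHw g) //; last by move: cw; rewrite (negPf aC).
rewrite That_restr_deg1 That_incl_deg1 totM_restrK // => b bC; apply: x0.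
by apply: contraNneq aC => <-.
Qed.
Lemma incl_deg r : That_deg C [set 0%N] (incl r).
Proof.
move=> n; have -> : ct_comp n (incl r) = incl (ct_comp n r).
  apply: dprodP => m; rewrite /That_incl !ct_compE; case: eqP => // _.
  exact: (esym (congr1 (fun h : T => h m) (hom_0 (That_incl_hom S C)))).
rewrite ct_comp_tpow; move: (ct_act _ _) (ps_tpow (r n)); have hi := That_incl_hom S C.
apply: ps_ind => [|f g hf hg|w f sw wf]; first by rewrite (hom_0 hi); exact: ps0.
  by rewrite (hom_add hi); exact: psD.
apply: (@ps_in _ _ _ _ (map val w)).
  rewrite /= size_map; split=> //; apply/eqP; rewrite /cut_deg eqn0Ngt -has_count.
  by apply/hasPn => a /mapP[b _ ->]; exact: (valP b).
elim: w f {sw} wf => [|a w IHw] f; first by move=> [d ->]; exists d; exact: That_incl_deg0.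
move=> [x [g [x0 wg ->]]]; rewrite (hom_mul hi) That_incl_deg1.
exists (totM_incl x), (incl g); split=> //; last exact: IHw.
move=> b ba; have [bC|bC] := boolP (b \in C); first exact: totM_incl0.
have -> : b = val (exist (fun a => a \notin C) b bC : arr (delete_arrows C)) by [].
rewrite totM_inclE; apply: x0; apply: contraNneq ba => <- //.
Qed.
Lemma clo_ideal (B : bimodule D D) (I : ideal (ctens B)) (f : ctens B) :
  (forall n, exists2 g, closed_ideal I g & forall m, (m <= n)%N -> f m = g m) ->
  closed_ideal I f.
Proof.
move=> h n; have [g cg fg] := h n; have [g' Ig gg] := cg n; exists g' => // m mn.
by rewrite fg // gg.
Qed.
Lemma trunc_ideal_incl r : trunc_ideal t xs W C r -> jac_ideal t xs W (incl r).
Proof.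
have hi := That_incl_hom S C.
pose I r := jac_ideal t xs W (incl r).
have I0 : I 0 by rewrite /I (hom_0 hi); exact: as0.
have IB x y : I x -> I y -> I (x - y) by move=> Ix Iy; rewrite /I (hom_sub hi); exact: asB.
have Il a x : I x -> I (a * x) by move=> Ix; rewrite /I (hom_mul hi); exact: idMl.
have Ir a x : I x -> I (x * a) by move=> Ix; rewrite /I (hom_mul hi); exact: idMr.
move=> cr; apply: clo_ideal => n; have [g Ig rg] := cr n; exists (incl g).
  apply: (Ig (@Ideal TC (AddSub I0 IB) Il Ir)) => x [a [xi [_ _ xE]]].
  rewrite /= /I xE => m; exists (pder t xs xi W) => // J' hJ; apply: hJ; by exists xi.
by move=> m mn; rewrite /That_incl rg.
Qed.
(** Split xi over the arrows. For an arrow outside C the derivative of W has degree 1 and dies under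
    restriction; for an arrow in C it has degree 0 and is a defining relation of the truncated
    algebra. *)
Lemma pder_restr xi : trunc_ideal t xs W C (restr (pder t xs xi W)).
Proof.
have hr := That_restr_hom S C; have [_ _ Wc] := W_pot.
rewrite (pder_split t_sym xs) (big_morph restr (hom_add hr) (hom_0 hr)).
apply: big_ind => [|x y|a _]; [exact: as0 | exact: asD |].
set xa := dcomp _ _.
have ca : carried C (a \in C) xa.
  move=> x x0; rewrite dcompE (_ : apart _ _ x = 0); first exact: (linear0 (xi : {linear _ -> _})).
  by apply: dprodP => b; rewrite apartE /=; case: eqP => // ->; exact: x0.
have hd := pder_deg t_sym cas Wc ca potential_deg.
have [aC|aC] := boolP (a \in C); last first.
  rewrite restr_kill; first exact: as0.
  by move: hd; rewrite (negPf aC); apply: That_deg_sub => -[|j].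
have hf : incl (restr (pder t xs xa W)) = pder t xs xa W.
  by apply: restr_fix; move: hd; rewrite aC; apply: That_deg_sub => j /= [].
move=> n; exists (restr (pder t xs xa W)) => // I hI; apply: hI; exists a, xa; split=> //.
move=> x xa0; rewrite /xa dcompE (_ : apart _ _ x = 0); first exact: (linear0 (xi : {linear _ -> _})).
by apply: dprodP => b; rewrite apartE /=; case: eqP => // ->.
Qed.
Lemma jac_ideal_restr f : jac_ideal t xs W f -> trunc_ideal t xs W C (restr f).
Proof.
have hi := That_restr_hom S C.
pose I f := trunc_ideal t xs W C (restr f).
have I0 : I 0 by rewrite /I (hom_0 hi); exact: as0.
have IB x y : I x -> I y -> I (x - y) by move=> Ix Iy; rewrite /I (hom_sub hi); exact: asB.
have Il a x : I x -> I (a * x) by move=> Ix; rewrite /I (hom_mul hi); exact: idMl.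
have Ir a x : I x -> I (x * a) by move=> Ix; rewrite /I (hom_mul hi); exact: idMr.
move=> cr; apply: clo_ideal => n; have [g Ig rg] := cr n; exists (restr g).
  apply: (Ig (@Ideal T (AddSub I0 IB) Il Ir)) => x [xi _ <-]; exact: pder_restr.
by move=> m mn; rewrite /That_restr /ct_map rg.
Qed.
Local Notation tinc := (@trunc_incl K Q S t xs W C).
Local Notation clA := (qcl (trunc_ideal t xs W C)).
Lemma trunc_inclE r : tinc (clA r) = clJ t xs W (incl r).
Proof.
apply: qcl_eq; rewrite -(hom_sub (That_incl_hom S C)); apply: trunc_ideal_incl.
exact: qcl_repr.
Qed.
Lemma trunc_incl_hom : kalg_hom tinc.
Proof.
have [hD hM hS] := That_incl_hom S C.
split=> [x y|x y|k].
- move: x y; apply: qclP => x; apply: qclP => y.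
  by rewrite -[_ + _]qclD !trunc_inclE hD clJD.
- move: x y; apply: qclP => x; apply: qclP => y.
  by rewrite [X in tinc X]qa_mulE !trunc_inclE hM clJM.
- by rewrite -[scal k]/(clA (scal k)) trunc_inclE hS.
Qed.
(** Restriction to the arrows outside C is a left inverse of the inclusion, and it maps the Jacobian
    ideal into the truncated one. *)
Lemma trunc_incl_inj : injective tinc.
Proof.
move=> x y; move: x y; apply: qclP => x; apply: qclP => y; rewrite !trunc_inclE => e.
apply: qcl_eq; rewrite -[x - y](That_inclK); apply: jac_ideal_restr.
rewrite (hom_sub (That_incl_hom S C)).
by apply/(quot_eqP (jac_ideal t xs W)); apply/eqP.
Qed.
Lemma trunc_incl_image (x : J) : jac_deg C [set 0%N] x <-> exists a, tinc a = x.
Proof.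
split=> [[f hf ->]|[a <-]].
  by exists (clA (restr f)); rewrite trunc_inclE restr_fix.
move: a; apply: qclP => r; rewrite trunc_inclE; exists (incl r) => //; exact: incl_deg.
Qed.
End Truncation.

(** * The idempotent of the sink and transport to the Jacobian algebra *)

Section SimpleCorner.
Variables (K : fieldType) (A : kalgType K) (e : A).
Hypothesis ee : e * e = e.
Hypothesis simple : simple_mod (princ e).
Lemma simple_idem_neq0 : e <> 0.
Proof.
move=> e0; have [[x /eqP x0] _] := simple; apply: x0; apply: val_inj.
rewrite -[LHS]/(val x : A) -(princ_mulc ee x).
exact: etrans (congr1 (fun c => (val x : A) * c) e0) (mulr0 _).
Qed.
(** Schur's lemma: A x is a nonzero submodule of the simple module A e, so it contains e. *)
Lemma simple_left_inv (x : A) : e * x * e = x -> x <> 0 -> exists2 y, e * y * e = y & y * x = e.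
Proof.
move=> exe x0; have xe : x * e = x by rewrite -exe -mulrA ee.
pose U := fun z : princ e => exists a : A, val z = a * x :> A.
have U0 : U 0 by exists 0; rewrite mul0r.
have UB z w : U z -> U w -> U (z - w).
  by move=> [a za] [b wb]; exists (a - b); rewrite mulrBl -za -wb.
have [_ s] := simple; have [|h|h] := s (AddSub U0 UB).
- by move=> a z [b zb]; exists (a * b); rewrite -mulrA -zb.
- case: x0; have := h (princ_of e x) _ => /(_ _)/(congr1 val) e1.
  by rewrite -xe; apply: e1; exists 1; rewrite mul1r.
have [a aE] := h (princ_of e e); have {}aE : e * e = a * x := aE.
exists (e * a * e); first by rewrite !mulrA ee -!mulrA ee.
by rewrite -!mulrA (_ : e * x = x) -?aE ?ee ?mulrA ?ee // -exe !mulrA ee.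
Qed.
Lemma simple_corner (x : A) : e * x * e = x -> x <> 0 -> exists y, x * y = e /\ y * x = e.
Proof.
move=> exe x0; have [y eye yx] := simple_left_inv exe x0.
have y0 : y <> 0 by move=> y0; apply: simple_idem_neq0; rewrite -yx y0 mul0r.
have [z eze zy] := simple_left_inv eye y0.
have ex : e * x = x by rewrite -exe !mulrA ee.
have ze : z * e = z by rewrite -eze -mulrA ee.
have xz : x = z by rewrite -ex -zy -mulrA yx ze.
by exists y; rewrite yx xz zy.
Qed.
End SimpleCorner.

Section SinkIdempotent.
Variables (K : fieldType) (Q : quiver) (S : species K Q) (C : {set arr Q}) (k : vert Q).
Hypothesis sink : strict_sink C k.
Local Notation SC := (restrict_species S C).
Local Notation vu := (vertex_unit S k).
Local Notation E := (ct_deg0 (totM SC) vu : That SC).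
Lemma no_path_from_sink n (u : tpow (totM SC) n.+1) : ct_act u E n.+1 = 0.
Proof.
elim: n u => [|n IHn] u.
  elim/ptens_ind: u => [|x d|p q hp hq].
  - by rewrite (@ct_act0 _ _ _ 1).
  - rewrite (@ct_act_ptens _ _ _ 0) -[LHS]/(ptens x ((d : totD (sp_D SC)) * vu : (totD (sp_D SC))^o)).
    rewrite -(vuC k d) -[_ * _]/(vu *: (d : (totD (sp_D SC))^o)) -ptensB.
    rewrite (_ : ract x vu = 0) ?ptens0l //.
    apply: dprodP => a; rewrite -[LHS]/(ract (x a) (vu (src (val a)))) vu_diff; last first.
      by move=> sa; have := valP a; rewrite (sink.1 _ sa).
    by apply: (addrI (ract (x a) 0)); rewrite -ractDr !addr0.
  - by rewrite (@ct_actDE _ _ _ 1) hp hq addr0.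
elim/ptens_ind: u => [|x v|p q hp hq].
- by rewrite (@ct_act0 _ _ _ n.+2).
- rewrite (@ct_act_ptens _ _ _ n.+1).
  exact: etrans (congr1 (fun u => ptens x u : tpow (totM SC) n.+2) (IHn v)) (ptens0r _ x).
- by rewrite (@ct_actDE _ _ _ n.+2) hp hq addr0.
Qed.
(** All arrows starting at k lie in C, so in the quiver without C the trivial path is the only path
    starting at k. *)
Lemma sink_corner (f : That SC) : f * E = E * f * E.
Proof.
have e0 g : g * E = ct_deg0 (totM SC) (g 0) * E :> That SC.
  apply: dprodP => n; rewrite !d0_R; case: n => [|n] //.
  by rewrite no_path_from_sink (@ct_act0 _ _ _ n.+1).
rewrite e0 [RHS]e0 -![_ * E]ct_deg0M; congr (ct_deg0 _ _).
have -> : (E * f) 0 = vu * f 0 by rewrite [E * f](ct_mul0act vu f).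
by rewrite (vuC k (f 0)) -mulrA (vuvu S k).
Qed.
End SinkIdempotent.

Section Regrading.
Variables (K : fieldType) (Q : quiver) (S : species K Q).
Variable t : {linear kspace (totD (sp_D S)) -> K^o}.
Variable xs : seq (dualK (totM S) * totM S).
Variable W : That S.
Variable C : {set arr Q}.
Variable k : vert Q.
Hypothesis sink : strict_sink C k.
Local Notation A := (trunc_jacobian t xs W C).
Local Notation J := (jacobian t xs W).
Local Notation e := (trunc_idem t xs W C k).
Lemma trunc_idem_idem : e * e = e.
Proof.
rewrite [LHS]qa_mulE; congr (qcl _ _).
by rewrite -[LHS]ct_deg0M (vuvu S k).
Qed.
Lemma trunc_idem_corner (a : A) : a * e = e * a * e.
Proof.
move: a; apply: qclP => r; rewrite [LHS]qa_mulE [e * _]qa_mulE [RHS]qa_mulE.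
by congr (qcl _ _); exact: (sink_corner sink r).
Qed.
Variable phi : pi3 A -> J.
Hypothesis hphi : kalg_hom phi.
Hypothesis bphi : bijective phi.
Hypothesis phi_deg : forall L : set nat,
  phi @` [set u : pi3 A | forall i, ~ L i -> u i = 0] = jac_deg C L.
Hypothesis phi0 : forall f : {linear A^o -> A^o}, phi (pi3_deg0 f) = trunc_incl (f (1 : A)).
Local Notation E := (iA e : pi3 A).
Local Notation F := (1 - iA e : pi3 A).
Definition Xp (b : bool) : pi3 A := if b then E else F.
Lemma phi_iA a : phi (iA a) = trunc_incl a.
Proof. by rewrite [LHS]phi0 -[rmulA a 1]/(1 * a) mul1r. Qed.
Lemma phi_Xp b : phi (Xp b) = XJ k t xs W b.
Proof.
have pE : phi E = clJ t xs W (ct_deg0 (totM S) (vertex_unit S k)).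
  rewrite phi_iA [LHS]trunc_inclE; congr clJ.
  exact: That_incl_deg0.
case: b => //=; rewrite (hom_sub hphi) (hom_1 hphi) pE.
by apply/eqP; rewrite eq_sym eq_sym subr_eq -[X in X + _]/(clJ t xs W (1 - _)) -clJD subrK.
Qed.
Lemma supp_ev (L : set nat) (u : pi3 A) :
  (forall i, ~ L i -> u i = 0) <-> (forall i, ~ L i -> ev i u = 0).
Proof.
split=> h i Li; first by rewrite /ev h.
by apply: linear_ext => a; rewrite (pi3_ptE i u (a : A)) h //; exact: scaler0.
Qed.
Lemma phi_supp (L : set nat) u : jac_deg C L (phi u) <-> forall i, ~ L i -> ev i u = 0.
Proof.
rewrite -supp_ev -phi_deg; split=> [[v vL]|h]; last by exists u.
by move=> /(bij_inj bphi) <-.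
Qed.
(** [jac_deg_mutate] transported along phi, which matches E with e_k and the degrees of R with those
    of C. *)
Lemma regrading (L : set nat) r : jac_deg (mutate_cut C k) L (phi r) <->
  [/\ forall i, ~ L i -> ev i (E * r * E) = 0,
      forall i, ~ L i -> ev i (F * r * F) = 0,
      forall i, ~ L i -> ev i.+1 (F * r * E) = 0 &
      forall i, ~ L i.+1 -> ev i (E * r * F) = 0].
Proof.
have [_ hM _] := hphi.
rewrite (jac_deg_mutate sink); split=> [h|[h1 h2 h3 h4] b c].
  have {}h b c : forall i, ~ shift L b c i -> ev i (Xp b * r * Xp c) = 0.
    by apply/phi_supp; rewrite !hM !phi_Xp; exact: h.
  split=> i Li.
  - by apply: (h true true) => -[m Lm] /addIn mi; apply: Li; rewrite -mi.
  - by apply: (h false false) => -[m Lm] /addIn mi; apply: Li; rewrite -mi.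
  - by apply: (h false true) => -[m Lm]; rewrite addn1 addn0 => -[mi]; apply: Li; rewrite -mi.
  - by apply: (h true false) => -[m Lm]; rewrite addn1 addn0 => mi; apply: Li; rewrite -mi.
rewrite -!phi_Xp -!hM; apply/phi_supp => i Li.
case: b c Li => [] [] Li.
- by apply: h1 => LLi; apply: Li; exists i.
- by apply: h4 => LLi; apply: Li; exists i.+1; rewrite // addn1 addn0.
(* In degree 0 this corner would have new degree -1; it vanishes because (1 - e) A e = 0. *)
- case: i Li => [|i] Li; first exact: (ev0_FuE trunc_idem_corner).
  by apply: h3 => LLi; apply: Li; exists i; rewrite // addn1 addn0.
- by apply: h2 => LLi; apply: Li; exists i.
Qed.
Lemma inU_regrading r : inU e 0 r <-> jac_deg (mutate_cut C k) [set 0%N] (phi r).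
Proof.
rewrite regrading; split=> [[h1 h2 h3 h4]|[h1 h2 h3 h4]]; split=> i Li.
- exact: h1.
- exact: h2.
- by apply: h3 => -[].
- exact: h4.
- exact: h1.
- exact: h2.
- by case: i Li => [|i] Li; [exact: (ev0_FuE trunc_idem_corner) | apply: h3 => /= i0; apply: Li; rewrite i0].
- by apply: h4.
Qed.
End Regrading.
Theorem theorem6p5 (K : fieldType) (perfectK : perfect_field K)
    (Q : quiver) (connectedQ : connected_quiver Q)
    (no_multiple_arrows : simply_arrowed Q)
    (S : species K Q)
    (t : {linear kspace (totD (sp_D S)) -> K^o}) (t_sym : symmetrizing_form t)
    (xs : seq (dualK (totM S) * totM S)) (xs_casimir : casimir t xs)
    (W : That S) (W_potential : potential W)
    (Q2 : set (seq (arr Q))) (Q2_cycles : cycles_of_potential W Q2)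
    (C : {set arr Q}) (C_preprojective : preprojective_cut t xs W Q2 C)
    (k : vert Q) (k_strict_sink : strict_sink C k)
    (k_apr : gives_apr2_tilting (trunc_idem t xs W C k)) :
  preprojective_cut t xs W Q2 (mutate_cut C k) /\
  alg_iso (end_op (apr2_module (trunc_idem t xs W C k)))
          (trunc_jacobian t xs W (mutate_cut C k)).
Proof.
have [cutC fdA glA [phi [hphi bphi phi_deg phi0]]] := C_preprojective.
have [_ [simple _] hom0 ext0 _] := k_apr.
have [[cycles _] _] := Q2_cycles.
have cutC' : cut Q2 (mutate_cut C k) := cut_mutate k_strict_sink cutC cycles.
have ee := trunc_idem_idem t xs W C k.
have fe0 (a : trunc_jacobian t xs W C) := trunc_idem_corner k_strict_sink a.
have gl (X Y : lmodType (trunc_jacobian t xs W C)) : xv 2 X Y.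
  by apply: projdim_xv; exact: glA.
have x0 := (xvP _ _ 0).2 ext0.
have hinc := trunc_incl_hom t xs W (mutate_cut C k).
have inj_inc := trunc_incl_inj t_sym xs_casimir W_potential Q2_cycles cutC'.
have im_inc (x : jacobian t xs W) := trunc_incl_image (mutate_cut C k) x.
have reg := regrading k_strict_sink hphi bphi phi_deg phi0.
have inUreg := inU_regrading k_strict_sink hphi bphi phi_deg phi0.
have [psi phiK psiK] := bphi.
have phi_inj := can_inj phiK.
(* Both truncated algebras sit inside the same Jacobian algebra, which phi identifies with Pi_3 of
   the old one. So the new truncated algebra embeds there, as the degree 0 part of the new
   grading. *)
pose io (b : trunc_jacobian t xs W (mutate_cut C k)) := psi (trunc_incl b).
have ioE b : phi (io b) = trunc_incl b by rewrite /io psiK.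
have hio : kalg_hom io.
  have [hD hM hS] := hphi; have [iD iM iS] := hinc.
  by split=> *; apply: phi_inj; rewrite ?hD ?hM ?hS !ioE ?iD ?iM ?iS.
have io_inj : injective io.
  by move=> x y xy; apply: inj_inc; rewrite -!ioE xy.
have io_im u : inU (trunc_idem t xs W C k) 0 u <-> exists b, io b = u.
  rewrite inUreg im_inc; split=> -[b bE]; exists b; last by rewrite -bE ioE.
  by apply: phi_inj; rewrite ioE.
have [fdB glB iso [Ph [hPh bPh Ph0 Ph_supp]]] := pi3_mutation fdA gl ee
  (simple_idem_neq0 ee simple) fe0 (simple_corner ee simple) hom0 x0 hio io_inj io_im.
split=> //; split=> //; first by move=> X; apply: xv_projdim => Y; exact: glB.
(* [Ph] reaches R with its new grading, and phi carries R to the Jacobian algebra; [regrading]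
   compares the degrees. *)
exists (phi \o Ph); split.
- have [hD hM hS] := hphi; have [pD pM pS] := hPh.
  by split=> * /=; rewrite ?pD ?pM ?pS ?hD ?hM ?hS.
- exact: bij_comp bphi bPh.
- move=> L; apply/seteqP; split=> [x [u uL <-]|x xL]; first by apply/reg; apply/Ph_supp.
  have [Phi' _ Ph'K] := bPh; exists (Phi' (psi x)); last by rewrite /= Ph'K psiK.
  by apply/Ph_supp; rewrite Ph'K; apply/reg; rewrite psiK.
- by move=> f; rewrite /= Ph0 ioE.
Qed.
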